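(* Let $n\geq 4k$, with $k>1$. Then there cannot exist a rank two vector bundle $\mathcal{E}$ on $\mathbf{P}^n$ for which the only non-zero intermediate cohomology modules are $H^1_*(\mathcal{E})$, $H^k_*(\mathcal{E})$, $H^{n-k}_*(\mathcal{E})$ and $H^{n-1}_*(\mathcal{E})$; that is, there is no rank two vector bundle $\mathcal{E}$ on $\mathbf{P}^n$ such that $H^i_*(\mathcal{E})\neq 0$ for $i\in\{1,k,n-k,n-1\}$ and $H^i_*(\mathcal{E})=0$ for all other $i$ with $1\leq i\leq n-1$.
   Context: $\mathbf{P}^n$ is projective $n$-space over a field, with $S$ the corresponding polynomial ring in $n+1$ variables, and $k$, $n$ are integers. For a vector bundle $\mathcal{E}$ on $\mathbf{P}^n$, $H^i_*(\mathcal{E})=\bigoplus_{\nu\in\mathbf{Z}}H^i(\mathbf{P}^n,\mathcal{E}(\nu))$, a graded $S$-module; the modules with $1\leq i\leq n-1$ are called the intermediate cohomology modules. *)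

(* Defs.v *)
From HB Require Import structures.
From mathcomp Require Import all_boot all_order all_algebra.
From mathcomp Require Import boolp classical_sets functions.
From mathcomp Require Import topology_structure.
From mathcomp Require Import mpoly.

Set Implicit Arguments.
Unset Strict Implicit.
Unset Printing Implicit Defensive.

Import GRing.Theory Num.Theory.
Local Open Scope classical_set_scope.
Local Open Scope ring_scope.


Record opens (X : topologicalType) :=
  Opens { oset :> set X; oset_open : open oset }.

Definition otop (X : topologicalType) : opens X := Opens (@openT X).

(* Functoriality is stated for arbitrary inclusion proofs, so that [res] does
   not depend on them. In [glue], agreement on W i `&` W j is agreement on
   every open set contained in both. *)
Record is_sheaf (X : topologicalType) (F : opens X -> zmodType)
    (res : forall U V : opens X, V `<=` U -> F U -> F V) : Prop := IsSheaf {
  sheaf_id : forall (U : opens X) (h : U `<=` U) s, res U U h s = s;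
  sheaf_comp : forall (U V W : opens X) (hVU : V `<=` U) (hWV : W `<=` V)
    (hWU : W `<=` U) s, res V W hWV (res U V hVU s) = res U W hWU s;
  sheaf_sep : forall (U : opens X) (I : Type) (W : I -> opens X)
    (h : forall i, W i `<=` U), U `<=` \bigcup_i (W i : set X) ->
    forall s t : F U, (forall i, res _ _ (h i) s = res _ _ (h i) t) -> s = t;
  sheaf_glue : forall (U : opens X) (I : Type) (W : I -> opens X)
    (h : forall i, W i `<=` U), U `<=` \bigcup_i (W i : set X) ->
    forall s : forall i, F (W i),
    (forall i j (V : opens X) (hi : V `<=` W i) (hj : V `<=` W j),
      res _ _ hi (s i) = res _ _ hj (s j)) ->
    exists t : F U, forall i, res _ _ (h i) t = s i
}.

Record ab_sheaf (X : topologicalType) := AbSheaf {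
  ab_sec :> opens X -> zmodType;
  ab_res : forall U V : opens X, V `<=` U -> {additive ab_sec U -> ab_sec V};
  ab_sheafP : is_sheaf (fun U V h => ab_res h : ab_sec U -> ab_sec V)
}.

Record ring_sheaf (X : topologicalType) := RingSheaf {
  rg_sec :> opens X -> comPzRingType;
  rg_res : forall U V : opens X, V `<=` U -> {rmorphism rg_sec U -> rg_sec V};
  rg_sheafP : is_sheaf (fun U V h => rg_res h : rg_sec U -> rg_sec V)
}.

Record mod_sheaf (X : topologicalType) (O : ring_sheaf X) := ModSheaf {
  md_sec :> forall U : opens X, lmodType (O U);
  md_res : forall U V : opens X, V `<=` U -> {additive md_sec U -> md_sec V};
  md_resZ : forall (U V : opens X) (h : V `<=` U) (a : O U) (s : md_sec U),
    md_res h (a *: s) = rg_res O h a *: md_res h s;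
  md_sheafP : is_sheaf (fun U V h => md_res h : md_sec U -> md_sec V)
}.

Definition ab_of_mod (X : topologicalType) (O : ring_sheaf X)
    (F : mod_sheaf O) : ab_sheaf X :=
  @AbSheaf X (fun U => F U) (@md_res X O F) (md_sheafP F).


Section Modules.
Context (X : topologicalType) (O : ring_sheaf X).

Record mod_hom (F G : mod_sheaf O) := ModHom {
  mh_fun :> forall U : opens X, {linear F U -> G U};
  mh_nat : forall (U V : opens X) (h : V `<=` U) (s : F U),
    mh_fun V (md_res F h s) = md_res G h (mh_fun U s)
}.

Record mod_bihom (F G H : mod_sheaf O) := ModBihom {
  bh_fun :> forall U : opens X, F U -> G U -> H U;
  bh_linl : forall U t, linear (fun s => @bh_fun U s t);
  bh_linr : forall U s, linear (@bh_fun U s);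
  bh_nat : forall (U V : opens X) (h : V `<=` U) (s : F U) (t : G U),
    bh_fun (md_res F h s) (md_res G h t) = md_res H h (bh_fun s t)
}.

(* T is the tensor product F (x)_O G: it carries a universal O-bilinear map.
   This determines T up to isomorphism. *)
Definition is_tensor (F G T : mod_sheaf O) : Prop :=
  exists b : mod_bihom F G T, forall (H : mod_sheaf O) (c : mod_bihom F G H),
    exists f : mod_hom T H,
      (forall U s t, f U (b U s t) = c U s t) /\
      (forall f' : mod_hom T H, (forall U s t, f' U (b U s t) = c U s t) ->
         forall U x, f' U x = f U x).

Definition locally_free (r : nat) (F : mod_sheaf O) : Prop :=
  forall x : X, exists U : opens X, oset U x /\
    exists phi : forall V : opens X, V `<=` U -> {linear 'rV[O V]_r -> F V},
      (forall (V : opens X) (h : V `<=` U), bijective (phi V h)) /\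
      (forall (V W : opens X) (hV : V `<=` U) (hW : W `<=` U) (h : W `<=` V)
         (v : 'rV[O V]_r),
         phi W hW (map_mx (rg_res O h) v) = md_res F h (phi V hV v)).

End Modules.


Section Cohomology.
Context (X : topologicalType).

Record ab_hom (F G : ab_sheaf X) := AbHom {
  ah_fun :> forall U : opens X, {additive F U -> G U};
  ah_nat : forall (U V : opens X) (h : V `<=` U) (s : F U),
    ah_fun V (ab_res F h s) = ab_res G h (ah_fun U s)
}.

Definition ab_mono (F G : ab_sheaf X) (f : ab_hom F G) : Prop :=
  forall U : opens X, injective (f U).

Definition injective_sheaf (J : ab_sheaf X) : Prop :=
  forall (F G : ab_sheaf X) (i : ab_hom F G) (f : ab_hom F J), ab_mono i ->
    exists g : ab_hom G J, forall U s, g U (i U s) = f U s.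

(* Exactness of F -> G -> H as sheaves: sections of the kernel are locally in
   the image. *)
Definition ab_exact (F G H : ab_sheaf X) (f : ab_hom F G) (g : ab_hom G H) :
    Prop :=
  (forall U s, g U (f U s) = 0) /\
  (forall (U : opens X) (t : G U), g U t = 0 -> forall x, oset U x ->
     exists (V : opens X) (h : V `<=` U), oset V x /\
       exists s : F V, f V s = ab_res G h t).

Record injective_resolution (F : ab_sheaf X) := InjectiveResolution {
  ir_term :> nat -> ab_sheaf X;
  ir_aug : ab_hom F (ir_term 0);
  ir_diff : forall j, ab_hom (ir_term j) (ir_term j.+1);
  ir_inj : forall j, injective_sheaf (ir_term j);
  ir_mono : ab_mono ir_aug;
  ir_exact0 : ab_exact ir_aug (ir_diff 0);
  ir_exact : forall j, ab_exact (ir_diff j) (ir_diff j.+1)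
}.

Definition cocycles (F : ab_sheaf X) (R : injective_resolution F) (i : nat) :
    set (R i (otop X)) :=
  [set s | ir_diff R i (otop X) s = 0].

Definition coboundaries (F : ab_sheaf X) (R : injective_resolution F)
    (i : nat) : set (R i (otop X)) :=
  match i return set (R i (otop X)) with
  | 0 => [set 0]
  | j.+1 => range (ir_diff R j (otop X))
  end.

Arguments cocycles [F] R i.
Arguments coboundaries [F] R i.

(* H^i(X, F) = cocycles / coboundaries is zero. Abelian sheaves have injective
   resolutions, and the quotient does not depend on the one chosen. *)
Definition cohomology_eq0 (i : nat) (F : ab_sheaf X) : Prop :=
  forall R : injective_resolution F, cocycles R i `<=` coboundaries R i.

End Cohomology.


Section ProjectiveSpace.
Context (K : fieldType) (n : nat).
Local Notation S := {mpoly K[n.+1]}.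
Local Notation "x %:F" := (@tofrac S x).

Record proj := ProjPoint {
  pideal :> prime_idealr S;
  pideal_homog : forall (f : S) (d : nat),
    f \in (pideal : pred S) -> pihomog mdeg d f \in (pideal : pred S);
  pideal_relevant : exists i : 'I_n.+1, 'X_i \notin (pideal : pred S)
}.

HB.instance Definition _ := gen_eqMixin proj.
HB.instance Definition _ := gen_choiceMixin proj.

Definition homogeneous (f : S) : Prop := exists d : nat, f \is d.-homog.

Definition zariski_open (U : set proj) : Prop :=
  exists T : set S, T `<=` homogeneous /\
    U = [set p : proj | exists2 f, T f & f \notin (p : pred S)].

Lemma zariski_openT : zariski_open setT.
Proof.
exists [set 1]; split.
  by move=> _ ->; exists 0%N; exact: dhomog1.
apply/seteqP; split=> // p _; exists 1 => //.
by rewrite idealr1.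
Qed.

Lemma zariski_openI (A B : set proj) :
  zariski_open A -> zariski_open B -> zariski_open (A `&` B).
Proof.
move=> [T [hT ->]] [T' [hT' ->]].
exists [set h | exists f g, [/\ T f, T' g & h = f * g]]; split.
  move=> _ [f [g [/hT[d fd] /hT'[e ge] ->]]].
  by exists (d + e)%N; exact: dhomogM.
apply/seteqP; split=> p /=.
  move=> [[f Tf fp] [g Tg gp]]; exists (f * g); first by exists f, g.
  by rewrite prime_idealrM negb_or fp gp.
move=> [_ [f [g [Tf Tg ->]]]]; rewrite prime_idealrM negb_or => /andP[fp gp].
by split; [exists f|exists g].
Qed.

Lemma zariski_open_bigU (I : Type) (f : I -> set proj) :
  (forall i, zariski_open (f i)) -> zariski_open (\bigcup_i f i).
Proof.
move=> /choice[T hT]; exists (\bigcup_i T i); split.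
  by move=> g [i _]; have [h _] := hT i; exact: h.
apply/seteqP; split=> p /=.
  move=> [i _]; have [_ ->] := hT i => -[g Tg gp].
  by exists g => //; exists i.
move=> [g [i _ Tg] gp]; exists i => //; have [_ ->] := hT i.
by exists g.
Qed.

HB.instance Definition _ := @isOpenTopological.Build proj
  zariski_open zariski_openT zariski_openI zariski_open_bigU.

(* As S is a domain, the localizations S_(p) lie in its fraction field. A
   section of O(d) over U assigns to each p in U an element of degree d of the
   homogeneous localization at p, and is locally given by one fraction a/b. *)
Definition is_section (d : int) (U : opens proj) (s : U -> {fraction S}) :
    Prop :=
  forall p : U, exists V : opens proj, oset V (val p) /\
    exists (a b : S) (da db : nat),
      [/\ a \is da.-homog, b \is db.-homog, da%:Z = db%:Z + d &
        forall q : U, oset V (val q) ->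
          b \notin (val q : pred S) /\ s q = a%:F / b%:F].

Let subf_div (F : fieldType) (x y z t : F) : y != 0 -> t != 0 ->
  x / y - z / t = (x * t - z * y) / (y * t).
Proof. by move=> hy ht; rewrite -mulNr addf_div // mulNr. Qed.

Lemma is_sectionB (d : int) (U : opens proj) (s t : U -> {fraction S}) :
  is_section d s -> is_section d t -> is_section d (s - t).
Proof.
move=> hs ht p.
have [V [Vp [a [b [da [db [ha hb hd hV]]]]]]] := hs p.
have [W [Wp [a' [b' [da' [db' [ha' hb' hd' hW]]]]]]] := ht p.
exists (Opens (openI (oset_open V) (oset_open W))); split=> //.
exists (a * b' - a' * b), (b * b'), (da + db')%N, (db + db')%N; split.
- have e : (da + db' = da' + db)%N.
    apply/eqP; rewrite -eqz_nat !PoszD hd hd'; apply/eqP.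
    by rewrite addrAC [in RHS]addrAC [X in X + d]addrC.
  by apply: rpredB; [exact: dhomogM | rewrite e; exact: dhomogM].
- exact: dhomogM.
- by rewrite !PoszD hd addrAC.
- move=> q [Vq Wq]; have [bq sq] := hV q Vq; have [b'q tq] := hW q Wq.
  have nz (c : S) : c \notin (val q : pred S) -> c%:F != 0.
    rewrite tofrac_eq0; apply: contra => /eqP ->; exact: idealr0.
  split; first by rewrite prime_idealrM negb_or bq.
  transitivity (s q - t q) => //; rewrite sq tq rmorphB !rmorphM /=.
  by apply: subf_div; exact: nz.
Qed.

Lemma is_sectionM (d : int) (U : opens proj) (s t : U -> {fraction S}) :
  is_section 0 s -> is_section d t -> is_section d (s * t).
Proof.
move=> hs ht p.
have [V [Vp [a [b [da [db [ha hb hd hV]]]]]]] := hs p.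
have [W [Wp [a' [b' [da' [db' [ha' hb' hd' hW]]]]]]] := ht p.
exists (Opens (openI (oset_open V) (oset_open W))); split=> //.
exists (a * a'), (b * b'), (da + da')%N, (db + db')%N; split.
- exact: dhomogM.
- exact: dhomogM.
- by rewrite !PoszD hd hd' addr0 addrA.
- move=> q [Vq Wq]; have [bq sq] := hV q Vq; have [b'q tq] := hW q Wq.
  split; first by rewrite prime_idealrM negb_or bq.
  transitivity (s q * t q) => //; rewrite sq tq !rmorphM /=.
  exact: mulf_div.
Qed.

Lemma is_section1 (U : opens proj) : is_section 0 (1 : U -> {fraction S}).
Proof.
move=> p; exists (otop proj); split=> //.
exists 1, 1, 0%N, 0%N; split=> //; [exact: dhomog1 | exact: dhomog1 |].
by move=> q _; rewrite idealr1 rmorph1 divr1.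
Qed.

Lemma zariski_open_basic (f : S) (d : nat) : f \is d.-homog ->
  open [set p : proj | f \notin (p : pred S)].
Proof.
move=> hf; exists [set f]; split; first by move=> _ ->; exists d.
apply/seteqP; split=> p /=; first by exists f.
by move=> [_ ->].
Qed.

Lemma is_section0 (d : int) (U : opens proj) :
  is_section d (0 : U -> {fraction S}).
Proof.
move=> p; have [i hi] := pideal_relevant (val p).
have hX k : 'X_i ^+ k \is [in K[n.+1], k.-homog].
  by rewrite -[X in X.-homog]mul1n; apply: dhomogMn; rewrite dhomogX; apply/eqP/mdeg1.
have prX k (q : proj) : 'X_i \notin (q : pred S) ->
    'X_i ^+ k \notin (q : pred S).
  move=> qi; elim: k => [|k IH]; first by rewrite expr0 idealr1.
  by rewrite exprS prime_idealrM negb_or qi.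
exists (Opens (zariski_open_basic (hX 1%N))); split=> //=.
exists 0, ('X_i ^+ absz d), (absz (d + absz d)), (absz d); split=> //.
- exact: rpred0.
- rewrite gez0_abs 1?addrC //.
  by rewrite -lerBlDr sub0r abszE -normrN ler_norm.
- by move=> q qi; rewrite prX // rmorph0 mul0r.
Qed.

Definition section_pred (d : int) (U : opens proj) : pred (U -> {fraction S}) :=
  fun s => `[< is_section d s >].

Lemma section_zmod_closed d U : zmod_closed (@section_pred d U).
Proof.
split; first by apply/asboolP; exact: is_section0.
by move=> s t /asboolP hs /asboolP ht; apply/asboolP; exact: is_sectionB.
Qed.

HB.instance Definition _ d U :=
  GRing.isZmodClosed.Build _ (@section_pred d U) (@section_zmod_closed d U).

Record twist_sec (d : int) (U : opens proj) := TwistSec {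
  tw_fun :> U -> {fraction S};
  _ : section_pred d tw_fun
}.

HB.instance Definition _ d U := [isSub for @tw_fun d U].
HB.instance Definition _ d U := [Choice of twist_sec d U by <:].
HB.instance Definition _ d U := [SubChoice_isSubZmodule of twist_sec d U by <:].

Lemma twist_secP d U (s : twist_sec d U) : is_section d s.
Proof. by case: s => s hs; apply/asboolP. Qed.

Lemma twist_sec_inj d U (s t : twist_sec d U) : (forall q, s q = t q) -> s = t.
Proof. by move=> st; apply/val_inj/funext. Qed.

Definition twist_mk d U s (hs : is_section d s) : twist_sec d U :=
  TwistSec (asboolT hs : section_pred d s).

Section Structures.
Context (U : opens proj).

Definition reg_one : twist_sec 0 U := twist_mk (@is_section1 U).

Definition twist_scale d (a : twist_sec 0 U) (s : twist_sec d U) :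
    twist_sec d U :=
  twist_mk (is_sectionM (twist_secP a) (twist_secP s)).

Let twist_scaleA d a b (s : twist_sec d U) :
  twist_scale a (twist_scale b s) = twist_scale (twist_scale a b) s.
Proof. by apply: twist_sec_inj => q; exact: mulrA. Qed.

Let twist_scale1 d : left_id reg_one (@twist_scale d).
Proof. by move=> s; apply: twist_sec_inj => q; exact: mul1r. Qed.

Let twist_scaleDr d : right_distributive (@twist_scale d) +%R.
Proof. by move=> a s t; apply: twist_sec_inj => q; exact: mulrDr. Qed.

Let twist_scaleDl d (s : twist_sec d U) :
  {morph (@twist_scale d)^~ s : a b / a + b}.
Proof. by move=> a b; apply: twist_sec_inj => q; exact: mulrDl. Qed.

Let twist_scaleC : commutative (@twist_scale 0).
Proof. by move=> a b; apply: twist_sec_inj => q; exact: mulrC. Qed.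

Let twist_mulA : associative (@twist_scale 0).
Proof. by move=> a b c; exact: twist_scaleA. Qed.

Let twist_mulDl : left_distributive (@twist_scale 0) +%R.
Proof. by move=> a b c; exact: twist_scaleDl. Qed.

HB.instance Definition _ := GRing.Zmodule_isComPzRing.Build (twist_sec 0 U)
  twist_mulA twist_scaleC (@twist_scale1 0) twist_mulDl.

HB.instance Definition _ d := GRing.Zmodule_isLmodule.Build
  (twist_sec 0 U) (twist_sec d U) (@twist_scaleA d) (@twist_scale1 d)
  (@twist_scaleDr d) (@twist_scaleDl d).

End Structures.

Lemma is_section_res d (U V : opens proj) (h : V `<=` U) (s : twist_sec d U) :
  is_section d (fun q : V => s (subfun h q)).
Proof.
move=> p; have [W [Wp [a [b [da [db [ha hb hd hW]]]]]]] := twist_secP s (subfun h p).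
exists W; split=> //; exists a, b, da, db; split=> // q Wq.
exact: (hW (subfun h q)).
Qed.

Definition twist_res d (U V : opens proj) (h : V `<=` U) (s : twist_sec d U) :
  twist_sec d V := twist_mk (is_section_res h s).

Let twist_res_additive d (U V : opens proj) (h : V `<=` U) :
  zmod_morphism (@twist_res d U V h).
Proof. by move=> s t; exact: twist_sec_inj. Qed.

HB.instance Definition _ d U V h := GRing.isZmodMorphism.Build
  (twist_sec d U) (twist_sec d V) (@twist_res d U V h)
  (twist_res_additive h).

Let twist_res_mul (U V : opens proj) (h : V `<=` U) :
  monoid_morphism (@twist_res 0 U V h).
Proof. by split=> [|s t]; exact: twist_sec_inj. Qed.

HB.instance Definition _ U V h := GRing.isMonoidMorphism.Build
  (twist_sec 0 U) (twist_sec 0 V) (@twist_res 0 U V h)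
  (twist_res_mul h).

Lemma twist_resE d (U V : opens proj) (h : V `<=` U) (s : twist_sec d U) q q' :
  val q = val q' -> twist_res h s q = s q'.
Proof. by move=> e; congr (s _); apply: val_inj; rewrite -e. Qed.

Arguments twist_resE {d U V h s q} q' _.

Lemma twist_sheafP d : is_sheaf (@twist_res d).
Proof.
split.
- by move=> U h s; apply: twist_sec_inj => q; exact: twist_resE.
- move=> U V W h1 h2 h3 s; apply: twist_sec_inj => q.
  by rewrite (twist_resE (subfun h1 (subfun h2 q))) // (twist_resE (subfun h3 q)).
- move=> U I W h hU s t st; apply: twist_sec_inj => q.
  have [i _ Wq] := hU _ (set_valP q).
  have := congr1 (fun u : twist_sec d (W i) => u (SigSub (mem_set Wq))) (st i).
  by rewrite !(twist_resE (q)).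
- move=> U I W h hU s hs.
  have /choice[c hc] : forall q : U, exists i, oset (W i) (val q).
    by move=> q; have [i _ Wq] := hU _ (set_valP q); exists i.
  pose t (q : U) : {fraction S} := s (c q) (SigSub (mem_set (hc q))).
  have tE i (q : U) (r : W i) : val r = val q -> t q = s i r.
    move=> e; pose V := Opens (openI (oset_open (W (c q))) (oset_open (W i))).
    have hi : V `<=` W (c q) by move=> x [].
    have hj : V `<=` W i by move=> x [].
    have Vq : oset V (val q) by split; [exact: hc | rewrite -e; exact: set_valP].
    have := congr1 (fun u : twist_sec d V => u (SigSub (mem_set Vq))) (hs _ _ V hi hj).
    by rewrite (twist_resE (SigSub (mem_set (hc q)))) // (twist_resE (r)).
  have ht : is_section d t.
    move=> p; have [V [Vp [a [b [da [db [ha hb hd hV]]]]]]] :=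
      twist_secP (s (c p)) (SigSub (mem_set (hc p))).
    exists (Opens (openI (oset_open V) (oset_open (W (c p))))).
    split; first by split=> //; exact: hc.
    exists a, b, da, db; split=> // q [Vq Wq].
    by rewrite (tE _ q (SigSub (mem_set Wq))) //; exact: (hV (SigSub (mem_set Wq)) Vq).
  exists (twist_mk ht) => i; apply: twist_sec_inj => q.
  by rewrite (twist_resE (subfun (h i) q)) //; exact: tE.
Qed.

Definition Oproj : ring_sheaf proj :=
  @RingSheaf proj (twist_sec 0) (@twist_res 0) (@twist_sheafP 0).

Lemma twist_resZ d (U V : opens proj) (h : V `<=` U) (a : Oproj U)
    (s : twist_sec d U) :
  twist_res h (a *: s) = rg_res Oproj h a *: twist_res h s.
Proof. exact: twist_sec_inj. Qed.

Definition twist (d : int) : mod_sheaf Oproj :=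
  @ModSheaf proj Oproj (twist_sec d) (@twist_res d) (@twist_resZ d)
    (@twist_sheafP d).

Definition vector_bundle (r : nat) (E : mod_sheaf Oproj) : Prop :=
  locally_free r E.

(* H^i_*(E) = 0: the direct sum of the H^i(E(v)) over v in Z vanishes iff all
   its summands do. E(v) is the tensor product of E and O(v). *)
Definition Hstar_eq0 (i : nat) (E : mod_sheaf Oproj) : Prop :=
  forall (v : int) (Ev : mod_sheaf Oproj), is_tensor E (twist v) Ev ->
    cohomology_eq0 i (ab_of_mod Ev).

End ProjectiveSpace.

(* Main.v *)
(* The theorem follows from: if H^j_* vanishes for k < j < n - k, then H^k_*
   vanishes, for E of rank two and 4k <= n.

   Put L = Frac S and m = n + 1.  On D(x_i) a bundle is a direct summand of a
   free module, so E is given by matrices A_i, B_i over L with A_i B_i = 1 and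
   B_j A_i regular on D(x_i x_j).  Sections over D(x_s) are then vectors v of
   L^2 such that B_i v is regular for i in s, and the cohomology of all twists
   of E is that of one Cech complex C of such modules.  Derived and Cech
   cohomology are compared by Cartan's criterion on the basis D(x_i f).

   Let F be the free complex in degrees <= k obtained by resolving the cocycles
   of C from degree k downwards, with its map F -> C.  The vanishing hypothesis
   and the Koszul complex show that F is exact in the range a < -k modulo
   (x_0, ..., x_n), and that over each D(x_s) it resolves E.  So F (x) F
   computes E (x) E locally, and 1 - (swap of the factors) corresponds to the
   projection of 2 x 2 matrices to antisymmetric ones.  As S is factorial, the
   antisymmetric sections form delta S for one delta in L: this is where the
   rank two enters, since the exterior square is then a line bundle and has no
   cohomology in degree 2k.

   If H^k_* is not zero, choose e in F^k not in m F^k + d F^(k-1), and g in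
   F^(k-1) with dg = sum x_i u_i in m F^k but not in m d F^(k-1).  The cochain
   made of e (x) g and the e (x) u_i is a cocycle of the tensor product of F (x) F
   with the Cech complex and S^m -> S; its antisymmetrization is a coboundary
   because of the previous paragraph, so that e (x) g - g (x) e lies
   in m (F (x) F) + d (F (x) F).  Functionals p, q which are 1 on e and g and
   vanish on m F + d F, resp. on the elements with boundary in m dF, give 1 = 0
   modulo m. *)

From Stdlib.setoid_ring Require Import Ring_theory Field_theory Ring Field.
Require Import Defs.
From HB Require Import structures.
From mathcomp Require Import all_boot all_order all_algebra.
From mathcomp Require Import boolp classical_sets functions.
From mathcomp Require Import topology_structure.
From mathcomp Require Import mpoly.
From mathcomp Require Import zify.

Set Implicit Arguments.
Unset Strict Implicit.
Unset Printing Implicit Defensive.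

Import GRing.Theory Num.Theory.
Local Open Scope ring_scope.

(** The complex F has a generator for every possible datum, so it is not finitely generated and
    neither minimal resolutions nor Nakayama's lemma are at hand. What replaces them is that a fixed
    power of each [x_i] kills the middle cohomology ([coh_tors]): arguments modulo the coordinates
    are iterated until this power is reached, and functionals come from Zorn's lemma. Modules are
    subsets of vector spaces over L, so that tensor products and the exchange of factors are linear
    algebra over L, while predicates keep track of integrality and degree.

    The bound 4k <= n comes from degrees. The Cech complex tensored with S^m -> S is exact below
    degree m - 1; each tensor factor F lowers this bound by k, the largest degree of its generators.
    The cocycle to be bounded has degree 2k - 1, which requires 2k - 1 < m - 1 - 2k.

    Cohomology is defined by all injective resolutions at once, so a vanishing hypothesis says
    something only after one resolution has been produced; characters of stalks with values in Q/Z
    provide it. *)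

Section FieldTactic.
Context (F : fieldType).
(* The field tactic recognizes operations by their head symbol; these aliases
   hide the various canonical instances behind the operations of F. *)
Definition fzero : F := 0.
Definition fone : F := 1.
Definition fadd (x y : F) : F := x + y.
Definition fmul (x y : F) : F := x * y.
Definition fopp (x : F) : F := - x.
Definition finv (x : F) : F := x^-1.
Definition fsub (x y : F) : F := x - y.
Definition fdiv (x y : F) : F := x / y.
Fact fring : @ring_theory F fzero fone fadd fmul fsub fopp eq.
Proof.
split=> *; rewrite /fadd /fmul /fone /fzero /fopp ?add0r ?mul1r ?addrA ?mulrA ?mulrDl ?subrr //; by [exact: addrC|exact: mulrC].
Qed.
Fact ffield : @field_theory F fzero fone fadd fmul fsub fopp fdiv finv eq.
Proof.
split=> //; [exact: fring|by apply/eqP; rewrite oner_eq0|].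
by move=> p /eqP p0; rewrite /fmul /finv mulVf.
Qed.
End FieldTactic.
Ltac fold_field F :=
  repeat match goal with
  | |- context [@Algebra.add ?M ?x ?y] => change (@Algebra.add M x y) with (@fadd F x y)
  | |- context [@GRing.mul ?M ?x ?y] => change (@GRing.mul M x y) with (@fmul F x y)
  | |- context [@Algebra.opp ?M ?x] => change (@Algebra.opp M x) with (@fopp F x)
  | |- context [@GRing.inv ?M ?x] => change (@GRing.inv M x) with (@finv F x)
  | |- context [@GRing.one ?M] => change (@GRing.one M) with (@fone F)
  | |- context [@Algebra.zero ?M] => change (@Algebra.zero M) with (@fzero F)
  end;
  match goal with |- @eq _ ?a ?b => change (@eq (GRing.Field.sort F) a b) end.

(** * Signs and the Cech differential *)

Lemma mulrz_suml (V : zmodType) (T : Type) (r : seq T) (P : pred T) (F : T -> V)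
    (z : int) :
  (\sum_(i <- r | P i) F i) *~ z = \sum_(i <- r | P i) F i *~ z.
Proof. by apply: (big_morph (fun x => x *~ z)) => [x y|]; rewrite ?mulrzDl ?mul0rz. Qed.

Section Signs.
Context (m : nat).
Local Notation I := 'I_m.
Implicit Types (i j : I) (s : {set I}).

Definition sgn i s : int := (-1) ^+ #|[set j in s | (j < i)%N]|.

Lemma sgnD1 i j s : j \in s -> j != i ->
  sgn i s = sgn i (s :\ j) * (-1) ^+ (j < i)%N.
Proof.
move=> js ji; rewrite /sgn -exprD; congr (_ ^+ _).
rewrite (cardsD1 j) inE js /= addnC; congr (_ + _)%N.
by apply: eq_card => k; rewrite !inE andbA.
Qed.

Lemma sgnU1 i s : sgn i (i |: s) = sgn i s.
Proof.
rewrite /sgn; congr (_ ^+ _); apply: eq_card => k; rewrite !inE.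
by case: eqP => // ->; rewrite ltnn !andbF.
Qed.

Lemma sgnD11 i s : sgn i (s :\ i) = sgn i s.
Proof.
rewrite /sgn; congr (_ ^+ _); apply: eq_card => k; rewrite !inE.
by case: eqP => //= ->; rewrite ltnn andbF.
Qed.

Lemma sgn2 i s : sgn i s * sgn i s = 1.
Proof. by rewrite -expr2 /sgn sqrr_sign. Qed.

Lemma sgn_anti i j s : i \in s -> j \in s -> i != j ->
  sgn i s * sgn j (s :\ i) = - (sgn j s * sgn i (s :\ j)).
Proof.
move=> si sj ij; have ji : j != i by rewrite eq_sym.
rewrite (sgnD1 sj ji) (sgnD1 si ij) /=.
case: (ltngtP i j) => [lt|gt|/val_inj e]; last by rewrite e eqxx in ij.
- by rewrite expr0 expr1; lia.
- by rewrite expr0 expr1; lia.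
Qed.

Section Cech.
Context (V : zmodType).
Implicit Types c : {set I} -> V.

(** The coboundary of the full simplex on ['I_m], in all degrees at once and augmented: the empty
    set has degree -1. [hS i] is the contraction of the simplex to its vertex [i]. *)
Definition dS c s : V := \sum_(i in s) c (s :\ i) *~ sgn i s.
Definition hS i c s : V := if i \in s then 0 else c (i |: s) *~ sgn i s.

Lemma dSdS c s : dS (dS c) s = 0.
Proof.
rewrite /dS; under eq_bigr => i si do rewrite mulrz_suml big_mkcond /=.
rewrite pair_big_dep /=.
pose F (p : I * I) := if (p.2 \in s :\ p.1) then c (s :\ p.1 :\ p.2) *~ sgn p.2 (s :\ p.1) *~ sgn p.1 s else 0 : V.
rewrite (eq_bigl (fun p : I * I => p.1 \in s)) => [|p]; last by rewrite andbT.
transitivity (\sum_(p : I * I | p.1 \in s) F p); first by apply: eq_bigr.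
have -> : \sum_(p : I * I | p.1 \in s) F p = \sum_(p : I * I | [&& p.1 \in s, p.2 \in s & p.1 != p.2]) F p.
  rewrite [LHS]big_mkcond [RHS]big_mkcond /=; apply: eq_bigr => -[i j] _ /=.
  by rewrite /F /= in_setD1 eq_sym; case: (i \in s); case: (j \in s); case: (i == j).
(* Removing i and then j, or j and then i, leaves the same set with opposite signs, so the half i <
   j of the sum cancels the other half. *)
rewrite (bigID (fun p : I * I => (p.1 < p.2)%N)) /=.
rewrite [X in _ + X](reindex_onto (fun p : I * I => (p.2, p.1)) (fun p : I * I => (p.2, p.1))) /=; last by case.
rewrite -[X in _ + X]opprK; apply/eqP; rewrite subr_eq0 -sumrN; apply/eqP.
apply: eq_big => [[i j]|[i j]] /=.
  rewrite eqxx andbT [j == i]eq_sym.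
  by case: (i \in s); case: (j \in s); rewrite ?andbF //=; case: ltngtP => //= /val_inj ->; rewrite eqxx.
case/andP=> /and3P[si sj ij] lt; rewrite /F /= !inE si sj ij eq_sym ij /=.
rewrite -!mulrzA -mulrNz; congr (_ *~ _).
  by congr c; apply/setP => l; rewrite !inE andbCA.
by rewrite mulrC sgn_anti // [in RHS]mulrC.
Qed.

Lemma dShS i c s : dS (hS i c) s + hS i (dS c) s = c s.
Proof.
rewrite /dS /hS; case: ifPn => si.
  rewrite addr0 (bigD1 i) //= big1 ?addr0 => [|j /andP[js ji]].
    by rewrite in_setD1 eqxx /= finset.setD1K // -mulrzA sgnD11 sgn2.
  by rewrite in_setD1 eq_sym ji si mul0rz.
rewrite big_setU1 //= !finset.setU1K // mulrzDl -!mulrzA sgnU1 sgn2 addrC -addrA.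
rewrite -[RHS]addr0; congr (_ + _).
rewrite mulrz_suml -big_split big1 //= => j js.
have ji : j != i by apply: contraNneq si => <-.
rewrite in_setD1 (negbTE si) andbF.
have -> : i |: s :\ j = (i |: s) :\ j.
  by apply/setP => l; rewrite !inE; case: (l =P i) => [->|//]; rewrite /= eq_sym ji.
rewrite -!mulrzA -mulrzDr.
have := @sgn_anti i j (i |: s) (finset.setU11 _ _) _ _.
rewrite inE js orbT eq_sym ji => /(_ isT isT).
rewrite sgnU1 finset.setU1K // => e.
suff -> : sgn j (i |: s) * sgn i s + sgn i (s :\ j) * sgn j s = 0 by rewrite mulr0z.
have := sgnD1 js ji; have := @sgnD1 j i (i |: s) (finset.setU11 _ _).
rewrite eq_sym ji finset.setU1K // => -> // ->.
case: (ltngtP i j) => [lt|gt|/val_inj e']; last by rewrite e' eqxx in ji.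
- by rewrite expr0 expr1; lia.
- by rewrite expr0 expr1; lia.
Qed.

Lemma dSD c c' s : dS (c + c') s = dS c s + dS c' s.
Proof. by rewrite /dS -big_split /=; apply: eq_bigr => i _; rewrite mulrzDl. Qed.

Lemma dSN c s : dS (- c) s = - dS c s.
Proof. by rewrite /dS -sumrN; apply: eq_bigr => i _; rewrite mulNrz. Qed.

Lemma dSB c c' s : dS (c - c') s = dS c s - dS c' s.
Proof. by rewrite dSD dSN. Qed.

Lemma dS_eq c c' s : (forall i, i \in s -> c (s :\ i) = c' (s :\ i)) ->
  dS c s = dS c' s.
Proof. by move=> e; apply: eq_bigr => i /e ->. Qed.

Lemma dS_sum (J : Type) (r : seq J) (P : pred J) (F : J -> {set I} -> V) s :
  dS (fun s => \sum_(j <- r | P j) F j s) s = \sum_(j <- r | P j) dS (F j) s.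
Proof. by rewrite /dS exchange_big; apply: eq_bigr => i _; rewrite mulrz_suml. Qed.

End Cech.

Lemma dS_raddf (V W : zmodType) (f : {additive V -> W}) c s :
  f (dS c s) = dS (f \o c) s.
Proof. by rewrite /dS raddf_sum; apply: eq_bigr => i _; rewrite raddfMz. Qed.

End Signs.

(** * Characters of abelian groups *)

Local Open Scope ring_scope.
Local Open Scope classical_set_scope.
Section Characters.

Definition is_subgroup (G : zmodType) (A : set G) : Prop :=
  A 0 /\ forall x y, A x -> A y -> A (x - y).

Lemma subgroupN (G : zmodType) (A : set G) x : is_subgroup A -> A x -> A (- x).
Proof. by move=> [A0 AB] Ax; rewrite -sub0r; exact: AB. Qed.

Lemma subgroupD (G : zmodType) (A : set G) x y :
  is_subgroup A -> A x -> A y -> A (x + y).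
Proof. by move=> hA Ax Ay; rewrite -[y]opprK; apply: hA.2 => //; exact: subgroupN. Qed.

Lemma subgroupMn (G : zmodType) (A : set G) x n : is_subgroup A -> A x -> A (x *+ n).
Proof.
move=> hA Ax; elim: n => [|n IH]; first by rewrite mulr0n; exact: hA.1.
by rewrite mulrS; exact: subgroupD.
Qed.

Lemma subgroupMz (G : zmodType) (A : set G) x z : is_subgroup A -> A x -> A (x *~ z).
Proof.
move=> hA Ax; case: z => n; first exact: subgroupMn.
by rewrite NegzE mulrNz; apply: subgroupN => //; exact: subgroupMn.
Qed.

Lemma subgroup_congB (G : zmodType) (A : set G) a a' b b' : is_subgroup A ->
  A (a - a') -> A (b - b') -> A ((a - b) - (a' - b')).
Proof.
move=> hA ha hb; have := hA.2 _ _ ha hb.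
suff -> : (a - a') - (b - b') = (a - b) - (a' - b') by [].
by rewrite !opprB addrACA [- a' - b]addrC [RHS]addrACA.
Qed.

Lemma subgroup_trans (G : zmodType) (A : set G) a b c : is_subgroup A ->
  A (a - b) -> A (b - c) -> A (a - c).
Proof. by move=> hA ha hb; have := subgroupD hA ha hb; rewrite subrKA. Qed.

Lemma subgroup_sym (G : zmodType) (A : set G) a b : is_subgroup A ->
  A (a - b) -> A (b - a).
Proof. by move=> hA ha; have := subgroupN hA ha; rewrite opprB. Qed.

Lemma pair_mulrz (G H : zmodType) (x : G) (y : H) z : (x, y) *~ z = (x *~ z, y *~ z).
Proof.
have Mn n : (x, y) *+ n = (x *+ n, y *+ n).
  by elim: n => [|n IH]; rewrite ?mulr0n // !mulrS IH.
by case: z => n; rewrite ?NegzE ?mulrNz -?pmulrn Mn.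
Qed.

Lemma pair_subE (G H : zmodType) (x x' : G) (y y' : H) :
  (x, y) - (x', y') = (x - x', y - y').
Proof. by []. Qed.

(** The alternative is between infinite and finite order of [g] modulo [A]. *)
Lemma subgroup_order (G : zmodType) (A : set G) (g : G) : is_subgroup A ->
  (forall z : int, A (g *~ z) -> z = 0) \/
  exists2 n : nat, (0 < n)%N & A (g *+ n) /\
    forall z : int, A (g *~ z) -> exists w : int, z = n%:Z * w.
Proof.
move=> hA.
have [[n /andP[n0 /asboolP An]]|no] := pselect (exists n : nat, (0 < n)%N && `[< A (g *+ n) >]); last first.
  left=> z; case: z => n An.
    case: n An => // n An; case: no; exists n.+1; apply/andP; split=> //; exact/asboolP.
  case: no; exists n.+1; apply/andP; split=> //; apply/asboolP.
  by move: An; rewrite NegzE mulrNz => /(subgroupN hA); rewrite opprK.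
right; have ex : exists n : nat, (0 < n)%N && `[< A (g *+ n) >].
  by exists n; rewrite n0; exact/asboolP.
case: (ex_minnP ex) => d /andP[d0 /asboolP Ad] dmin; exists d => //; split=> // z Az.
exists (z %/ d)%Z; rewrite mulrC [LHS](divz_eq z d%:Z).
suff -> : (z %% d)%Z = 0 by rewrite addr0.
have Ar : A (g *~ (z %% d)%Z).
  rewrite /modz mulrzBr; apply: hA.2 => //; rewrite mulrC mulrzA.
  exact: subgroupMz.
have d0' : d%:Z != 0 by rewrite eqz_nat -lt0n.
have := modz_ge0 z d0'; have := ltz_pmod z (_ : 0 < d%:Z).
move: Ar; case: (z %% d)%Z => [[|r]|r] Ar //.
move=> /(_ d0) lt _; suff : (d <= r.+1)%N by move: lt; rewrite ltz_nat; lia.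
by apply: dmin; apply/andP; split=> //; apply/asboolP.
Qed.

Context (T : zmodType).
Hypothesis T_div : forall (t : T) n, (0 < n)%N -> exists t', t' *+ n = t.
Hypothesis T_tor : forall n, (1 < n)%N -> exists2 t : T, t != 0 & t *+ n = 0.

(** The graph of a homomorphism from a subgroup of [G] to [T]. For graphs, extension is inclusion
    and the bound of a chain is its union. *)
Definition partial_hom (G : zmodType) (A : set (G * T)) : Prop :=
  is_subgroup A /\ forall t, A (0, t) -> t = 0.

(** Baer's argument that a divisible group is injective. A maximal graph that missed [g] could be
    extended to [g] by dividing the value prescribed at the first multiple of [g] in its domain. *)
Lemma partial_hom_ext (G : zmodType) (R : set (G * T)) : partial_hom R ->
  exists f : {additive G -> T}, forall g t, R (g, t) -> f g = t.
Proof.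
move=> hR.
pose P (A : set (G * T)) := A = set0 \/ partial_hom A /\ R `<=` A.
have [] := @Zorn_bigcup _ P.
  move=> F FP Ftot.
  have [[X0 FX0 X0n]|no] := pselect (exists2 X, F X & X <> set0); last first.
    left; apply/seteqP; split=> // x [X FX Xx].
    have [e|//] := pselect (X = set0); first by rewrite e in Xx.
    by move=> Xn; case: no; exists X.
  right; have FX X : F X -> X <> set0 -> partial_hom X /\ R `<=` X.
    by move=> /FP[].
  have [hX0 RX0] := FX _ FX0 X0n.
  split; last by move=> x Rx; exists X0 => //; exact: RX0.
  split; last first.
    move=> t [X FXX Xt]; have [|[_ h] _] := FX _ FXX; last exact: h.
    by move=> e; rewrite e in Xt.
  split; first by exists X0 => //; exact: hX0.1.1.
  have key X : F X -> forall x y, X x -> X y -> X (x - y).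
    move=> FXX x y Xx Xy; have [|[[_ h] _] _] := FX _ FXX; last exact: h.
    by move=> e; rewrite e in Xx.
  move=> x y [X FXX Xx] [Y FYY Yy]; have [XY|YX] := Ftot _ _ FXX FYY.
    by exists Y => //; apply: key => //; exact: XY.
  by exists X => //; apply: key => //; exact: YX.
move=> A [[A0|[[hA Afun] RA]] Amax].
  exfalso; apply: (Amax R); last by right; split=> //.
  by rewrite A0; split=> // /(_ (0, 0)); apply; exact: hR.1.1.
have Auniq g t t' : A (g, t) -> A (g, t') -> t = t'.
  move=> At At'; apply/eqP; rewrite -subr_eq0; apply/eqP/Afun.
  by rewrite -[0](subrr g); exact: (hA.2 _ _ At At').
have Atot g : exists t, A (g, t).
  have [//|no] := pselect (exists t, A (g, t)); exfalso.
  pose D := [set x : G | exists t, A (x, t)].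
  have hD : is_subgroup D.
    split; first by exists 0; exact: hA.1.
    by move=> x y [t At] [t' At']; exists (t - t'); exact: (hA.2 _ _ At At').
  have [q hq] : exists q, forall z t, A (g *~ z, t) -> t = q *~ z.
    have [h|[n n0 [[t At] h]]] := subgroup_order g hD.
      exists 0 => z t At; have z0 : z = 0 by apply: h; exists t.
      by move: At; rewrite z0 !mulr0z => /Afun.
    have [q qt] := T_div t n0; exists q => z t' At'.
    have [|w e] := h z; first by exists t'.
    apply: (Auniq _ _ _ At'); rewrite e mulrzA [X in (_, X)]mulrzA -!pmulrn qt.
    by rewrite -pair_mulrz; exact: subgroupMz.
  pose B := [set p : G * T | exists x t z, A (x, t) /\ p = (x + g *~ z, t + q *~ z)].
  apply: (Amax B); last first.
    right; split; last first.
      by move=> [x t] /RA At; exists x, t, 0; rewrite !mulr0z !addr0.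
    split; first split.
    - by exists 0, 0, 0; rewrite !mulr0z !addr0; split=> //; exact: hA.1.
    - move=> _ _ [x [t [z [At ->]]]] [x' [t' [z' [At' ->]]]].
      exists (x - x'), (t - t'), (z - z'); split; first exact: (hA.2 _ _ At At').
      rewrite pair_subE !mulrzBr; congr pair; by rewrite opprD addrACA.
    - move=> t [x [t' [z [At' [e ->]]]]].
      have ez : g *~ (- z) = x by rewrite mulrNz; apply/eqP; rewrite eq_sym -addr_eq0 -e.
      by rewrite -ez in At'; rewrite (hq _ _ At') mulrNz addNr.
  split; last first.
    by move=> BA; apply: no; exists q; apply: BA; exists 0, 0, 1; rewrite !mulr1z !add0r; split=> //; exact: hA.1.
  by move=> [x t] At; exists x, t, 0; rewrite !mulr0z !addr0.
have [f fA] := choice Atot.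
have fadd : zmod_morphism f.
  by move=> x y; apply: Auniq (fA _) _; exact: (hA.2 _ _ (fA x) (fA y)).
pose fM := GRing.isZmodMorphism.Build _ _ f fadd.
pose F : {additive G -> T} := HB.pack f fM.
by exists F => g t /RA At; apply: Auniq At; exact: fA.
Qed.

Lemma character_sep (G : zmodType) (N : set G) (g : G) : is_subgroup N -> ~ N g ->
  exists f : {additive G -> T}, (forall x, N x -> f x = 0) /\ f g <> 0.
Proof.
move=> hN Ng.
(* The value prescribed for [g]: any nonzero element if [g] has infinite order modulo [N], and a
   nonzero element killed by that order otherwise. *)
have [q q0 hq] : exists2 q : T, q != 0 & forall z, N (g *~ z) -> q *~ z = 0.
  have [h|[n n0 [Nn h]]] := subgroup_order g hN.
    have [q q0 _] := @T_tor 2 isT; exists q => // z /h ->; exact: mulr0z.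
  have [|q q0 qn] := @T_tor n.
    by rewrite ltn_neqAle n0 andbT; apply/eqP => e; apply: Ng; rewrite -[g]mulr1n e.
  by exists q => // z /h[w ->]; rewrite mulrzA -pmulrn qn mul0rz.
pose R := [set p : G * T | exists x z, N x /\ p = (x + g *~ z, q *~ z)].
have hR : partial_hom R.
  split; first split.
  - by exists 0, 0; rewrite !mulr0z addr0; split=> //; exact: hN.1.
  - move=> _ _ [x [z [Nx ->]]] [x' [z' [Nx' ->]]].
    exists (x - x'), (z - z'); split; first exact: hN.2.
    rewrite pair_subE !mulrzBr; congr pair; by rewrite opprD addrACA.
  - move=> t [x [z [Nx [e ->]]]].
    have ez : g *~ (- z) = x by rewrite mulrNz; apply/eqP; rewrite eq_sym -addr_eq0 -e.
    by rewrite -[z]opprK mulrNz hq ?oppr0 // ez.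
have [f hf] := partial_hom_ext hR; exists f; split.
  by move=> x Nx; apply: hf; exists x, 0; rewrite !mulr0z addr0.
rewrite (hf g q); first exact/eqP.
by exists 0, 1; rewrite !mulr1z add0r; split=> //; exact: hN.1.
Qed.

End Characters.

Definition int_rat : pred rat := fun x => x \is a Num.int.

Lemma int_rat_zmod : zmod_closed int_rat.
Proof. by split=> [|x y hx hy]; [exact: rpred0 | exact: rpredB]. Qed.

HB.instance Definition _ := GRing.isZmodClosed.Build _ int_rat int_rat_zmod.

Definition QZ : zmodType := Quotient.quot (GRing.ZmodClosed.clone rat int_rat _).

Lemma QZ_div (t : QZ) n : (0 < n)%N -> exists t', t' *+ n = t.
Proof.
move=> n0; exists (\pi_QZ (repr t / n%:R))%qT.
rewrite -[RHS]reprK -raddfMn /=; congr (\pi_ _ _)%qT.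
by rewrite -[LHS]mulr_natr divfK // pnatr_eq0 -lt0n.
Qed.

Lemma QZ_tor n : (1 < n)%N -> exists2 t : QZ, t != 0 & t *+ n = 0.
Proof.
move=> n1; exists (\pi_QZ (n%:R^-1))%qT.
  have -> : (0 : QZ) = (\pi_QZ 0)%qT by rewrite raddf0.
  rewrite -Quotient.idealrBE subr0.
  apply/negP => /intrP[z e].
  have : (1 : rat) = z%:~R * n%:R by rewrite -e mulVf // pnatr_eq0; case: n n1 {e}.
  rewrite -[n%:R]/(n%:Z%:~R) -intrM -[1]/(1%:~R) => /intr_inj.
  by case: z {e} => [[|[|z]]|z]; lia.
rewrite -raddfMn /= -[_ *+ n]mulr_natr mulVf ?pnatr_eq0; last by case: n n1.
have -> : (0 : QZ) = (\pi_QZ 0)%qT by rewrite raddf0.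
by apply/eqP; rewrite -Quotient.idealrBE subr0; apply/intrP; exists 1.
Qed.

(** * Injective resolutions *)

Section DepProd.
Context (T : Type) (G : T -> zmodType).

Definition dprod := forall t, G t.

HB.instance Definition _ := gen_eqMixin dprod.
HB.instance Definition _ := gen_choiceMixin dprod.

Definition dprod0 : dprod := fun t => 0.
Definition dprodN (f : dprod) : dprod := fun t => - f t.
Definition dprodD (f g : dprod) : dprod := fun t => f t + g t.

Fact dprodA : associative dprodD.
Proof. by move=> f g h; apply: functional_extensionality_dep => t; exact: addrA. Qed.
Fact dprodC : commutative dprodD.
Proof. by move=> f g; apply: functional_extensionality_dep => t; exact: addrC. Qed.
Fact dprod0D : left_id dprod0 dprodD.
Proof. by move=> f; apply: functional_extensionality_dep => t; exact: add0r. Qed.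
Fact dprodND : left_inverse dprod0 dprodN dprodD.
Proof. by move=> f; apply: functional_extensionality_dep => t; exact: addNr. Qed.

HB.instance Definition _ := GRing.isZmodule.Build dprod dprodA dprodC dprod0D dprodND.

End DepProd.

Section Germs.
Context (X : topologicalType).

Definition opensI (U V : opens X) : opens X :=
  Opens (openI (oset_open U) (oset_open V)).

Lemma opensIl U V : opensI U V `<=` U. Proof. by move=> x []. Qed.
Lemma opensIr U V : opensI U V `<=` V. Proof. by move=> x []. Qed.

Context (A : ab_sheaf X) (x : X).

(** The stalk at [x] is presented as a subquotient of a product rather than as a direct limit:
    [gext] extends a section by 0 to a family over all opens, and [gnull x] holds the families that
    vanish on all opens inside some neighbourhood of [x]. *)
Definition germs : zmodType := @dprod (opens X) A.

Definition gext (V : opens X) (s : A V) : germs := fun W =>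
  match pselect (W `<=` V) with left h => ab_res A h s | right _ => 0 end.

Lemma gextB V (s t : A V) : gext (s - t) = gext s - gext t.
Proof.
apply: functional_extensionality_dep => W; rewrite /gext [RHS]/GRing.add /= /dprodD /GRing.opp /= /dprodN.
by case: pselect => h; rewrite ?raddfB ?subrr.
Qed.

Definition gnull (h : germs) : Prop :=
  exists W : opens X, oset W x /\ forall V : opens X, V `<=` W -> h V = 0.

Lemma gnull_subgroup : is_subgroup gnull.
Proof.
split; first by exists (otop X).
move=> g h [W [Wx gW]] [W' [W'x hW]]; exists (opensI W W'); split=> // V VW.
rewrite /GRing.add /= /dprodD /GRing.opp /= /dprodN gW ?hW ?subrr //.
  by move=> y /VW[].
by move=> y /VW[].
Qed.

Lemma gext_res (V W : opens X) (h : W `<=` V) (s : A V) : oset W x ->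
  gnull (gext s - gext (ab_res A h s)).
Proof.
move=> Wx; exists W; split=> // U UW.
rewrite /GRing.add /= /dprodD /GRing.opp /= /dprodN /gext.
case: pselect => [h1|]; last by case; exact: subset_trans UW h.
case: pselect => [h2|//]; apply/eqP; rewrite subr_eq0; apply/eqP; symmetry.
exact: (sheaf_comp (ab_sheafP A)).
Qed.

Lemma gextE (U V : opens X) (h : U `<=` V) (s : A V) : gext s U = ab_res A h s.
Proof.
rewrite /gext; case: pselect => [h1|//].
by rewrite -(sheaf_comp (ab_sheafP A) h (@subset_refl _ U) h1) (sheaf_id (ab_sheafP A)).
Qed.

Lemma gext_null (V : opens X) (s : A V) : oset V x -> gnull (gext s) ->
  exists (W : opens X) (h : W `<=` V), oset W x /\ ab_res A h s = 0.
Proof.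
move=> Vx [W [Wx hW]]; exists (opensI W V), (@opensIr _ _); split=> //.
by rewrite -gextE; apply: hW; exact: opensIl.
Qed.

End Germs.

(** A character of the stalk at [gc_pt], given by compatible maps on sections. On opens that avoid
    the point the maps are unconstrained. *)
Record gchar (X : topologicalType) (A : ab_sheaf X) := Gchar {
  gc_pt : X;
  gc_fun : forall V : opens X, {additive A V -> QZ};
  gc_res : forall (V W : opens X) (h : W `<=` V) (s : A V), oset W gc_pt ->
    gc_fun W (ab_res A h s) = gc_fun V s
}.

Lemma gextD X (A : ab_sheaf X) V : zmod_morphism (@gext X A V).
Proof. by move=> s t; exact: gextB. Qed.

HB.instance Definition _ X (A : ab_sheaf X) V :=
  GRing.isZmodMorphism.Build (A V) (germs A) (@gext X A V) (@gextD X A V).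

Definition gchar_of (X : topologicalType) (A : ab_sheaf X) (x : X)
    (f : {additive germs A -> QZ}) (fN : forall h, gnull x h -> f h = 0) : gchar A.
Proof.
refine (@Gchar X A x (fun V => f \o @gext X A V) _).
abstract by move=> V W h s Wx; apply/esym/eqP; rewrite -subr_eq0 /= -raddfB fN //; exact: gext_res.
Defined.

Definition gchar_kills X (F A : ab_sheaf X) (f : ab_hom F A) (c : gchar A) : Prop :=
  forall V s, oset V (gc_pt c) -> gc_fun c V (f V s) = 0.

(** The families that lie near [x] in the image of [F] form a subgroup. If [s] is not locally in it,
    some character with values in Q/Z kills the subgroup but not [s], and such a character factors
    through the stalk. *)
Lemma gchar_sep X (F A : ab_sheaf X) (f : ab_hom F A) (V : opens X) (s : A V) x :
  oset V x ->
  (forall c : gchar A, gchar_kills f c -> gc_pt c = x -> gc_fun c V s = 0) ->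
  exists (W : opens X) (h : W `<=` V), oset W x /\ exists u : F W, f W u = ab_res A h s.
Proof.
move=> Vx hs.
pose N (h : germs A) := exists (W : opens X) (u : F W), oset W x /\ gnull x (h - gext (f W u)).
have hN : is_subgroup N.
  split.
    exists (otop X), 0; split=> //; rewrite !raddf0 ?subr0 ?addr0.
    exact: (gnull_subgroup A x).1.
  move=> g h [W [u [Wx gW]]] [W' [u' [W'x hW]]].
  exists (opensI W W'), (ab_res F (@opensIl _ W W') u - ab_res F (@opensIr _ W W') u'); split=> //.
  have -> : gext (f (opensI W W') (ab_res F (@opensIl _ W W') u - ab_res F (@opensIr _ W W') u'))
      = gext (ab_res A (@opensIl _ W W') (f W u)) - gext (ab_res A (@opensIr _ W W') (f W' u')).
    by rewrite -!ah_nat -!raddfB.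
  have Wx' : oset (opensI W W') x by [].
  have NG := gnull_subgroup A x.
  apply: (subgroup_congB NG).
    by apply: (subgroup_trans NG gW); exact: gext_res.
  by apply: (subgroup_trans NG hW); exact: gext_res.
have [[W [u [Wx gW]]]|no] := pselect (N (gext s)).
  have VWx : oset (opensI V W) x by [].
  have : gnull x (gext (ab_res A (@opensIl _ V W) s - ab_res A (@opensIr _ V W) (f W u))).
    rewrite raddfB /=; have NG := gnull_subgroup A x.
    apply: (subgroup_trans NG (subgroup_sym NG (gext_res (@opensIl _ V W) s VWx))).
    by apply: (subgroup_trans NG gW); exact: gext_res.
  move=> /(gext_null VWx)[U [h [Ux e]]].
  have hV : U `<=` V by move=> y /h[].
  have hW : U `<=` W by move=> y /h[].
  exists U, hV; split=> //; exists (ab_res F hW u); rewrite ah_nat.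
  move/eqP: e; rewrite raddfB /= subr_eq0.
  by rewrite (sheaf_comp (ab_sheafP A) _ _ hV) (sheaf_comp (ab_sheafP A) _ _ hW) => /eqP.
have [chi [chiN]] := character_sep QZ_div QZ_tor hN no.
have hnull h : gnull x h -> chi h = 0.
  by move=> hh; apply: chiN; exists (otop X), 0; rewrite !raddf0 ?subr0 ?addr0.
case; have := hs (gchar_of hnull) _ erefl; apply.
move=> W u Wx /=; apply: chiN; exists W, u; split=> //.
by rewrite subrr; exact: (gnull_subgroup A x).1.
Qed.

Section FunSheaf.
Context (X : topologicalType) (T : Type) (pt : T -> X).

(** Sections of a product of skyscraper sheaves Q/Z, one at the point [pt t] for each [t]. *)
Definition fun_sec (U : opens X) : zmodType := {t : T | oset U (pt t)} -> QZ.

Definition fun_res (U V : opens X) (h : V `<=` U) (s : fun_sec U) : fun_sec V :=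
  fun t => s (exist _ (sval t) (h _ (svalP t))).

Fact fun_res_additive U V h : zmod_morphism (@fun_res U V h).
Proof. by []. Qed.

HB.instance Definition _ U V h :=
  GRing.isZmodMorphism.Build _ _ (@fun_res U V h) (fun_res_additive h).

Lemma fun_sec_eq U (s : fun_sec U) t t' : sval t = sval t' -> s t = s t'.
Proof. by move=> e; congr s; exact: eq_sig_hprop. Qed.

Lemma fun_sheafP : is_sheaf fun_res.
Proof.
split.
- by move=> U h s; apply/funext => t; exact: (fun_sec_eq s).
- by move=> U V W h1 h2 h3 s; apply/funext => t; exact: (fun_sec_eq s).
- move=> U I W h hU s t st; apply/funext => -[u hu].
  have [i _ Wi] := hU _ hu.
  have := congr1 (fun f : fun_sec (W i) => f (exist _ u Wi)) (st i).
  by rewrite /fun_res /= (fun_sec_eq s (t' := exist _ u hu)) // (fun_sec_eq t (t' := exist _ u hu)).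
- move=> U I W h hU s hs.
  have /choice[c hc] : forall t : {t : T | oset U (pt t)}, exists i, oset (W i) (pt (sval t)).
    by move=> t; have [i _ Wi] := hU _ (svalP t); exists i.
  exists (fun t => s (c t) (exist _ (sval t) (hc t))) => i; apply/funext => t.
  pose t' : {t : T | oset U (pt t)} := exist _ (sval t) (h i _ (svalP t)).
  have := congr1 (fun f : fun_sec (opensI (W (c t')) (W i)) => f (exist _ (sval t) (conj (hc t') (svalP t))))
    (hs (c t') i _ (@opensIl _ _ _) (@opensIr _ _ _)).
  rewrite /fun_res /=.
  by move=> e; etransitivity; first (etransitivity; last exact: e); exact: fun_sec_eq.
Qed.

Definition fun_sheaf : ab_sheaf X :=
  @AbSheaf X fun_sec (fun U V h => @fun_res U V h) fun_sheafP.

(** A morphism to this sheaf is a family of characters of stalks. A monomorphism is injective on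
    stalks, so each character extends along it because Q/Z is divisible. *)
Lemma fun_sheaf_injective : injective_sheaf fun_sheaf.
Proof.
move=> F G i f imono.
have key (t : T) : exists chi : {additive germs G -> QZ},
    (forall h, gnull (pt t) h -> chi h = 0) /\
    forall (V : opens X) (hV : oset V (pt t)) (s : F V),
      chi (gext (i V s)) = f V s (exist (fun t => oset V (pt t)) t hV).
  set x := pt t; have NG := gnull_subgroup G x.
  pose R (p : germs G * QZ) := exists (V : opens X) (hV : oset V x) (s : F V),
    gnull x (p.1 - gext (i V s)) /\ p.2 = f V s (exist (fun t => oset V (pt t)) t hV).
  have hR : partial_hom R.
    split; first split.
    - exists (otop X), I, 0; rewrite !raddf0 ?subr0 ?addr0; split=> //; exact: NG.1.
    - move=> [g q] [g' q'] [W [Wx [u [gW /= eq]]]] [W' [W'x [u' [hW /= eq']]]].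
      exists (opensI W W'), (conj Wx W'x), (ab_res F (@opensIl _ W W') u - ab_res F (@opensIr _ W W') u').
      have -> : gext (i (opensI W W') (ab_res F (@opensIl _ W W') u - ab_res F (@opensIr _ W W') u'))
          = gext (ab_res G (@opensIl _ W W') (i W u)) - gext (ab_res G (@opensIr _ W W') (i W' u')).
        by rewrite -!ah_nat -!raddfB.
      have Wx' : oset (opensI W W') x by [].
      split.
        apply: (subgroup_congB NG).
          by apply: (subgroup_trans NG gW); exact: gext_res.
        by apply: (subgroup_trans NG hW); exact: gext_res.
      rewrite /= eq eq' raddfB /= !ah_nat; congr (_ - _); exact: fun_sec_eq.
    - move=> q [V [Vx [s [hs /= ->]]]].
      move: hs; rewrite /= sub0r => /(subgroupN NG); rewrite opprK.
      move=> /(gext_null Vx)[W [h [Wx]]]; rewrite -ah_nat -[RHS](raddf0 (i W)) => /imono e.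
      have := congr1 (fun g : fun_sec W => g (exist (fun t => oset W (pt t)) t Wx)) (ah_nat f h s).
      rewrite e raddf0 => e2; apply: (etrans _ (esym e2)).
      exact: (fun_sec_eq (f V s)).
  have [chi hchi] := partial_hom_ext QZ_div hR; exists chi; split.
    move=> h hh; apply: hchi; exists (otop X), I, 0.
    by rewrite !raddf0 ?subr0 ?addr0.
  move=> V hV s; apply: hchi; exists V, hV, s; split=> //=.
  by rewrite subrr; exact: NG.1.
have [chi hchi] := choice key.
pose g (U : opens X) (s : G U) : fun_sheaf U := fun t => chi (sval t) (gext s).
have gadd U : zmod_morphism (g U).
  by move=> s s'; apply/funext => t; rewrite /g raddfB raddfB.
pose gM U := GRing.isZmodMorphism.Build _ _ (g U) (gadd U).
pose gA U : {additive G U -> fun_sheaf U} := HB.pack (g U) (gM U).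
have gnat (U V : opens X) (h : V `<=` U) (s : G U) : gA V (ab_res G h s) = ab_res fun_sheaf h (gA U s).
  apply/funext => t; rewrite /= /g /fun_res /=; apply/esym/eqP; rewrite -subr_eq0 -raddfB.
  by rewrite (hchi (sval t)).1 //; apply: gext_res; exact: (svalP t).
exists (AbHom gnat) => U s; apply/funext => -[t ht] /=.
exact: (hchi t).2.
Qed.

End FunSheaf.

Section Resolution.
Context (X : topologicalType).

Definition killing (F A : ab_sheaf X) (f : ab_hom F A) := {c : gchar A | gchar_kills f c}.

Section Coker.
Context (F A : ab_sheaf X) (f : ab_hom F A).

(** One skyscraper Q/Z for every stalk character of [A] that kills the image of [F]. These
    characters separate the germs outside the image, so [A] modulo the image embeds in an injective
    sheaf without any sheafification. *)
Definition coker_sheaf : ab_sheaf X := fun_sheaf (fun c : killing f => gc_pt (sval c)).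

Definition coker_fun (U : opens X) (s : A U) : coker_sheaf U :=
  fun c => gc_fun (sval (sval c)) U s.

Fact coker_fun_additive U : zmod_morphism (@coker_fun U).
Proof. by move=> s t; apply/funext => c; rewrite /coker_fun raddfB. Qed.

HB.instance Definition _ U :=
  GRing.isZmodMorphism.Build _ _ (@coker_fun U) (@coker_fun_additive U).

Fact coker_fun_nat (U V : opens X) (h : V `<=` U) (s : A U) :
  coker_fun (ab_res A h s) = ab_res coker_sheaf h (coker_fun s).
Proof. by apply/funext => c; rewrite /coker_fun /= /fun_res gc_res //; exact: (svalP c). Qed.

Definition coker_hom : ab_hom A coker_sheaf := AbHom coker_fun_nat.

Lemma coker_exact : ab_exact f coker_hom.
Proof.
split=> [U s|U t t0 x Ux].
  by apply/funext => c; rewrite /= /coker_fun; apply: (svalP (sval c)); exact: (svalP c).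
have [c hc cx|W [h [Wx [u e]]]] := @gchar_sep X F A f U t x Ux.
  have Uc : oset U (gc_pt c) by rewrite cx.
  exact: (congr1 (fun g : coker_sheaf U => g (exist _ (exist _ c hc) Uc)) t0).
by exists W, h; split=> //; exists u.
Qed.

Lemma coker_injective : injective_sheaf coker_sheaf.
Proof. exact: fun_sheaf_injective. Qed.

End Coker.

Definition zero_sheaf : ab_sheaf X := fun_sheaf (fun t : False => match t with end).

Section Zero.
Context (A : ab_sheaf X).
Definition zero_fun (U : opens X) (s : zero_sheaf U) : A U := 0.
Fact zero_fun_additive U : zmod_morphism (@zero_fun U).
Proof. by move=> s t; rewrite /zero_fun subrr. Qed.
HB.instance Definition _ U :=
  GRing.isZmodMorphism.Build _ _ (@zero_fun U) (@zero_fun_additive U).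
Fact zero_fun_nat (U V : opens X) (h : V `<=` U) (s : zero_sheaf U) :
  zero_fun (ab_res zero_sheaf h s) = ab_res A h (zero_fun s).
Proof. by rewrite /zero_fun raddf0. Qed.
Definition zero_hom : ab_hom zero_sheaf A := AbHom zero_fun_nat.
End Zero.

Lemma coker_zero_mono (A : ab_sheaf X) : ab_mono (coker_hom (zero_hom A)).
Proof.
move=> U s t e; apply/eqP; rewrite -subr_eq0; apply/eqP.
have st0 : coker_hom (zero_hom A) U (s - t) = 0 by rewrite raddfB /= e subrr.
have /choice[W hW] : forall x : {x | oset U x}, exists W : opens X,
    exists h : W `<=` U, oset W (sval x) /\ ab_res A h (s - t) = 0.
  move=> [x Ux]; have [W [h [Wx [u e']]]] := (coker_exact (zero_hom A)).2 U _ st0 x Ux.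
  by exists W, h; split=> //; rewrite -e'.
have hU x : W x `<=` U by have [h _] := hW x.
apply: (sheaf_sep (ab_sheafP A) (h := hU)).
  by move=> x Ux; have [h [Wx _]] := hW (exist _ x Ux); exists (exist _ x Ux).
move=> x; rewrite raddf0; have [h [_ e']] := hW x.
by rewrite (_ : hU x = h) //; exact: Prop_irrelevance.
Qed.

Context (A : ab_sheaf X).

(** Source and target are bundled with the map, so that the resolution is a recursion in a fixed
    type. *)
Record res_state := ResState { rs_src : ab_sheaf X; rs_tgt : ab_sheaf X; rs_hom : ab_hom rs_src rs_tgt }.

Definition res_next (st : res_state) : res_state :=
  ResState (coker_hom (rs_hom st)).

Fixpoint res_seq (n : nat) : res_state :=
  match n with
  | 0 => ResState (coker_hom (zero_hom A))
  | n.+1 => res_next (res_seq n)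
  end.

Definition std_resolution : injective_resolution A.
Proof.
refine (@InjectiveResolution X A (fun n => rs_tgt (res_seq n)) (rs_hom (res_seq 0))
  (fun n => rs_hom (res_seq n.+1)) _ _ _ _).
- by case=> [|n]; exact: coker_injective.
- exact: coker_zero_mono.
- exact: coker_exact.
- by move=> n; exact: coker_exact.
Qed.

End Resolution.

(** * Cech and derived cohomology *)

Section CechSheaf.
Context (X : topologicalType).

Section Cover.
Context (U : opens X) (m : nat) (W : 'I_m -> opens X).
Local Notation I := 'I_m.
Implicit Types s : {set I}.

Definition wcap_set s : set X := oset U `&` [set x | forall i, i \in s -> oset (W i) x].

Fact wcap_open s : open (wcap_set s).
Proof.
suff h (r : seq I) : open (oset U `&` [set x | forall i, i \in r -> oset (W i) x]).
  have -> : wcap_set s = oset U `&` [set x | forall i, i \in enum s -> oset (W i) x].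
    by congr (_ `&` _); apply/seteqP; split=> x h' i hi; apply: h'; move: hi; rewrite mem_enum.
  exact: h.
elim: r => [|i r IH].
  rewrite (_ : _ `&` _ = oset U); first exact: oset_open.
  by apply/seteqP; split=> [x []|x Ux].
rewrite (_ : _ `&` _ = oset (W i) `&` (oset U `&` [set x | forall i, i \in r -> oset (W i) x])).
  by apply: openI => //; exact: oset_open.
apply/seteqP; split=> x.
  move=> [Ux h]; split; first by apply: h; exact: mem_head.
  by split=> // j jr; apply: h; rewrite inE jr orbT.
move=> [Wx [Ux h]]; split=> // j; rewrite inE => /orP[/eqP ->//|]; exact: h.
Qed.

Definition wcap s : opens X := Opens (wcap_open s).

Lemma wcapS s (t : {set I}) : t \subset s -> wcap s `<=` wcap t.
Proof. by move=> /fintype.subsetP ts x [Ux h]; split=> // i /ts; exact: h. Qed.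

Lemma wcapD s i : wcap s `<=` wcap (s :\ i).
Proof. by apply: wcapS; exact: subD1set. Qed.

Lemma wcapU s : wcap s `<=` U. Proof. by move=> x []. Qed.

Lemma wcap0 : U `<=` wcap finset.set0.
Proof. by move=> x Ux; split=> // i; rewrite inE. Qed.

Definition cochain (A : ab_sheaf X) := forall s, A (wcap s).

Definition dC (A : ab_sheaf X) (c : cochain A) : cochain A :=
  fun s => \sum_(i in s) ab_res A (@wcapD s i) (c (s :\ i)) *~ sgn i s.

Definition cut n (A : ab_sheaf X) (c : cochain A) : cochain A :=
  fun s => if #|s| == n then c s else 0.

Lemma gchar_dC (A : ab_sheaf X) (c : cochain A) s (g : gchar A) :
  oset (wcap s) (gc_pt g) ->
  gc_fun g (wcap s) (dC c s) = dS (fun t => gc_fun g (wcap t) (c t)) s.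
Proof.
move=> gs; rewrite /dC raddf_sum; apply: eq_bigr => i _.
by rewrite raddfMz gc_res.
Qed.

(** Stalk characters move the terms of [dC], which come from sections over different opens, into the
    single group Q/Z; identities for [dC] then follow from those for [dS]. *)
Lemma gchar_eq (A : ab_sheaf X) (V : opens X) (s t : A V) :
  (forall g : gchar A, oset V (gc_pt g) -> gc_fun g V s = gc_fun g V t) -> s = t.
Proof.
move=> h; apply: (@coker_zero_mono X A V); apply/funext => c.
by apply: h; exact: (svalP c).
Qed.

Lemma dCdC (A : ab_sheaf X) (c : cochain A) s : dC (dC c) s = 0.
Proof.
apply: gchar_eq => g gs; rewrite gchar_dC // raddf0 -[RHS](dSdS (fun t => gc_fun g (wcap t) (c t)) s).
by apply: dS_eq => i si; rewrite gchar_dC //; exact: (@wcapD s i _ gs).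
Qed.

Lemma dC_eq (A : ab_sheaf X) (c c' : cochain A) s :
  (forall t : {set I}, #|t|.+1 = #|s| -> c t = c' t) -> dC c s = dC c' s.
Proof.
move=> h; apply: eq_bigr => i si; rewrite h //.
by rewrite [in RHS](cardsD1 i) si.
Qed.

Lemma dC_cut (A : ab_sheaf X) (c : cochain A) n s : #|s| = n.+1 -> dC (cut n c) s = dC c s.
Proof. by move=> sn; apply: dC_eq => t; rewrite sn /cut => -[->]; rewrite eqxx. Qed.

Lemma dCB (A : ab_sheaf X) (c c' : cochain A) s :
  dC (fun t => c t - c' t) s = dC c s - dC c' s.
Proof. by rewrite /dC -sumrB; apply: eq_bigr => i _; rewrite raddfB mulrzBl. Qed.

Lemma dC_hom (A B : ab_sheaf X) (f : ab_hom A B) (c : cochain A) s :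
  f (wcap s) (dC c s) = dC (fun t => f (wcap t) (c t)) s.
Proof. by rewrite raddf_sum; apply: eq_bigr => i _; rewrite raddfMz ah_nat. Qed.

Lemma dC_res (A : ab_sheaf X) (a : A U) s i : s = [set i]%SET ->
  dC (fun t => ab_res A (@wcapU t) a) s = ab_res A (@wcapU s) a.
Proof.
move=> ->; rewrite /dC big_set1 (sheaf_comp (ab_sheafP A) _ _ (@wcapU _)).
suff -> : sgn i [set i]%SET = 1 by rewrite mulr1z.
by rewrite /sgn (_ : [set j in _ | _] = finset.set0) ?cards0 //; apply/setP => j; rewrite !inE; case: eqP => // ->; rewrite ltnn.
Qed.

Lemma dC_res0 (A : ab_sheaf X) (c : cochain A) i :
  dC c [set i]%SET = ab_res A (@wcapU _) (ab_res A wcap0 (c finset.set0)).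
Proof.
rewrite -(dC_res _ (i := i)) //; apply: dC_eq => t; rewrite cards1 => -[/eqP].
rewrite cards_eq0 => /eqP ->.
rewrite (sheaf_comp (ab_sheafP A) _ _ (@subset_refl _ _)).
by rewrite (sheaf_id (ab_sheafP A)).
Qed.

(** [p] is the Cech degree, so the cochains that matter are those on sets with [p.+1] elements. [K]
    stands for a subsheaf, such as the kernel of a differential, which is never built as a sheaf. *)
Definition cech_exact (A : ab_sheaf X) (K : forall V, A V -> Prop) p : Prop :=
  forall c : cochain A, (forall s, K _ (c s)) ->
    (forall s, #|s| = p.+2 -> dC c s = 0) ->
    exists b : cochain A, (forall s, K _ (b s)) /\ forall s, #|s| = p.+1 -> dC b s = c s.

Hypothesis UW : U `<=` \bigcup_i (W i : set X).

(** Each point [pt t] of [U] lies in some [W i]; the contraction of the simplex to that [i] is a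
    homotopy on the component at [t]. *)
Lemma fun_cech_exact (T : Type) (pt : T -> X) p :
  cech_exact (A := fun_sheaf pt) (fun _ _ => True) p.
Proof.
move=> c _ c0.
have /choice[f hf] : forall t : {t : T | oset U (pt t)}, exists i, oset (W i) (pt (sval t)).
  by move=> t; have [i _ Wi] := UW (svalP t); exists i.
pose c' (t : T) (s : {set I}) : QZ :=
  match pselect (oset (wcap s) (pt t)) with left h => c s (exist _ t h) | right _ => 0 end.
have c'E (t : T) s (h : oset (wcap s) (pt t)) : c' t s = c s (exist _ t h).
  by rewrite /c'; case: pselect => // h'; exact: (fun_sec_eq (c s)).
pose b : cochain (fun_sheaf pt) := fun s t =>
  hS (f (exist (fun t => oset U (pt t)) (sval t) (@wcapU s _ (svalP t)))) (c' (sval t)) s.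
have ev (e : cochain (fun_sheaf pt)) r (x : T) (hr : oset (wcap r) (pt x)) :
    dC e r (exist (fun t => oset (wcap r) (pt t)) x hr) = dS (fun q => match pselect (oset (wcap q) (pt x)) with
      left h => e q (exist (fun t => oset (wcap q) (pt t)) x h) | right _ => 0 end) r.
  rewrite /dC fct_sumE; apply: eq_bigr => i _.
  case: pselect => [h|]; last by case; exact: (@wcapD r i _ hr).
  have mz (V : opens X) (y : fun_sheaf pt V) z v : (y *~ z) v = y v *~ z.
    have mn n : (y *+ n) v = y v *+ n by elim: n => [|n IH]; rewrite ?mulr0n // !mulrS -IH.
    by case: z => n; rewrite ?NegzE ?mulrNz -?pmulrn -mn.
  by rewrite mz; congr (_ *~ _); exact: (fun_sec_eq (e _)).
exists b; split=> // s sp; apply/funext => -[x hx].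
pose u := exist (fun t => oset U (pt t)) x (@wcapU s _ hx).
transitivity (dS (hS (f u) (c' x)) s).
  rewrite ev; apply: dS_eq => i si; case: pselect => [h|]; last by case; exact: (@wcapD s i _ hx).
  by rewrite /b /=; congr (hS (f _) _ _); exact: eq_sig_hprop.
have /eqP := dShS (f u) (c' x) s; rewrite eq_sym -subr_eq => /eqP <-.
rewrite (c'E _ _ hx) (_ : hS _ _ s = 0) ?subr0 //.
rewrite /hS; case: ifPn => // fs.
have hr : oset (wcap (f u |: s)) (pt x).
  split; first exact: (@wcapU s _ hx).
  move=> i; rewrite !inE => /orP[/eqP ->|si]; first exact: (hf u).
  by have [_ h] := hx; exact: h.
by rewrite -[dS _ _](ev c _ _ hr) c0 ?mul0rz // cardsU1 fs sp.
Qed.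

(** An injective sheaf embeds in a product of skyscrapers by [coker_zero_mono], hence is a retract
    of it. *)
Lemma injective_cech_exact (J : ab_sheaf X) p : injective_sheaf J ->
  cech_exact (A := J) (fun _ _ => True) p.
Proof.
move=> Jinj c _ c0.
have idnat (V V' : opens X) (h : V' `<=` V) (s : J V) :
  (idfun : {additive J V' -> J V'}) (ab_res J h s) = ab_res J h ((idfun : {additive J V -> J V}) s) by [].
have [r hr] := Jinj _ _ _ (AbHom idnat) (@coker_zero_mono X J).
have [||b [_ hb]] := @fun_cech_exact _ (fun c : killing (zero_hom J) => gc_pt (sval c)) p (fun s => coker_hom (zero_hom J) _ (c s)) => //.
  by move=> s sp; rewrite -[LHS](dC_hom (coker_hom (zero_hom J))) c0 // raddf0.
exists (fun s => r _ (b s)); split=> // s sp.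
by rewrite -dC_hom hb // hr.
Qed.

End Cover.

(** * Cartan's criterion on a basis of opens *)

Section Cartan.
Context (B : opens X -> Prop).

Definition iscov (U : opens X) m (W : 'I_m -> opens X) : Prop :=
  U `<=` \bigcup_i (W i : set X) /\ forall s, s != finset.set0 -> B (wcap U W s).

Hypothesis refine_cover : forall U (V : X -> opens X), B U ->
  (forall x, oset U x -> oset (V x) x) ->
  exists m (W : 'I_m -> opens X), iscov U W /\ forall i, exists2 x, oset U x & W i `<=` V x.

Definition cech_acyclic (A : ab_sheaf X) (K : forall V, A V -> Prop) : Prop :=
  forall U m (W : 'I_m -> opens X), B U -> iscov U W -> forall p, (0 < p)%N ->
  cech_exact U W (A := A) K p.

Section Res.
Context (F : ab_sheaf X) (R : injective_resolution F).

Definition rker j : forall V, R j V -> Prop := fun V s => ir_diff R j V s = 0.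

Lemma diff_diff j V (s : R j V) : ir_diff R j.+1 V (ir_diff R j V s) = 0.
Proof. exact: (ir_exact R j).1. Qed.

Definition rlift j U := forall t : R j.+1 U, rker t -> exists s : R j U, ir_diff R j U s = t.

(** On overlaps, local preimages of [t] differ by a 1-cocycle with values in the kernel. Writing it
    as a coboundary corrects them to a cocycle of [R j], which glues. *)
Lemma patch_lift j U m (W : 'I_m -> opens X) (t : R j.+1 U) :
  U `<=` \bigcup_i (W i : set X) -> rker t ->
  (forall i, exists s : R j (wcap U W [set i]%SET), ir_diff R j _ s = ab_res _ (@wcapU U m W _) t) ->
  cech_exact U W (@rker j) 1 -> exists s : R j U, ir_diff R j U s = t.
Proof.
move=> UW t0 loc ex1.
have hloc (s : {set _}) : exists b : R j (wcap U W s), #|s| = 1 -> ir_diff R j _ b = ab_res _ (@wcapU U m W _) t.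
  have [/cards1P[i ->]|/eqP h] := boolP (#|s| == 1)%N; last by exists 0.
  by have [b hb] := loc i; exists b.
pose b0 : cochain U W (R j) := fun s => sval (cid (hloc s)).
have hb0 (s : {set _}) : #|s| = 1 -> ir_diff R j _ (b0 s) = ab_res _ (@wcapU U m W _) t.
  exact: (svalP (cid (hloc s))).
pose e := cut 2 (dC b0).
have eK s : rker (e s).
  rewrite /e /cut /rker; case: eqP => s2; last by rewrite raddf0.
  rewrite dC_hom -(@dC_eq _ _ _ _ (dC (fun t' => ab_res _ (@wcapU U m W t') t))) ?dCdC //.
  move=> r; rewrite s2 => -[r1]; rewrite hb0 //.
  by move/eqP: r1 => /cards1P[i ri]; rewrite (dC_res _ _ ri).
have [|a [aK ha]] := ex1 e eK; first by move=> s s3; rewrite dC_cut // dCdC.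
have [||b [_ hb]] := @injective_cech_exact U m W UW (R j) 0 (@ir_inj _ _ R j) (fun s => b0 s - a s) => //.
  by move=> s s2; rewrite dCB ha // /e /cut s2 eqxx subrr.
exists (ab_res _ (@wcap0 U m W) (b finset.set0)).
apply: (sheaf_sep (ab_sheafP (R j.+1)) (W := fun i => wcap U W [set i]%SET) (h := fun i => @wcapU U m W _)).
  by move=> x Ux; have [i _ Wi] := UW _ Ux; exists i => //; split=> // l /[!inE]/eqP ->.
move=> i; rewrite -[RHS]hb0 ?cards1 // -ah_nat -dC_res0 hb ?cards1 // raddfB /=.
by rewrite aK subr0.
Qed.

Lemma acyclic_lift j U : cech_acyclic (@rker j) -> B U -> rlift j U.
Proof.
move=> ac BU t t0.
have /choice[V hV] : forall x, exists V : opens X, oset U x -> oset V x /\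
    exists h : V `<=` U, exists s : R j V, ir_diff R j V s = ab_res (R j.+1) h t.
  move=> x; have [Ux|] := pselect (oset U x); last by exists U.
  by have [V [h [Vx hs]]] := (ir_exact R j).2 U t t0 x Ux; exists V => _; split=> //; exists h.
have [|m [W [[UW cW] hW]]] := @refine_cover U V BU; first by move=> x /hV[].
apply: (patch_lift UW t0); last exact: ac.
move=> i; have [x Ux Wx] := hW i; have [_ [h [s hs]]] := hV x Ux.
have h1 : wcap U W [set i]%SET `<=` V x.
  by move=> y [_ hy]; apply: Wx; apply: hy; rewrite inE.
exists (ab_res _ h1 s); rewrite ah_nat hs; exact: (sheaf_comp (ab_sheafP _)).
Qed.

Lemma lift_cochain j U m (W : 'I_m -> opens X) (c : cochain U W (R j.+1)) :
  cech_acyclic (@rker j) -> iscov U W -> (forall s, rker (c s)) ->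
  exists b : cochain U W (R j), forall s, s != finset.set0 -> ir_diff R j _ (b s) = c s.
Proof.
move=> ac [_ cW] cK.
have h s : exists b : R j (wcap U W s), s != finset.set0 -> ir_diff R j _ b = c s.
  have [->|/eqP s0] := pselect (s = finset.set0); first by exists 0; rewrite eqxx.
  by have [b hb] := acyclic_lift ac (cW _ s0) (cK s); exists b.
by exists (fun s => sval (cid (h s))) => s; exact: (svalP (cid (h s))).
Qed.

(** Dimension shifting along 0 -> ker_j -> R_j -> ker_(j+1) -> 0: on the nonempty intersections of
    the cover the last map is onto by acyclicity, and [R j] has no Cech cohomology. *)
Lemma cech_shift j U m (W : 'I_m -> opens X) p : cech_acyclic (@rker j) ->
  iscov U W -> (0 < p)%N ->
  cech_exact U W (@rker j.+1) p <-> cech_exact U W (@rker j) p.+1.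
Proof.
move=> ac cov p0; have UW := cov.1; split=> ex c cK c0.
  have [||b [_ hb]] := @injective_cech_exact U m W UW (R j) p.+1 (@ir_inj _ _ R j) c => //.
  have [||b2 [b2K hb2]] := ex (cut p.+1 (fun s => ir_diff R j _ (b s))).
  - by move=> s; rewrite /cut /rker; case: ifP => _; rewrite ?raddf0 ?diff_diff.
  - by move=> s sp; rewrite dC_cut // -dC_hom hb // cK.
  have [b3 hb3] := lift_cochain ac cov b2K.
  exists (cut p.+1 (fun s => b s - dC b3 s)); split=> [s|s sp].
    rewrite /cut /rker; case: eqP => sp; last by rewrite raddf0.
    rewrite raddfB /= dC_hom (@dC_eq _ _ _ _ _ b2) ?hb2 // /cut ?sp ?eqxx ?subrr //.
    by move=> r; rewrite ?sp => -[rp]; apply: hb3; rewrite -cards_eq0 rp -lt0n.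
  by rewrite dC_cut // dCB hb // dCdC subr0.
have [c' hc'] := lift_cochain ac cov cK.
pose e := cut p.+2 (dC c').
have ne (s : {set 'I_m}) l : #|s| = l.+1 -> s != finset.set0 by rewrite -cards_eq0 => ->.
have eK s : rker (e s).
  rewrite /e /cut /rker; case: eqP => sp; last by rewrite raddf0.
  by rewrite dC_hom (@dC_eq _ _ _ _ _ c) ?c0 // => r; rewrite sp => -[] /ne; exact: hc'.
have [|a [aK ha]] := ex e eK; first by move=> s s3; rewrite dC_cut // dCdC.
have [||b [_ hb]] := @injective_cech_exact U m W UW (R j) p (@ir_inj _ _ R j) (fun s => c' s - a s) => //.
  by move=> s s2; rewrite dCB ha // /e /cut s2 eqxx subrr.
exists (fun s => ir_diff R j _ (b s)); split=> [s|s sp]; first exact: diff_diff.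
by rewrite -dC_hom hb // raddfB /= aK subr0; apply: hc'; exact: ne sp.
Qed.

Lemma acyclic_shift j : cech_acyclic (@rker j) -> cech_acyclic (@rker j.+1).
Proof. by move=> ac U m W BU cov p p0; apply/(cech_shift ac cov p0); exact: ac. Qed.

(** [cech_shift] carries the statement for [j.+1] and [i] to the one for [j] and [i.+1]. Only the
    case of derived degree [j.+1] and Cech degree 1 compares the two cohomologies directly. *)
Lemma cech_derived j m (W : 'I_m -> opens X) i : cech_acyclic (@rker j) ->
  iscov (otop X) W ->
  rlift (i + j) (otop X) <-> cech_exact (otop X) W (@rker j) i.+1.
Proof.
elim: i j => [|i IH] j ac cov; last first.
  by rewrite addSnnS (IH _ (acyclic_shift ac) cov); exact: cech_shift.
have UW := cov.1; split=> [lift c cK c0|ex t t0].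
  have [||b [_ hb]] := @injective_cech_exact _ m W UW (R j) 1 (@ir_inj _ _ R j) c => //.
  have [||t [_ ht]] := @injective_cech_exact _ m W UW (R j.+1) 0 (@ir_inj _ _ R j.+1) (fun s => ir_diff R j _ (b s)) => //.
    by move=> s s2; rewrite -dC_hom hb // cK.
  (* The differentials of [b] agree on overlaps and glue to the closed section [t0]; a preimage of
     [t0] corrects [b] to a cochain with values in the kernel. *)
  pose t0 := ab_res _ (@wcap0 (otop X) m W) (t finset.set0).
  have [|s hs] := (lift : rlift j _) t0.
    apply: (sheaf_sep (ab_sheafP (R j.+2)) (W := fun i => wcap _ W [set i]%SET) (h := fun i => @wcapU _ m W _)).
      by move=> x Ux; have [l _ Wi] := UW _ Ux; exists l => //; split=> // l' /[!inE]/eqP ->.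
    by move=> l; rewrite raddf0 -ah_nat -dC_res0 ht ?cards1 // diff_diff.
  exists (cut 1 (fun r => b r - dC (fun r' => ab_res _ (@wcapU _ m W r') s) r)); split=> [r|r r2].
    rewrite /cut /rker; case: eqP => r1; last by rewrite raddf0.
    move/eqP: (r1) => /cards1P[l rl]; rewrite (dC_res _ _ rl) raddfB /= ah_nat hs.
    by rewrite rl -dC_res0 ht ?cards1 // subrr.
  by rewrite dC_cut // dCB hb // dCdC subr0.
apply: (patch_lift UW t0) ex => l.
apply: (acyclic_lift ac); first by apply: cov.2; rewrite -cards_eq0 cards1.
by rewrite /rker ah_nat t0 raddf0.
Qed.

Lemma rker0 V (s : R 0 V) : rker s -> exists u : F V, ir_aug R V u = s.
Proof.
move=> s0.
have /choice[W hW] : forall x : {x | oset V x}, exists W : opens X,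
    exists h : W `<=` V, oset W (sval x) /\ exists u : F W, ir_aug R W u = ab_res _ h s.
  by move=> [x Vx]; have [W [h [Wx hu]]] := (ir_exact0 R).2 V s s0 x Vx; exists W, h.
have hV x : W x `<=` V by have [h _] := hW x.
have exu x : exists u : F (W x), ir_aug R (W x) u = ab_res _ (hV x) s.
  by have [h [_ [u hu]]] := hW x; exists u; rewrite hu (Prop_irrelevance h (hV x)).
pose u x : F (W x) := sval (cid (exu x)).
have hu x : ir_aug R (W x) (u x) = ab_res _ (hV x) s := svalP (cid (exu x)).
have cov : V `<=` \bigcup_x (W x : set X).
  by move=> x Vx; have [h [Wx _]] := hW (exist _ x Vx); exists (exist _ x Vx).
have [|v hv] := @sheaf_glue _ _ _ (ab_sheafP F) V _ W hV cov u.
  move=> i j Y hi hj; apply: (ir_mono (i := R)).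
  rewrite !ah_nat !hu.
  have hY : Y `<=` V by exact: subset_trans hi (hV i).
  by rewrite (sheaf_comp (ab_sheafP _) _ _ hY) (sheaf_comp (ab_sheafP _) _ _ hY).
exists v; apply: (sheaf_sep (ab_sheafP (R 0)) (h := hV)) => // x.
by rewrite -ah_nat hv hu.
Qed.

Lemma cech_aug U m (W : 'I_m -> opens X) p :
  cech_exact U W (A := F) (fun _ _ => True) p <-> cech_exact U W (@rker 0) p.
Proof.
have aug0 V (u : F V) : rker (ir_aug R V u) by exact: (ir_exact0 R).1.
split=> ex c cK c0.
  pose c' : cochain U W F := fun s => sval (cid (rker0 (cK s))).
  have hc' s : ir_aug R _ (c' s) = c s := svalP (cid (rker0 (cK s))).
  have [||b [_ hb]] := ex c' => //.
    move=> s sp; apply: (ir_mono (i := R)).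
    rewrite raddf0 dC_hom -(c0 s) //; apply: dC_eq => t _; exact: hc'.
  exists (fun s => ir_aug R _ (b s)); split=> [s|s sp]; first exact: aug0.
  by rewrite -dC_hom hb // hc'.
have [||b [bK hb]] := ex (fun s => ir_aug R _ (c s)).
- by move=> s; exact: aug0.
- by move=> s sp; rewrite -dC_hom c0 // raddf0.
pose b' : cochain U W F := fun s => sval (cid (rker0 (bK s))).
have hb' s : ir_aug R _ (b' s) = b s := svalP (cid (rker0 (bK s))).
exists b'; split=> // s sp; apply: (ir_mono (i := R)); rewrite dC_hom -hb //.
by apply: dC_eq => t _; exact: hb'.
Qed.

End Res.

Definition sheaf_acyclic (F : ab_sheaf X) := cech_acyclic (A := F) (fun _ _ => True).

Lemma resolution_cech (F : ab_sheaf X) (R : injective_resolution F) m (W : 'I_m -> opens X) i :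
  sheaf_acyclic F -> iscov (otop X) W ->
  (@cocycles _ _ R i.+1 `<=` @coboundaries _ _ R i.+1) <->
  cech_exact (otop X) W (A := F) (fun _ _ => True) i.+1.
Proof.
move=> ac cov.
have ac0 : cech_acyclic (@rker F R 0).
  by move=> U l V BU cV p p0; apply/(cech_aug R); exact: ac.
rewrite (cech_aug R) -(cech_derived _ ac0 cov) addn0.
split=> h t t0; first by have [s _ hs] := h t t0; exists s.
by have [s hs] := h t t0; exists s.
Qed.

(** Vanishing for all resolutions implies the Cech statement only through some actual resolution,
    here [std_resolution]. *)
Lemma cohomology_cech (F : ab_sheaf X) m (W : 'I_m -> opens X) i :
  sheaf_acyclic F -> iscov (otop X) W ->
  cohomology_eq0 i.+1 F <-> cech_exact (otop X) W (A := F) (fun _ _ => True) i.+1.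
Proof.
move=> ac cov; split=> [h|h R]; last exact/(resolution_cech R i ac cov).
apply/(resolution_cech (std_resolution F) i ac cov); exact: h.
Qed.

End Cartan.
End CechSheaf.

Close Scope classical_set_scope.

(** * Localizations at monomials *)

Section PolyFilter.
Context (K : fieldType) (m : nat).
Implicit Types (a b : {mpoly K[m]}) (k : 'X_{1..m}).

Definition mfilter (P : pred 'X_{1..m}) a := \sum_(k <- msupp a | P k) a@_k *: 'X_[k].

Lemma mcoeff_mfilter P a k : (mfilter P a)@_k = if P k then a@_k else 0.
Proof.
rewrite /mfilter raddf_sum /=.
under eq_bigr => l _ do rewrite mcoeffZ mcoeffX.
have [ka|ka] := boolP (k \in msupp a); last first.
  rewrite (memN_msupp_eq0 ka) if_same big_seq_cond big1 // => l /andP[la _].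
  by case: eqP => [e|_]; rewrite ?mulr0 //; move: la; rewrite e (negbTE ka).
rewrite big_mkcond (bigD1_seq k) //= eqxx mulr1 big1 ?addr0 // => l lk.
by case: ifP; rewrite // (negbTE lk) mulr0.
Qed.

Lemma mfilterD P a b : mfilter P (a + b) = mfilter P a + mfilter P b.
Proof.
apply/mpolyP => k; rewrite mcoeffD !mcoeff_mfilter mcoeffD.
by case: ifP; rewrite ?addr0.
Qed.

Lemma mfilter_id (P : pred _) a : (forall k, k \in msupp a -> P k) -> mfilter P a = a.
Proof.
move=> h; apply/mpolyP => k; rewrite mcoeff_mfilter; case: ifP => // Pk.
by have [/h|/memN_msupp_eq0 ->//] := boolP (k \in msupp a); rewrite Pk.
Qed.

Lemma mfilterMX (P : pred _) a k : mfilter P (a * 'X_[k]) = mfilter (fun l => P (l + k)%MM) a * 'X_[k].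
Proof.
apply/mpolyP => l; rewrite mcoeff_mfilter.
have [kl|kl] := boolP (k <= l)%MM.
  have e : l = (k + (l - k))%MM by rewrite addmC submK.
  by rewrite e !mcoeffMX mcoeff_mfilter [(_ - _ + k)%MM]addmC -e.
have z b : (b * 'X_[k])@_l = 0.
  apply: memN_msupp_eq0; rewrite (perm_mem (msuppMX b k)); apply/mapP => -[x _ e].
  by move: kl; rewrite e lem_addr.
by rewrite !z if_same.
Qed.

Lemma mdivX a k : (forall l, l \in msupp a -> (k <= l)%MM) -> exists b, a = b * 'X_[k].
Proof.
move=> h; exists (\sum_(l <- msupp a) a@_l *: 'X_[l - k]).
rewrite {1}[a]mpolyE mulr_suml big_seq [in RHS]big_seq.
by apply: eq_bigr => l /h kl; rewrite -scalerAl -mpolyXD submK.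
Qed.

End PolyFilter.

Section LocRings.
Context (K : fieldType) (m : nat).
Local Notation S := {mpoly K[m]}.
Local Notation L := {fraction S}.
Local Notation I := 'I_m.
Local Notation "x %:F" := (@tofrac S x).
Implicit Types (s t : {set I}) (z w : L) (i j : I) (a b : S).

Lemma tofrac_inj : injective (@tofrac S).
Proof. by move=> a b /eqP; rewrite tofrac_eq => /eqP. Qed.

Definition inS z := exists a, z = a%:F.

Lemma inSB z w : inS z -> inS w -> inS (z - w).
Proof. by move=> [a ->] [b ->]; exists (a - b); rewrite rmorphB. Qed.
Lemma inSM z w : inS z -> inS w -> inS (z * w).
Proof. by move=> [a ->] [b ->]; exists (a * b); rewrite rmorphM. Qed.
Lemma inS0 : inS 0. Proof. by exists 0; rewrite rmorph0. Qed.
Lemma inS1 : inS 1. Proof. by exists 1; rewrite rmorph1. Qed.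
Lemma inSN z : inS z -> inS (- z).
Proof. by move=> h; rewrite -sub0r; apply: inSB => //; exact: inS0. Qed.
Lemma inSD z w : inS z -> inS w -> inS (z + w).
Proof. by move=> hz hw; rewrite -[w]opprK; apply: inSB => //; exact: inSN. Qed.
Lemma inSX z n : inS z -> inS (z ^+ n).
Proof. by move=> h; elim: n => [|n IH]; rewrite ?expr0 ?exprS; [exact: inS1|exact: inSM]. Qed.
Lemma inS_sum (J : Type) (r : seq J) (P : pred J) (F : J -> L) :
  (forall l, P l -> inS (F l)) -> inS (\sum_(l <- r | P l) F l).
Proof. by move=> h; elim/big_ind: _ => //; [exact: inS0|exact: inSD]. Qed.

Definition xv i : L := ('X_i)%:F.
Definition mset s : 'X_{1..m} := [multinom (i \in s : nat) | i < m].
Lemma msetE s i : mset s i = (i \in s) :> nat. Proof. exact: mnmE. Qed.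
Definition xm s : L := ('X_[mset s])%:F.

Lemma X_neq0 (k : 'X_{1..m}) : 'X_[k] != 0 :> S.
Proof. by rewrite -msupp_eq0 msuppX. Qed.

Lemma xv_neq0 i : xv i != 0. Proof. by rewrite tofrac_eq0 X_neq0. Qed.
Lemma xm_neq0 s : xm s != 0. Proof. by rewrite tofrac_eq0 X_neq0. Qed.
Lemma inS_xv i : inS (xv i). Proof. by eexists. Qed.
Lemma inS_xm s : inS (xm s). Proof. by eexists. Qed.
Hint Resolve xv_neq0 xm_neq0 inS_xv inS_xm inS0 inS1 : core.

Lemma xmU1 i s : i \notin s -> xm (i |: s) = xv i * xm s.
Proof.
move=> si; rewrite /xm /xv -rmorphM -mpolyXD; congr (_%:F); congr 'X_[_].
apply/mnmP => j; rewrite mnmDE mnm1E !mnmE !inE eq_sym.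
by case: eqP => //= e; rewrite -e (negbTE si).
Qed.

Lemma xmD1 i s : i \in s -> xm s = xv i * xm (s :\ i).
Proof. by move=> si; rewrite -xmU1 ?inE ?eqxx // finset.setD1K. Qed.

Lemma xm0 : xm finset.set0 = 1.
Proof.
rewrite /xm (_ : mset _ = 0%MM) ?mpolyX0 ?rmorph1 //.
by apply/mnmP => j; rewrite mnm0E mnmE inE.
Qed.

Lemma xm1 i : xm [set i]%SET = xv i.
Proof. by rewrite -[[set i]%SET]finset.setU0 xmU1 ?inE // xm0 mulr1. Qed.

Lemma xmS s t : s \subset t -> exists2 w, inS w & xm t = w * xm s.
Proof.
move=> st; exists (xm (t :\: s)) => //; rewrite /xm -rmorphM -mpolyXD.
congr (_%:F); congr 'X_[_]; apply/mnmP => j; rewrite mnmDE !mnmE !inE.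
by case js: (j \in s) => //=; rewrite ?(fintype.subsetP st _ js) ?addn0.
Qed.

Definition loc s z := exists N, inS (xm s ^+ N * z).
(** With coefficients x_s^-1 S on the set [s], the Cech differential is that of the Koszul complex
    of the coordinates. *)
Definition kos s z := inS (xm s * z).

Lemma loc_up s z N N' : (N <= N')%N -> inS (xm s ^+ N * z) -> inS (xm s ^+ N' * z).
Proof.
by move=> le h; rewrite -(subnK le) exprD -mulrA; apply: inSM => //; exact: inSX.
Qed.

Lemma locS s t z : s \subset t -> loc s z -> loc t z.
Proof.
move=> /xmS[w hw e] [N h]; exists N; rewrite e exprMn -mulrA.
by apply: inSM => //; exact: inSX.
Qed.

Lemma inS_loc s z : inS z -> loc s z.
Proof. by exists 0; rewrite expr0 mul1r. Qed.

Lemma loc_set0 z : loc finset.set0 z -> inS z.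
Proof. by move=> [N]; rewrite xm0 expr1n mul1r. Qed.

Lemma locB s z w : loc s z -> loc s w -> loc s (z - w).
Proof.
move=> [N h] [N' h']; exists (N + N')%N; rewrite mulrBr; apply: inSB.
  by apply: loc_up h; exact: leq_addr.
by apply: loc_up h'; exact: leq_addl.
Qed.

Lemma loc0 s : loc s 0. Proof. exact: inS_loc. Qed.
Lemma loc1 s : loc s 1. Proof. exact: inS_loc. Qed.
Hint Resolve loc0 loc1 : core.

Lemma locN s z : loc s z -> loc s (- z).
Proof. by move=> h; rewrite -sub0r; apply: locB. Qed.
Lemma locD s z w : loc s z -> loc s w -> loc s (z + w).
Proof. by move=> hz hw; rewrite -[w]opprK; apply: locB => //; exact: locN. Qed.
Lemma locM s z w : loc s z -> loc s w -> loc s (z * w).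
Proof.
move=> [N h] [N' h']; exists (N + N')%N; rewrite exprD mulrACA; exact: inSM.
Qed.
Lemma locX s z n : loc s z -> loc s (z ^+ n).
Proof. by move=> h; elim: n => [|n IH]; rewrite ?expr0 ?exprS //; exact: locM. Qed.
Lemma loc_sum s (J : Type) (r : seq J) (P : pred J) (F : J -> L) :
  (forall l, P l -> loc s (F l)) -> loc s (\sum_(l <- r | P l) F l).
Proof. by move=> h; elim/big_ind: _ => //; exact: locD. Qed.

Lemma loc_xvV i s : i \in s -> loc s (xv i)^-1.
Proof.
by move=> si; exists 1%N; rewrite expr1 (xmD1 si) mulrC mulKf ?xv_neq0.
Qed.

Lemma loc_U1 i s z : loc (i |: s) z -> exists N, loc s (xv i ^+ N * z).
Proof.
have [si|si] := boolP (i \in s).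
  have -> : i |: s = s by apply/finset.setUidPr; rewrite finset.sub1set.
  by move=> h; exists 0; rewrite expr0 mul1r.
move=> [N h]; exists N, N; move: h; rewrite xmU1 // exprMn mulrA [_ ^+ _ * xv _ ^+ _]mulrC //.
Qed.

Lemma kosS s t z : s \subset t -> kos s z -> kos t z.
Proof. by move=> /xmS[w hw e] h; rewrite /kos e -mulrA; exact: inSM. Qed.

(** The part of a Laurent polynomial made of the monomials with non-negative exponent of [x_i], and
    0 outside the Laurent polynomials. It fixes what has no [x_i] in the denominator and removes
    [x_i] from any denominator. *)
Definition rho i z : L :=
  match pselect (loc finset.setT z) with
  | left h => let: exist N h' := cid h in let: exist a _ := cid h' in
      (mfilter (fun k : 'X_{1..m} => (N <= k i)%N) a)%:F / xm finset.setT ^+ N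
  | right _ => 0
  end.

Lemma mset_compl s : (mset s + mset (~: s) = mset finset.setT)%MM.
Proof. by apply/mnmP => j; rewrite mnmDE !mnmE !inE; case: (j \in s). Qed.

Lemma xm_compl s : xm finset.setT = xm s * xm (~: s).
Proof. by rewrite /xm -rmorphM -mpolyXD mset_compl. Qed.

Lemma rhoE i s N a z : xm s ^+ N * z = a%:F ->
  xm s ^+ N * rho i z = (mfilter (fun k => ((if i \in s then N else 0) <= k i)%N) a)%:F.
Proof.
move=> za; rewrite /rho; case: pselect => [h|]; last first.
  by case; apply: (locS (finset.subsetT s)); exists N, a.
case: cid => M h'; case: cid => b hb; clear h h'.
pose T : {set I} := finset.setT.
(* Cross-multiplication compares the given fraction with the one chosen in [rho]; filtering this
   polynomial identity by the exponent of [x_i] compares their projections. *)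
have e : a * 'X_[mset (~: s)] ^+ N * 'X_[mset T] ^+ M = b * 'X_[mset T] ^+ N.
  apply: tofrac_inj; rewrite !tofracM !tofracXn -za -hb.
  rewrite -/(xm (~: s)) -/T -/(xm T); set w := xm T ^+ M.
  rewrite (xm_compl s) exprMn; set u := xm s ^+ N; set v := xm (~: s) ^+ N.
  by rewrite -[u * z * v]mulrA [z * v]mulrC mulrA mulrC mulrA mulrAC.
have := congr1 (mfilter (fun k : 'X_{1..m} => (N + M <= k i)%N)) e.
rewrite !mpolyXn !mfilterMX -!mpolyXn.
set b1 := mfilter _ b; set a1 := mfilter _ a => e2.
have -> : mfilter (fun k : 'X_{1..m} => (M <= k i)%N) b = b1.
  by congr mfilter; apply/funext => l; rewrite mnmDE mulmnE msetE finset.in_setT mul1n; rewrite [(N + M)%N]addnC leq_add2r.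
have -> : mfilter (fun k : 'X_{1..m} => ((if i \in s then N else 0) <= k i)%N) a = a1.
  congr mfilter; apply/funext => l; rewrite !mnmDE !mulmnE !msetE finset.in_setT finset.in_setC mul1n leq_add2r.
  by case: (i \in s) => /=; rewrite ?mul0n ?mul1n ?addn0 ?leq0n ?leq_addl.
have := congr1 (fun p => p%:F) e2; rewrite /= !tofracM !tofracXn.
rewrite -/(xm (~: s)) -/T -/(xm T) => e3.
have TM : xm T ^+ M != 0 by rewrite expf_neq0 ?xm_neq0.
have sN : xm (~: s) ^+ N != 0 by rewrite expf_neq0 ?xm_neq0.
apply: (mulIf TM); apply: (mulIf sN); rewrite [RHS]mulrAC e3.
by rewrite -[X in X * _]mulrA divfK // mulrAC mulrC (xm_compl s) exprMn.
Qed.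

Lemma rho_id i s z : loc s z -> i \notin s -> rho i z = z.
Proof.
move=> [N [a za]] si; have := rhoE i za; rewrite (negbTE si) mfilter_id // -za => /mulfI; apply.
by rewrite expf_neq0 ?xm_neq0.
Qed.

Lemma rho_dvd i s N a z : i \in s -> xm s ^+ N * z = a%:F ->
  inS (xm (s :\ i) ^+ N * rho i z).
Proof.
move=> si za; have := rhoE i za; rewrite si.
have [|b ->] := @mdivX K m (mfilter (fun k : 'X_{1..m} => (N <= k i)%N) a) (U_(i) *+ N)%MM.
  move=> l; rewrite mcoeff_msupp mcoeff_mfilter; case: ifP; rewrite ?eqxx // => hl _.
  by apply/mnm_lepP => j; rewrite mulmnE mnm1E; case: eqP => [<-|]; rewrite ?mul1n ?mul0n.
have xN : xv i ^+ N != 0 by rewrite expf_neq0 ?xv_neq0.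
rewrite rmorphM -mpolyXn rmorphXn /= -/(xv i) (xmD1 si) exprMn -mulrA [RHS]mulrC => /(mulfI xN) ->.
by exists b.
Qed.

Lemma rho_loc i s z : loc s z -> loc (s :\ i) (rho i z).
Proof.
move=> hz; have [si|si] := boolP (i \in s); last first.
  by rewrite (rho_id hz si); apply: locS hz; rewrite finset.subsetD1 subxx.
by case: hz => N [a za]; exists N; exact: rho_dvd za.
Qed.

Lemma kos_loc s z : kos s z -> loc s z.
Proof. by move=> h; exists 1%N; rewrite expr1. Qed.

Lemma rho_kos i s z : kos s z -> kos (s :\ i) (rho i z).
Proof.
move=> hz; have [si|si] := boolP (i \in s); last first.
  by rewrite (rho_id (kos_loc hz) si); apply: kosS hz; rewrite finset.subsetD1 subxx.
by case: hz => a za; have := @rho_dvd i s 1 a z si; rewrite !expr1; apply.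
Qed.

Lemma rhoD i z w : loc finset.setT z -> loc finset.setT w -> rho i (z + w) = rho i z + rho i w.
Proof.
move=> [N hz] [M hw].
have [a za] := loc_up (leq_addr M N) hz; have [b wb] := loc_up (leq_addl N M) hw.
have zwab : xm finset.setT ^+ (N + M) * (z + w) = (a + b)%:F.
  by rewrite rmorphD /= mulrDr za wb.
apply: (@mulfI _ (xm finset.setT ^+ (N + M))); first by rewrite expf_neq0 ?xm_neq0.
by rewrite mulrDr (rhoE i za) (rhoE i wb) (rhoE i zwab) mfilterD rmorphD.
Qed.

Lemma rho0 i : rho i 0 = 0.
Proof. by have := @rhoD i 0 0 (loc0 _) (loc0 _); rewrite addr0 -{1}[rho i 0]addr0 => /addrI. Qed.

Lemma rhoN i z : loc finset.setT z -> rho i (- z) = - rho i z.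
Proof.
move=> hz; apply/eqP; rewrite -subr_eq0 opprK -rhoD ?addNr ?rho0 //; exact: locN.
Qed.

Section Exact.
Context (P : {set I} -> L -> Prop).
Hypothesis P0 : forall s, P s 0.
Hypothesis PB : forall s z w, P s z -> P s w -> P s (z - w).
Hypothesis PS : forall s t z, s \subset t -> P s z -> P t z.
Hypothesis Ploc : forall s z, P s z -> loc s z.
Hypothesis Prho : forall i s z, P s z -> P (s :\ i) (rho i z).

Let PN s z : P s z -> P s (- z).
Proof. by move=> h; rewrite -sub0r; exact: PB. Qed.
Let PD s z w : P s z -> P s w -> P s (z + w).
Proof. by move=> hz hw; rewrite -[w]opprK; apply: PB => //; exact: PN. Qed.
Let PMsgn s z i t : P s z -> P s (z *~ sgn i t).
Proof.
move=> h; rewrite /sgn; elim: #|_| => [|k IH]; first by rewrite expr0 mulr1z.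
by rewrite exprS mulN1r mulrNz; exact: PN.
Qed.

Lemma P_dS c s : (forall t, P t (c t)) -> P s (dS c s).
Proof.
move=> h; rewrite /dS; elim/big_ind: _ => // [|i si]; first exact: PD.
by apply: PMsgn; apply: PS (h _); rewrite finset.subsetDl.
Qed.

Let rhoMsgn z i j t : loc finset.setT z -> rho i (z *~ sgn j t) = rho i z *~ sgn j t.
Proof.
move=> h; rewrite /sgn; elim: #|_| => [|k IH]; first by rewrite expr0 !mulr1z.
rewrite exprS mulN1r !mulrNz rhoN ?IH //.
elim: (k) => [|l IHl]; first by rewrite expr0 mulr1z.
by rewrite exprS mulN1r mulrNz; exact: locN.
Qed.

Lemma rho_dS i c s : (forall t, loc finset.setT (c t)) ->
  rho i (dS c s) = dS (fun t => rho i (c t)) s.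
Proof.
move=> h; rewrite /dS.
have lM z j : loc finset.setT z -> loc finset.setT (z *~ sgn j s).
  move=> hz; rewrite /sgn; elim: #|_| => [|l IHl]; first by rewrite expr0 mulr1z.
  by rewrite exprS mulN1r mulrNz; exact: locN.
suff : forall r : seq I, loc finset.setT (\sum_(j <- r | j \in s) c (s :\ j) *~ sgn j s) /\
    rho i (\sum_(j <- r | j \in s) c (s :\ j) *~ sgn j s) =
    \sum_(j <- r | j \in s) rho i (c (s :\ j)) *~ sgn j s by move=> /(_ (index_enum I))[].
elim=> [|j r [IH1 IH2]]; first by rewrite !big_nil rho0.
rewrite !big_cons; case: ifP => // js; split; first by apply: locD => //; exact: lM.
by rewrite rhoD ?IH2 ?rhoMsgn //; exact: lM.
Qed.

(** [hS i] followed by [rho i] is a homotopy that respects the coefficients allowed at each set. On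
    the sets that avoid [i] it makes the part [c1] not yet bounded a coboundary. Treating the
    indices one after the other bounds [c] on all sets that avoid some index, and [p < m] makes
    these all sets of size [p]. *)
Lemma cech_rho_exact p c : (p < m)%N -> (forall s, P s (c s)) ->
  (forall s, #|s| = p.+1 -> dS c s = 0) ->
  exists b : {set I} -> L, (forall s, P s (b s)) /\ forall s, #|s| = p -> dS b s = c s.
Proof.
move=> pm Pc c0.
have key (r : seq I) : exists b : {set I} -> L, (forall s, P s (b s)) /\
    forall s i, #|s| = p -> i \in r -> i \notin s -> dS b s = c s.
  elim: r => [|i r [b [Pb hb]]]; first by exists (fun=> 0); split.
  pose c1 s := c s - dS b s.
  have Pc1 s : P s (c1 s) by apply: PB => //; exact: P_dS.
  have c10 s : #|s| = p.+1 -> dS c1 s = 0.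
    by move=> sp; rewrite [dS _ _]dSB c0 // dSdS subr0.
  pose bi s := rho i (hS i c1 s).
  have Phs s : P (i |: s) (hS i c1 s).
    by rewrite /hS; case: ifP => // _; exact: PMsgn.
  have Pbi s : P s (bi s).
    by apply: PS (Prho i (Phs s)); rewrite finset.subDset.
  have dbi s : #|s| = p -> dS bi s = rho i (c1 s).
    move=> sp; rewrite /bi -rho_dS; last by move=> t; apply: locS (Ploc (Phs t)); exact: finset.subsetT.
    congr (rho i _); have := dShS i c1 s.
    rewrite [X in _ + X](_ : _ = 0) ?addr0 // /hS; case: ifPn => // si.
    by rewrite c10 ?mul0rz // cardsU1 si sp.
  exists (fun s => b s + bi s); split=> [s|s j sp]; first exact: PD.
  rewrite [dS _ _]dSD dbi // inE => /orP[/eqP -> si|jr js].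
    by rewrite (rho_id (Ploc (Pc1 s)) si) /c1 addrC subrK.
  by rewrite /c1 (hb _ j) // subrr rho0 addr0.
have [b [Pb hb]] := key (enum I); exists b; split=> // s sp.
have [i si] : exists i, i \notin s.
  apply/existsP; rewrite -negb_forall; apply/negP => /forallP h.
  by move: pm; rewrite -sp (eq_card (B := I)) ?card_ord ?ltnn // => i; rewrite h.
by apply: (hb _ i) => //; rewrite mem_enum.
Qed.

End Exact.

Lemma loc_exact p c : (p < m)%N -> (forall s, loc s (c s)) ->
  (forall s, #|s| = p.+1 -> dS c s = 0) ->
  exists b : {set I} -> L, (forall s, loc s (b s)) /\ forall s, #|s| = p -> dS b s = c s.
Proof. by apply: cech_rho_exact => //; [exact: locB|exact: locS|exact: rho_loc]. Qed.

Lemma kos_exact p c : (p < m)%N -> (forall s, kos s (c s)) ->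
  (forall s, #|s| = p.+1 -> dS c s = 0) ->
  exists b : {set I} -> L, (forall s, kos s (b s)) /\ forall s, #|s| = p -> dS b s = c s.
Proof.
apply: cech_rho_exact => // [s|s z w hz hw|||].
- by rewrite /kos mulr0.
- by rewrite /kos mulrBr; exact: inSB.
- exact: kosS.
- exact: kos_loc.
- exact: rho_kos.
Qed.

Definition kc (c : K) : L := (c%:MP)%:F.

Lemma ct_split a : exists (c : K) (b : I -> S), a = c%:MP + \sum_i 'X_i * b i.
Proof.
elim/mpolyind: a => [|c k a _ _ [c' [b' ->]]].
  by exists 0, (fun=> 0); rewrite mpolyC0 add0r big1 // => i _; rewrite mulr0.
have [->|k0] := eqVneq k 0%MM.
  by exists (c + c'), b'; rewrite mpolyX0 alg_mpolyC mpolyCD addrA.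
have [i ki] : exists i, k i != 0%N.
  apply/existsP; rewrite -negb_forall; apply: contraNN k0 => /forallP h.
  by apply/eqP/mnmP => j; rewrite mnm0E; apply/eqP; rewrite -[_ == _]negbK h.
exists c', (fun j => b' j + (if j == i then c *: 'X_[k - U_(i)] else 0)).
under [X in _ = _ + X]eq_bigr do rewrite mulrDr.
rewrite big_split /= [RHS]addrA [LHS]addrC; congr (_ + _).
rewrite (bigD1 i) //= eqxx big1 ?addr0 => [|j /negbTE ->]; last by rewrite mulr0.
by rewrite -scalerAr -mpolyXD addmC submK // lep1mP.
Qed.

Definition inI (A : {pred I}) z := exists b : I -> L, (forall i, inS (b i)) /\
  z = \sum_(i in A) xv i * b i.

Lemma inI0 (A : {pred I}) : inI A 0.
Proof. by exists (fun=> 0); split=> //; rewrite big1 // => i _; rewrite mulr0. Qed.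

Lemma inIB (A : {pred I}) z w : inI A z -> inI A w -> inI A (z - w).
Proof.
move=> [b [hb ->]] [b' [hb' ->]]; exists (fun i => b i - b' i); split=> [i|]; first exact: inSB.
by rewrite -sumrB; apply: eq_bigr => i _; rewrite mulrBr.
Qed.

Lemma inIM (A : {pred I}) z w : inS z -> inI A w -> inI A (z * w).
Proof.
move=> hz [b [hb ->]]; exists (fun i => z * b i); split=> [i|]; first exact: inSM.
by rewrite mulr_sumr; apply: eq_bigr => i _; rewrite mulrCA.
Qed.

Lemma inI_xv (A : {pred I}) i z : i \in A -> inS z -> inI A (xv i * z).
Proof.
move=> iA hz; exists (fun j => if j == i then z else 0); split=> [j|]; first by case: ifP.
by rewrite (bigD1 i) //= eqxx big1 ?addr0 // => j /andP[_ /negbTE ->]; rewrite mulr0.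
Qed.

Lemma inIP (A : {pred I}) a :
  inI A a%:F <-> forall k, k \in msupp a -> exists2 i, i \in A & k i != 0%N.
Proof.
split=> [[b [hb e]] k ka|h].
  have /choice[b' hb'] : forall i, exists b' : S, b i = b'%:F by move=> i; exact: hb.
  have {e} e : a = \sum_(i in A) b' i * 'X_i.
    apply: tofrac_inj; rewrite e raddf_sum /=; apply: eq_bigr => i _.
    by rewrite hb' -rmorphM mulrC.
  have [/exists_inP[i iA ki]|/exists_inPn no] := boolP [exists i in A, k i != 0%N]; first by exists i.
  move: ka; rewrite mcoeff_msupp e raddf_sum /= big1 ?eqxx // => i iA.
  apply: memN_msupp_eq0; rewrite (perm_mem (msuppMX _ _)); apply/mapP => -[l _ ek].
  have := no i iA; rewrite negbK ek mnmDE mnm1E eqxx //.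
rewrite [a]mpolyE raddf_sum /= big_seq; elim/big_ind: _ => [|z w hz hw|k /h[i iA ki]].
- exact: inI0.
- by rewrite -[w]opprK; apply: inIB => //; rewrite -sub0r; apply: inIB => //; exact: inI0.
have -> : a@_k *: 'X_[k] = 'X_i * (a@_k *: 'X_[k - U_(i)]) :> S.
  by rewrite -scalerAr -mpolyXD addmC submK // lep1mP.
by rewrite rmorphM; apply: inI_xv => //; eexists.
Qed.

(** The coordinates form a regular sequence in any order: a factor [x_j] with [j] outside [A] does
    not make a monomial divisible by a variable of [A]. *)
Lemma inI_reg (A : {pred I}) j z : j \notin A -> inS z -> inI A (xv j * z) -> inI A z.
Proof.
move=> jA [a ->]; rewrite -rmorphM /= => /inIP h; apply/inIP => k ka.
have [|i iA ki] := h (k + U_(j))%MM.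
  by rewrite mulrC (perm_mem (msuppMX _ _)); apply/mapP; exists k => //; rewrite addmC.
exists i => //; move: ki; rewrite mnmDE mnm1E.
have -> : (j == i) = false by apply: contraNF jA => /eqP ->.
by rewrite ?add0n ?addn0.
Qed.

Lemma kc_inI (A : {pred I}) c : inI A (kc c) -> c = 0.
Proof.
move=> /inIP h; apply: contraTeq isT => c0; have [|i _] := h 0%MM.
  by rewrite mcoeff_msupp mcoeffC eqxx mulr1.
by rewrite mnm0E.
Qed.

Lemma inS_split z : inS z -> exists c, inI predT (z - kc c).
Proof.
move=> [a ->]; have [c [b ->]] := ct_split a; exists c.
rewrite rmorphD /= addrC addKr; exists (fun i => (b i)%:F); split=> [i|]; first by eexists.
by rewrite raddf_sum /=; apply: eq_bigr => i _; rewrite rmorphM.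
Qed.

End LocRings.

(** * Complexes with finitely supported coefficients *)

Section FinSupp.
Context (R : fieldType) (X : choiceType) (Y : lmodType R).

Definition fs_pred : pred (X -> Y) :=
  fun f => `[< exists s : seq X, forall x, x \notin s -> f x = 0 >].

Lemma fs_submod : submod_closed fs_pred.
Proof.
split; first by apply/asboolP; exists [::].
move=> a f g /asboolP[s hs] /asboolP[t ht]; apply/asboolP; exists (s ++ t) => x.
rewrite mem_cat negb_or => /andP[xs xt].
by rewrite /GRing.add /= /GRing.scale /= hs // ht // scaler0 addr0.
Qed.

HB.instance Definition _ := GRing.isSubmodClosed.Build R (X -> Y) fs_pred fs_submod.

(** [fs X Y] is the direct sum of copies of [Y] indexed by [X], that is, [Y] tensored with the free
    module on [X]; [fsc c y] below is then the elementary tensor of [c] and [y]. *)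
Record fs := Fs { fs_fun :> X -> Y; fs_subproof : fs_pred fs_fun }.

HB.instance Definition _ := [isSub for fs_fun].
HB.instance Definition _ := [Choice of fs by <:].
HB.instance Definition _ := [SubChoice_isSubLmodule of fs by <:].

Lemma fsP (f : fs) : exists s : seq X, forall x, x \notin s -> f x = 0.
Proof. by case: f => f hf; exact/asboolP. Qed.

Definition fs_mk (f : X -> Y) (hf : exists s : seq X, forall x, x \notin s -> f x = 0) : fs :=
  Fs (asboolT hf : fs_pred f).

Lemma fs_eq (f g : fs) : (forall x, f x = g x) -> f = g.
Proof. by move=> h; apply/val_inj/funext. Qed.

Lemma fsD (f g : fs) x : (f + g) x = f x + g x. Proof. by []. Qed.
Lemma fsB (f g : fs) x : (f - g) x = f x - g x. Proof. by []. Qed.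
Lemma fsZ a (f : fs) x : (a *: f) x = a *: f x. Proof. by []. Qed.
Lemma fs0 x : (0 : fs) x = 0. Proof. by []. Qed.
Lemma fs_sum (J : Type) (r : seq J) (P : pred J) (F : J -> fs) x :
  (\sum_(j <- r | P j) F j) x = \sum_(j <- r | P j) F j x.
Proof. by elim/big_rec2: _ => //= j y f Pj <-. Qed.

Definition supp (f : fs) : seq X := undup (sval (cid (fsP f))).
Lemma supp_uniq f : uniq (supp f). Proof. exact: undup_uniq. Qed.
Lemma suppP f x : x \notin supp f -> f x = 0.
Proof. by rewrite mem_undup; exact: (svalP (cid (fsP f))). Qed.

Lemma fs_choice (s : seq X) (Q : X -> Y -> Prop) :
  (forall x, exists y, Q x y) -> (forall x, x \notin s -> Q x 0) ->
  exists f : fs, forall x, Q x (f x).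
Proof.
move=> h h0; have [f hf] := choice h.
unshelve eexists (fs_mk (f := fun x => if x \in s then f x else 0) _).
  by exists s => x /negbTE ->.
by move=> x /=; case: ifPn => [xs|/h0].
Qed.

Definition single_fun (x : X) (y : Y) : X -> Y := fun z => if z == x then y else 0.
Fact single_fs x y : exists s : seq X, forall z, z \notin s -> single_fun x y z = 0.
Proof. by exists [:: x] => z; rewrite inE /single_fun => /negbTE ->. Qed.
Definition single x y : fs := fs_mk (single_fs x y).

Lemma singleE x y z : single x y z = if z == x then y else 0. Proof. by []. Qed.

Fact single_linear x : linear (single x).
Proof.
move=> a y y'; apply: fs_eq => z; rewrite fsD fsZ !singleE.
by case: ifP; rewrite ?scaler0 ?addr0.
Qed.
HB.instance Definition _ x := GRing.isLinear.Build R Y fs _ (single x) (single_linear x).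

Lemma fs_decomp (f : fs) s : uniq s -> (forall x, x \notin s -> f x = 0) ->
  f = \sum_(x <- s) single x (f x).
Proof.
move=> us hs; apply: fs_eq => z; rewrite fs_sum.
under eq_bigr do rewrite singleE.
have [zs|zs] := boolP (z \in s).
  rewrite (bigD1_seq z) //= eqxx big1 ?addr0 // => x xz; by rewrite eq_sym (negbTE xz).
rewrite hs // big_seq big1 // => x xs; case: eqP => // e; by rewrite e xs in zs.
Qed.

Lemma fs_split (f : fs) : f = \sum_(x <- supp f) single x (f x).
Proof. by apply: fs_decomp; [exact: supp_uniq|exact: suppP]. Qed.

Section Ext.
Context (Z : lmodType R) (phi : X -> {linear Y -> Z}).

Definition fext (f : fs) : Z := \sum_(x <- supp f) phi x (f x).

Lemma fextE (f : fs) s : uniq s -> (forall x, x \notin s -> f x = 0) ->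
  fext f = \sum_(x <- s) phi x (f x).
Proof.
move=> us hs; rewrite /fext.
have e (t : seq X) : uniq t -> (forall x, x \notin t -> f x = 0) ->
   \sum_(x <- t) phi x (f x) = \sum_(x <- [seq x <- t | f x != 0]) phi x (f x).
  move=> _ _; rewrite big_filter [RHS]big_mkcond /=; apply: eq_bigr => x _.
  by case: eqP => [->|//]; rewrite raddf0.
rewrite (e _ (supp_uniq f) (@suppP f)) (e _ us hs); apply: perm_big.
apply: uniq_perm; rewrite ?filter_uniq ?supp_uniq // => x; rewrite !mem_filter.
case: (eqVneq (f x) 0) => //= fx.
have -> : x \in supp f by apply: contraNT fx => /suppP ->.
by have -> : x \in s by apply: contraNT fx => /hs ->.
Qed.

Fact fext_linear : linear fext.
Proof.
move=> a f g; pose s := undup (supp f ++ supp g).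
have us : uniq s by exact: undup_uniq.
have hs x : x \notin s -> f x = 0 /\ g x = 0.
  by rewrite mem_undup mem_cat negb_or => /andP[/suppP -> /suppP ->].
rewrite (fextE us) => [|x /hs[fx gx]]; last by rewrite fsD fsZ fx gx scaler0 addr0.
rewrite (@fextE f s us) => [|x /hs[]//]; rewrite (@fextE g s us) => [|x /hs[]//].
by rewrite scaler_sumr -big_split /=; apply: eq_bigr => x _; rewrite -linearP.
Qed.
HB.instance Definition _ := GRing.isLinear.Build R fs Z _ fext fext_linear.

Lemma fext_single x y : fext (single x y) = phi x y.
Proof.
rewrite (@fextE _ [:: x]) //; first by rewrite big_seq1 singleE eqxx.
by move=> z; rewrite inE singleE => /negbTE ->.
Qed.

End Ext.

Lemma fs_lin_eq (Z : lmodType R) (f g : {linear fs -> Z}) :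
  (forall x y, f (single x y) = g (single x y)) -> forall w, f w = g w.
Proof.
move=> h w; rewrite (fs_split w) !raddf_sum; apply: eq_bigr => x _; exact: h.
Qed.

Lemma fs_lin_eq0 (Z : lmodType R) (f : {linear fs -> Z}) :
  (forall x y, f (single x y) = 0) -> forall w, f w = 0.
Proof.
by move=> h w; rewrite (fs_split w) raddf_sum big1 // => x _; exact: h.
Qed.

End FinSupp.

Arguments single {R X Y} x y.
Arguments supp {R X Y} f.

Section Scalar.
Context (R : fieldType) (X : choiceType) (Y : lmodType R).

Fact fsc_fs (c : fs X R^o) (y : Y) : exists s : seq X, forall x, x \notin s -> c x *: y = 0.
Proof. by have [s hs] := fsP c; exists s => x /hs ->; rewrite scale0r. Qed.
Definition fsc (c : fs X R^o) (y : Y) : fs X Y := @fs_mk R X Y _ (fsc_fs c y).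

Lemma fscE c y x : fsc c y x = (c x : R) *: y. Proof. by []. Qed.

Fact fsc_linear c : linear (fsc c).
Proof.
move=> a y y'; apply: fs_eq => x; rewrite fsD fsZ !fscE scalerDr !scalerA.
by rewrite mulrC.
Qed.
HB.instance Definition _ c := GRing.isLinear.Build R Y (fs X Y) _ (fsc c) (fsc_linear c).

End Scalar.

Section Map.
Context (R : fieldType) (X : choiceType) (Y Z : lmodType R) (phi : X -> {linear Y -> Z}).

Fact fmap_fs (f : fs X Y) : exists s : seq X, forall x, x \notin s -> phi x (f x) = 0.
Proof. by have [s hs] := fsP f; exists s => x /hs ->; rewrite raddf0. Qed.
Definition fmap (f : fs X Y) : fs X Z := fs_mk (fmap_fs f).
Lemma fmapE f x : fmap f x = phi x (f x). Proof. by []. Qed.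
Fact fmap_linear : linear fmap.
Proof. by move=> a f g; apply: fs_eq => x; rewrite fsD fsZ !fmapE linearP. Qed.
HB.instance Definition _ := GRing.isLinear.Build R (fs X Y) (fs X Z) _ fmap fmap_linear.
Lemma fmap_single x y : fmap (single x y) = single x (phi x y).
Proof. by apply: fs_eq => z; rewrite fmapE !singleE; case: eqP => [->|]; rewrite ?raddf0. Qed.
End Map.

Definition sgz (R : fieldType) (z : int) : R := (-1) ^+ absz z.

Lemma sgzS (R : fieldType) z : sgz R (z + 1) = - sgz R z.
Proof.
rewrite /sgz; case: z => [n|[|n]].
- by rewrite -PoszD addn1 absz_nat exprS mulN1r.
- by rewrite NegzE addNr /= expr0 expr1 opprK.
- have -> : Negz n.+1 + 1 = Negz n by lia.
  by rewrite -[absz (Negz n)]/(n.+1) -[absz (Negz n.+1)]/(n.+2) [in RHS]exprS mulN1r opprK.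
Qed.

Lemma sgz2 (R : fieldType) z : sgz R z * sgz R z = 1.
Proof. by rewrite /sgz -expr2 sqrr_sign. Qed.

Lemma sgzM (R : fieldType) z w : sgz R (z + w) = sgz R z * sgz R w.
Proof.
rewrite /sgz -exprD -signr_odd -[RHS]signr_odd; congr (_ ^+ nat_of_bool _); lia.
Qed.

(* Complexes are ungraded modules with a differential; the grading and the
   integral structure are carried separately by predicates. *)
Record cpx (R : fieldType) := Cpx {
  cmod :> lmodType R;
  cd : {linear cmod -> cmod};
  cdd : forall y, cd (cd y) = 0
}.

Section DX.
Context (R : fieldType) (X : choiceType) (inc : X -> fs X R^o) (Y : lmodType R).
Definition dX : fs X Y -> fs X Y := fext (fun g => @fsc R X Y (inc g) : {linear Y -> fs X Y}).
HB.instance Definition _ := GRing.Linear.on dX.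
Lemma dX_single g y : dX (single g y) = fsc (inc g) y.
Proof. by rewrite /dX fext_single. Qed.
Lemma dXE w h : dX w h = \sum_(g <- supp w) inc g h *: w g.
Proof. by rewrite /dX /fext fs_sum. Qed.
End DX.
Arguments dX {R X} inc {Y} w.

Record bcx (R : fieldType) := Bcx {
  bX :> choiceType;
  bdeg : bX -> int;
  binc : bX -> fs bX R^o;
  bincdeg : forall g h, binc g h != 0 -> bdeg h = bdeg g + 1;
  bincinc : forall g, dX binc (binc g) = 0
}.

Section Tensor.
Context (R : fieldType) (X : bcx R).
Local Notation inc := (@binc R X).
Local Notation deg := (@bdeg R X).

Lemma dX_fsc (Y : lmodType R) (c : fs X R^o) (y : Y) : dX inc (fsc c y) = fsc (dX inc c) y.
Proof.
have l1 : linear (fun c : fs X R^o => fsc c y).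
  by move=> a b b'; apply: fs_eq => x; rewrite fsD fsZ !fscE fsD fsZ scalerDl scalerA.
pose f := GRing.isLinear.Build R (fs X R^o) (fs X Y) _ (fun c : fs X R^o => fsc c y) l1.
pose F : {linear fs X R^o -> fs X Y} := HB.pack (fun c : fs X R^o => fsc c y) f.
have := @fs_lin_eq R X R^o (fs X Y) (dX inc \o F) (F \o dX inc); apply=> x a /=.
have -> : fsc (single x a) y = @single R X Y x ((a : R) *: y).
  by apply: fs_eq => z; rewrite fscE !singleE; case: eqP; rewrite ?scale0r.
rewrite !dX_single; apply: fs_eq => z; rewrite !fscE.
by rewrite scalerA.
Qed.

Lemma dXdX (Y : lmodType R) (w : fs X Y) : dX inc (dX inc w) = 0.
Proof.
apply: (@fs_lin_eq0 R X Y _ (dX inc \o dX inc)) => x y /=.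
rewrite dX_single dX_fsc bincinc; apply: fs_eq => z.
by rewrite fscE fs0 scale0r.
Qed.

Lemma dX_deg (Y : lmodType R) (w : fs X Y) a :
  (forall g, deg g != a -> w g = 0) -> forall h, deg h != a + 1 -> dX inc w h = 0.
Proof.
move=> hw h ha; rewrite dXE big1 // => g _.
have [ga|/hw ->] := eqVneq (deg g) a; last by rewrite scaler0.
have [->|/bincdeg e] := eqVneq (inc g h) 0; first by rewrite scale0r.
by rewrite e ga eqxx in ha.
Qed.

Lemma dX_ext (Y : lmodType R) (w w' : fs X Y) h :
  (forall g, deg g = deg h - 1 -> w g = w' g) -> dX inc w h = dX inc w' h.
Proof.
move=> e; apply/eqP; rewrite -subr_eq0 -fsB -raddfB dXE big1 // => g _.
have [->|/bincdeg eg] := eqVneq (inc g h) 0; first by rewrite scale0r.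
by rewrite fsB e ?subrr ?scaler0 // eg addrK.
Qed.

Context (Y : cpx R).
Definition sd : fs X Y -> fs X Y := fmap (fun g => (sgz R (deg g)) \*: cd Y : {linear Y -> Y}).
HB.instance Definition _ := GRing.Linear.on sd.
Lemma sdE w g : sd w g = sgz R (deg g) *: cd Y (w g). Proof. by []. Qed.

Definition dT (w : fs X Y) : fs X Y := dX inc w + sd w.
Fact dT_linear : linear dT.
Proof. by move=> a f g; rewrite /dT !linearP scalerDr addrACA. Qed.
HB.instance Definition _ := GRing.isLinear.Build R (fs X Y) (fs X Y) _ dT dT_linear.

Lemma dTE w h : dT w h = dX inc w h + sgz R (deg h) *: cd Y (w h). Proof. by []. Qed.

Lemma dX_sd w : dX inc (sd w) + sd (dX inc w) = 0.
Proof.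
apply: (@fs_lin_eq0 R X Y _ ((dX inc \o sd) \+ (sd \o dX inc))) => g y /=.
apply: fs_eq => h; rewrite fsD fs0 sdE dX_single fscE /sd fmap_single dX_single fscE /=.
have [->|/bincdeg e] := eqVneq (inc g h) 0; first by rewrite !scale0r raddf0 scaler0 addr0.
have eZ : cd Y ((inc g h : R) *: y) = (inc g h : R) *: cd Y y by exact: linearZ.
rewrite e sgzS eZ !scalerA -scalerDl mulNr.
by rewrite [X in _ - X]mulrC subrr scale0r.
Qed.

Lemma dTdT w : dT (dT w) = 0.
Proof.
rewrite /dT !raddfD /= dXdX add0r addrA dX_sd add0r.
apply: fs_eq => g; rewrite !sdE linearZ /= cdd scaler0 scaler0.
by [].
Qed.

Definition tens : cpx R := @Cpx R (fs X Y) dT dTdT.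

Section Graded.
Context (N : X -> int -> Y -> Prop).

(** [N g b] holds the elements of degree [b] allowed as coefficients of the basis vector [g]. The
    dependence on [g] encodes localizations: in a Cech basis the denominators allowed vary with the
    set [g]. *)
Record good : Prop := Good {
  good0 : forall g b, N g b 0;
  goodB : forall g b y z, N g b y -> N g b z -> N g b (y - z);
  goodZ : forall g h b y, N g b y -> N h b (inc g h *: y);
  goodd : forall g b y, N g b y -> N g (b + 1) (cd Y y)
}.
Hypothesis hN : good.

Lemma goodN g b y : N g b y -> N g b (- y).
Proof. by move=> h; rewrite -sub0r; apply: (goodB hN) => //; exact: good0. Qed.
Lemma goodD g b y z : N g b y -> N g b z -> N g b (y + z).
Proof. by move=> hy hz; rewrite -[z]opprK; apply: (goodB hN) => //; exact: goodN. Qed.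
Lemma good_sum g b (J : Type) (r : seq J) (F : J -> Y) :
  (forall j, N g b (F j)) -> N g b (\sum_(j <- r) F j).
Proof. by move=> h; elim/big_ind: _ => //; [exact: good0|exact: goodD]. Qed.
Lemma good_sgz g b y z : N g b y -> N g b (sgz R z *: y).
Proof. by move=> h; rewrite /sgz -signr_odd; case: odd; rewrite ?scaleN1r ?scale1r //; exact: goodN. Qed.

Definition inN j (w : fs X Y) := forall g, N g (j - deg g) (w g).

Lemma inN0 j : inN j 0. Proof. by move=> g; exact: good0. Qed.
Lemma inNB j v w : inN j v -> inN j w -> inN j (v - w).
Proof. by move=> hv hw g; exact: (goodB hN). Qed.
Lemma inND j v w : inN j v -> inN j w -> inN j (v + w).
Proof. by move=> hv hw g; exact: goodD. Qed.

Lemma inN_dX j w : inN j w -> inN (j + 1) (dX inc w).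
Proof.
move=> h x; rewrite dXE; apply: good_sum => g.
have [->|e] := eqVneq (inc g x) 0; first by rewrite scale0r; exact: good0.
rewrite (bincdeg e); have -> : j + 1 - (deg g + 1) = j - deg g by lia.
exact: (@goodZ hN g x _ _ (h g)).
Qed.

Lemma inN_dT j w : inN j w -> inN (j + 1) (dT w).
Proof.
move=> h; apply: inND; first exact: inN_dX.
move=> g; rewrite sdE; apply: good_sgz.
by have := goodd hN (h g); rewrite addrAC.
Qed.

Definition exact_at j := forall w, inN j w -> dT w = 0 -> exists2 v, inN (j - 1) v & w = dT v.

Definition conc a (w : fs X Y) := forall g, deg g != a -> w g = 0.

(** Vanishing at the place (a, j - a) on the second page of the spectral sequence that filters by
    the degree in [X]: [u] is a cycle of [X] with coefficients in the cohomology of [Y], and it has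
    to be a boundary there. *)
Definition step j a := forall u : fs X Y, conc a u ->
  (forall g, N g (j - a) (u g)) -> (forall g, cd Y (u g) = 0) ->
  (forall h, deg h = a + 1 -> exists2 y, N h (j - a - 1) y & dX inc u h = cd Y y) ->
  exists v y : fs X Y, [/\ conc (a - 1) v, forall g, N g (j - a) (v g),
    forall g, cd Y (v g) = 0, conc a y &
    (forall g, N g (j - a - 1) (y g)) /\
    forall g, deg g = a -> u g = dX inc v g + cd Y (y g)].

Fact restr_fs a (w : fs X Y) : exists s : seq X, forall x, x \notin s ->
  (if deg x == a then w x else 0) = 0.
Proof. by have [s hs] := fsP w; exists s => x /hs ->; rewrite if_same. Qed.
Definition restr a (w : fs X Y) : fs X Y := fs_mk (restr_fs a w).
Lemma restrE a w x : restr a w x = if deg x == a then w x else 0. Proof. by []. Qed.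

Lemma chase_step j a w : inN j w -> dT w = 0 -> (forall g, deg g < a -> w g = 0) ->
  step j a -> exists2 u, inN (j - 1) u & forall g, deg g < a + 1 -> (w - dT u) g = 0.
Proof.
move=> wN w0 wa st.
have cu : conc a (restr a w) by move=> g /negbTE; rewrite restrE => ->.
have dXw h : deg h = a -> dX inc w h = 0.
  by move=> ha; rewrite (@dX_ext _ _ 0) ?raddf0 // => g e; rewrite wa // e ha; lia.
have [||||v [y [cv vN v0 cy [yN e]]]] := st (restr a w).
- exact: cu.
- by move=> g; rewrite restrE; case: eqP => [<-|_]; [exact: wN|exact: good0].
- move=> g; rewrite restrE; case: eqP => [ga|_]; last by rewrite raddf0.
  have := congr1 (fun f : fs X Y => f g) w0; rewrite dTE dXw // add0r fs0 => /eqP.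
  rewrite scaler_eq0 => /orP[/eqP s0|/eqP //].
  by have := sgz2 R (deg g); rewrite s0 mul0r => /eqP; rewrite eq_sym oner_eq0.
- move=> h ha; exists (- (sgz R (deg h) *: w h)).
    apply: goodN; apply: good_sgz; have := wN h; rewrite ha.
    by have -> : j - (a + 1) = j - a - 1 by lia.
  rewrite raddfN /= linearZ /=; apply/eqP; rewrite -addr_eq0; apply/eqP.
  have := congr1 (fun f : fs X Y => f h) w0; rewrite dTE fs0 => <-; congr (_ + _).
  by apply: dX_ext => g eg; rewrite restrE eg ha addrK eqxx.
(* The sign cancels the one that [sd] attaches to basis degree [a]. *)
pose y' := sgz R a *: y.
exists (v + y').
  apply: inND => g.
    have [ga|ga] := eqVneq (deg g) (a - 1); last by rewrite cv //; exact: good0.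
    by rewrite ga; have -> : j - 1 - (a - 1) = j - a by lia.
  have [ga|ga] := eqVneq (deg g) a; last by rewrite /y' fsZ cy // scaler0; exact: good0.
  by rewrite ga /y' fsZ; apply: good_sgz; have -> : j - 1 - a = j - a - 1 by lia.
have dTD : dT (v + y') = dT v + dT y' by exact: raddfD.
move=> g ga; rewrite dTD fsB fsD !dTE v0 scaler0 addr0.
have [ea|ea] := eqVneq (deg g) a.
  rewrite {1}[dX inc y' g](@dX_deg _ _ a) ?add0r; first last.
  - by rewrite ea; lia.
  - by move=> x hx; rewrite /y' fsZ cy ?scaler0.
  rewrite /y' fsZ linearZ /= scalerA ea sgz2 scale1r -e //.
  by rewrite restrE ea eqxx subrr.
rewrite wa; last by lia.
rewrite (@dX_deg _ v (a - 1)) ?add0r //; last by lia.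
rewrite (@dX_deg _ y' a) ?add0r; first last.
- by lia.
- by move=> x hx; rewrite /y' fsZ cy ?scaler0.
by rewrite /y' fsZ cy // scaler0 raddf0 ?scaler0 ?addr0 ?subr0 ?oppr0 ?addr0.
Qed.

Lemma chase j a (n : nat) w : inN j w -> dT w = 0 -> (forall g, deg g < a -> w g = 0) ->
  (forall c, a <= c < a + n%:Z -> step j c) ->
  exists2 u, inN (j - 1) u & forall g, deg g < a + n%:Z -> (w - dT u) g = 0.
Proof.
elim: n a w => [|n IH] a w wN w0 wa st.
  exists 0; first exact: inN0.
  by move=> g; rewrite addr0 raddf0 subr0; exact: wa.
have [|u uN hu] := chase_step wN w0 wa; first by apply: st; lia.
have [||||u' uN' hu'] := IH (a + 1) (w - dT u).
- apply: inNB => //; have := inN_dT uN.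
  by have -> : j - 1 + 1 = j by lia.
- by have -> : dT (w - dT u) = dT w - dT (dT u) by [exact: raddfB]; rewrite w0 dTdT subr0.
- exact: hu.
- by move=> c hc; apply: st; lia.
exists (u + u'); first exact: inND.
have -> : dT (u + u') = dT u + dT u' by exact: raddfD.
move=> g hg; rewrite opprD addrA; apply: hu'; lia.
Qed.

Lemma fs_deg_lower (w : fs X Y) : exists a : int, forall g, deg g < a -> w g = 0.
Proof.
have [s hs] := fsP w.
have [a ha] : exists a : int, forall g, g \in s -> a <= deg g.
  elim: (s) => [|x r [a ha]]; first by exists 0.
  exists (Num.min a (deg x)) => g; rewrite inE => /orP[/eqP ->|/ha h]; lia.
exists a => g ga; apply: hs; apply/negP => /ha; lia.
Qed.

Lemma chase_to j a0 w : inN j w -> dT w = 0 -> (forall c, c < a0 -> step j c) ->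
  exists2 u, inN (j - 1) u & forall g, deg g < a0 -> (w - dT u) g = 0.
Proof.
move=> wN w0 st; have [a ha] := fs_deg_lower w.
have [n hn] : exists n : nat, Num.min a a0 + n%:Z = a0.
  exists (absz (a0 - Num.min a a0)); lia.
have [|c hc|u uN hu] := @chase j (Num.min a a0) n w wN w0.
- by move=> g hg; apply: ha; lia.
- by apply: st; lia.
by exists u => // g hg; apply: hu; rewrite hn.
Qed.

(** Finite support bounds the degrees in [w] from below and [D] bounds them from above, so finitely
    many steps, each removing the lowest component, exhaust [w]. *)
Lemma chase_exact D j : (forall g, deg g < D) -> (forall c, c < D -> step j c) -> exact_at j.
Proof.
move=> hD st w wN w0; have [u uN hu] := chase_to wN w0 st; exists u => //.
by apply/eqP; rewrite -subr_eq0; apply/eqP/fs_eq => g; exact: hu.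
Qed.

Lemma step_exact j a :
  (forall g y, deg g = a -> N g (j - a) y -> cd Y y = 0 ->
     exists2 y', N g (j - a - 1) y' & y = cd Y y') -> step j a.
Proof.
move=> ex u cu uN u0 _.
have [||y hy] := @fs_choice R X Y (supp u) (fun g y => [/\ deg g != a -> y = 0, N g (j - a - 1) y & deg g = a -> u g = cd Y y]).
2: move=> g /suppP g0; split=> // [|_]; [exact: good0|by rewrite g0 raddf0].
- move=> g; have [ga|ga] := eqVneq (deg g) a.
    by have [y yN e] := ex g (u g) ga (uN g) (u0 g); exists y; split.
  by exists 0; split=> // [|/eqP]; [exact: good0|rewrite (negbTE ga)].
exists 0, y; split.
- by move=> g _.
- by move=> g; exact: good0.
- by move=> g; rewrite fs0 raddf0.
- by move=> g ga; have [h _ _] := hy g; exact: h.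
- split=> g; first by have [] := hy g.
  by move=> ga; rewrite raddf0 fs0 add0r; have [_ _] := hy g; apply.
Qed.

End Graded.

(** Exactness in degree [a] of [X] with coefficients in the quotient of [P] by [P0], stated on
    representatives. *)
Definition relex (P P0 : Y -> Prop) a := forall u : fs X Y, conc a u ->
  (forall g, P (u g)) -> (forall h, P0 (dX inc u h)) ->
  exists2 v : fs X Y, conc (a - 1) v & (forall g, P (v g)) /\
    forall g, P0 (u g - dX inc v g).

Lemma step_relex (N : int -> Y -> Prop) j a :
  good (fun=> N) ->
  relex (fun y => N (j - a) y /\ cd Y y = 0) (fun y => exists2 y', N (j - a - 1) y' & y = cd Y y') a ->
  step (fun=> N) j a.
Proof.
move=> hN re u cu uN u0 hu.
have [|h|v cv [vN hv]] := re u cu.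
- by move=> g; split.
- have [ha|ha] := eqVneq (bdeg h) (a + 1); first by have [y yN e] := hu h ha; exists y.
  by exists 0; [exact: (good0 hN h)|rewrite raddf0 (dX_deg cu)].
have [||y hy] := @fs_choice R X Y (supp u ++ supp (dX inc v)) (fun g y => [/\ bdeg g != a -> y = 0, N (j - a - 1) y & bdeg g = a -> u g - dX inc v g = cd Y y]).
2: move=> g; rewrite mem_cat negb_or => /andP[/suppP g0 /suppP g1]; split=> // [|_]; [exact: (good0 hN g)|by rewrite g0 g1 subr0 raddf0].
- move=> g; have [ga|ga] := eqVneq (bdeg g) a.
    by have [y yN e] := hv g; exists y; split.
  by exists 0; split=> // [|/eqP]; [exact: (good0 hN g)|rewrite (negbTE ga)].
exists v, y; split=> //.
- by move=> g; have [] := vN g.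
- by move=> g; have [] := vN g.
- by move=> g ga; have [h _ _] := hy g; exact: h.
- split=> g; first by have [] := hy g.
  by move=> ga; have [_ _ e] := hy g; rewrite -e // addrC subrK.
Qed.

End Tensor.

Section More.
Context (R : fieldType).

Lemma dT_single (X : bcx R) (Y : cpx R) g (y : Y) :
  dT (single g y) = fsc (@binc R X g) y + single g (sgz R (bdeg g) *: cd Y y).
Proof.
rewrite /dT dX_single; congr (_ + _); apply: fs_eq => h; rewrite sdE !singleE.
by case: eqP => [->|]; rewrite // raddf0 scaler0.
Qed.

Lemma sgz_neq0 z : sgz R z != 0.
Proof. by apply/eqP => s0; have := sgz2 R z; rewrite s0 mul0r => /eqP; rewrite eq_sym oner_eq0. Qed.

Section ExtLemma.
Context (X : bcx R) (Y : cpx R) (N : int -> Y -> Prop).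
Hypothesis hN : good (X := X) (fun=> N).
Hypothesis N0 : forall b, N b 0.

(** If [Y] has cohomology only in its top degree [b1], its tensor product with [X] computes [X] with
    coefficients in that cohomology. A cycle [u] with such coefficients is completed to a cocycle of
    total degree [a + b1] by components of higher degree in [X]; a primitive of this cocycle yields
    one of [u]. *)
Lemma relex_of_exact (D b1 a : int) : (forall g : X, bdeg g < D) ->
  (forall (b : int) y, b < b1 -> N b y -> cd Y y = 0 -> exists2 y', N (b - 1) y' & y = cd Y y') ->
  (forall y, N b1 y -> cd Y y = 0) ->
  exact_at (X := X) (fun=> N) (a + b1) ->
  relex X (N b1) (fun y => exists2 y', N (b1 - 1) y' & y = cd Y y') a.
Proof.
move=> hD ex top exT u cu uN hu.
(* [n] counts the degrees above [a] in which [dT w] has been made 0. *)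
have key (n : nat) : exists w : fs X Y, [/\ inN (X := X) (fun=> N) (a + b1) w,
    forall g : X, bdeg g <= a -> w g = u g &
    forall g : X, bdeg g < a + 1 + n%:Z -> dT w g = 0].
  elim: n => [|n [w [wN wu w0]]].
    exists u; split=> // g.
      have [->|/cu ->] := eqVneq (bdeg g) a; last exact: N0.
      by rewrite addrC addKr.
    move=> ga; rewrite dTE (dX_deg cu) ?add0r; last by lia.
    by rewrite (top _ (uN g)) scaler0.
  pose c := a + 1 + n%:Z; pose r := dT w.
  have rN : inN (X := X) (fun=> N) (a + b1 + 1) r by exact: inN_dT.
  have r0 (h : X) : bdeg h = c -> cd Y (r h) = 0.
    move=> hc; have := congr1 (fun f : fs X Y => f h) (dTdT w).
    rewrite dTE (@dX_ext _ _ _ _ 0); last first.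
      by move=> g eg; rewrite w0 // eg hc /c; lia.
    by move=> /eqP; rewrite raddf0 !fs0 add0r scaler_eq0 (negbTE (sgz_neq0 _)) => /eqP.
  have rB (h : X) : bdeg h = c -> exists2 y, N (b1 - n%:Z - 1) y & r h = cd Y y.
    (* The first correction comes from the hypothesis on [u], all later ones from the exactness of
       [Y] below [b1]. *)
    move=> hc; case: n @c {w0} hc r0 => [|n] c hc r0.
      rewrite subr0; have [y yN e] := hu h.
      exists (y + sgz R (bdeg h) *: w h).
        apply: (@goodD R X Y (fun=> N) hN h) => //; apply: (@good_sgz R X Y (fun=> N) hN h).
        by have := wN h; rewrite hc /c; have -> : a + b1 - (a + 1 + 0%:Z) = b1 - 1 by lia.
      have -> : cd Y (y + sgz R (bdeg h) *: w h) = cd Y y + sgz R (bdeg h) *: cd Y (w h).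
        by rewrite -linearZ /=; exact: raddfD.
      rewrite -e /r dTE; congr (_ + _).
      by apply: dX_ext => g eg; rewrite wu // eg hc /c; lia.
    apply: ex; [lia| |exact: r0].
    by have := rN h; rewrite hc /c; have -> : a + b1 + 1 - (a + 1 + n.+1%:Z) = b1 - n.+1%:Z by lia.
  have [||y hy] := @fs_choice R X Y (supp r) (fun g y => [/\ bdeg g != c -> y = 0,
     N (b1 - n%:Z - 1) y & bdeg g = c -> r g = cd Y y]).
  2: by move=> g /suppP g0; split=> // _; rewrite g0 raddf0.
  - move=> g; have [ga|ga] := eqVneq (bdeg g) c.
      by have [y yN e] := rB g ga; exists y; split.
    by exists 0; split=> // /eqP; rewrite (negbTE ga).
  exists (w - sgz R c *: y); split.
  - apply: (inNB hN) => // g; rewrite fsZ; apply: (@good_sgz R X Y (fun=> N) hN g).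
    have [y0 yN _] := hy g; have [ga|/y0 -> //] := eqVneq (bdeg g) c.
    by rewrite ga /c; have -> : a + b1 - (a + 1 + n%:Z) = b1 - n%:Z - 1 by lia.
  - move=> g ga; rewrite fsB fsZ; have [y0 _ _] := hy g; rewrite y0; last by apply/eqP; rewrite /c; lia.
    by rewrite scaler0 subr0 wu.
  - move=> g ga; have -> : dT (w - sgz R c *: y) = dT w - sgz R c *: dT y.
      by rewrite -linearZ /=; exact: raddfB.
    rewrite fsB fsZ [dT y g]dTE (dX_deg (a := c)); first last.
    + by rewrite /c; lia.
    + by move=> h hc; have [y0 _ _] := hy h; exact: y0.
    rewrite add0r; have [gc|gc] := eqVneq (bdeg g) c; last first.
      have [y0 _ _] := hy g; rewrite (y0 gc).
      by rewrite raddf0 !scaler0 subr0 w0 //; move: gc; rewrite /c => /eqP gc; lia.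
    by rewrite gc scalerA sgz2 scale1r; have [_ _ ey] := hy g; rewrite -(ey gc); exact: subrr.
have [w [wN wu w0]] := key (absz ((D : int) - a - 1)%R).
have dw0 : dT w = 0 by apply/fs_eq => g; apply: w0; have := hD g; lia.
have [w' w'N e] := exT w wN dw0.
have dr g : bdeg g = a -> dX (@binc R X) (restr (a - 1) w') g = dX (@binc R X) w' g.
  by move=> ga; apply: dX_ext => h; rewrite ga restrE => ->; rewrite eqxx.
exists (restr (a - 1) w'); [|split].
- by move=> g /negbTE; rewrite restrE => ->.
- move=> g; rewrite restrE; case: eqP => [ga|//].
  by have := w'N g; rewrite ga; have -> : a + b1 - 1 - (a - 1) = b1 by lia.
- move=> g; have [ga|ga] := eqVneq (bdeg g) a; last first.
    rewrite cu // (dX_deg (a := a - 1)) ?subrr; first by exists 0; rewrite ?raddf0.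
    + by move=> h /negbTE; rewrite restrE => ->.
    + by rewrite subrK.
  exists (sgz R a *: w' g).
    apply: (@good_sgz R X Y (fun=> N) hN g); have := w'N g; rewrite ga.
    by have -> : a + b1 - 1 - a = b1 - 1 by lia.
  by rewrite dr // -wu ?ga // e dTE addrC addKr ga linearZ.
Qed.
End ExtLemma.

(** * Exchange of two free factors *)

Section Swap.
Context (X1 X2 : bcx R).

Section Mod.
Context (Y : lmodType R).
Fact sw_fs1 (w : fs X1 (fs X2 Y)) h : exists s : seq X1, forall g, g \notin s ->
  sgz R (bdeg g * bdeg h) *: w g h = 0.
Proof. by have [s hs] := fsP w; exists s => g /hs ->; rewrite fs0 scaler0. Qed.
Fact sw_fs (w : fs X1 (fs X2 Y)) : exists s : seq X2, forall h, h \notin s ->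
  fs_mk (sw_fs1 w h) = 0.
Proof.
exists (flatten [seq supp (w g) | g <- supp w]) => h hs; apply: fs_eq => g.
rewrite fs0 /=; have [gs|/suppP ->] := boolP (g \in supp w); last by rewrite fs0 scaler0.
rewrite (suppP (x := h)) ?scaler0 //; apply: contra hs => hg.
by apply/flattenP; exists (supp (w g)) => //; apply/mapP; exists g.
Qed.
Definition sw (w : fs X1 (fs X2 Y)) : fs X2 (fs X1 Y) := fs_mk (sw_fs w).
Lemma swE w h g : sw w h g = sgz R (bdeg g * bdeg h) *: w g h. Proof. by []. Qed.
Fact sw_linear : linear sw.
Proof.
move=> a v w; apply: fs_eq => h; apply: fs_eq => g.
change (sgz R (bdeg g * bdeg h) *: (a *: v g h + w g h) =
  a *: (sgz R (bdeg g * bdeg h) *: v g h) + sgz R (bdeg g * bdeg h) *: w g h).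
by rewrite scalerDr !scalerA mulrC.
Qed.
HB.instance Definition _ := GRing.isLinear.Build R _ _ _ sw sw_linear.
End Mod.

Context (Y : cpx R).
(** The sign (-1)^(deg g deg h) is the one that makes the exchange a chain map. This is checked on
    pairs of basis vectors, where a vector never occurs in its own boundary for reasons of
    degree. *)
Lemma dT_sw (w : fs X1 (tens X2 Y)) :
  dT (Y := tens X1 Y) (sw w) = sw (dT (Y := tens X2 Y) w).
Proof.
pose F : {linear fs X1 (tens X2 Y) -> fs X2 (tens X1 Y)} := @dT R X2 (tens X1 Y) \o (@sw Y).
pose G : {linear fs X1 (tens X2 Y) -> fs X2 (tens X1 Y)} := (@sw Y) \o @dT R X1 (tens X2 Y).
apply: (@fs_lin_eq R X1 (tens X2 Y) _ F G) => g.
apply: (@fs_lin_eq R X2 Y _ (F \o @single R X1 (tens X2 Y) g) (G \o @single R X1 (tens X2 Y) g)) => h y.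
rewrite /= /F /G /=.
have -> : sw (single g (single h y)) = single h (single g (sgz R (bdeg g * bdeg h) *: y)).
  apply: fs_eq => h'; apply: fs_eq => g'; rewrite swE !singleE.
  case: (eqVneq g' g) => [->|]; case: (eqVneq h' h) => [->|]; rewrite ?fs0 ?scaler0 ?singleE ?eqxx //.
    by move=> /negbTE ->; rewrite scaler0.
  by move=> /negbTE ->.
rewrite dT_single [in RHS]dT_single; apply: fs_eq => h'; apply: fs_eq => g'.
set s0 := sgz R (bdeg g * bdeg h).
change ((@binc R X2 h h' : R) *: (if g' == g then s0 *: y else 0) + (if h' == h then sgz R (bdeg h) *: dT (single g (s0 *: y)) else 0) g'
 = sgz R (bdeg g' * bdeg h') *: ((@binc R X1 g g' : R) *: (if h' == h then y else 0) + (if g' == g then sgz R (bdeg g) *: dT (single h y) else 0) h')).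
rewrite !dT_single.
have e0 (Q : bcx R) (q q' : Q) : binc q q' = 0 \/ bdeg q' = bdeg q + 1.
  by have [->|/bincdeg ->] := eqVneq (binc q q') 0; [left|right].
have z1 (a b : int) : sgz R (a * (b + 1)) = sgz R (a * b) * sgz R a by rewrite mulrDr mulr1 sgzM.
have z2 (a b : int) : sgz R ((a + 1) * b) = sgz R (a * b) * sgz R b by rewrite mulrDl mul1r sgzM.
have hself (Q : bcx R) (q : Q) : binc q q = 0 by case: (e0 Q q q) => // e1; lia.
case: (eqVneq g' g) => [->|ng]; case: (eqVneq h' h) => [->|nh].
- change ((@binc R X2 h h : R) *: (s0 *: y) + sgz R (bdeg h) *: ((@binc R X1 g g : R) *: (s0 *: y) + (if g == g then sgz R (bdeg g) *: cd Y (s0 *: y) else 0))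
   = s0 *: ((@binc R X1 g g : R) *: y + sgz R (bdeg g) *: ((@binc R X2 h h : R) *: y + (if h == h then sgz R (bdeg h) *: cd Y y else 0)))).
  have eZ : cd Y (s0 *: y) = s0 *: cd Y y by exact: linearZ.
  rewrite !eqxx !hself !scale0r !add0r eZ !scalerA; congr (_ *: _).
  by rewrite mulrC [sgz R (bdeg h) * _]mulrC mulrA.
- change ((@binc R X2 h h' : R) *: (s0 *: y) + 0
   = sgz R (bdeg g * bdeg h') *: ((@binc R X1 g g : R) *: 0 + sgz R (bdeg g) *: ((@binc R X2 h h' : R) *: y + (if h' == h then sgz R (bdeg h) *: cd Y y else 0)))).
  rewrite (negbTE nh) scaler0 add0r !addr0.
  have [->|e1] := e0 X2 h h'; first by rewrite !(scale0r, scaler0).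
  by rewrite e1 z1 !scalerA -[_ * sgz R _ * sgz R _]mulrA sgz2 mulr1 mulrC.
- change ((@binc R X2 h h : R) *: 0 + sgz R (bdeg h) *: ((@binc R X1 g g' : R) *: (s0 *: y) + (if g' == g then sgz R (bdeg g) *: cd Y (s0 *: y) else 0))
   = sgz R (bdeg g' * bdeg h) *: ((@binc R X1 g g' : R) *: y + 0)).
  rewrite (negbTE ng) scaler0 add0r !addr0.
  have [->|e1] := e0 X1 g g'; first by rewrite !(scale0r, scaler0, mulr0).
  by rewrite e1 z2 !scalerA; congr (_ *: _); rewrite mulrC mulrA.
- change ((@binc R X2 h h' : R) *: 0 + 0 = sgz R (bdeg g' * bdeg h') *: ((@binc R X1 g g' : R) *: 0 + (0 : fs X2 Y) h')).
  by rewrite !scaler0 fs0 !addr0 scaler0.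
Qed.
End Swap.

Lemma swK (X1 X2 : bcx R) (Y : lmodType R) (w : fs X1 (fs X2 Y)) : sw (sw w) = w.
Proof.
apply: fs_eq => g; apply: fs_eq => h; rewrite !swE scalerA [bdeg h * _]mulrC.
by rewrite sgz2 scale1r.
Qed.

Section ChainMap.
Context (X : bcx R).

Lemma dX_fmap (Y Z : lmodType R) (phi : {linear Y -> Z}) (w : fs X Y) :
  dX (@binc R X) (fmap (fun=> phi) w) = fmap (fun=> phi) (dX (@binc R X) w).
Proof.
apply: (@fs_lin_eq R X Y _ (dX (@binc R X) \o fmap (fun=> phi)) (fmap (fun=> phi) \o dX (@binc R X))) => g y /=.
by rewrite fmap_single !dX_single; apply: fs_eq => h; rewrite fmapE !fscE linearZ.
Qed.

Lemma dT_fmap (Y Z : cpx R) (phi : {linear Y -> Z}) (w : fs X Y) :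
  (forall y, phi (cd Y y) = cd Z (phi y)) ->
  dT (fmap (fun=> phi) w) = fmap (fun=> phi) (dT w).
Proof.
move=> h; rewrite /dT dX_fmap; apply: fs_eq => g.
by rewrite [RHS]fmapE !fsD !sdE !fmapE -h linearD linearZ.
Qed.

Context (Y : cpx R) (h : {linear Y -> Y}).
Definition hT : fs X Y -> fs X Y := fmap (fun g => (sgz R (bdeg g)) \*: h : {linear Y -> Y}).
HB.instance Definition _ := GRing.Linear.on hT.
Lemma hTE w g : hT w g = sgz R (bdeg g) *: h (w g). Proof. by []. Qed.

Lemma dT_hT w : (forall y, cd Y (h y) + h (cd Y y) = y) -> dT (hT w) + hT (dT w) = w.
Proof.
move=> hh.
have e1 : dX (@binc R X) (hT w) + hT (dX (@binc R X) w) = 0.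
  have cdd0 : forall y : Y, h (h y) = 0 -> True by [].
  apply: (@fs_lin_eq0 R X Y _ ((dX (@binc R X) \o hT) \+ (hT \o dX (@binc R X)))) => g y /=.
  apply: fs_eq => x; rewrite fsD fs0 hTE dX_single fscE /hT fmap_single dX_single fscE /=.
  have [->|/bincdeg e] := eqVneq (@binc R X g x) 0; first by rewrite !scale0r raddf0 scaler0 addr0.
  have eZ : h ((@binc R X g x : R) *: y) = (@binc R X g x : R) *: h y by exact: linearZ.
  rewrite e sgzS eZ !scalerA -scalerDl mulNr.
  by rewrite [X in _ - X]mulrC subrr scale0r.
have hTD (a b : fs X Y) : hT (a + b) = hT a + hT b by exact: raddfD.
rewrite /dT hTD addrACA e1 add0r; apply: fs_eq => g.
rewrite fsD sdE !hTE sdE !linearZ /= !scalerA sgz2 !scale1r; exact: hh.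
Qed.
End ChainMap.

End More.

(** * The Cech complex as a based complex *)

Section CechBase.
Context (R : fieldType) (m : nat).
Local Notation I := 'I_m.

Lemma dX_fin (X : choiceType) (inc : X -> fs X R^o) (Y : lmodType R) (e : seq X) (w : fs X Y) h :
  uniq e -> (forall x, x \notin e -> w x = 0) ->
  dX inc w h = \sum_(g <- e) (inc g h : R) *: w g.
Proof. by move=> ue he; rewrite /dX (fextE _ ue he) fs_sum. Qed.

Definition cinc (g h : {set I}) : R := \sum_(i in h | h :\ i == g) (sgn i h)%:~R.

Lemma sum_cinc (Y : lmodType R) (w : {set I} -> Y) h :
  \sum_(g : {set I}) cinc g h *: w g = dS w h.
Proof.
rewrite /cinc /dS; under eq_bigr do rewrite scaler_suml big_mkcondr /=.
rewrite exchange_big /=; apply: eq_bigr => i ih.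
rewrite (bigD1 (h :\ i)) //= eqxx scaler_int big1 ?addr0 // => g /negbTE.
by rewrite eq_sym => ->.
Qed.

Lemma cinc_card g h : cinc g h != 0 -> #|h| = #|g|.+1.
Proof.
move=> c; have [i /andP[ih /eqP <-]|no] := pickP (fun i => (i \in h) && (h :\ i == g)).
  by rewrite (cardsD1 i h) ih.
by rewrite /cinc big_pred0 ?eqxx // in c.
Qed.

Lemma fs_finite (X : finType) (Y : lmodType R) (f : X -> Y) :
  exists s : seq X, forall x, x \notin s -> f x = 0.
Proof. by exists (enum X) => x; rewrite mem_enum. Qed.

Definition fsf (X : finType) (Y : lmodType R) (f : X -> Y) : fs X Y := fs_mk (fs_finite f).
Lemma fsfE (X : finType) (Y : lmodType R) (f : X -> Y) x : fsf f x = f x. Proof. by []. Qed.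

Definition cbinc (g : {set I}) : fs {set I} R^o := fsf (cinc g : _ -> R^o).

Lemma dX_cech (Y : lmodType R) (w : fs {set I} Y) h : dX cbinc w h = dS w h.
Proof.
rewrite (@dX_fin _ _ _ (enum {: {set I}})) ?enum_uniq //.
  by rewrite -sum_cinc big_enum.
by move=> x; rewrite mem_enum.
Qed.

Section Shift.
Variable e : int.
Let cdeg (g : {set I}) : int := #|g|%:Z - e.
Fact cbincdeg g h : cbinc g h != 0 -> cdeg h = cdeg g + 1.
Proof. by rewrite -[cbinc g h]/(cinc g h) => /cinc_card; rewrite /cdeg => ->; lia. Qed.
Fact cbincinc g : dX cbinc (cbinc g) = 0.
Proof.
apply: fs_eq => h; rewrite dX_cech fs0.
pose w : fs {set I} R^o := fsf (fun x => (x == g)%:R).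
have wE y : w y = (y == g)%:R by [].
have e1 x : cbinc g x = dS w x.
  rewrite -sum_cinc (bigD1 g) //= big1 => [|y /negbTE yg]; last first.
    by rewrite ?wE yg scaler0.
  by rewrite ?wE eqxx addr0 /GRing.scale /= mulr1.
by rewrite (@dS_eq _ _ _ (dS w)) ?dSdS // => i _; exact: e1.
Qed.
(** [e] is 1 for the usual Cech degree, with the empty set in degree -1, and 0 for the Koszul
    complex, with the empty set in degree 0. *)
Definition cech : bcx R := @Bcx R {set I} cdeg cbinc cbincdeg cbincinc.
Lemma cech_deg (g : cech) : bdeg g = #|g : {set I}|%:Z - e. Proof. by []. Qed.
Lemma dX_cechE (Y : lmodType R) (w : fs cech Y) h : dX (@binc R cech) w h = dS w h.
Proof. exact: dX_cech. Qed.
End Shift.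

Section Kappa.
Context (x : I -> R).
Local Notation T := ({set I} * option I)%type.
(** The matrix of the Cech complex tensored with S^m -> S, e_i |-> x_i. [Some i] stands for e_i, of
    degree -1, and [None] for the generator of S. As the cokernel of S^m -> S is S modulo the
    coordinates, a congruence modulo the coordinates becomes a boundary in this complex. *)
Definition kainc (g h : T) : R := match g.2, h.2 with
  | None, None => cinc g.1 h.1
  | Some i, Some j => if i == j then cinc g.1 h.1 else 0
  | Some i, None => if g.1 == h.1 then (-1) ^+ #|g.1| * x i else 0
  | None, Some _ => 0 end.
Definition kadeg (g : T) : int := #|g.1|%:Z - (if g.2 is Some _ then 1 else 0).
Definition kabinc (g : T) : fs T R^o := fsf (kainc g : _ -> R^o).

Lemma kabincdeg g h : kabinc g h != 0 -> kadeg h = kadeg g + 1.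
Proof.
rewrite -[kabinc g h]/(kainc g h) /kainc /kadeg; case: g h => [g [i|]] [h [j|]] /=; rewrite ?eqxx //.
- by case: (eqVneq i j) => [_ /cinc_card e|_ /eqP //]; rewrite e -addn1 PoszD addrAC.
- by case: (eqVneq g h) => [-> _|_ /eqP //]; lia.
- by move=> /cinc_card e; rewrite e -addn1 PoszD addrAC.
Qed.

Lemma dX_kappa (Y : lmodType R) (w : fs T Y) t o : dX kabinc w (t, o) = match o with
  | Some i => dS (fun s => w (s, Some i)) t
  | None => dS (fun s => w (s, None)) t + (-1) ^+ #|t| *: \sum_i x i *: w (t, Some i) end.
Proof.
rewrite (@dX_fin _ _ _ (enum {: T})) ?enum_uniq //; last by move=> y; rewrite mem_enum.
rewrite big_enum /= (eq_bigr (fun p => kainc (p.1, p.2) (t, o) *: w (p.1, p.2))) => [|[] //].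
rewrite -(pair_bigA _ (fun s q => kainc (s, q) (t, o) *: w (s, q))) /= exchange_big /=.
have bo (F : option I -> Y) : \sum_q F q = F None + \sum_i F (Some i).
  rewrite (bigD1 None) //=; congr (_ + _).
  rewrite (reindex_omap Some id) /=; last by case.
  by apply: eq_bigl => i; rewrite eqxx.
rewrite bo; case: o => [i|] /=.
  rewrite big1 ?add0r => [|s _]; last by rewrite scale0r.
  rewrite (bigD1 i) //= [X in _ + X]big1 ?addr0 => [|j /negbTE ji]; last first.
    by rewrite big1 // => s _; rewrite /kainc /= ji scale0r.
  by rewrite -sum_cinc; apply: eq_bigr => s _; rewrite /kainc /= eqxx.
rewrite -sum_cinc; congr (_ + _); rewrite scaler_sumr; apply: eq_bigr => i _.
rewrite (bigD1 t) //= big1 ?addr0 => [|s /negbTE st]; last by rewrite /kainc /= st scale0r.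
by rewrite /kainc /= eqxx scalerA.
Qed.

Lemma dS_sign (Y : lmodType R) (f : {set I} -> Y) t :
  dS (fun s => (-1) ^+ #|s| *: f s) t = - ((-1) ^+ #|t| *: dS f t).
Proof.
rewrite /dS scaler_sumr -sumrN; apply: eq_bigr => i it.
by rewrite (cardsD1 i t) it exprS mulN1r scaleNr opprK -!scaler_int !scalerA mulrC.
Qed.

Lemma kabincinc g : dX kabinc (kabinc g) = 0.
Proof.
pose w : fs T R^o := fsf (fun x => (x == g)%:R).
have wE y : w y = (y == g)%:R by [].
have -> : kabinc g = dX kabinc w.
  apply: fs_eq => y; rewrite (@dX_fin _ _ _ (enum {: T})) ?enum_uniq //; last by move=> z; rewrite mem_enum.
  rewrite big_enum /= (bigD1 g) //= big1 => [|z /negbTE yg]; last first.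
    by rewrite ?wE yg scaler0.
  by rewrite ?wE eqxx addr0 /GRing.scale /= mulr1.
apply: fs_eq => -[t o]; rewrite dX_kappa fs0; case: o => [i|].
  rewrite (@dS_eq _ _ _ (dS (fun s => w (s, Some i)))) ?dSdS // => j _.
  by rewrite dX_kappa.
rewrite (@dS_eq _ _ _ (dS (fun s => w (s, None)) + (fun s => (-1) ^+ #|s| *: \sum_i x i *: w (s, Some i)))); last first.
  by move=> j _; rewrite dX_kappa.
rewrite dSD dSdS add0r dS_sign dS_sum.
apply/eqP; rewrite addrC subr_eq0; apply/eqP; congr (_ *: _); apply: eq_bigr => i _.
rewrite dX_kappa /dS scaler_sumr; apply: eq_bigr => j _.
by rewrite -!scaler_int !scalerA mulrC.
Qed.

Definition kappa : bcx R := @Bcx R T kadeg kabinc kabincdeg kabincinc.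
Lemma dX_kappaE (Y : lmodType R) (w : fs kappa Y) t o : dX (@binc R kappa) w (t, o) = match o with
  | Some i => dS (fun s => w (s, Some i)) t
  | None => dS (fun s => w (s, None)) t + (-1) ^+ #|t| *: \sum_i x i *: w (t, Some i) end.
Proof. exact: dX_kappa. Qed.

Section Homotopy.
Context (Y : lmodType R) (l : I).
(** A contraction over the field only: it puts at [t] a coefficient from [l |: t], which integrally
    costs a power of [x_l]. *)
Definition hka (w : fs kappa Y) : fs kappa Y :=
  fsf (fun p : T => hS l (fun s => w (s, p.2)) p.1).
Fact hka_linear : linear hka.
Proof.
move=> a v w; apply: fs_eq => -[t o]; rewrite fsD fsZ !fsfE /hS /=.
case: ifP => _; first by rewrite scaler0 addr0.
change ((a *: v (l |: t, o) + w (l |: t, o)) *~ sgn l t =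
  a *: (v (l |: t, o) *~ sgn l t) + w (l |: t, o) *~ sgn l t).
by rewrite mulrzDl -!scaler_int !scalerA mulrC.
Qed.
HB.instance Definition _ := GRing.isLinear.Build R _ _ _ hka hka_linear.
Lemma hkaE w t o : hka w (t, o) = hS l (fun s => w (s, o)) t. Proof. by []. Qed.

Lemma hka_homotopy (w : fs kappa Y) :
  dX (@binc R kappa) (hka w) + hka (dX (@binc R kappa) w) = w.
Proof.
apply: fs_eq => -[t o]; rewrite fsD hkaE dX_kappaE; case: o => [i|].
  rewrite -[RHS](dShS l (fun s => w (s, Some i)) t); congr (_ + _).
  rewrite /hS; case: ifP => // _; by rewrite dX_kappaE.
rewrite -[RHS](dShS l (fun s => w (s, None)) t) -addrA; congr (_ + _).
rewrite /hS; case: ifPn => lt.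
  rewrite addr0; apply/eqP; rewrite scaler_eq0; apply/orP; right.
  rewrite big1 // => i _; rewrite hkaE /hS lt scaler0 //.
rewrite dX_kappaE mulrzDl addrCA -[RHS]addr0; congr (_ + _).
rewrite cardsU1 lt add1n exprS mulN1r scaleNr -!scaler_int scalerN scalerA.
apply/eqP; rewrite subr_eq0 mulrC -scalerA; apply/eqP; congr (_ *: _).
rewrite scaler_sumr; apply: eq_bigr => i _; rewrite hkaE /hS (negbTE lt).
by rewrite -scaler_int !scalerA mulrC.
Qed.
End Homotopy.
End Kappa.

Section Triv.
Context (Y : lmodType R).
Definition triv : cpx R := @Cpx R Y (\0 : {linear Y -> Y}) (fun _ => erefl).
Lemma triv_cd (y : triv) : cd triv y = 0. Proof. by []. Qed.
End Triv.

Lemma dT_triv (X : bcx R) (Y : lmodType R) (w : fs X (triv Y)) : dT w = dX (@binc R X) w.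
Proof. by apply: fs_eq => g; rewrite dTE triv_cd scaler0 addr0. Qed.

End CechBase.

(** * Free complexes mapping to a complex *)

Section Gen.
Context (R : fieldType) (inR : R -> Prop) (C : cpx R) (NC : int -> C -> Prop) (k : int).
Hypothesis inR0 : inR 0.
Hypothesis inR1 : inR 1.

(* A generator of degree k - j is a cocycle [l] of degree k - j + 1 on the
   previous generators, as a list of coefficients, and a cochain [c] of C
   bounding its image in C. Data that are not of this form get zero
   differential and zero image. *)
Inductive gen : Type := Gen of nat & seq (R * gen) & cmod C.
HB.instance Definition _ := gen_eqMixin gen.
HB.instance Definition _ := gen_choiceMixin gen.

Definition gdeg (g : gen) : int := let: Gen j _ _ := g in k - j%:Z.

Definition gvec (l : seq (R * gen)) : fs gen R^o := \sum_(p <- l) single p.2 (p.1 : R^o).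

Definition gvalid j (l : seq (R * gen)) (c : C) (s : fs gen R^o * C) :=
  [/\ forall g, gdeg g != k - j%:Z + 1 -> gvec l g = 0, forall g, inR (gvec l g),
      s.1 = 0, s.2 = cd C c & NC (k - j%:Z) c].

(** Boundary and image are computed together, because the validity of a generator depends on both
    for the earlier ones. *)
Fixpoint gie (g : gen) : fs gen R^o * C :=
  let: Gen j l c := g in
  let s := (fix go (l : seq (R * gen)) : fs gen R^o * C :=
    match l with
    | [::] => (0, 0)
    | (a, h) :: l' => (a *: (gie h).1 + (go l').1, a *: (gie h).2 + (go l').2)
    end) l in
  if `[< gvalid j l c s >] then (gvec l, c) else (0, 0).

Lemma gieE j l c : gie (Gen j l c) =
  if `[< gvalid j l c (\sum_(p <- l) p.1 *: (gie p.2).1, \sum_(p <- l) p.1 *: (gie p.2).2) >]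
  then (gvec l, c) else (0, 0).
Proof.
have -> : (\sum_(p <- l) p.1 *: (gie p.2).1, \sum_(p <- l) p.1 *: (gie p.2).2) =
 (fix go (l : seq (R * gen)) : fs gen R^o * C :=
    match l with
    | [::] => (0, 0)
    | (a, h) :: l' => (a *: (gie h).1 + (go l').1, a *: (gie h).2 + (go l').2)
    end) l.
  by elim: l => [|[a h] l IH]; rewrite ?big_nil // !big_cons -IH.
by [].
Qed.

Definition ginc g : fs gen R^o := (gie g).1.
Definition geps g : C := (gie g).2.

Fact scl_linear (v : C) : linear (fun a : R^o => (a : R) *: v).
Proof. by move=> a b c; rewrite scalerDl scalerA. Qed.
Definition scl (v : C) : R^o -> C := fun a => (a : R) *: v.
HB.instance Definition _ v := GRing.isLinear.Build R R^o C _ (scl v) (scl_linear v).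
Definition eps : fs gen R^o -> C := fext (fun g => scl (geps g) : {linear R^o -> C}).
HB.instance Definition _ := GRing.Linear.on eps.
Lemma eps_single g a : eps (single g a) = (a : R) *: geps g.
Proof. by rewrite /eps fext_single. Qed.

Lemma dX_gvec l : dX ginc (gvec l) = \sum_(p <- l) p.1 *: (gie p.2).1.
Proof.
rewrite /gvec raddf_sum; apply: eq_bigr => p _; rewrite /= dX_single.
by apply: fs_eq => g; rewrite fscE fsZ [LHS]mulrC.
Qed.
Lemma eps_gvec l : eps (gvec l) = \sum_(p <- l) p.1 *: (gie p.2).2.
Proof. by rewrite /gvec raddf_sum; apply: eq_bigr => p _; rewrite /= eps_single. Qed.

Lemma gieP g : (ginc g = 0 /\ geps g = 0) \/ [/\ forall h, gdeg h != gdeg g + 1 -> ginc g h = 0,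
  forall h, inR (ginc g h), dX ginc (ginc g) = 0, eps (ginc g) = cd C (geps g) & NC (gdeg g) (geps g)].
Proof.
case: g => j l c; rewrite /ginc /geps gieE; case: asboolP => [[h1 h2 h3 h4 h5]|_]; last by left.
by right; rewrite /= -/ginc dX_gvec eps_gvec; split.
Qed.

Fact gincdeg g h : ginc g h != 0 -> gdeg h = gdeg g + 1.
Proof.
by have [[-> _]|[d _ _ _ _]] := gieP g; rewrite ?eqxx // => /eqP e; apply/eqP/negPn/negP => /d.
Qed.
Fact gincinc g : dX ginc (ginc g) = 0.
Proof. by have [[-> _]|[]] := gieP g; rewrite ?raddf0. Qed.
Definition genx : bcx R := @Bcx R gen gdeg ginc gincdeg gincinc.

Lemma inR_ginc g h : inR (@binc R genx g h).
Proof. by rewrite /=; have [[-> _]|[]] := gieP g. Qed.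

Lemma gdeg_le (g : genx) : bdeg g <= k.
Proof. by case: g => j l c /=; lia. Qed.

Lemma eps_dX (u : fs genx R^o) : eps (dX (@binc R genx) u) = cd C (eps u).
Proof.
apply: (@fs_lin_eq R genx R^o C (eps \o dX (@binc R genx)) (cd C \o eps)) => g a /=.
rewrite dX_single eps_single linearZ /=.
have -> : fsc (binc g) a = (a : R) *: @binc R genx g by apply: fs_eq => h; rewrite fscE fsZ [LHS]mulrC.
rewrite linearZ /=; congr (_ *: _).
by have [[e1 e2]|[_ _ _ e _]] := gieP g; rewrite /= ?e // e1 e2 !raddf0.
Qed.

Lemma NC_geps (g : genx) : (forall b, NC b 0) -> NC (bdeg g) (geps g).
Proof. by move=> h; have [[_ ->]|[]] := gieP g. Qed.

(** The generator made of [u] and [c] themselves is the lift. For [a = k + 1] the cocycle [u] is 0,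
    since no generator has that degree, and the lemma then covers the cocycles of [C] in degree
    [k]. *)
Lemma gen_lift (a : int) (u : fs genx R^o) (c : C) : a <= k + 1 ->
  (forall g, bdeg g != a -> u g = 0) -> (forall g, inR (u g)) -> dX (@binc R genx) u = 0 ->
  NC (a - 1) c -> eps u = cd C c ->
  exists v : fs genx R^o, [/\ forall g, bdeg g != a - 1 -> v g = 0, forall g, inR (v g),
    dX (@binc R genx) v = u & eps v = c].
Proof.
move=> ak cu uR u0 cN e.
pose l := [seq (u g : R, g) | g <- supp u].
have lu : gvec l = u by rewrite /gvec big_map /= [RHS]fs_split.
pose j := absz ((k : int) + 1 - a)%R.
have ej : k - j%:Z = a - 1 by rewrite /j; lia.
pose g : genx := Gen j l c.
have val : gie g = (u, c).
  rewrite gieE; case: asboolP => [_|no]; first by rewrite lu.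
  case: no; rewrite -dX_gvec -eps_gvec lu; split=> [h|h|//|//|]; last by rewrite ej.
    by rewrite lu ej subrK; exact: (cu (h : genx)).
  by rewrite lu.
exists (single g 1); split.
- move=> h hd; rewrite singleE; case: (eqVneq h g) hd => // -> /=; by rewrite ej eqxx.
- by move=> h; rewrite singleE; case: eqP.
- rewrite dX_single; apply: fs_eq => h; rewrite fscE /= /ginc val /=.
  by rewrite /GRing.scale /= mulr1.
- by rewrite eps_single scale1r /geps val.
Qed.

End Gen.

(** * Relative exactness *)

Section Tame.
Context (K : fieldType) (m : nat).
Local Notation S := {mpoly K[m]}.
Local Notation L := {fraction S}.
Local Notation I := 'I_m.
Local Notation inS := (@inS K m).
Local Notation xv := (@xv K m).

Record Smod (Y : lmodType L) (P : Y -> Prop) : Prop := SMod {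
  sm0 : P 0;
  smB : forall y z, P y -> P z -> P (y - z);
  smZ : forall s y, inS s -> P y -> P (s *: y)
}.

Lemma smN (Y : lmodType L) (P : Y -> Prop) y : Smod P -> P y -> P (- y).
Proof. by move=> hP h; rewrite -sub0r; apply: (smB hP) => //; exact: sm0. Qed.
Lemma smD (Y : lmodType L) (P : Y -> Prop) y z : Smod P -> P y -> P z -> P (y + z).
Proof. by move=> hP hy hz; rewrite -[z]opprK; apply: (smB hP) => //; exact: smN. Qed.
Lemma sm_sum (Y : lmodType L) (P : Y -> Prop) (J : Type) (r : seq J) (Q : pred J) (F : J -> Y) :
  Smod P -> (forall j, Q j -> P (F j)) -> P (\sum_(j <- r | Q j) F j).
Proof. by move=> hP h; elim/big_ind: _ => //; [exact: (sm0 hP)|move=> *; exact: smD]. Qed.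

Section Torsion.
Context (X : bcx L) (Y : cpx L) (a : int).
Hypothesis hinc : forall g h : X, inS (binc g h).
Hypothesis base : relex X (Y := triv (L^o)) inS (inI predT) a.

Lemma smod_dX (P : Y -> Prop) (w : fs X Y) h : Smod P -> (forall g, P (w g)) -> P (dX (@binc L X) w h).
Proof. by move=> hP hw; rewrite dXE; apply: sm_sum => // g _; exact: (smZ hP). Qed.

Lemma relex_trans (P Q P0 : Y -> Prop) : Smod P -> Smod P0 ->
  (forall y, Q y -> P y) -> (forall y, P0 y -> Q y) ->
  relex X P Q a -> relex X Q P0 a -> relex X P P0 a.
Proof.
move=> hP hP0 QP P0Q r1 r2 u cu uP hu.
have [|v cv [vP hv]] := r1 u cu uP; first by move=> h; apply: P0Q.
have dB : dX (@binc L X) (u - dX (@binc L X) v) = dX (@binc L X) u.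
  have -> : dX (@binc L X) (u - dX (@binc L X) v) = dX (@binc L X) u - dX (@binc L X) (dX (@binc L X) v) by exact: raddfB.
  by rewrite dXdX subr0.
have [|g|h|v' cv' [v'Q hv']] := r2 (u - dX (@binc L X) v).
- by move=> g ga; rewrite fsB cu // (dX_deg cv) ?subrr // subrK.
- exact: hv.
- by rewrite dB; exact: hu.
exists (v + v'); first by move=> g ga; rewrite fsD cv // cv' // addr0.
split=> g; first by rewrite fsD; apply: smD => //; exact: QP.
have -> : dX (@binc L X) (v + v') = dX (@binc L X) v + dX (@binc L X) v' by exact: raddfD.
by rewrite fsD opprD addrA; exact: hv'.
Qed.

Section Kill.
Context (P P0 : Y -> Prop).
Hypothesis (hP : Smod P) (hP0 : Smod P0).
Hypothesis kill : forall i y, P y -> P0 (xv i *: y).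

Fixpoint spn (l : seq Y) (z : Y) : Prop :=
  if l is y :: l' then exists2 s, inS s & spn l' (z - s *: y) else P0 z.

Lemma spn_smod l : Smod (spn l).
Proof.
elim: l => [//|y l IH]; split=> /=.
- by exists 0; [exact: inS0|rewrite scale0r subr0; exact: (sm0 IH)].
- move=> z z' [s hs h] [s' hs' h']; exists (s - s'); first exact: inSB.
  by rewrite scalerBl !opprB (AC (2*2) (1*4*(3*2))) /= -[s' *: y - z']opprB; exact: (smB IH).
- move=> s z hs [s' hs' h]; exists (s * s'); first exact: inSM.
  by rewrite -scalerA -scalerBr; exact: (smZ IH).
Qed.

Lemma spnP0 l y : P0 y -> spn l y.
Proof.
elim: l => [//|z l IH] h /=; exists 0; first exact: inS0.
by rewrite scale0r subr0; exact: IH.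
Qed.

Lemma inI_kill z y : inI predT z -> P y -> P0 (z *: y).
Proof.
move=> [b [hb ->]] hy; rewrite scaler_suml; apply: sm_sum => // i _.
by rewrite -scalerA; apply: kill; exact: (smZ hP).
Qed.

(** One generator [y] of the list at a time. The coefficients [s] of [u] along [y] have their
    boundary in the ideal of the coordinates, since otherwise [y] itself would be in [spn l]; so
    [base] makes [s] a boundary modulo that ideal, and [u] can be moved into [spn l]. *)
Lemma relex_spn l : (forall y, y \in l -> P y) -> forall u : fs X Y, conc a u ->
  (forall g, spn l (u g)) -> (forall h, P0 (dX (@binc L X) u h)) ->
  exists2 v : fs X Y, conc (a - 1) v & (forall g, P (v g)) /\
    forall g, P0 (u g - dX (@binc L X) v g).
Proof.
elim: l => [|y l IH] lP u cu uP hu.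
  exists 0; first by [].
  by split=> g; [exact: (sm0 hP)|rewrite raddf0 subr0; exact: uP].
have Py : P y by apply: lP; rewrite inE eqxx.
have lP' z : z \in l -> P z by move=> zl; apply: lP; rewrite inE zl orbT.
have hQ := spn_smod l.
have [yQ|nyQ] := pselect (spn l y).
  apply: IH => // g; have [s hs h] := uP g.
  by rewrite -[u g](subrK (s *: y)); apply: (smD hQ) => //; exact: (smZ hQ).
have [||s hs] := @fs_choice L X (L^o) (supp u) (fun g s => [/\ inS s, bdeg g != a -> s = 0 & spn l (u g - (s : L) *: y)]).
2: by move=> g /suppP g0; split=> //; [exact: inS0|rewrite g0 scale0r subr0; exact: (sm0 hQ)].
- move=> g; have [ga|ga] := eqVneq (bdeg g) a.
    by have [s hs h] := uP g; exists s; split.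
  by exists 0; split=> //; [exact: inS0|rewrite cu // scale0r subr0; exact: (sm0 hQ)].
have dfsc (t : fs X L^o) h : dX (@binc L X) (fsc t y) h = (dX (@binc L X) t h : L) *: y.
  by rewrite (dX_fsc (X := X)).
have [|g|h|t ct [tS ht]] := base (u := s).
- by move=> g; have [] := hs g.
- by have [] := hs g.
- have dsS : inS (dX (@binc L X) s h).
    rewrite dXE; apply: inS_sum => g _; have [sS _ _] := hs g; exact: (inSM (hinc g h) sS).
  have [c hc] := inS_split dsS.
  have [c0|c0] := eqVneq c 0.
    by move: hc; rewrite c0 /kc mpolyC0 rmorph0 subr0.
  case: nyQ; have h1 : spn l ((dX (@binc L X) s h : L) *: y).
    rewrite -dfsc -[fsc s y](subKr u).
    have -> : dX (@binc L X) (u - (u - fsc s y)) = dX (@binc L X) u - dX (@binc L X) (u - fsc s y) by exact: raddfB.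
    apply: (smB hQ); first by apply: spnP0; exact: hu.
    by apply: (smod_dX _ hQ) => g; have [] := hs g.
  have h2 : spn l (kc m c *: y).
    rewrite -[kc m c](subKr (dX (@binc L X) s h : L)) scalerBl.
    by apply: (smB hQ) => //; apply: spnP0; exact: inI_kill.
  have := smZ hQ (s := kc m c^-1) _ h2; rewrite scalerA /kc -rmorphM -mpolyCM mulVf //.
  rewrite mpolyC1 rmorph1 scale1r; apply; by eexists.
have cty : conc (a - 1) (fsc t y : fs X Y) by move=> g ga; rewrite fscE ct // scale0r.
have dB : dX (@binc L X) (u - dX (@binc L X) (fsc t y)) = dX (@binc L X) u.
  have -> : dX (@binc L X) (u - dX (@binc L X) (fsc t y)) = dX (@binc L X) u - dX (@binc L X) (dX (@binc L X) (fsc t y)) by exact: raddfB.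
  by rewrite dXdX subr0.
have [|g|h|v cv [vP hv]] := IH lP' (u - dX (@binc L X) (fsc t y)).
- by move=> g ga; rewrite fsB cu // (dX_deg cty) ?subrr // subrK.
- have [_ _ h] := hs g; rewrite fsB dfsc.
  have -> : u g - (dX (@binc L X) t g : L) *: y = (u g - (s g : L) *: y) + ((s g - dX (@binc L X) t g : L) *: y).
    by rewrite scalerBl addrA subrK.
  by apply: (smD hQ) => //; apply: spnP0; apply: inI_kill => //; exact: ht.
- by rewrite dB; exact: hu.
exists (fsc t y + v); first by move=> g ga; rewrite fsD cty // cv // addr0.
split=> g; first by rewrite fsD; apply: (smD hP) => //; rewrite fscE; exact: (smZ hP).
have -> : dX (@binc L X) (fsc t y + v) = dX (@binc L X) (fsc t y) + dX (@binc L X) v by exact: raddfD.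
by rewrite fsD opprD addrA; exact: hv.
Qed.

(** [P] modulo [P0] is a vector space over [K], and the finitely many values of [u] span a
    finite-dimensional part of it. *)
Lemma relex_kill : relex X P P0 a.
Proof.
move=> u cu uP hu; apply: (relex_spn (l := [seq u g | g <- supp u])) => //.
  by move=> y /mapP[g _ ->].
move=> g; have [gs|/suppP ->] := boolP (g \in supp u); last by apply: spnP0; exact: sm0.
elim: (supp u) gs => // h r IH /=; rewrite inE => /orP[/eqP ->|/IH hh].
  by exists 1; [exact: inS1|rewrite scale1r subrr; apply: spnP0; exact: sm0].
exists 0; first exact: inS0.
by rewrite scale0r subr0.
Qed.
End Kill.

Fixpoint tors (P0 : Y -> Prop) e y : Prop :=
  if e is e'.+1 then forall j, tors P0 e' (xv j *: y) else P0 y.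

Lemma tors_smod P0 e : Smod P0 -> Smod (tors P0 e).
Proof.
move=> h0; elim: e => [//|e IH]; split=> /=.
- by move=> j; rewrite scaler0; exact: (sm0 IH).
- by move=> y z hy hz j; rewrite scalerBr; exact: (smB IH).
- by move=> s y hs hy j; rewrite scalerA mulrC -scalerA; exact: (smZ IH).
Qed.

Lemma tors_le P0 e y : Smod P0 -> tors P0 e y -> tors P0 e.+1 y.
Proof. by move=> h0 h j; apply: (smZ (tors_smod e h0)) => //; exact: inS_xv. Qed.

Lemma tors0 P0 e y : Smod P0 -> P0 y -> tors P0 e y.
Proof. by move=> h0 h; elim: e => // e; exact: tors_le. Qed.

(** Induction on the sum of the exponents: multiplication by [x_j] lowers [r j]. When the sum is 0,
    the index [i0] gives [P0 y]. *)
Lemma torsP P0 (i0 : I) (r : I -> nat) y : Smod P0 -> (forall j, P0 (xv j ^+ r j *: y)) ->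
  tors P0 (\sum_j r j) y.
Proof.
move=> h0; move: {2}(\sum_j r j)%N (erefl (\sum_j r j)%N) => e.
elim: e r y => [|e IH] r y er hr; rewrite er /=.
  have := hr i0; have -> : r i0 = 0%N by move/eqP: er; rewrite sum_nat_eq0 => /forallP/(_ i0)/eqP.
  by rewrite expr0 scale1r.
move=> j; have [rj|rj] := eqVneq (r j) 0%N.
  have := hr j; rewrite rj expr0 scale1r => hy; apply: tors0 => //.
  by apply: (smZ h0) => //; exact: inS_xv.
pose r' l := if l == j then (r j).-1 else r l.
have er' : (\sum_l r' l = e)%N.
  have e1 : (\sum_l r' l = (r j).-1 + \sum_(l | l != j) r l)%N.
    rewrite (bigD1 j) //= {1}/r' eqxx; congr (_ + _)%N.
    by apply: eq_bigr => l lj; rewrite /r' (negbTE lj).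
  by move: er rj; rewrite e1 (bigD1 j) //=; case: (r j) => // q; rewrite addSn => -[].
rewrite -er'; apply: IH => // l; rewrite /r'; case: eqP => [->|_].
  by rewrite scalerA -exprSr prednK ?lt0n.
by rewrite scalerA mulrC -scalerA; apply: (smZ h0) => //; exact: inS_xv.
Qed.

(** Filter [P] by the elements that the e-th power of the coordinate ideal carries into [P0]. The
    successive quotients fall under [relex_kill], and finite support bounds the [e] needed. *)
Lemma relex_tors P P0 : Smod P -> Smod P0 -> (forall y, P0 y -> P y) ->
  (forall y, P y -> exists e, tors P0 e y) -> relex X P P0 a.
Proof.
move=> hP h0 P0P ht.
have PI e : Smod (fun y => P y /\ tors P0 e y).
  have := tors_smod e h0 => hT; split.
  - by split; [exact: (sm0 hP)|exact: (sm0 hT)].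
  - by move=> y z [? ?] [? ?]; split; [exact: (smB hP)|exact: (smB hT)].
  - by move=> s y hs [? ?]; split; [exact: (smZ hP)|exact: (smZ hT)].
have key e : relex X (fun y => P y /\ tors P0 e y) P0 a.
  elim: e => [|e IH].
    move=> u cu uP hu; exists 0; first by [].
    split=> g; first by split; [exact: (sm0 hP)|exact: (sm0 h0)].
    by rewrite raddf0 subr0; have [] := uP g.
  apply: (relex_trans (PI e.+1) h0 _ _ _ IH).
  - by move=> y [? ?]; split=> //; exact: tors_le.
  - by move=> y hy; split; [exact: P0P|exact: tors0].
  apply: (relex_kill (PI e.+1) (PI e)).
  - by move=> i y [hy /= ty]; split; [apply: (smZ hP) => //; exact: inS_xv|exact: ty].
move=> u cu uP hu.
have [e he] : exists e, forall g, tors P0 e (u g).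
  have [e he] : exists e, forall g, g \in supp u -> tors P0 e (u g).
    elim: (supp u) => [|g s [e he]]; first by exists 0%N.
    have [e' he'] := ht _ (uP g); exists (e + e')%N => h; rewrite inE.
    have le f f' y : tors P0 f y -> tors P0 (f' + f) y.
      by elim: f' => // f' IH ht'; apply: tors_le => //; exact: IH.
    by case/orP=> [/eqP ->|/he hh]; [exact: le|rewrite addnC; exact: le].
  exists e => g; have [gs|/suppP ->] := boolP (g \in supp u); first exact: he.
  exact: (sm0 (tors_smod e h0)).
have [|v cv [vP hv]] := key e u cu _ hu; first by move=> g; split.
by exists v => //; split=> // g; have [] := vP g.
Qed.

End Torsion.
End Tame.

Section Tame2.
Context (K : fieldType) (m : nat).
Local Notation S := {mpoly K[m]}.
Local Notation L := {fraction S}.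
Local Notation I := 'I_m.
Local Notation inS := (@inS K m).
Local Notation xv := (@xv K m).
Local Notation loc := (@loc K m).
Local Notation kos := (@kos K m).

Lemma kdegS (t : {set I}) i : bdeg ((t, Some i) : kappa xv) = #|t|%:Z - 1.
Proof. by []. Qed.
Lemma kdegN (t : {set I}) : bdeg ((t, None) : kappa xv) = #|t|%:Z.
Proof. exact: subr0. Qed.

(** Exactness below [b0], together with contractions over L whose denominators are powers of a
    single [x_j], one for each [j]. The latter make all cohomology torsion for the coordinates, also
    in the degrees where it does not vanish. *)
Record tame (Y : cpx L) (N : int -> Y -> Prop) (b0 : int) : Prop := Tame {
  tm_smod : forall b, Smod (N b);
  tm_d : forall b y, N b y -> N (b + 1) (cd Y y);
  tm_ex : forall (b : int) y, b < b0 -> N b y -> cd Y y = 0 -> exists2 y', N (b - 1) y' & y = cd Y y';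
  tm_tors : forall j : I, exists h : {linear Y -> Y},
    (forall y, cd Y (h y) + h (cd Y y) = y) /\
    forall b y, N b y -> exists r, N (b - 1) (xv j ^+ r *: h y)
}.

Lemma smod_good (X : bcx L) (Y : cpx L) (N : int -> Y -> Prop) :
  (forall g h : X, inS (binc g h)) -> (forall b, Smod (N b)) ->
  (forall b y, N b y -> N (b + 1) (cd Y y)) -> good (X := X) (fun=> N).
Proof.
move=> hinc hN hd; split=> //.
- by move=> _ b; exact: (sm0 (hN b)).
- by move=> _ b; exact: (smB (hN b)).
- by move=> g h b y; apply: (smZ (hN b)); exact: hinc.
Qed.

Lemma inN_smod (X : bcx L) (Y : cpx L) (N : X -> int -> Y -> Prop) j :
  (forall g b, Smod (N g b)) -> Smod (inN N j).
Proof.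
move=> hN; split.
- by move=> g; exact: (sm0 (hN _ _)).
- by move=> v w hv hw g; exact: (smB (hN _ _)).
- by move=> s w hs hw g; exact: (smZ (hN _ _)).
Qed.

Lemma xvX_smod (Y : cpx L) (P : Y -> Prop) j r r' y : Smod P -> (r <= r')%N ->
  P (xv j ^+ r *: y) -> P (xv j ^+ r' *: y).
Proof.
move=> hP le h; rewrite -(subnK le) exprD -scalerA; apply: (smZ hP) => //.
by apply: inSX; exact: inS_xv.
Qed.

(** In total degree j < b0 - k, a component of degree c >= -k in [X] leaves degree j - c < b0 for
    [Y], where [Y] is exact. For c < -k the cohomology of [Y] is torsion, and [X] is exact with
    torsion coefficients by [relex_tors]. *)
Lemma tame_tens (i0 : I) (X : bcx L) (Y : cpx L) (N : int -> Y -> Prop) (b0 k : int) :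
  (forall g h : X, inS (binc g h)) -> (forall g : X, bdeg g <= k) ->
  (forall a : int, a < - k -> relex X (Y := triv (L^o)) inS (inI predT) a) ->
  tame N b0 -> tame (Y := tens X Y) (inN (X := X) (fun=> N)) (b0 - k).
Proof.
move=> hinc hk base [hN hd hex ht].
have gN := smod_good hinc hN hd.
split.
- by move=> b; apply: inN_smod.
- by move=> b y; exact: (inN_dT gN).
- move=> j w jb wN w0.
  apply: (@chase_exact L X Y (fun=> N) gN (k + 1) j) => // [g|c ck]; first by have := hk g; lia.
  have [ckk|ckk] := lerP (- k) c.
    apply: (step_exact gN) => g y gc; apply: hex; lia.
  apply: (step_relex gN); apply: relex_tors => //; first exact: base.
  + split; first by rewrite raddf0; split=> //; exact: (sm0 (hN _)).
    * move=> y z [hy y0] [hz z0]; split; first exact: (smB (hN _)).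
      by have -> : cd Y (y - z) = cd Y y - cd Y z by [exact: raddfB]; rewrite y0 z0 subrr.
    * move=> s y hs [hy y0]; split; first exact: (smZ (hN _)).
      by have -> : cd Y (s *: y) = s *: cd Y y by [exact: linearZ]; rewrite y0 scaler0.
  + split; first by exists 0; [exact: (sm0 (hN _))|rewrite raddf0].
    * move=> y z [y' hy ->] [z' hz ->]; exists (y' - z'); first exact: (smB (hN _)).
      by symmetry; exact: raddfB.
    * move=> s y hs [y' hy ->]; exists (s *: y'); first exact: (smZ (hN _)).
      by symmetry; exact: linearZ.
  + move=> y [y' hy ->]; split; last exact: cdd.
    by have := hd _ _ hy; rewrite subrK.
  + move=> y [hy y0].
    have /choice[r hr] : forall l : I, exists r, exists2 y', N (j - c - 1) y' & xv l ^+ r *: y = cd Y y'.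
      move=> l; have [h [hh /(_ _ _ hy)[r hr]]] := ht l; exists r, (xv l ^+ r *: h y) => //.
      have -> : cd Y (xv l ^+ r *: h y) = xv l ^+ r *: cd Y (h y) by exact: linearZ.
      by rewrite -{1}[y]hh y0 raddf0 addr0.
    eexists; apply: (torsP i0) hr.
    split; first by exists 0; [exact: (sm0 (hN _))|rewrite raddf0].
    * move=> y1 z [y' hy1 ->] [z' hz ->]; exists (y' - z'); first exact: (smB (hN _)).
      by symmetry; exact: raddfB.
    * move=> s y1 hs [y' hy1 ->]; exists (s *: y'); first exact: (smZ (hN _)).
      by symmetry; exact: linearZ.
- move=> j; have [h [hh hr]] := ht j; exists (@hT L X Y h); split.
    by move=> y; exact: dT_hT.
  move=> b y yN.
  have [r hr'] : exists r, forall g, g \in supp y -> N (b - bdeg g - 1) (xv j ^+ r *: h (y g)).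
    elim: (supp y) => [|g s [r IH]]; first by exists 0%N.
    have [r' hr'] := hr _ _ (yN g); exists (r + r')%N => x; rewrite in_cons => /orP[/eqP ->|xs].
      by apply: xvX_smod hr' => //; exact: leq_addl.
    by apply: xvX_smod (IH x xs) => //; exact: leq_addr.
  exists r => g; have [gs|/suppP g0] := boolP (g \in supp y); last first.
    have -> : (xv j ^+ r *: hT h y) g = 0 by rewrite fsZ hTE g0 raddf0 !scaler0.
    exact: (sm0 (hN _)).
  have -> : (xv j ^+ r *: hT h y) g = sgz L (bdeg g) *: (xv j ^+ r *: h (y g)).
    by rewrite fsZ hTE !scalerA mulrC.
  apply: (@good_sgz L X Y (fun=> N) gN g).
  by have := hr' g gs; rewrite addrAC.
Qed.

Section Coef.
Context (Q : {set I} -> L -> Prop).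

(** Exactness at the sets of size [q]. The index is an integer, so that degrees can be shifted
    freely; below 0 there are no sets. *)
Definition cex (q : int) := forall c : {set I} -> L, (forall s, Q s (c s)) ->
  (forall s : {set I}, #|s|%:Z != q -> c s = 0) -> (forall s, dS c s = 0) ->
  exists b : {set I} -> L, [/\ forall s, Q s (b s), forall s : {set I}, #|s|%:Z != q - 1 -> b s = 0 &
    forall s, dS b s = c s].

Lemma cex_of_nat (q : int) : (forall s, Q s 0) ->
  (forall p c, p%:Z = q -> (forall s, Q s (c s)) ->
  (forall s : {set I}, #|s| = p.+1 -> dS c s = 0) ->
  exists b : {set I} -> L, (forall s, Q s (b s)) /\ forall s : {set I}, #|s| = p -> dS b s = c s) ->
  cex q.
Proof.
move=> Q0 h c cQ cc c0.
have [q0|q0] := ltrP q 0.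
  exists (fun=> 0); split=> // s; rewrite cc; last by lia.
  by rewrite /dS big1 // => i _; rewrite mul0rz.
have qE : (absz q)%:Z = q by lia.
have [b [bQ hb]] := h (absz q) c qE cQ (fun s _ => c0 s).
exists (fun s : {set I} => if #|s|%:Z == q - 1 then b s else 0); split.
- by move=> s; case: ifP.
- by move=> s /negbTE ->.
- move=> s; have [sq|sq] := eqVneq #|s|%:Z q.
    rewrite -hb; last by lia.
    apply: dS_eq => i si; rewrite -sq (cardsD1 i s) si.
    by case: eqP => // -[]; rewrite add1n -addn1 PoszD addrK.
  rewrite cc // /dS big1 // => i si; case: eqP => e; last by rewrite mul0rz.
  by move: sq; rewrite (cardsD1 i s) si add1n -addn1 PoszD e subrK eqxx.
Qed.

Definition cN (p : {set I}) (b : int) (z : triv (L^o)) : Prop := (b != 0 -> z = 0) /\ Q p z.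
Definition kN (p : kappa xv) (b : int) (z : triv (L^o)) : Prop := cN p.1 b z.

Hypothesis Q0 : forall s, Q s 0.
Hypothesis QB : forall s z w, Q s z -> Q s w -> Q s (z - w).
Hypothesis QZ : forall s z w, inS z -> Q s w -> Q s (z * w).
Hypothesis QS : forall (s t : {set I}) z, s \subset t -> Q s z -> Q t z.

Lemma cN_smod p b : Smod (cN p b).
Proof.
split; first by split=> //.
- move=> y z [y0 hy] [z0 hz]; split; last exact: QB.
  by move=> b0; rewrite y0 // z0 // subrr.
- move=> s y hs [y0 hy]; split; last exact: QZ.
  by move=> b0; rewrite y0 // scaler0.
Qed.

Lemma inS_sign n : inS ((-1) ^+ n).
Proof. by apply: inSX; apply: inSN; exact: inS1. Qed.

Lemma inS_sgn i (s : {set I}) : inS (sgn i s)%:~R.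
Proof. by rewrite /sgn rmorphXn /= rmorphN1; exact: inS_sign. Qed.

Lemma inS_cinc (g h : {set I}) : inS (cinc L g h).
Proof. by apply: inS_sum => i _; exact: inS_sgn. Qed.

Lemma cinc_sub (g h : {set I}) : cinc L g h != 0 -> g \subset h.
Proof.
move=> c; have [i /andP[ih /eqP <-]|no] := pickP (fun i => (i \in h) && (h :\ i == g)).
  by apply: finset.subsetDl.
by rewrite /cinc big_pred0 ?eqxx // in c.
Qed.

Lemma inS_kainc g h : inS (kainc xv g h).
Proof.
rewrite /kainc; case: g.2 h.2 => [i|] [j|]; try exact: inS0; try exact: inS_cinc.
  by case: eqP => _; [exact: inS_cinc|exact: inS0].
by case: eqP => _; [apply: inSM; [exact: inS_sign|exact: inS_xv]|exact: inS0].
Qed.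

Lemma kainc_sub g h : kainc xv g h != 0 -> g.1 \subset h.1.
Proof.
rewrite /kainc; case: g.2 h.2 => [i|] [j|]; rewrite ?eqxx //; try exact: cinc_sub.
  by case: (i == j); rewrite ?eqxx //; exact: cinc_sub.
by case: (g.1 =P h.1) => [->|]; rewrite ?eqxx.
Qed.

Lemma kN_good : good (X := kappa xv) kN.
Proof.
split.
- by move=> g b; exact: (sm0 (cN_smod _ _)).
- by move=> g b; exact: (smB (cN_smod _ _)).
- move=> g h b y [y0 hy]; have [-> |c] := eqVneq (binc g h) 0.
    by rewrite scale0r; exact: (sm0 (cN_smod _ _)).
  split; first by move=> b0; rewrite y0 // scaler0.
  by apply: QZ; [exact: inS_kainc|apply: QS hy; exact: kainc_sub].
- by move=> g b y _; rewrite triv_cd; exact: (sm0 (cN_smod _ _)).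
Qed.

Lemma cechN_good e : good (X := cech L m e) cN.
Proof.
split.
- by move=> g b; exact: (sm0 (cN_smod _ _)).
- by move=> g b; exact: (smB (cN_smod _ _)).
- move=> g h b y [y0 hy]; have [-> |c] := eqVneq (binc g h) 0.
    by rewrite scale0r; exact: (sm0 (cN_smod _ _)).
  split; first by move=> b0; rewrite y0 // scaler0.
  by apply: QZ; [exact: inS_cinc|apply: QS hy; exact: cinc_sub].
- by move=> g b y _; rewrite triv_cd; exact: (sm0 (cN_smod _ _)).
Qed.

Lemma cech_exact_at e j : cex (j + e) -> exact_at (X := cech L m e) cN j.
Proof.
move=> ex w wN; rewrite dT_triv => w0.
have [s|s sj|s|b [bQ bc hb]] := ex w.
- by have [] := wN s.
- by have [h _] := wN s; apply: h; move: sj => /eqP sj; apply/eqP; rewrite cech_deg; lia.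
- by have := congr1 (fun f : fs (cech L m e) (triv L^o) => f s) w0; rewrite dX_cechE.
exists (fsf (b : _ -> L^o)).
  move=> s; split; last exact: bQ.
  by rewrite cech_deg => h; apply: bc; apply/eqP; move/eqP: h; lia.
by apply: fs_eq => s; rewrite dT_triv dX_cechE -hb.
Qed.

(** The components at [Some i] are bounded first, and the rest, then concentrated at [None],
    afterwards. In the same degree the sets of the former kind have one more element, which is why
    both [j] and [j + 1] occur. *)
Lemma kappa_exact_at j : cex j -> cex (j + 1) -> exact_at (X := kappa xv) kN j.
Proof.
move=> ex0 ex1 w wN; rewrite dT_triv => w0.
have w0E t o := congr1 (fun f : fs (kappa xv) (triv L^o) => f (t, o)) w0.
have /choice[b hb] : forall i : I, exists b : {set I} -> L, [/\ forall s, Q s (b s),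
    forall s : {set I}, #|s|%:Z != j + 1 - 1 -> b s = 0 & forall s, dS b s = w (s, Some i)].
  move=> i; apply: ex1.
  - by move=> s; have [] := wN (s, Some i).
  - move=> s sj; have [h _] := wN (s, Some i); apply: h; move/eqP: sj => sj; apply/eqP.
    by rewrite ?kdegS ?kdegN; lia.
  - by move=> s; have := w0E s (Some i); rewrite dX_kappaE.
pose v1 : fs (kappa xv) (triv L^o) := fsf (fun p : {set I} * option I => (if p.2 is Some i then b i p.1 else 0) : L^o).
have v1N : inN (X := kappa xv) kN (j - 1) v1.
  move=> [s [i|]]; last exact: (good0 kN_good).
  have [bQ bc _] := hb i; split; last exact: bQ.
  by rewrite ?kdegS ?kdegN => /eqP h; apply: bc; apply/eqP => /= h1; apply: h; rewrite h1; lia.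
pose w' := w - dX (@binc L (kappa xv)) v1.
have w'N : inN (X := kappa xv) kN j w'.
  apply: (inNB kN_good) => //; have := inN_dX kN_good v1N; by rewrite subrK.
have w'S s i : w' (s, Some i) = 0.
  by rewrite fsB dX_kappaE /=; have [_ _ <-] := hb i; rewrite subrr.
have w'0 : dX (@binc L (kappa xv)) w' = 0.
  have -> : dX (@binc L (kappa xv)) w' = dX (@binc L (kappa xv)) w - dX (@binc L (kappa xv)) (dX (@binc L (kappa xv)) v1) by exact: raddfB.
  by rewrite dXdX subr0.
have [s|s sj|s|b0 [bQ bc hb0]] := ex0 (fun s => w' (s, None)).
- by have [] := w'N (s, None).
- have [h _] := w'N (s, None); apply: h; move/eqP: sj => sj; apply/eqP.
  by rewrite ?kdegS ?kdegN; lia.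
- have := congr1 (fun f : fs (kappa xv) (triv L^o) => f (s, None)) w'0; rewrite dX_kappaE.
  by rewrite [X in _ *: X]big1 ?scaler0 ?addr0 // => i _; rewrite w'S scaler0.
pose v0 : fs (kappa xv) (triv L^o) := fsf (fun p : {set I} * option I => (if p.2 is Some i then 0 else b0 p.1) : L^o).
exists (v1 + v0).
  apply: (inND kN_good) => // -[s [i|]]; first exact: (good0 kN_good).
  split; last exact: bQ.
  by rewrite ?kdegS ?kdegN => /eqP h; apply: bc; apply/eqP => /= h1; apply: h; rewrite h1; lia.
have -> : dT (v1 + v0) = dT v1 + dT v0 by exact: raddfD.
rewrite !dT_triv; apply/eqP; rewrite addrC -subr_eq; apply/eqP/fs_eq => -[s [i|]].
  rewrite -/w' w'S dX_kappaE /=; by rewrite /dS big1 // => l _; rewrite mul0rz.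
rewrite -/w' dX_kappaE /= hb0 [X in _ *: X]big1 ?scaler0 ?addr0 // => i _.
by rewrite scaler0.
Qed.
End Coef.

Lemma loc_cex (q : int) : q < m%:Z -> cex loc q.
Proof.
move=> qm; apply: cex_of_nat => [s|p c e cl c0]; first exact: loc0.
by apply: loc_exact => //; lia.
Qed.

Lemma kos_cex (q : int) : q < m%:Z -> cex kos q.
Proof.
move=> qm; apply: cex_of_nat => [s|p c e cl c0]; first by rewrite /kos mulr0; exact: inS0.
by apply: kos_exact => //; lia.
Qed.

Lemma locZ s z w : inS z -> loc s w -> loc s (z * w).
Proof. by move=> hz; apply: locM; exact: inS_loc. Qed.

(** Degree [b] needs the Cech complex at the sizes [b] and [b + 1], both below [m]; hence the bound
    [m - 1]. *)
Lemma kappa_tame : tame (Y := tens (kappa xv) (triv L^o)) (inN (X := kappa xv) (kN loc)) (m%:Z - 1).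
Proof.
have gN : good (X := kappa xv) (kN loc).
  by apply: kN_good; [exact: loc0|exact: locB|exact: locZ|exact: locS].
split.
- by move=> b; apply: inN_smod => g c; apply: cN_smod; [exact: loc0|exact: locB|exact: locZ].
- by move=> b y; exact: (inN_dT gN).
- move=> b y hb yN y0; apply: (@kappa_exact_at loc) => //; try exact: loc0; try exact: locB.
  + exact: locZ.
  + exact: locS.
  + by apply: loc_cex; lia.
  + by apply: loc_cex; lia.
- move=> l; exists (@hka _ _ xv (L^o) l); split.
    by move=> y; rewrite /= !dT_triv; exact: hka_homotopy.
  move=> b y yN.
  have /choice[r hr] : forall p : {set I} * option I, exists r, loc p.1 (xv l ^+ r * (hka l y p : L)).
    move=> [t o]; rewrite hkaE /hS; case: ifPn => lt.
      by exists 0%N; rewrite mulr0; exact: loc0.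
    have [_ /= h] := yN (l |: t, o); have [r hr] := loc_U1 h; exists r.
    rewrite /= mulrzAr -mulrzr; apply: locM => //; apply: inS_loc; exact: inS_sgn.
  exists (\sum_(p : {set I} * option I) r p)%N => -[t o]; split.
    move=> hd; rewrite fsZ hkaE /hS; case: ifPn => lt; first by rewrite scaler0.
    have [y0 _] := yN (l |: t, o); rewrite y0; first by rewrite mul0rz scaler0.
    case: o hd {y0} => [i|]; rewrite ?kdegS ?kdegN cardsU1 lt => /eqP hd; apply/eqP => h'; apply: hd; lia.
  have le : (r (t, o) <= \sum_(p : {set I} * option I) r p)%N by rewrite (bigD1 (t, o)) //= leq_addr.
  rewrite fsZ /=; have := hr (t, o) => /= h; rewrite -(subnK le) exprD.
  rewrite -[_ *: _]/(xv l ^+ _ * xv l ^+ _ * _) -mulrA; apply: locZ => //.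
  by apply: inSX; exact: inS_xv.
Qed.

End Tame2.

(** * Koszul complexes and bundles *)

Section Koszul.
Context (K : fieldType) (m : nat).
Local Notation S := {mpoly K[m]}.
Local Notation L := {fraction S}.
Local Notation I := 'I_m.
Local Notation inS := (@inS K m).
Local Notation xv := (@xv K m).
Local Notation xm := (@xm K m).
Local Notation kos := (@kos K m).

Lemma kos0 s : kos s 0. Proof. by rewrite /kos mulr0; exact: inS0. Qed.
Lemma kosB s z w : kos s z -> kos s w -> kos s (z - w).
Proof. by rewrite /kos mulrBr; exact: inSB. Qed.
Lemma kosZ s z w : inS z -> kos s w -> kos s (z * w).
Proof. by move=> hz hw; rewrite /kos mulrCA; exact: inSM. Qed.

Definition Kos : cpx L := tens (cech L m 0) (triv (L^o)).
Definition NKos (b : int) : Kos -> Prop := inN (X := cech L m 0) (cN kos) b.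

Lemma NKos_smod b : Smod (NKos b).
Proof. by apply: inN_smod => s c; apply: cN_smod; [exact: kos0|exact: kosB|exact: kosZ]. Qed.

Lemma NKos_good : good (X := cech L m 0) (cN kos).
Proof. by apply: cechN_good; [exact: kos0|exact: kosB|exact: kosZ|exact: kosS]. Qed.

Lemma cdeg0 (s : {set I}) : bdeg (s : cech L m 0) = #|s|%:Z.
Proof. exact: subr0. Qed.

Lemma xm_setD (i : I) : (xm finset.setT)^-1 * xv i = (xm (finset.setT :\ i))^-1.
Proof. by rewrite (@xmD1 K m i finset.setT) ?finset.in_setT // invfM mulrAC mulVf ?mul1r ?xv_neq0. Qed.

(** With T the set of all indices, the Koszul complex has cohomology only at the top, where it is
    x_T^-1 S modulo all x_(T - i)^-1 S. Multiplication by x_T identifies this with S modulo the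
    coordinates, and [relex_of_exact] applies. *)
Lemma relex_of_kos (X : bcx L) (D a : int) : (forall g h : X, inS (binc g h)) ->
  (forall g : X, bdeg g < D) ->
  exact_at (X := X) (Y := Kos) (fun=> NKos) (a + m%:Z) ->
  relex X (Y := triv (L^o)) inS (inI predT) a.
Proof.
move=> hinc hD ex.
have gN : good (X := X) (Y := Kos) (fun=> NKos).
  apply: smod_good => //; [exact: NKos_smod|move=> b y; exact: (inN_dT NKos_good)].
have N00 b : NKos b 0 by exact: (sm0 (NKos_smod b)).
have exK (b : int) y : b < m%:Z -> NKos b y -> cd Kos y = 0 -> exists2 y', NKos (b - 1) y' & y = cd Kos y'.
  move=> bm; apply: (@cech_exact_at K m kos) => //; apply: kos_cex; by rewrite addr0.
have top y : NKos m%:Z y -> cd Kos y = 0.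
  move=> yN; rewrite [cd Kos y]dT_triv; apply: fs_eq => s; rewrite dX_cechE fs0 /dS big1 // => i si.
  have [h _] := yN (s :\ i); rewrite h ?mul0rz // cdeg0.
  have := max_card (mem s); rewrite card_ord (cardsD1 i s) si => le; apply/eqP; lia.
have re := relex_of_exact gN N00 hD exK top ex.
move=> u cu uS hu.
(* [io] and, further below, [pr] translate between S and the top Koszul term by dividing and
   multiplying by x_T. *)
pose io (z : L^o) : Kos := single (finset.setT : cech L m 0) ((xm finset.setT)^-1 *: z).
have ioL : linear io.
  move=> c z w; rewrite /io; apply: fs_eq => s; rewrite fsD fsZ !singleE.
  case: ifP => _; last by rewrite scaler0 addr0.
  by rewrite scalerDr !scalerA mulrC.
pose ioM := GRing.isLinear.Build L L^o Kos _ io ioL.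
pose iol : {linear L^o -> Kos} := HB.pack io ioM.
have cT : #|[set: I]%SET|%:Z = m%:Z by rewrite cardsT card_ord.
have ioN z : inS z -> NKos m%:Z (io z).
  move=> hz s; rewrite /io singleE; case: eqP => [->|_]; last by apply: (sm0 (cN_smod _ _ _ _ _)); [exact: kos0|exact: kosB|exact: kosZ].
  split; first by rewrite cdeg0 cT subrr eqxx.
  by rewrite /kos /= mulrA mulfV ?xm_neq0 // mul1r.
have ioB z : inI predT z -> exists2 y', NKos (m%:Z - 1) y' & io z = cd Kos y'.
  move=> [b [hb e]].
  pose y' : fs (cech L m 0) (triv L^o) := fsf (fun s : {set I} =>
    (\sum_(i | finset.setT :\ i == s) (xm (finset.setT :\ i))^-1 * (b i *~ sgn i finset.setT)) : L^o).
  have yN : NKos (m%:Z - 1) y'.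
    move=> s; split.
      move=> h; rewrite /y' /= big_pred0 // => i; apply/negP => /eqP e1.
      have e3 : #|[set: I]%SET :\ i|%:Z = m%:Z - 1.
        by have := cT; rewrite (cardsD1 i finset.setT) finset.in_setT PoszD => <-; rewrite addrC addKr.
      by move: h; rewrite cdeg0 -e1 e3 subrr eqxx.
    rewrite /kos /y' /= mulr_sumr; apply: inS_sum => i /eqP <-.
    by rewrite mulrA mulfV ?xm_neq0 // mul1r -mulrzr; apply: inSM => //; exact: inS_sgn.
  exists y' => //; rewrite [cd Kos y']dT_triv; apply: fs_eq => s; rewrite dX_cechE /io singleE.
  case: (s =P finset.setT) => [->|/eqP sT].
    rewrite /dS e scaler_sumr; apply: eq_big => [i|i _]; first by rewrite finset.in_setT.
    rewrite /y' /= (bigD1 i) //= big1 ?addr0 => [|j /andP[/eqP e1 ji]]; last first.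
      by have := finset.setD11 i finset.setT; rewrite -e1 !inE eq_sym ji.
    rewrite -mulrzAr -mulrzA sgn2 -[_ *: _]/(_ * (_ * _)) mulrA xm_setD.
    by [].
  have : (#|s : {set I}| < m)%N.
    have : (#|s : {set I}| < #|[set: I]%SET|)%N by apply: proper_card; rewrite finset.properT.
    by rewrite cardsT card_ord.
  move=> sm; rewrite /dS big1 // => i si.
  have [h _] := yN (s :\ i); rewrite h ?mul0rz // cdeg0.
  move: sm; rewrite (cardsD1 i s) si => sm; apply/eqP; lia.
have [|g|h|v cv [vN hv]] := re (fmap (fun=> iol) u).
- by move=> g ga; rewrite fmapE cu // raddf0.
- rewrite fmapE; exact: (ioN _ (uS g)).
- rewrite dX_fmap fmapE; exact: (ioB _ (hu h)).
have vS g : inS (xm finset.setT * v g finset.setT).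
  by have [_ h] := vN g finset.setT.
pose pr (y : Kos) : L^o := xm finset.setT * y (finset.setT : cech L m 0).
have prL : linear pr.
  by move=> c y z; rewrite /pr -[(c *: y + z) _]/(c * y _ + z _) mulrDr mulrCA.
pose prM := GRing.isLinear.Build L Kos L^o _ pr prL.
pose prl : {linear Kos -> L^o} := HB.pack pr prM.
exists (fmap (fun=> prl) v); first by move=> g ga; rewrite fmapE cv // raddf0.
split=> // g; rewrite dX_fmap fmapE.
have -> : u g - prl (dX (@binc L X) v g) = prl (fmap (fun=> iol) u g - dX (@binc L X) v g).
  rewrite [RHS]raddfB; congr (_ - _); rewrite fmapE /= /pr /io singleE eqxx.
  by rewrite -[_ *: _]/(_ * _) mulrA mulfV ?xm_neq0 // mul1r.
have [y' yN ->] := hv g.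
rewrite /= /pr [cd Kos y']dT_triv dX_cechE /dS mulr_sumr.
have /choice[b hb] : forall i : I, exists b, inS b /\
   xm finset.setT * (y' (finset.setT :\ i) *~ sgn i finset.setT) = xv i * b.
  move=> i; have [_ h] := yN (finset.setT :\ i).
  exists (xm (finset.setT :\ i) * y' (finset.setT :\ i) * (sgn i finset.setT)%:~R); split.
    by apply: inSM => //; exact: inS_sgn.
  by rewrite -mulrzr (@xmD1 K m i finset.setT) ?finset.in_setT // !mulrA.
exists b; split=> [i|]; first by have [] := hb i.
by apply: eq_big => [i|i _]; [rewrite finset.in_setT|have [] := hb i].
Qed.
End Koszul.

(** * The Cech complex of a bundle *)

Section Bundle.
Context (K : fieldType) (m : nat).
Local Notation S := {mpoly K[m]}.
Local Notation L := {fraction S}.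
Local Notation I := 'I_m.
Local Notation xv := (@xv K m).
Local Notation loc := (@loc K m).
Context (r : nat) (A : I -> 'M[L]_(2, r)) (B : I -> 'M[L]_(r, 2)).
Hypothesis hAB : forall i, A i *m B i = 1%:M.
Hypothesis hBA : forall i j x y, loc [set i; j]%SET ((B j *m A i) x y).
Local Notation V := 'cV[L]_2.

(** The sections over D(x_s), read in the charts [B i]. The empty set carries only 0, so that [Cc]
    is the Cech complex without augmentation. *)
Definition Esec (s : {set I}) (v : V) : Prop :=
  (s = finset.set0 -> v = 0) /\ forall i, i \in s -> forall x, loc s ((B i *m v) x 0).

Lemma loc_mulmx (s : {set I}) (p q l : nat) (M : 'M[L]_(p, q)) (N : 'M[L]_(q, l)) :
  (forall x y, loc s (M x y)) -> (forall x y, loc s (N x y)) -> forall x y, loc s ((M *m N) x y).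
Proof. by move=> hM hN x y; rewrite mxE; apply: loc_sum => z _; exact: locM. Qed.

(** The transition matrices [B j *m A i] are regular where [x_i] and [x_j] are inverted, so
    regularity in one chart implies it in the others. *)
Lemma Esec_one i (s : {set I}) v : i \in s -> (forall x, loc s ((B i *m v) x 0)) -> Esec s v.
Proof.
move=> si h; split; first by move=> s0; rewrite s0 inE in si.
move=> j sj x; rewrite -[v]mul1mx -(hAB i) -mulmxA mulmxA; apply: loc_mulmx => y z.
  by apply: (locS _ (hBA i j y z)); apply/fintype.subsetP => l; rewrite !inE => /orP[] /eqP ->.
rewrite [z]ord1; exact: (h y).
Qed.

Lemma Esec_smod s : Smod (Esec s).
Proof.
split.
- by split=> // i _ x; rewrite mulmx0 mxE; exact: loc0.
- move=> v w [v0 hv] [w0 hw]; split; first by move=> s0; rewrite v0 // w0 // subrr.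
  by move=> i si x; rewrite mulmxBr !mxE; have := locB (hv i si x) (hw i si x); rewrite !mxE.
- move=> c v hc [v0 hv]; split; first by move=> s0; rewrite v0 // scaler0.
  by move=> i si x; rewrite -scalemxAr mxE; apply: locZ => //; exact: hv.
Qed.

Lemma EsecZ (s : {set I}) c v : loc s c -> Esec s v -> Esec s (c *: v).
Proof.
move=> hc [v0 hv]; split; first by move=> s0; rewrite v0 // scaler0.
by move=> i si x; rewrite -scalemxAr mxE; apply: locM => //; exact: hv.
Qed.

Lemma EsecS (s t : {set I}) v : s \subset t -> Esec s v -> Esec t v.
Proof.
move=> st hv; have [s0|[i si]] := finset.set_0Vmem s.
  by have [v0 _] := hv; rewrite v0 //; exact: (sm0 (Esec_smod t)).
apply: (@Esec_one i); first exact: (fintype.subsetP st).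
by have [_ h] := hv => x; apply: locS st _; exact: h.
Qed.

Definition EN (s : {set I}) (b : int) (v : triv V) : Prop := (b != 0 -> v = 0) /\ Esec s v.
Lemma EN_smod s b : Smod (EN s b).
Proof.
have h := Esec_smod s; split.
- by split=> //; exact: (sm0 h).
- move=> v w [v0 hv] [w0 hw]; split; last exact: (smB h).
  by move=> b0; rewrite v0 // w0 // subrr.
- move=> c v hc [v0 hv]; split; last exact: (smZ h).
  by move=> b0; rewrite v0 // scaler0.
Qed.
Lemma EN_good : good (X := cech L m 1) EN.
Proof.
split.
- by move=> g b; exact: (sm0 (EN_smod _ _)).
- by move=> g b; exact: (smB (EN_smod _ _)).
- move=> g h b y [y0 hy]; have [-> |c] := eqVneq (binc g h) 0.
    by rewrite scale0r; exact: (sm0 (EN_smod _ _)).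
  split; first by move=> b0; rewrite y0 // scaler0.
  apply: (smZ (Esec_smod _)); first exact: inS_cinc.
  exact: (EsecS (cinc_sub c) hy).
- by move=> g b y _; rewrite triv_cd; exact: (sm0 (EN_smod _ _)).
Qed.

Definition Cc : cpx L := tens (cech L m 1) (triv V).
Definition NC (b : int) : Cc -> Prop := inN (X := cech L m 1) EN b.
Lemma NC_smod b : Smod (NC b).
Proof. by apply: inN_smod => s c; exact: EN_smod. Qed.
Lemma NC_d b c : NC b c -> NC (b + 1) (cd Cc c).
Proof. exact: (inN_dT EN_good). Qed.
Lemma cdCc (c : Cc) s : (cd Cc c : fs (cech L m 1) V) s = dS (fun t => (c : fs (cech L m 1) V) t) s.
Proof. by rewrite [cd Cc c]dT_triv dX_cechE. Qed.
Lemma NC_conc b c (s : {set I}) : NC b c -> #|s|%:Z != b + 1 -> (c : fs (cech L m 1) V) s = 0.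
Proof. by move=> h sb; have [h0 _] := h s; apply: h0; rewrite cech_deg; apply/eqP; move/eqP: sb; lia. Qed.
Lemma NC_E b c (s : {set I}) : NC b c -> Esec s ((c : fs (cech L m 1) V) s).
Proof. by move=> h; have [] := h s. Qed.
Lemma NC_neg b c : b < 0 -> NC b c -> c = 0.
Proof.
move=> b0 h; apply: fs_eq => s; have [s0|sb] := eqVneq s finset.set0.
  by have [h0 _] := NC_E s h; rewrite h0.
by apply: (NC_conc h); have := card_gt0 s; rewrite sb => s1; apply/eqP; lia.
Qed.

(* x_i^N B_i and x_i^N A_i compare E with a trivial bundle. *)
Lemma clear_denominators (i : I) : exists N, forall j x y,
  loc [set j]%SET (xv i ^+ N * (B j *m A i) x y) /\ forall z t, loc [set j]%SET (xv i ^+ N * (B i *m A j) z t).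
Proof.
have h1 (f : I -> 'I_r -> 'I_r -> L) : (forall j x y, loc [set i; j]%SET (f j x y)) ->
   exists N, forall j x y, loc [set j]%SET (xv i ^+ N * f j x y).
  move=> hf; have /choice[N hN] : forall p : I * ('I_r * 'I_r), exists N, loc [set p.1]%SET (xv i ^+ N * f p.1 p.2.1 p.2.2).
    by move=> p; apply: loc_U1; exact: hf.
  exists (\sum_p N p)%N => j x y.
  have le : (N (j, (x, y)) <= \sum_p N p)%N by rewrite (bigD1 (j, (x, y))) //= leq_addr.
  rewrite -(subnK le) exprD -mulrA; apply: locZ; last exact: (hN (j, (x, y))).
  by apply: inSX; exact: inS_xv.
have [N hN] := h1 (fun j x y => (B j *m A i) x y) (fun j x y => hBA i j x y).
have [N' hN'] := h1 (fun j x y => (B i *m A j) x y) (fun j x y => eq_ind _ (fun s => loc s _) (hBA j i x y) _ (finset.setUC _ _)).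
exists (N + N')%N => j x y; split=> [|z t].
  by rewrite exprD mulrAC mulrC; apply: locZ => //; apply: inSX; exact: inS_xv.
by rewrite exprD -mulrA; apply: locZ => //; apply: inSX; exact: inS_xv.
Qed.

(** Multiplication by a power of [x_i] factors through a free module of rank [r], whose Cech
    cohomology vanishes in these degrees. The exponent depends neither on [c] nor on the degree,
    which lets it stand in for finite generation later. *)
Lemma coh_tors (i : I) : exists N, forall (a : int) (c : Cc), 1 <= a -> a + 1 < m%:Z ->
  NC a c -> cd Cc c = 0 -> exists2 b, NC (a - 1) b & xv i ^+ N *: c = cd Cc b.
Proof.
have [N hN] := clear_denominators i.
exists (N + N)%N => a c a1 am cN c0.
pose c' := c : fs (cech L m 1) V.
have locB0 (s : {set I}) v x : Esec s v -> loc s (xv i ^+ N * (B i *m v) x 0).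
  move=> [v0 hv]; have [s0|[j sj]] := finset.set_0Vmem s.
    by rewrite v0 // mulmx0 mxE mulr0; exact: loc0.
  rewrite -[v]mul1mx -(hAB j) -mulmxA mulmxA mxE mulr_sumr; apply: loc_sum => y _.
  rewrite mulrA; apply: locM; last exact: hv.
  have [_ h] := hN j y y; apply: locS (h x y); by rewrite finset.sub1set.
have EA (s : {set I}) (z : 'cV[L]_r) : s != finset.set0 -> (forall x, loc s (z x 0)) -> Esec s (xv i ^+ N *: (A i *m z)).
  move=> /finset.set0Pn[j sj] hz; apply: (Esec_one sj) => x.
  rewrite -scalemxAr mxE mulmxA mxE mulr_sumr; apply: loc_sum => y _.
  rewrite mulrA; apply: locM; last exact: hz.
  have [h _] := hN j x y; apply: locS h; by rewrite finset.sub1set.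
have /choice[b hb] : forall x, exists b : {set I} -> L, [/\ forall s, loc s (b s),
   forall s : {set I}, #|s|%:Z != a + 1 - 1 -> b s = 0 & forall s, dS b s = xv i ^+ N * (B i *m c' s) x 0].
  move=> x; apply: loc_cex => //.
  - by move=> s; apply: locB0; exact: (NC_E s cN).
  - by move=> s sa; rewrite /c' (NC_conc cN sa) mulmx0 mxE mulr0.
  - move=> s; pose f (v : V) := xv i ^+ N * (B i *m v) x 0.
    have fl : zmod_morphism f by move=> v w; rewrite /f mulmxBr !mxE mulrBr.
    pose fM := GRing.isZmodMorphism.Build V L f fl.
    pose fa : {additive V -> L} := HB.pack f fM.
    have := dS_raddf fa c' s; rewrite /= => <-.
    by rewrite -cdCc c0 fs0 /f mulmx0 mxE mulr0.
pose bb : fs (cech L m 1) V := fsf (fun s : {set I} => xv i ^+ N *: (A i *m (\col_x b x s))).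
exists bb.
  move=> s; rewrite /bb fsfE; split.
    rewrite cech_deg => sa; rewrite (_ : \col_x b x s = 0) ?mulmx0 ?scaler0 //.
    apply/matrixP => x y; rewrite !mxE; have [_ h _] := hb x; apply: h.
    by apply/eqP; move/eqP: sa; lia.
  have [s0|sn] := eqVneq s finset.set0; last first.
    by apply: EA => // x; rewrite mxE; have [] := hb x.
  rewrite (_ : \col_x b x s = 0) ?mulmx0 ?scaler0; first exact: (sm0 (Esec_smod s)).
  apply/matrixP => x y; rewrite !mxE; have [_ h _] := hb x; apply: h.
  by rewrite s0 cards0; apply/eqP; lia.
apply: fs_eq => s; rewrite cdCc fsZ /bb.
pose g (v : 'cV[L]_r) := xv i ^+ N *: (A i *m v).
have gl : zmod_morphism g by move=> v w; rewrite /g mulmxBr scalerBr.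
pose gM := GRing.isZmodMorphism.Build 'cV[L]_r V g gl.
pose ga : {additive 'cV[L]_r -> V} := HB.pack g gM.
have := dS_raddf ga (fun s => \col_x b x s) s; rewrite /= /g => e.
rewrite [RHS](_ : _ = g (dS (fun s => \col_x b x s) s)); last by rewrite /g e.
have -> : dS (fun s => \col_x b x s) s = xv i ^+ N *: (B i *m c' s).
  apply/matrixP => x y; rewrite ord1 mxE; have [_ _ <-] := hb x.
  by rewrite /dS summxE; apply: eq_bigr => l _; rewrite -scaler_int !mxE mulrC mulrzr.
by rewrite /g -scalemxAr scalerA mulmxA hAB mul1mx exprD.
Qed.

End Bundle.

(** * Exactness of [F] modulo the coordinates *)

Section Resolution.
Context (K : fieldType) (m : nat).
Local Notation S := {mpoly K[m]}.
Local Notation L := {fraction S}.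
Local Notation I := 'I_m.
Local Notation inS := (@inS K m).
Local Notation xv := (@xv K m).
Local Notation xm := (@xm K m).
Local Notation loc := (@loc K m).
Context (r : nat) (A : I -> 'M[L]_(2, r)) (B : I -> 'M[L]_(r, 2)).
Hypothesis hAB : forall i, A i *m B i = 1%:M.
Hypothesis hBA : forall i j x y, loc [set i; j]%SET ((B j *m A i) x y).
Local Notation V := 'cV[L]_2.
Local Notation C := (Cc K m).
Local Notation NC := (NC B).
Local Notation Esec := (Esec B).
Context (k : int).
Hypothesis hC : forall (j : int) (c : C), k < j -> j < m%:Z - 1 - k -> NC j c -> cd C c = 0 ->
  exists2 b, NC (j - 1) b & c = cd C b.

Lemma cards_le_ord (s : {set I}) : (#|s| <= m)%N.
Proof. by have := max_card (mem s); rewrite card_ord. Qed.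

Definition FF : bcx L := genx inS NC k.
Definition epsF : {linear fs FF L^o -> C} := @eps L inS C NC k.
Lemma inS_FF (g h : FF) : inS (binc g h).
Proof. exact: (inR_ginc (@inS0 K m)). Qed.
Lemma FF_deg (g : FF) : bdeg g <= k. Proof. exact: gdeg_le. Qed.

Definition cF : cpx L := tens FF (triv (L^o)).
Definition NF (b : int) (u : cF) : Prop := (forall g, bdeg g != b -> u g = 0) /\ forall g, inS (u g).

Lemma NF_smod b : Smod (NF b).
Proof.
split.
- by split=> // g; exact: inS0.
- move=> u v [u0 hu] [v0 hv]; split=> g; last exact: (inSB (hu g) (hv g)).
  by move=> gb; rewrite fsB u0 // v0 // subrr.
- move=> s u hs [u0 hu]; split=> g; last exact: (inSM hs (hu g)).
  by move=> gb; rewrite fsZ u0 // scaler0.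
Qed.

Lemma NF_d b u : NF b u -> NF (b + 1) (cd cF u).
Proof.
move=> [u0 hu]; rewrite [cd cF u]dT_triv; split=> g; first exact: (dX_deg u0).
by rewrite dXE; apply: inS_sum => h _; apply: inSM => //; exact: inS_FF.
Qed.

Lemma NF_top b u : k < b -> NF b u -> u = 0.
Proof.
move=> kb [u0 _]; apply: fs_eq => g; rewrite u0 //; have := FF_deg g; case: eqP => // -> le; lia.
Qed.

Lemma epsF_d u : epsF (cd cF u) = cd C (epsF u).
Proof. by rewrite [cd cF u]dT_triv; exact: (eps_dX (inR:=inS)). Qed.

Lemma epsF_N b u : NF b u -> NC b (epsF u).
Proof.
move=> [u0 hu]; rewrite /epsF /= /eps /fext; apply: (sm_sum _ (NC_smod B b)) => g _.
have [->|ub] := eqVneq (u g) 0; first by rewrite raddf0; exact: (sm0 (NC_smod B b)).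
apply: (smZ (NC_smod B b)); first exact: (hu (g : FF)).
have -> : b = bdeg (g : FF) by apply/eqP; rewrite eq_sym; apply: contraNT ub => /u0 ->.
by apply: (@NC_geps L inS C NC k (g : FF)) => c; exact: (sm0 (NC_smod B c)).
Qed.

Lemma F_lift (a : int) (u : cF) (c : C) : a <= k + 1 -> NF a u -> cd cF u = 0 ->
  NC (a - 1) c -> epsF u = cd C c ->
  exists v, [/\ NF (a - 1) v, cd cF v = u & epsF v = c].
Proof.
move=> ak [u0 uS]; rewrite [cd cF u]dT_triv => du cN e.
have [v [v0 vS dv ev]] := gen_lift (@inS0 K m) (@inS1 K m) ak u0 uS du cN e.
by exists v; split=> //; rewrite [cd cF v]dT_triv.
Qed.

Definition cone_d (p : (cF * C)%type) : (cF * C)%type := (cd cF p.1, epsF p.1 - cd C p.2).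
Fact cone_linear : linear cone_d.
Proof.
move=> a [u c] [u' c']; apply/pair_equal_spec; split; rewrite /cone_d /=; first exact: (linearP (cd cF)).
have -> : epsF (a *: u + u') = a *: epsF u + epsF u' by exact: linearP.
have -> : cd C (a *: c + c') = a *: cd C c + cd C c' by exact: linearP.
by rewrite scalerBr opprD addrACA.
Qed.
HB.instance Definition _ := GRing.isLinear.Build L (cF * C)%type (cF * C)%type _ cone_d cone_linear.
Fact cone_dd p : cone_d (cone_d p) = 0.
Proof.
case: p => u c; apply/pair_equal_spec; split; rewrite /cone_d /=; first exact: (cdd (c:=cF)).
have -> : cd C (epsF u - cd C c) = cd C (epsF u) - cd C (cd C c) by exact: raddfB.
by rewrite epsF_d cdd subr0 subrr.
Qed.
Definition cone : cpx L := @Cpx L (cF * C)%type cone_d cone_dd.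
Definition Ncone (b : int) (p : cone) : Prop := NF b p.1 /\ NC (b - 1) p.2.
Lemma Ncone_smod b : Smod (Ncone b).
Proof.
have h1 := NF_smod b; have h2 := NC_smod B (b - 1); split.
- by split; [exact: (sm0 h1)|exact: (sm0 h2)].
- by move=> p q [? ?] [? ?]; split; [exact: (smB h1)|exact: (smB h2)].
- by move=> s p hs [? ?]; split; [exact: (smZ h1)|exact: (smZ h2)].
Qed.
Lemma Ncone_d b p : Ncone b p -> Ncone (b + 1) (cd cone p).
Proof.
move=> [h1 h2]; split; first exact: NF_d.
rewrite addrK; apply: (smB (NC_smod B b)); first exact: epsF_N.
by have := NC_d hAB hBA h2; rewrite subrK.
Qed.

(** Up to degree [k + 1] this is how the generators of [F] were made ([F_lift]). Above, [F] is 0 and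
    only the assumed vanishing of the cohomology of [C] in degree [b - 1] remains. *)
Lemma cone_exact b p : b <= m%:Z - 1 - k -> Ncone b p -> cd cone p = 0 ->
  exists2 q, Ncone (b - 1) q & p = cd cone q.
Proof.
move=> bn [uN cN] /pair_equal_spec[u0 /subr0_eq ec].
have [bk|bk] := lerP b (k + 1).
  have [v [vN dv ev]] := F_lift bk uN u0 cN ec.
  exists (v, 0); first by split=> //; exact: (sm0 (NC_smod B _)).
  by rewrite /= /cone_d /= dv ev raddf0 subr0 -surjective_pairing.
have p1 : p.1 = 0 by apply: (NF_top _ uN); lia.
have c0 : cd C p.2 = 0 by rewrite -ec p1 raddf0.
have [||b' bN eb] := hC _ _ cN c0; [lia|lia|].
exists (0, - b'); first by split; [exact: (sm0 (NF_smod _))|apply: (smN (NC_smod B _))].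
rewrite /= /cone_d /= !raddf0 add0r; have -> : cd C (- b') = - cd C b' by exact: raddfN.
by rewrite opprK -eb -p1 -surjective_pairing.
Qed.

Section Scaled.
Context (Y : cpx L) (N : int -> Y -> Prop).
Hypothesis (hN : forall b, Smod (N b)) (hd : forall b y, N b y -> N (b + 1) (cd Y y)).
(** Coefficients x_s^-1 [N] at the set [s]: the Koszul complex tensored with the integral structure
    [N]. *)
Definition Nsc (s : {set I}) (b : int) (y : Y) : Prop := N b (xm s *: y).

Lemma Nsc_good : good (X := cech L m 0) Nsc.
Proof.
rewrite /Nsc; split.
- by move=> g b; rewrite scaler0; exact: (sm0 (hN _)).
- by move=> g b y z; rewrite scalerBr; exact: (smB (hN _)).
- move=> g h b y hy; have [-> |c] := eqVneq (binc g h) 0.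
    by rewrite scale0r scaler0; exact: (sm0 (hN _)).
  have [w hw ->] := @xmS K m _ _ (cinc_sub c).
  rewrite scalerA mulrC mulrA -scalerA; apply: (smZ (hN _)) => //.
  by apply: inSM => //; exact: inS_cinc.
- move=> g b y hy; have -> : xm g *: cd Y y = cd Y (xm g *: y) by symmetry; exact: linearZ.
  exact: hd.
Qed.

Lemma Nsc_exact (b0 : int) (j : int) : j <= b0 ->
  (forall (b : int) y, b <= b0 -> N b y -> cd Y y = 0 -> exists2 y', N (b - 1) y' & y = cd Y y') ->
  exact_at (X := cech L m 0) Nsc j.
Proof.
move=> jb ex; apply: (@chase_exact _ _ _ _ Nsc_good (m%:Z + 1)).
  by move=> g; rewrite cdeg0; have := cards_le_ord g; lia.
move=> c cm; apply: (step_exact Nsc_good) => g y gc yN y0.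
have cg : 0 <= c by rewrite -gc cdeg0.
have [||y' y'N e] := ex (j - c) (xm g *: y) _ yN.
- by lia.
- by rewrite linearZ /= y0 scaler0.
exists ((xm g)^-1 *: y'); first by rewrite /Nsc scalerA mulfV ?xm_neq0 // scale1r.
by rewrite linearZ /= -e scalerA mulVf ?xm_neq0 // scale1r.
Qed.
End Scaled.

(* Over a chart the Koszul complex is contractible: multiplication by a
   coordinate x_i is invertible there. *)
Definition NVK (s : {set I}) (b : int) (w : tens (cech L m 0) (triv V)) : Prop :=
  forall t : {set I}, (#|t|%:Z != b -> w t = 0) /\ Esec s (xm t *: w t).

Lemma NVK_good : good (X := cech L m 1) NVK.
Proof.
split.
- by move=> g b t; split=> //; rewrite scaler0; exact: (sm0 (Esec_smod B g)).
- move=> g b y z hy hz t; have [y0 yE] := hy t; have [z0 zE] := hz t; split.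
    by move=> tb; rewrite fsB y0 // z0 // subrr.
  by rewrite fsB scalerBr; exact: (smB (Esec_smod B g)).
- move=> g h b y hy t; have [y0 yE] := hy t; split; first by move=> tb; rewrite fsZ y0 // scaler0.
  rewrite fsZ; have [-> |c] := eqVneq (binc g h) 0.
    by rewrite scale0r scaler0; exact: (sm0 (Esec_smod B h)).
  rewrite scalerA mulrC -scalerA; apply: (smZ (Esec_smod B h)); first exact: inS_cinc.
  exact: (EsecS hAB hBA (cinc_sub c)).
- move=> g b y hy t; rewrite [cd _ y]dT_triv dX_cechE; split.
    move=> tb; rewrite /dS big1 // => i it; have [y0 _] := hy (t :\ i); rewrite y0 ?mul0rz //.
    by move: tb; rewrite (cardsD1 i t) it => /eqP tb; apply/eqP => e; apply: tb; lia.
  rewrite /dS scaler_sumr; apply: (sm_sum _ (Esec_smod B g)) => i it.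
  have [_ yE] := hy (t :\ i); rewrite (xmD1 K it) -scaler_int scalerA mulrAC -scalerA.
  apply: (smZ (Esec_smod B g)) => //; apply: inSM; [exact: inS_xv|exact: inS_sgn].
Qed.

(** [step] holds in every column: at a nonempty [g] the contraction [hS i] with [i] in [g] is
    integral, and at the empty set the coefficients are 0. *)
Lemma CK_exact (j : int) : exact_at (X := cech L m 1) NVK j.
Proof.
apply: (@chase_exact _ _ _ _ NVK_good m%:Z).
  move=> g; rewrite cech_deg; have := cards_le_ord g; lia.
move=> c cm; apply: (step_exact NVK_good) => g y gc yN.
rewrite [cd _ y]dT_triv => y0.
have [g0|[i gi]] := finset.set_0Vmem (g : {set I}).
  exists 0; first exact: (good0 NVK_good g).
  rewrite raddf0; apply: fs_eq => t; have [_ [h _]] := yN t.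
  by have /eqP := h g0; rewrite scaler_eq0 (negbTE (xm_neq0 _ _)) => /eqP.
exists (fsf (fun t : {set I} => hS i y t : V)).
  move=> t; rewrite fsfE /hS; split.
    move=> tb; case: ifPn => // it; have [h _] := yN (i |: t); rewrite h ?mul0rz //.
    by rewrite cardsU1 it; apply/eqP => e; move/eqP: tb; apply; lia.
  case: ifPn => it; first by rewrite scaler0; exact: (sm0 (Esec_smod B g)).
  have [_ h] := yN (i |: t); rewrite -scaler_int scalerA mulrC -scalerA.
  apply: (smZ (Esec_smod B g)); first exact: inS_sgn.
  have -> : xm t = (xv i)^-1 * xm (i |: t) by rewrite xmU1 // mulKf // xv_neq0.
  by rewrite -scalerA; apply: EsecZ => //; exact: loc_xvV.
apply: fs_eq => t; rewrite [cd _ _]dT_triv dX_cechE -[LHS](dShS i y t).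
have -> : hS i (dS y) t = 0; last by rewrite addr0.
rewrite /hS; case: ifP => // _.
by have := congr1 (fun f : fs (cech L m 0) (triv V) => f (i |: t)) y0; rewrite dX_cechE => ->; rewrite mul0rz.
Qed.

(** [epsF] maps a cocycle to one of [C] tensored with the Koszul complex, where everything is exact.
    Together with a primitive of its image it is a cocycle of the cone tensored with the Koszul
    complex, which is exact in this range because the cone is; the first component of a primitive
    there is the one wanted. *)
Lemma FK_exact (j : int) : j <= m%:Z - 1 - k ->
  exact_at (X := FF) (Y := Kos K m) (fun=> @NKos K m) j.
Proof.
move=> jn w wN w0.
pose u : fs (cech L m 0) cF := sw (w : fs FF (fs (cech L m 0) L^o)).
have du : dT u = 0 by rewrite [dT u]dT_sw w0 raddf0.
have uN s : NF (j - #|s : {set I}|%:Z) (xm s *: u s).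
  split=> g.
    move=> gj; rewrite fsZ /u swE; have [h _] := wN g s; rewrite h ?scaler0 //.
    by apply: contra gj; rewrite cdeg0 => /eqP gj; apply/eqP; lia.
  have [_ h] := wN g s; rewrite fsZ /u swE scalerA mulrC -scalerA /sgz; apply: inSM => //.
  by apply: inSX; apply: inSN; exact: inS1.
pose e : fs (cech L m 0) C := fmap (fun=> epsF) u.
have de : dT e = 0 by rewrite (@dT_fmap L (cech L m 0) cF C epsF u epsF_d) du raddf0.
have eN s : NC (j - #|s : {set I}|%:Z) (xm s *: (e s : C)).
  have -> : xm s *: e s = epsF (xm s *: u s) by rewrite linearZ.
  exact: (epsF_N (uN s)).
have [c cN ec] : exists2 c : fs (cech L m 0) C, (forall s, NC (j - 1 - #|s : {set I}|%:Z) (xm s *: (c s : C))) & e = dT c.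
  pose f : fs (cech L m 1) (tens (cech L m 0) (triv V)) := sw (e : fs (cech L m 0) (fs (cech L m 1) V)).
  have df : dT f = 0 by rewrite [dT f]dT_sw de raddf0.
  have [|f' f'N ef] := CK_exact (j := j) _ df.
    move=> s t; rewrite /f swE; have [h1 h2] := eN t s; split.
      move=> tj; have [e0 _] := eN t s.
      have /eqP := e0 ltac:(by rewrite cech_deg; apply: contra tj => /eqP tj; apply/eqP; rewrite cech_deg; lia).
      by rewrite -[(_ *: _ : C) s]/(xm t *: (e t : fs (cech L m 1) V) s) scaler_eq0 (negbTE (xm_neq0 _ _)) => /eqP ->; rewrite scaler0.
    rewrite scalerA mulrC -scalerA; apply: (smZ (Esec_smod B s)) => //.
    by rewrite /sgz; apply: inSX; apply: inSN; exact: inS1.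
  exists (sw (f' : fs (cech L m 1) (fs (cech L m 0) V))).
    move=> t s; rewrite -[(_ *: _ : C) s]/(xm t *: sw (f' : fs (cech L m 1) (fs (cech L m 0) V)) t s).
    rewrite swE; have [h1 h2] := f'N s t; split.
      move=> tj; rewrite h1 ?scaler0 //; apply: contra tj => /eqP tj; apply/eqP.
      by move: tj; rewrite cech_deg; lia.
    rewrite scalerA mulrC -scalerA; apply: (smZ (Esec_smod B s)) => //.
    by rewrite /sgz; apply: inSX; apply: inSN; exact: inS1.
  by rewrite [dT _]dT_sw -ef /f swK.
(* The second component of the cone is shifted by one degree, so [c] must be twisted by the sign of
   the Koszul degree. *)
pose sc : fs (cech L m 0) C := fmap (fun s => (sgz L (bdeg s)) \*: (idfun : {linear C -> C}) : {linear C -> C}) c.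
have pf : exists l : seq (cech L m 0), forall s, s \notin l -> (u s, sc s) = 0 :> cone.
  by exists (enum {: {set I}}) => s; rewrite mem_enum.
pose W : fs (cech L m 0) cone := fs_mk pf.
pose p1 (p : cone) : cF := p.1.
pose p1l : {linear cone -> cF} := HB.pack p1 (GRing.isLinear.Build L cone cF _ p1 (fun a b c => erefl)).
pose p2 (p : cone) : C := p.2.
pose p2l : {linear cone -> C} := HB.pack p2 (GRing.isLinear.Build L cone C _ p2 (fun a b c => erefl)).
have W1 : fmap (fun=> p1l) W = u by apply: fs_eq.
have W2 : fmap (fun=> p2l) W = sc by apply: fs_eq.
have dW : dT W = 0.
  apply: fs_eq => s.
  have E1 : (dT W s).1 = 0.
    transitivity (dT (fmap (fun=> p1l) W) s); last by rewrite W1 du.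
    by rewrite (@dT_fmap L (cech L m 0) cone cF p1l W).
  suff E2 : (dT W s).2 = 0 by rewrite [dT W s]surjective_pairing E1 E2.
  rewrite dTE; have -> : (dX (@binc L (cech L m 0)) W s + sgz L (bdeg s) *: cd cone (W s)).2 =
     dX (@binc L (cech L m 0)) (fmap (fun=> p2l) W) s + sgz L (bdeg s) *: (epsF (u s) - cd C (sc s)).
    by rewrite dX_fmap.
  rewrite W2; have -> : dX (@binc L (cech L m 0)) sc s = - (sgz L (bdeg s) *: dX (@binc L (cech L m 0)) c s).
    rewrite !dX_cechE /dS scaler_sumr -sumrN; apply: eq_bigr => i si.
    have -> : (sc : fs _ _) (s :\ i) = - sgz L (bdeg s) *: c (s :\ i).
      rewrite /sc fmapE /=; congr (_ *: _).
      have -> : #|(s : {set I})|%:Z - 0 = #|(s : {set I}) :\ i|%:Z - 0 + 1.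
        by rewrite (cardsD1 i (s : {set I})) si; lia.
      by rewrite sgzS opprK.
    by rewrite -!scaler_int !scalerA mulrN scaleNr mulrC.
  have -> : cd C (sc s) = sgz L (bdeg s) *: cd C (c s) by rewrite /sc fmapE /= linearZ.
  rewrite -scalerN -scalerDr -[epsF (u s)]/(e s) ec dTE.
  by rewrite addrK addNr scaler0.
have WN : inN (X := cech L m 0) (Nsc Ncone) j W.
  move=> s; rewrite cdeg0; split; first exact: uN.
  have -> : (xm s *: W s).2 = sgz L (bdeg s) *: (xm s *: c s) :> C.
    by rewrite !scalerA mulrC -scalerA.
  apply: (smZ (NC_smod B _)).
    by rewrite /sgz; apply: inSX; apply: inSN; exact: inS1.
  have := cN s; by have -> : j - 1 - #|s : {set I}|%:Z = j - #|s : {set I}|%:Z - 1 by lia.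
have [W' W'N eW] := Nsc_exact Ncone_smod Ncone_d jn cone_exact WN dW.
have [u' u'N eu] : exists2 u' : fs (cech L m 0) cF,
    (forall s : cech L m 0, NF (j - 1 - bdeg s) (xm s *: u' s)) & u = dT u'.
  exists (fmap (fun=> p1l) W').
    by move=> s; have [h _] := W'N s.
  by rewrite (@dT_fmap L (cech L m 0) cone cF p1l W') // -eW W1.
exists (sw (u' : fs (cech L m 0) (fs FF L^o))).
  move=> g s; rewrite swE; have [h1 h2] := u'N s; split.
    move=> gj; have /eqP := h1 g ltac:(by apply: contra gj => /eqP gj; apply/eqP; rewrite gj; lia).
    by rewrite fsZ scaler_eq0 (negbTE (xm_neq0 _ _)) => /eqP ->; rewrite scaler0.
  have := h2 g; rewrite fsZ => h3.
  have h4 : inS (sgz L (bdeg s * bdeg g)) by rewrite /sgz; apply: inSX; apply: inSN; exact: inS1.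
  have := inSM h4 h3; rewrite /kos; congr inS; exact: mulrCA.
by rewrite [dT _]dT_sw -eu /u swK.
Qed.

(** The top of the Koszul complex has degree [m], and [a + m] lies in the range of [FK_exact]
    precisely for [a < - k]. *)
Lemma FF_relex (a : int) : a < - k -> relex FF (Y := triv (L^o)) inS (inI predT) a.
Proof.
move=> ak; apply: (@relex_of_kos K m FF (k + 1)); first exact: inS_FF.
  by move=> g; have := FF_deg g; lia.
by apply: FK_exact; lia.
Qed.

End Resolution.

(** * The tensor square over a chart *)

Section ChaseMid.
Context (R : fieldType) (X : bcx R) (Y : cpx R) (N : X -> int -> Y -> Prop).
Hypothesis hN : good N.

(** A chase in which [step] is not known for the lowest column [a]: there the first correction [v]
    is supplied, and only the later columns run by themselves. *)
Lemma chase_mid (D j a : int) (w v : fs X Y) : (forall g : X, bdeg g < D) ->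
  inN N j w -> dT w = 0 -> (forall g, bdeg g < a -> w g = 0) ->
  (forall c : int, a < c -> step N j c) ->
  conc (a - 1) v -> (forall g, N g (j - a) (v g)) -> (forall g, cd Y (v g) = 0) ->
  (forall g, bdeg g = a -> exists2 y, N g (j - a - 1) y & w g - dX (@binc R X) v g = cd Y y) ->
  exists2 u, inN N (j - 1) u & w = dT u.
Proof.
move=> hD wN w0 wa st cv vN v0 hy.
have [||y y2] := @fs_choice R X Y (supp w ++ supp (dX (@binc R X) v)) (fun g y => [/\ bdeg g != a -> y = 0, N g (j - a - 1) y & bdeg g = a -> w g - dX (@binc R X) v g = cd Y y]).
2: by move=> g; rewrite mem_cat negb_or => /andP[/suppP g0 /suppP g1]; split=> // [|_]; [exact: good0|rewrite g0 g1 subr0 raddf0].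
- move=> g; have [ga|ga] := eqVneq (bdeg g) a.
    by have [y yN e] := hy g ga; exists y; split.
  by exists 0; split=> // [|/eqP]; [exact: good0|rewrite (negbTE ga)].
have cy : conc a y by move=> g ga; have [h _ _] := y2 g; exact: h.
pose z := v + sgz R a *: y.
have zN : inN N (j - 1) z.
  apply: (inND hN) => g.
    have [ga|ga] := eqVneq (bdeg g) (a - 1); last by rewrite cv //; exact: good0.
    by rewrite ga; have -> : j - 1 - (a - 1) = j - a by lia.
  have [ga|ga] := eqVneq (bdeg g) a; last by rewrite fsZ cy // scaler0; exact: good0.
  rewrite ga fsZ; apply: (good_sgz hN); have -> : j - 1 - a = j - a - 1 by lia.
  by have [] := y2 g.
have dTD : dT z = dT v + dT (sgz R a *: y) by exact: raddfD.
have zlow g : bdeg g < a + 1 -> (w - dT z) g = 0.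
  move=> ga; rewrite dTD fsB fsD !dTE v0 scaler0 addr0.
  have [ea|ea] := eqVneq (bdeg g) a.
    rewrite {1}[dX _ (sgz R a *: y) g](@dX_deg _ _ _ _ a) ?add0r; first last.
    - by rewrite ea; lia.
    - by move=> x hx; rewrite fsZ cy ?scaler0.
    have [_ _ e] := y2 g; rewrite fsZ linearZ /= scalerA ea sgz2 scale1r -e //.
    by rewrite opprD addrA subrr.
  rewrite wa; last by lia.
  rewrite (@dX_deg _ _ _ v (a - 1)) ?add0r //; last by lia.
  rewrite (@dX_deg _ _ _ (sgz R a *: y) a) ?add0r; first last.
  - by lia.
  - by move=> x hx; rewrite fsZ cy ?scaler0.
  by rewrite fsZ cy // scaler0 raddf0 scaler0 oppr0.
have [||||u uN hu] := @chase R X Y N hN j (a + 1) (absz (D - a)%R) (w - dT z).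
- by apply: (inNB hN) => //; have := inN_dT hN zN; rewrite subrK.
- have -> : dT (w - dT z) = dT w - dT (dT z) by exact: raddfB.
  by rewrite w0 dTdT subr0.
- exact: zlow.
- by move=> c hc; apply: st; lia.
exists (z + u); first exact: (inND hN).
have -> : dT (z + u) = dT z + dT u by exact: raddfD.
apply/eqP; rewrite -subr_eq0; apply/eqP/fs_eq => g; rewrite opprD addrA.
by apply: hu; have := hD g; lia.
Qed.
End ChaseMid.

Section LinearMaps.
Context (R : fieldType).
Definition mulc p q (M : 'M[R]_(p, q)) (v : 'cV[R]_q) : 'cV[R]_p := M *m v.
Fact mulc_linear p q (M : 'M[R]_(p, q)) : linear (mulc M).
Proof. by move=> a v w; rewrite /mulc mulmxDr -scalemxAr. Qed.
HB.instance Definition _ p q (M : 'M[R]_(p, q)) := GRing.isLinear.Build R _ _ _ (mulc M) (mulc_linear M).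
Definition coordc q (x : 'I_q) (v : 'cV[R]_q) : R^o := v x 0.
Fact coordc_linear q (x : 'I_q) : linear (coordc x).
Proof. by move=> a v w; rewrite /coordc !mxE. Qed.
HB.instance Definition _ q (x : 'I_q) := GRing.isLinear.Build R _ R^o _ (coordc x) (coordc_linear x).
Definition transp q (M : 'M[R]_q) : 'M[R]_q := M^T.
Fact transp_linear q : linear (@transp q).
Proof. by move=> a M N; rewrite /transp linearD linearZ. Qed.
HB.instance Definition _ q := GRing.isLinear.Build R _ _ _ (@transp q) (@transp_linear q).
End LinearMaps.

Section Square.
Context (K : fieldType) (m : nat).
Local Notation S := {mpoly K[m]}.
Local Notation L := {fraction S}.
Local Notation I := 'I_m.
Local Notation inS := (@inS K m).
Local Notation xv := (@xv K m).
Local Notation xm := (@xm K m).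
Local Notation loc := (@loc K m).
Context (r : nat) (A : I -> 'M[L]_(2, r)) (B : I -> 'M[L]_(r, 2)).
Hypothesis hAB : forall i, A i *m B i = 1%:M.
Hypothesis hBA : forall i j x y, loc [set i; j]%SET ((B j *m A i) x y).
Local Notation V := 'cV[L]_2.
Local Notation C := (Cc K m).
Local Notation NC := (NC B).
Local Notation Esec := (Esec B).
Context (k : int).
Local Notation FF := (FF B k).
Local Notation cF := (cF B k).
Local Notation NF := (@NF K m r B k).
Local Notation epsF := (epsF B k).
Hypothesis k0 : 0 <= k.
Hypothesis km : k + 1 < m%:Z.
Context (i0 : I).

Definition NFt (t : {set I}) (b : int) : cF -> Prop := inN (X := FF) (fun=> cN loc t) b.
Lemma cNl_smod t b : Smod (cN loc t b).
Proof. by apply: cN_smod; [exact: loc0|exact: locB|exact: locZ]. Qed.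
Lemma NFt_smod t b : Smod (NFt t b).
Proof. by apply: inN_smod => g c; exact: cNl_smod. Qed.
Lemma NFt_goodX t : good (X := FF) (fun=> cN loc t).
Proof.
apply: smod_good; [exact: inS_FF|exact: cNl_smod|].
by move=> b y _; rewrite triv_cd; exact: (sm0 (cNl_smod _ _)).
Qed.
Lemma NFt_d t b u : NFt t b u -> NFt t (b + 1) (cd cF u).
Proof. exact: (inN_dT (NFt_goodX t)). Qed.
Lemma NFt_conc t b u (g : FF) : NFt t b u -> bdeg g != b -> u g = 0.
Proof. by move=> h gb; have [h0 _] := h g; apply: h0; rewrite subr_eq0 eq_sym. Qed.
Lemma NFt_loc t b u (g : FF) : NFt t b u -> loc t (u g).
Proof. by move=> h; have [] := h g. Qed.
Lemma NFtP t b (u : cF) : (forall g : FF, bdeg g != b -> u g = 0) -> (forall g : FF, loc t (u g)) -> NFt t b u.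
Proof. by move=> h1 h2 g; split=> //; rewrite subr_eq0 eq_sym; exact: h1. Qed.
Lemma NFtZ t b z u : loc t z -> NFt t b u -> NFt t b (z *: u).
Proof.
move=> hz hu; apply: NFtP => g; first by move=> gb; rewrite fsZ (NFt_conc hu) // scaler0.
rewrite fsZ; exact: (locM hz (NFt_loc g hu)).
Qed.
Lemma NF_NFt t b u : NF b u -> NFt t b u.
Proof. by move=> [h1 h2]; apply: NFtP => // g; exact: inS_loc. Qed.
Lemma NFt_clear t b u : NFt t b u -> exists N, NF b (xm t ^+ N *: u).
Proof.
move=> hu; have [N hN] : exists N, forall g : FF, g \in supp u -> inS (xm t ^+ N * u g).
  elim: (supp u) => [|g s [N IH]]; first by exists 0%N.
  have [N' hN'] := NFt_loc g hu; exists (N + N')%N => h; rewrite in_cons => /orP[/eqP ->|/IH hh].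
    by apply: loc_up hN'; exact: leq_addl.
  by apply: loc_up hh; exact: leq_addr.
exists N; split=> g; first by move=> gb; rewrite fsZ (NFt_conc hu) // scaler0.
have [gs|/suppP g0] := boolP (g \in supp u); first by rewrite fsZ; exact: (hN g gs).
by rewrite fsZ g0 scaler0; exact: inS0.
Qed.

Lemma xmXV t N : loc t (xm t ^+ N)^-1.
Proof. by exists N; rewrite mulfV ?expf_neq0 ?xm_neq0 //; exact: inS1. Qed.
Lemma xmXK (Y : lmodType L) t N (u : Y) : (xm t ^+ N)^-1 *: (xm t ^+ N *: u) = u.
Proof. by rewrite scalerA mulVf ?scale1r // expf_neq0 ?xm_neq0. Qed.

(** After clearing denominators, a cocycle of positive degree maps to a class killed by a power of
    [x_i], with [i] in [t]. Multiplied by this power the cocycle lifts by [F_lift], and the power is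
    invertible over the chart. In negative degrees the image in [C] is 0. *)
Lemma Ft_exact (t : {set I}) b u : t != finset.set0 -> b != 0 -> NFt t b u -> cd cF u = 0 ->
  exists2 v, NFt t (b - 1) v & u = cd cF v.
Proof.
move=> /finset.set0Pn[i it] b0 hu u0; have [N uN] := NFt_clear hu.
have [kb|bk] := ltrP k b.
  exists 0; first exact: (sm0 (NFt_smod _ _)).
  by rewrite raddf0 -[u](xmXK t N) (NF_top kb uN) scaler0.
have du : cd cF (xm t ^+ N *: u) = 0 by rewrite linearZ /= u0 scaler0.
have [N' [c [cN ec]]] : exists N' c, NC (b - 1) c /\ xv i ^+ N' *: epsF (xm t ^+ N *: u) = cd C c.
  have eN := epsF_N uN.
  have [bn|bp] := ltrP b 0.
    by exists 0%N, 0; split; [exact: (sm0 (NC_smod B _))|rewrite (NC_neg bn eN) scaler0 raddf0].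
  have [N' hN'] := coh_tors hAB hBA i.
  have [|||c cN ec] := hN' b _ _ _ eN; [lia|lia|by rewrite -epsF_d du raddf0|].
  by exists N', c.
pose s : L := xv i ^+ N' * xm t ^+ N.
have sN : NF b (s *: u).
  by rewrite /s -scalerA; apply: (smZ (NF_smod B k b)) => //; apply: inSX; exact: inS_xv.
have [|||v [vN dv _]] := F_lift (a := b) (u := s *: u) (c := c) _ sN _ cN.
- lia.
- by rewrite linearZ /= u0 scaler0.
- by rewrite -ec /s -scalerA linearZ.
have s0 : s != 0 by exact: (mulf_neq0 (expf_neq0 _ (xv_neq0 _ _)) (expf_neq0 _ (xm_neq0 _ _))).
exists (s^-1 *: v).
  apply: NFtZ; last exact: NF_NFt.
  by rewrite /s invfM; apply: locM; [rewrite -exprVn; apply: locX; exact: loc_xvV|exact: xmXV].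
by rewrite linearZ /= dv scalerA mulVf // scale1r.
Qed.

Lemma geps_set0 (g : FF) : (geps inS NC k g : fs (cech L m 1) V) (finset.set0 : {set I}) = 0.
Proof.
have h : NC (bdeg g) (geps inS NC k g).
  by apply: (@NC_geps L inS C NC k g) => b; exact: (sm0 (NC_smod B b)).
by have [h0 _] := NC_E finset.set0 h; exact: h0.
Qed.

Definition atv (i : I) (c : C) : V := (c : fs (cech L m 1) V) [set i]%SET.
Fact atv_linear i : linear (atv i). Proof. by []. Qed.
HB.instance Definition _ i := GRing.isLinear.Build L C V _ (atv i) (atv_linear i).
(** The augmentation of [F] to [E]. On cocycles the choice of [i0] is immaterial, as a 0-cocycle of
    [C] has the same value at every index ([atv_eq]). *)
Definition ev : cF -> V := atv i0 \o epsF.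
HB.instance Definition _ := GRing.Linear.on ev.
Definition eg (g : FF) : V := atv i0 (geps inS NC k g).

Lemma epsF_set0 u : (epsF u : fs (cech L m 1) V) (finset.set0 : {set I}) = 0.
Proof.
pose f (c : C) : V := (c : fs (cech L m 1) V) (finset.set0 : {set I}).
pose fl : {linear C -> V} := HB.pack f (GRing.isLinear.Build L C V _ f (fun a b c => erefl)).
apply: (@fs_lin_eq0 L FF L^o V (fl \o epsF)) => g a /=.
rewrite [epsF _]eps_single /f.
by rewrite -[(_ *: _ : C) _]/(_ *: (geps inS NC k g : fs (cech L m 1) V) (finset.set0 : {set I})) geps_set0 scaler0.
Qed.

Lemma ev_single (g : FF) a : ev (single g a) = (a : L) *: eg g.
Proof. by rewrite /ev /= [epsF _]eps_single linearZ. Qed.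

Lemma ev_sum (u : cF) : ev u = \sum_(g <- supp u) u g *: eg g.
Proof. by rewrite {1}(fs_split u) raddf_sum; apply: eq_bigr => g _; rewrite -ev_single. Qed.

Lemma eg0 (g : FF) : bdeg g != 0 -> eg g = 0.
Proof.
move=> gb; have h : NC (bdeg g) (geps inS NC k g).
  by apply: (@NC_geps L inS C NC k g) => b; exact: (sm0 (NC_smod B b)).
by apply: (NC_conc h); rewrite cards1; apply/eqP => e; move/eqP: gb; apply; lia.
Qed.

Lemma ev_d u : ev (cd cF u) = 0.
Proof.
rewrite /ev /= epsF_d /atv cdCc /dS big1 // => i; rewrite !inE => /eqP ->.
have -> : [set i0]%SET :\ i0 = finset.set0 by apply/setP => x; rewrite !inE; case: eqP.
by rewrite epsF_set0 mul0rz.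
Qed.

Lemma atv_eq t u i : NFt t 0 u -> cd cF u = 0 -> atv i (epsF u) = ev u.
Proof.
move=> hu u0; have [-> //|ii] := eqVneq i i0.
have h : dS (fun t => (epsF u : fs (cech L m 1) V) t) [set i; i0]%SET = 0.
  by rewrite -cdCc -epsF_d u0 raddf0.
move: h; rewrite /dS (bigD1 i) ?inE ?eqxx //= (bigD1 i0) ?inE ?eqxx ?orbT 1?eq_sym //=.
rewrite big1 ?addr0 => [|j /andP[/andP[]]]; last first.
  by rewrite !inE => /orP[] /eqP ->; rewrite eqxx.
have e1 : [set i; i0]%SET :\ i = [set i0]%SET by rewrite finset.setU1K // inE.
have e2 : [set i; i0]%SET :\ i0 = [set i]%SET by rewrite finset.setUC finset.setU1K // inE eq_sym.
rewrite e1 e2.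
have := sgn_anti (m := m) (i := i) (j := i0) (s := [set i; i0]%SET); rewrite !inE !eqxx orbT => /(_ isT isT ii).
rewrite e1 e2.
have s1 l : sgn l [set l]%SET = 1.
  rewrite /sgn (_ : [set _ in _ | _]%SET = finset.set0) ?cards0 //.
  by apply/setP => x; rewrite !inE; case: (x =P l) => //= ->; rewrite ltnn.
rewrite !s1 !mulr1 => ->; rewrite mulrNz addrC => /eqP; rewrite subr_eq0 => /eqP e.
have := congr1 (fun z => z *~ sgn i0 [set i; i0]%SET) e.
by rewrite -!mulrzA sgn2 !mulr1z.
Qed.

Lemma ev_E (t : {set I}) u : t != finset.set0 -> NFt t 0 u -> cd cF u = 0 -> Esec t (ev u).
Proof.
move=> /finset.set0Pn[i it] hu u0; have [N uN] := NFt_clear hu.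
have h := NC_E [set i]%SET (epsF_N uN).
have e : xm t ^+ N *: ev u = (epsF (xm t ^+ N *: u) : fs (cech L m 1) V) [set i]%SET.
  rewrite -(atv_eq i hu u0) -[RHS]/(atv i _).
  have -> : epsF (xm t ^+ N *: u) = xm t ^+ N *: epsF u by rewrite linearZ.
  by rewrite linearZ.
rewrite -[ev u](xmXK t N) e; apply: EsecZ; first exact: xmXV.
by apply: (EsecS hAB hBA _ h); rewrite finset.sub1set.
Qed.

Lemma ev_ker (t : {set I}) u : t != finset.set0 -> NFt t 0 u -> cd cF u = 0 -> ev u = 0 ->
  exists2 v, NFt t (0 - 1) v & u = cd cF v.
Proof.
move=> tn hu u0 eu; have [N uN] := NFt_clear hu.
have e0 : epsF (xm t ^+ N *: u) = 0.
  apply: fs_eq => s; have [s1|s1] := eqVneq #|s : {set I}|%:Z (0 + 1); last exact: (NC_conc (epsF_N uN)).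
  have /cards1P[i ->] : #|s : {set I}| == 1%N by move: s1; rewrite add0r => /eqP; rewrite eqz_nat.
  rewrite -[LHS]/(atv i _).
  have -> : epsF (xm t ^+ N *: u) = xm t ^+ N *: epsF u by rewrite linearZ.
  by rewrite linearZ /= (atv_eq i hu u0) eu scaler0.
have [|||v [vN dv _]] := F_lift (a := 0) (u := xm t ^+ N *: u) (c := 0) _ uN _ (sm0 (NC_smod B _)).
- lia.
- by rewrite linearZ /= u0 scaler0.
- by rewrite e0 raddf0.
exists ((xm t ^+ N)^-1 *: v); first by apply: NFtZ; [exact: xmXV|exact: NF_NFt].
by rewrite linearZ /= dv xmXK.
Qed.

(** A power of x_t times [e] is a section over every D(x_j), hence a 0-cocycle of [C], and [F] lifts
    it by construction. *)
Lemma ev_onto (t : {set I}) e : t != finset.set0 -> Esec t e -> exists u, [/\ NFt t 0 u, cd cF u = 0 & ev u = e].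
Proof.
move=> /finset.set0Pn[i it] [_ he].
have /choice[N hN] : forall p : I * 'I_r, exists N, loc [set p.1]%SET (xm t ^+ N * (B p.1 *m e) p.2 0).
  move=> [j x] /=; have : loc (j |: t) ((B j *m e) x 0).
    have -> : B j *m e = (B j *m A i) *m (B i *m e) by rewrite mulmxA -(mulmxA (B j)) hAB mulmx1.
    apply: loc_mulmx => y z.
      apply: (locS _ (hBA i j y z)); apply/fintype.subsetP => l; rewrite !inE => /orP[] /eqP ->; by rewrite ?eqxx ?it ?orbT.
    rewrite [z]ord1; apply: locS (he i it y); exact: finset.subsetU1.
  move=> [N h]; exists N; exists N.
  have [w ws ew] : exists2 w, inS w & w * xm (j |: t) = xm t * xv j.
    have [jt|jt] := boolP (j \in t); last by exists 1; [exact: inS1|rewrite mul1r xmU1 // mulrC].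
    exists (xv j); first exact: inS_xv.
    by rewrite (finset.setUidPr _) ?finset.sub1set // mulrC.
  rewrite xm1 mulrA -exprMn [xv j * _]mulrC -ew exprMn -mulrA; apply: inSM => //; exact: inSX.
pose M := (\sum_p N p)%N.
pose c : fs (cech L m 1) V := fsf (fun s : {set I} => if #|s| == 1%N then xm t ^+ M *: e else 0).
have cN : NC (1 - 1) c.
  rewrite subrr => s; split.
    rewrite cech_deg fsfE => h; case: eqP => // s1; move: h; rewrite s1 /=; lia.
  rewrite fsfE; case: ifP => [/cards1P[j ->]|_]; last exact: (sm0 (Esec_smod B _)).
  apply: (Esec_one hAB hBA (i := j)); first by rewrite inE.
  move=> x; rewrite -scalemxAr mxE.
  have le : (N (j, x) <= M)%N by rewrite /M (bigD1 (j, x)) //= leq_addr.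
  rewrite -(subnK le) exprD -mulrA; apply: locZ; last exact: (hN (j, x)).
  by apply: inSX; exact: inS_xm.
have dc : cd C c = 0.
  apply: fs_eq => s; rewrite cdCc fs0.
  have [s2|s2] := eqVneq #|s : {set I}| 2; last first.
    rewrite /dS big1 // => j js; rewrite /c fsfE; case: eqP => e1; last by rewrite mul0rz.
    by move: s2; rewrite (cardsD1 j (s : {set I})) js e1.
  (* [c] is constant on singletons, so it agrees there with a coboundary from the empty set and
     [dSdS] applies. *)
  rewrite (@dS_eq _ _ _ (dS (fun s : {set I} => if s == finset.set0 then xm t ^+ M *: e *~ sgn i0 [set i0]%SET else 0))).
    by rewrite dSdS.
  move=> j js; rewrite /c fsfE; have s1 : #|(s : {set I}) :\ j| = 1%N by move: s2; rewrite (cardsD1 j (s : {set I})) js => -[].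
  rewrite s1 eqxx; move/eqP: s1 => /cards1P[l ->]; rewrite /dS big_set1.
  have -> : [set l]%SET :\ l = finset.set0 by apply/setP => x; rewrite !inE; case: eqP.
  have s1' q : sgn q [set q]%SET = 1.
    rewrite /sgn (_ : [set _ in _ | _]%SET = finset.set0) ?cards0 //.
    by apply/setP => x; rewrite !inE; case: (x =P q) => //= ->; rewrite ltnn.
  by rewrite eqxx !s1'.
have [||||u [uN du eu]] := F_lift (k := k) (B := B) (a := 1) (u := 0) (c := c) _ _ _ cN.
- lia.
- exact: (sm0 (NF_smod B k _)).
- exact: raddf0.
- by rewrite raddf0 dc.
rewrite subrr in uN.
exists ((xm t ^+ M)^-1 *: u); split.
- by apply: NFtZ; [exact: xmXV|exact: NF_NFt].
- by rewrite linearZ /= du scaler0.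
- by rewrite linearZ /= /ev /= eu /atv /c fsfE cards1 eqxx xmXK.
Qed.

(* Sections of E over a chart are a direct summand of a free module, so lifting
   E-valued chains along F reduces to coordinates. *)
Lemma Eval_lift (t : {set I}) (b : int) (U : fs FF V) i : i \in t ->
  (forall g, bdeg g != b -> U g = 0) -> (forall g, Esec t (U g)) -> dX (@binc L FF) U = 0 ->
  (forall u : cF, NFt t b u -> cd cF u = 0 ->
     (exists x, forall g, u g = (B i *m U g) x 0) -> exists2 v, NFt t (b - 1) v & u = cd cF v) ->
  exists y : fs FF cF, [/\ conc (b - 1) y, forall g, NFt t 0 (y g), forall g, cd cF (y g) = 0 &
    fmap (fun=> ev : {linear cF -> V}) (dX (@binc L FF) y) = U].
Proof.
move=> it U0 UE dU hex.
pose co x : {linear V -> L^o} := (@coordc L r x \o @mulc L r 2 (B i)).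
have /choice[v hv] : forall x : 'I_r, exists v, NFt t (b - 1) v /\ fmap (fun=> co x) U = cd cF v.
  move=> x; have [|||v vN ev'] := hex (fmap (fun=> co x) U).
  - apply: NFtP => g; first by move=> gb; rewrite fmapE U0 // raddf0.
    by have [_ h] := UE g; exact: h.
  - by rewrite [cd _ _]dT_triv dX_fmap dU raddf0.
  - by exists x.
  - by exists v.
have Vfs : exists s : seq FF, forall g, g \notin s -> A i *m (\col_x (v x g : L)) = 0.
  exists (flatten [seq supp (v x) | x <- enum 'I_r]) => g gs.
  rewrite (_ : \col_x _ = 0) ?mulmx0 //; apply/matrixP => x y; rewrite !mxE; apply: (@suppP L FF L^o (v x)).
  apply: contra gs => gs; apply/flattenP; exists (supp (v x)) => //.
  by apply/mapP; exists x; rewrite ?mem_enum.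
pose V' : fs FF V := fs_mk Vfs.
have dV : dX (@binc L FF) V' = U.
  apply: fs_eq => g.
  pose Ai : {linear 'cV[L]_r -> V} := @mulc L 2 r (A i).
  have vfs : exists s : seq FF, forall g, g \notin s -> \col_x (v x g : L) = 0.
    exists (flatten [seq supp (v x) | x <- enum 'I_r]) => h hs.
    apply/matrixP => x y; rewrite !mxE; apply: (@suppP L FF L^o (v x)).
    apply: contra hs => hs; apply/flattenP; exists (supp (v x)) => //.
    by apply/mapP; exists x; rewrite ?mem_enum.
  have -> : V' = fmap (fun=> Ai) (fs_mk vfs) by apply: fs_eq.
  rewrite dX_fmap fmapE /=.
  have -> : dX (@binc L FF) (fs_mk vfs) g = B i *m U g.
    apply/matrixP => x y; rewrite ord1.
    pose pc : {linear 'cV[L]_r -> L^o} := @coordc L r x.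
    have -> : dX (@binc L FF) (fs_mk vfs) g x 0 = fmap (fun=> pc) (dX (@binc L FF) (fs_mk vfs)) g by [].
    rewrite -dX_fmap; have -> : fmap (fun=> pc) (fs_mk vfs) = v x.
      by apply: fs_eq => h; rewrite fmapE /= /coordc mxE.
    have [_ e] := hv x; have := congr1 (fun f : cF => f g) e; rewrite [cd _ _]dT_triv => <-.
    by [].
  by rewrite /mulc mulmxA hAB mul1mx.
have VE g : Esec t (V' g).
  apply: (Esec_one hAB hBA it) => x; rewrite mulmxA mxE; apply: loc_sum => y _; apply: locM.
    by apply: locS (hBA i i x y); apply/fintype.subsetP => l; rewrite !inE orbb => /eqP ->.
  by rewrite mxE; have [h _] := hv y; exact: (NFt_loc g h).
have tn : t != finset.set0 by apply/finset.set0Pn; exists i.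
have [||y hy] := @fs_choice L FF cF (supp V') (fun g y => [/\ bdeg g != b - 1 -> y = 0, NFt t 0 y, cd cF y = 0 & ev y = V' g]).
2: by move=> g /suppP g0; split=> //; rewrite ?raddf0 ?g0 //; exact: (sm0 (NFt_smod _ _)).
- move=> g; have [gb|gb] := eqVneq (bdeg g) (b - 1).
    by have [u [h1 h2 h3]] := ev_onto tn (VE g); exists u; split.
  exists 0; split=> //; rewrite ?raddf0 //; first exact: (sm0 (NFt_smod _ _)).
  rewrite /V' /= (_ : \col_x _ = 0) ?mulmx0 //; apply/matrixP => x z; rewrite !mxE.
  by have [h _] := hv x; exact: (NFt_conc h).
exists y; split.
- by move=> g gb; have [h _ _ _] := hy g; exact: h.
- by move=> g; have [] := hy g.
- by move=> g; have [] := hy g.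
- rewrite -dX_fmap -dV; congr (dX _ _); apply: fs_eq => g; rewrite fmapE; by have [] := hy g.
Qed.

Definition G : cpx L := tens FF cF.
Definition NG (t : {set I}) (b : int) : G -> Prop := inN (X := FF) (fun=> NFt t) b.
Lemma NG_good t : good (X := FF) (fun=> NFt t).
Proof. by apply: smod_good; [exact: inS_FF|exact: NFt_smod|exact: NFt_d]. Qed.
Lemma NG_smod t b : Smod (NG t b).
Proof. by apply: inN_smod => g c; exact: NFt_smod. Qed.
Lemma NG_d t b w : NG t b w -> NG t (b + 1) (cd G w).
Proof. exact: (inN_dT (NG_good t)). Qed.
Lemma FF_ltk (g : FF) : bdeg g < k + 1.
Proof. by have := FF_deg g; lia. Qed.

Lemma NG_step t b c : t != finset.set0 -> b - c != 0 -> step (X := FF) (fun=> NFt t) b c.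
Proof. by move=> tn bc; apply: (step_exact (NG_good t)) => g y gc yN y0; exact: Ft_exact. Qed.

(** In all columns but one, exactness of [F] off degree 0 suffices. In the remaining column the
    coefficients are sections of [E], and [F] tensored with [E] stays exact because [E] is a summand
    of a free module over the chart. *)
Lemma G_exact t b w : t != finset.set0 -> b != 0 -> NG t b w -> cd G w = 0 ->
  exists2 v, NG t (b - 1) v & w = cd G v.
Proof.
move=> tn b0; move: w; apply: (@chase_exact _ _ _ _ (NG_good t) (k + 1) b FF_ltk) => c ck.
have [cb|cb] := eqVneq c b; last by apply: NG_step => //; rewrite subr_eq0 eq_sym.
apply: (step_relex (NG_good t)) => u cu uP hu; rewrite {c ck}cb in cu uP hu *.
rewrite subrr in uP hu *.
have /finset.set0Pn[i it] := tn.
have [||||y [cy yN y0 ey]] := @Eval_lift t b (fmap (fun=> ev : {linear cF -> V}) u) i it.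
- by move=> g gb; rewrite fmapE cu // raddf0.
- by move=> g; have [h1 h2] := uP g; exact: ev_E.
- by rewrite dX_fmap; apply: fs_eq => h; rewrite fmapE; have [y' _ ->] := hu h; exact: ev_d.
- by move=> v vN v0 _; exact: Ft_exact.
exists y => //; split=> // g.
apply: ev_ker => //.
- by apply: (smB (NFt_smod t 0)); [have [] := uP g|apply: (smod_dX (@inS_FF _ _ _ _ _) _ (NFt_smod t 0))].
- have -> : cd cF (u g - dX (@binc L FF) y g) = cd cF (u g) - cd cF (dX (@binc L FF) y g) by exact: raddfB.
  have -> : cd cF (dX (@binc L FF) y g) = dX (@binc L FF) (fmap (fun=> cd cF) y) g by rewrite dX_fmap.
  have -> : fmap (fun=> cd cF) y = 0 by apply: fs_eq => h; rewrite fmapE y0.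
  by rewrite raddf0 subr0; have [] := uP g.
- have -> : ev (u g - dX (@binc L FF) y g) = ev (u g) - ev (dX (@binc L FF) y g) by exact: raddfB.
  by have := congr1 (fun f : fs FF V => f g) ey; rewrite !fmapE => ->; exact: subrr.
Qed.

Definition outer (a : V) : V -> 'M[L]_2 := fun v => a *m v^T.
Fact outer_linear a : linear (outer a).
Proof. by move=> c v w; rewrite /outer linearD /= linearZ /= mulmxDr -scalemxAr. Qed.
HB.instance Definition _ a := GRing.isLinear.Build L V 'M[L]_2 _ (outer a) (outer_linear a).
Definition Psi : fs FF V -> 'M[L]_2 := fext (fun g => outer (eg g) : {linear V -> 'M[L]_2}).
HB.instance Definition _ := GRing.Linear.on Psi.
(** The tensor square of [ev], with L^2 (x) L^2 identified with 2 x 2 matrices: g (x) h goes to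
    ev(g) ev(h)^T. *)
Definition pig : G -> 'M[L]_2 := Psi \o fmap (fun=> ev : {linear cF -> V}).
HB.instance Definition _ := GRing.Linear.on pig.

Lemma Psi_single g v : Psi (single g v) = eg g *m v^T.
Proof. by rewrite /Psi fext_single. Qed.

Lemma Psi_dX U : Psi (dX (@binc L FF) U) = 0.
Proof.
apply: (@fs_lin_eq0 L FF V _ (Psi \o dX (@binc L FF))) => g v /=.
rewrite dX_single.
have e (c : cF) : Psi (fsc (c : fs FF L^o) v) = ev c *m v^T.
  rewrite /Psi (@fextE _ _ _ _ _ _ (supp c)) ?supp_uniq //; last by move=> h /suppP hc; rewrite fscE hc scale0r.
  rewrite ev_sum mulmx_suml; apply: eq_bigr => h _.
  by have -> : fsc (c : fs FF L^o) v h = (c h : L) *: v by []; rewrite linearZ /= /outer -scalemxAl.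
have eb : ginc inS NC k g = cd cF (single (g : FF) (1 : L^o)).
  by rewrite [cd _ _]dT_triv dX_single; apply: fs_eq => h; rewrite fscE [RHS]mulr1.
by rewrite eb e ev_d mul0mx.
Qed.

Lemma pig_fsc (u v : cF) : pig (fsc (u : fs FF L^o) v) = ev u *m (ev v)^T.
Proof.
rewrite /pig /= /Psi (@fextE _ _ _ _ _ _ (supp u)) ?supp_uniq //; last first.
  by move=> h /suppP hc; rewrite fmapE fscE hc scale0r raddf0.
rewrite ev_sum mulmx_suml; apply: eq_bigr => h _.
have -> : fmap (fun=> ev : {linear cF -> V}) (fsc (u : fs FF L^o) v) h = (u h : L) *: ev v by rewrite -linearZ.
by rewrite linearZ /= /outer -scalemxAl.
Qed.

Lemma pig_d w : pig (cd G w) = 0.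
Proof.
have e1 : fmap (fun=> ev : {linear cF -> V}) (cd G w) = dX (@binc L FF) (fmap (fun=> ev : {linear cF -> V}) w) + fmap (fun=> ev : {linear cF -> V}) (sd w).
  by rewrite dX_fmap; exact: raddfD.
have e2 : fmap (fun=> ev : {linear cF -> V}) (sd w) = 0.
  by apply: fs_eq => g; rewrite fmapE sdE linearZ /= ev_d scaler0.
by rewrite /pig [LHS]/= e1 e2 addr0 Psi_dX.
Qed.

Lemma pig_single2 g h a : pig (single g (single h a)) = (a : L) *: (eg g *m (eg h)^T).
Proof. have -> : pig (single g (single h a)) = Psi (single g (ev (single h a))) by rewrite -(@fmap_single L FF cF V (fun=> ev)).
by rewrite Psi_single ev_single linearZ /= -scalemxAr. Qed.

Lemma pig_sw (w : G) : pig (sw (w : fs FF (fs FF L^o)) : G) = (pig w)^T.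
Proof.
pose tr : {linear 'M[L]_2 -> 'M[L]_2} := @transp L 2.
pose f1 : {linear fs FF (fs FF L^o) -> 'M[L]_2} := (pig : {linear fs FF (fs FF L^o) -> 'M[L]_2}) \o @sw L FF FF L^o.
pose f2 : {linear fs FF (fs FF L^o) -> 'M[L]_2} := tr \o (pig : {linear fs FF (fs FF L^o) -> 'M[L]_2}).
apply: (@fs_lin_eq L FF (fs FF L^o) _ f1 f2) => g.
apply: (@fs_lin_eq L FF L^o _ (f1 \o @single L FF (fs FF L^o) g) (f2 \o @single L FF (fs FF L^o) g)) => h a.
rewrite /f1 /f2 /=.
have -> : sw (single g (single h a)) = single h (single g (sgz L (bdeg g * bdeg h) *: a)).
  apply: fs_eq => h'; apply: fs_eq => g'; rewrite swE !singleE.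
  case: (eqVneq g' g) => [->|ng]; case: (eqVneq h' h) => [->|nh]; rewrite ?fs0 ?scaler0 ?singleE ?eqxx ?(negbTE ng) ?(negbTE nh) ?scaler0 //.
rewrite !pig_single2 /transp; have [g0|/eg0 e0] := eqVneq (bdeg g) 0.
  by rewrite g0 mul0r /sgz expr0 scale1r linearZ /= trmx_mul trmxK.
by rewrite e0 linearZ /= trmx_mul trmxK trmx0 mulmx0 !scaler0.
Qed.

(** The sections over D(x_t) of [E] tensored with itself, as matrices. *)
Definition Qsec (t : {set I}) (X : 'M[L]_2) : Prop :=
  forall i, i \in t -> forall x y, loc t ((B i *m X *m (B i)^T) x y).

(** [ev] of one chart coordinate of [U] is one column of [Psi U] in that chart; this ties the kernel
    of [pig] to the kernel of [ev]. *)
Lemma Psi_coord i (U : fs FF V) (u : cF) x : (forall g, u g = (B i *m U g) x 0) ->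
  ev u = col x (Psi U *m (B i)^T).
Proof.
move=> hu; rewrite /Psi (@fextE _ _ _ _ _ _ (supp U)) ?supp_uniq //; last exact: suppP.
have -> : ev u = \sum_(g <- supp U) u g *: eg g.
  rewrite -[LHS]/(ev u) {1}(@fs_decomp L FF L^o u (supp U)) ?supp_uniq //.
    by rewrite raddf_sum; apply: eq_bigr => g _; rewrite -ev_single.
  by move=> g /suppP g0; rewrite hu g0 mulmx0 mxE.
rewrite mulmx_suml; apply/matrixP => y z; rewrite !mxE !summxE; apply: eq_bigr => g _.
by rewrite [z]ord1 mxE hu /= /outer -mulmxA -trmx_mul [RHS]mxE big_ord1 [X in _ = _ * X]mxE mulrC.
Qed.

(** Without components of negative degree, the column of degree 0 consists of closed elements of the
    second factor, and [pig] depends on it alone. *)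
Lemma G_reduce t w : t != finset.set0 -> NG t 0 w -> cd G w = 0 ->
  exists u w', [/\ NG t (0 - 1) u, w = w' + cd G u, NG t 0 w', cd G w' = 0 &
    forall g, bdeg g < 0 -> w' g = 0].
Proof.
move=> tn wN w0; have [|u uN hu] := chase_to (a0 := 0) (NG_good t) wN w0.
  by move=> c c0; apply: NG_step => //; apply/eqP; lia.
exists u, (w - dT u); split=> //.
- by rewrite subrK.
- by apply: (smB (NG_smod t 0)) => //; have := NG_d uN; rewrite subrK.
- have -> : cd G (w - dT u) = cd G w - cd G (cd G u) by exact: raddfB.
  by rewrite w0 cdd subr0.
Qed.

Section Reduced.
Context (t : {set I}) (w : G).
Hypotheses (tn : t != finset.set0) (wN : NG t 0 w) (w0 : cd G w = 0).
Hypothesis wlow : forall g, bdeg g < 0 -> w g = 0.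
Let U : fs FF V := restr (Y := triv V) 0 (fmap (fun=> ev : {linear cF -> V}) w).
Let UE g : U g = if bdeg g == 0 then ev (w g) else 0. Proof. by []. Qed.

Lemma red_closed g : bdeg g = 0 -> cd cF (w g) = 0.
Proof.
move=> gb; have := congr1 (fun f : fs FF cF => f g) w0; rewrite [cd G w]/(dT w) dTE.
rewrite (@dX_ext _ _ _ _ 0) => [|h hg]; last by rewrite wlow // hg gb.
by rewrite raddf0 fs0 add0r gb /sgz expr0 scale1r.
Qed.
Lemma red_E g : Esec t (U g).
Proof.
rewrite UE; case: eqP => [gb|_]; last exact: (sm0 (Esec_smod B t)).
apply: ev_E => //; last exact: red_closed.
by have := wN g; rewrite gb subrr.
Qed.
Lemma red_dX : dX (@binc L FF) U = 0.
Proof.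
apply: fs_eq => h; have [h1|h1] := eqVneq (bdeg h) 1; last first.
  by rewrite (@dX_deg _ _ _ _ 0) // => g /negbTE g0; rewrite UE g0.
rewrite (@dX_ext _ _ _ U (fmap (fun=> ev : {linear cF -> V}) w)) => [|g]; last first.
  by rewrite h1 subrr UE => ->; rewrite eqxx.
rewrite dX_fmap fmapE; have := congr1 (fun f : fs FF cF => f h) w0; rewrite [cd G w]/(dT w) dTE fs0.
by move=> /eqP; rewrite addr_eq0 => /eqP ->; rewrite raddfN /= linearZ /= ev_d scaler0 oppr0.
Qed.
Lemma red_pig : pig w = Psi U.
Proof.
rewrite /pig /= /Psi (@fextE _ _ _ _ _ _ (supp w)) ?supp_uniq //; last by move=> g /suppP g0; rewrite fmapE g0 raddf0.
rewrite (@fextE _ _ _ _ _ _ (supp w)) ?supp_uniq //; last first.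
  by move=> g /suppP g0; rewrite UE g0 raddf0 if_same.
apply: eq_bigr => g _; rewrite UE fmapE; case: eqP => [//|/eqP/eg0 e].
by rewrite /= /outer e !mul0mx.
Qed.
Lemma red_coord i x : i \in t -> exists2 u : cF, NFt t 0 u /\ cd cF u = 0 & forall g, u g = (B i *m U g) x 0.
Proof.
move=> it.
pose co : {linear V -> L^o} := (@coordc L r x \o @mulc L r 2 (B i)).
exists (fmap (fun=> co) U) => //; split.
  apply: NFtP => g; first by move=> /negbTE gb; rewrite fmapE UE gb raddf0.
  by have [_ h] := red_E g; exact: h.
by rewrite [cd _ _]dT_triv dX_fmap red_dX raddf0.
Qed.

Lemma red_Q : Qsec t (pig w).
Proof.
move=> i it x y; rewrite red_pig.
have [u [uN u0] hu] := red_coord y it.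
have [_ /(_ i it x)] := ev_E tn uN u0; rewrite (Psi_coord hu).
by rewrite -mulmxA !mxE; congr loc; apply: eq_bigr => z _; rewrite !mxE.
Qed.

(** If [pig w] is 0, every chart coordinate of [U] is in the kernel of [ev], hence a boundary. So
    [Eval_lift] lifts [U], and [chase_mid] starts from this lift. *)
Lemma red_ker : pig w = 0 -> exists2 v, NG t (0 - 1) v & w = cd G v.
Proof.
move=> w00; have /finset.set0Pn[i it] := tn.
have [||||y [cy yN y0 ey]] := @Eval_lift t 0 U i it.
- by move=> g /negbTE gb; rewrite UE gb.
- exact: red_E.
- exact: red_dX.
- move=> u uN u0 [x hx]; apply: ev_ker => //.
  by rewrite (Psi_coord hx) -red_pig w00 mul0mx; apply/matrixP => a b; rewrite !mxE.
apply: (chase_mid (D := k + 1) (a := 0) (v := y) (NG_good t)) => //.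
- exact: FF_ltk.
- by move=> c c0; apply: NG_step => //; apply/eqP; lia.
move=> g gb; apply: ev_ker => //.
- apply: (smB (NFt_smod t 0)); last by apply: (smod_dX (@inS_FF _ _ _ _ _) _ (NFt_smod t 0)).
  by have := wN g; rewrite gb subrr.
- have -> : cd cF (w g - dX (@binc L FF) y g) = cd cF (w g) - cd cF (dX (@binc L FF) y g) by exact: raddfB.
  have -> : cd cF (dX (@binc L FF) y g) = dX (@binc L FF) (fmap (fun=> cd cF) y) g by rewrite dX_fmap.
  have -> : fmap (fun=> cd cF) y = 0 by apply: fs_eq => h; rewrite fmapE y0.
  by rewrite raddf0 subr0 red_closed.
- have -> : ev (w g - dX (@binc L FF) y g) = ev (w g) - ev (dX (@binc L FF) y g) by exact: raddfB.
  have := congr1 (fun f : fs FF V => f g) ey; rewrite fmapE UE gb eqxx => ->; exact: subrr.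
Qed.
End Reduced.

Lemma pig_Q t w : t != finset.set0 -> NG t 0 w -> cd G w = 0 -> Qsec t (pig w).
Proof.
move=> tn wN w0; have [u [w' [uN e w'N w'0 w'l]]] := G_reduce tn wN w0.
rewrite e; have -> : pig (w' + cd G u) = pig w' + pig (cd G u) by exact: raddfD.
by rewrite pig_d addr0; exact: red_Q.
Qed.

Lemma pig_ker t w : t != finset.set0 -> NG t 0 w -> cd G w = 0 -> pig w = 0 ->
  exists2 v, NG t (0 - 1) v & w = cd G v.
Proof.
move=> tn wN w0 pw; have [u [w' [uN e w'N w'0 w'l]]] := G_reduce tn wN w0.
have pw' : pig w' = 0.
  by rewrite -pw e; have -> : pig (w' + cd G u) = pig w' + pig (cd G u) by [exact: raddfD]; rewrite pig_d addr0.
have [v vN ev'] := red_ker tn w'N w'0 w'l pw'.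
exists (v + u); first exact: (smD (NG_smod t _)).
by rewrite e ev'; symmetry; exact: raddfD.
Qed.

(** [X] is the sum of M_xy a_x a_y^T over the columns a_x of [A i], where M = B_i X B_i^T is regular
    over the chart, and each column lifts by [ev_onto]. *)
Lemma pig_onto t X : t != finset.set0 -> Qsec t X -> exists w, [/\ NG t 0 w, cd G w = 0 & pig w = X].
Proof.
move=> tn hX; have /finset.set0Pn[i it] := tn.
have /choice[al hal] : forall x : 'I_r, exists u, [/\ NFt t 0 u, cd cF u = 0 & ev u = col x (A i)].
  move=> x; apply: ev_onto => //; apply: (Esec_one hAB hBA it) => y.
  have -> : (B i *m col x (A i)) y 0 = (B i *m A i) y x by rewrite !mxE; apply: eq_bigr => z _; rewrite !mxE.
  apply: (locS _ (hBA i i y x)); apply/fintype.subsetP => l; by rewrite !inE orbb => /eqP ->.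
pose M := B i *m X *m (B i)^T.
exists (\sum_x \sum_y M x y *: fsc (al x : fs FF L^o) (al y)); split.
- apply: (sm_sum _ (NG_smod t 0)) => x _; apply: (sm_sum _ (NG_smod t 0)) => y _ g.
  rewrite fsZ fscE scalerA; have [hx _ _] := hal x; have [hy _ _] := hal y.
  have [gb|gb] := eqVneq (bdeg g) 0; last first.
    by rewrite (NFt_conc hx gb) mulr0 scale0r; exact: (sm0 (NFt_smod _ _)).
  rewrite gb subrr; apply: NFtZ => //; apply: locM; first exact: hX.
  exact: (NFt_loc g hx).
- have d1 x y : cd G (fsc (al x : fs FF L^o) (al y)) = 0.
    have [_ hx _] := hal x; have [_ hy _] := hal y.
    have e1 : dX (@binc L FF) (fsc (al x : fs FF L^o) (al y)) = 0.
      rewrite (dX_fsc (X := FF)); have -> : dX (@binc L FF) (al x) = 0 by rewrite -hx [cd _ _]dT_triv.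
      by apply: fs_eq => g; rewrite fscE scale0r.
    have e2 : sd (fsc (al x : fs FF L^o) (al y)) = 0.
      apply: fs_eq => g; rewrite sdE fscE.
      have -> : cd cF ((al x g : L) *: al y) = (al x g : L) *: cd cF (al y) by exact: linearZ.
      by rewrite hy !scaler0.
    transitivity (dX (@binc L FF) (fsc (al x : fs FF L^o) (al y)) + sd (fsc (al x : fs FF L^o) (al y))); first by [].
    by rewrite e1 e2 addr0.
  rewrite raddf_sum big1 // => x _; rewrite raddf_sum big1 // => y _.
  transitivity (M x y *: cd G (fsc (al x : fs FF L^o) (al y))); first exact: linearZ.
  by rewrite d1 scaler0.
- rewrite raddf_sum /=.
  transitivity (\sum_x \sum_y M x y *: (col x (A i) *m (col y (A i))^T)).
    apply: eq_bigr => x _; rewrite raddf_sum; apply: eq_bigr => y _.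
    transitivity (M x y *: pig (fsc (al x : fs FF L^o) (al y))); first exact: linearZ.
    rewrite pig_fsc; by have [_ _ ->] := hal x; have [_ _ ->] := hal y.
  have -> : X = A i *m M *m (A i)^T.
    by rewrite /M !mulmxA hAB mul1mx -mulmxA -trmx_mul hAB trmx1 mulmx1.
  apply/matrixP => a b; rewrite summxE !mxE.
  under eq_bigr => x _ do rewrite summxE.
  rewrite exchange_big; apply: eq_bigr => y _; rewrite mxE mulr_suml; apply: eq_bigr => x _.
  by move: (M x y) => q; rewrite !mxE big_ord1 !mxE mulrA [q * _]mulrC.
Qed.

End Square.

(** * The antisymmetric part *)

Section DoubleSwap.
Context (R : fieldType) (X1 X2 X3 : bcx R) (Y : lmodType R).
Lemma sw2E (w : fs X1 (fs X2 (fs X3 Y))) g h p :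
  fmap (fun=> @sw R X1 X3 Y : {linear fs X1 (fs X3 Y) -> fs X3 (fs X1 Y)}) (@sw R X1 X2 (fs X3 Y) w) g h p =
  sgz R (bdeg p * bdeg h) *: (sgz R (bdeg p * bdeg g) *: w p g h).
Proof. by []. Qed.
Lemma sw3E (y : fs X2 (fs X3 (fs X1 Y))) p g h :
  @sw R X2 X1 (fs X3 Y) (fmap (fun=> @sw R X3 X1 Y : {linear fs X3 (fs X1 Y) -> fs X1 (fs X3 Y)}) y) p g h =
  sgz R (bdeg g * bdeg p) *: (sgz R (bdeg h * bdeg p) *: y g h p).
Proof. by []. Qed.
End DoubleSwap.

Lemma telescope4 (Z : zmodType) (a b c e : Z) : a - b = a - c + (e - b) + (c - e).
Proof. by rewrite addrAC [a - c + _]addrA subrK addrA subrK. Qed.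

Section Step.

Context (K : fieldType) (m : nat).
Local Notation S := {mpoly K[m]}.
Local Notation L := {fraction S}.
Local Notation I := 'I_m.
Local Notation inS := (@inS K m).
Local Notation xv := (@xv K m).
Local Notation loc := (@loc K m).
Context (r : nat) (A : I -> 'M[L]_(2, r)) (B : I -> 'M[L]_(r, 2)).
Hypothesis hAB : forall i, A i *m B i = 1%:M.
Hypothesis hBA : forall i j x y, loc [set i; j]%SET ((B j *m A i) x y).
Context (k : int).
Local Notation FF := (FF B k).
Local Notation cF := (cF B k).
Local Notation NF := (@NF K m r B k).

Hypothesis k0 : 0 <= k.
Hypothesis km : k + 1 < m%:Z.
Context (i0 : I).
Local Notation G := (G B k).
Local Notation NG := (@NG K m r B k).
Local Notation pig := (@pig K m r B k i0).
Local Notation Qsec := (Qsec B).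
Local Notation Kp := (kappa xv).

Lemma NG_mono (s t : {set I}) b y : s \subset t -> NG s b y -> NG t b y.
Proof. by move=> st h g g'; have [h1 h2] := h g g'; split=> //; exact: locS st h2. Qed.

Definition tw : G -> G := fun w => sw (w : fs FF (fs FF L^o)).
Fact tw_linear : linear tw.
Proof. by move=> a v w; exact: (linearP (@sw L FF FF L^o)). Qed.
HB.instance Definition _ := GRing.isLinear.Build L G G _ tw tw_linear.

Lemma tw_d w : tw (cd G w) = cd G (tw w).
Proof. by symmetry; exact: (@dT_sw L FF FF (triv L^o) w). Qed.

Lemma NG_tw t b w : NG t b w -> NG t b (tw w).
Proof.
move=> h g g'; rewrite /tw swE; have [h1 h2] := h g' g; split.
  by move=> bg; rewrite h1 ?scaler0 //; apply: contra bg => /eqP bg; apply/eqP; rewrite -bg; lia.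
by apply: locZ => //; rewrite /sgz; exact: inS_sign.
Qed.

(** [N2] admits the empty set, with coefficients in S there; [N1] is the subcomplex of the cochains
    that vanish on it, which sees only the sheaf on projective space. *)
Definition N1 (p : Kp) (b : int) (y : G) : Prop := (p.1 = finset.set0 -> y = 0) /\ NG p.1 b y.
Definition N2 (p : Kp) (b : int) (y : G) : Prop := NG p.1 b y.

Lemma N2_good : good (X := Kp) N2.
Proof.
split.
- by move=> g b; exact: (sm0 (NG_smod B k _ _)).
- by move=> g b; exact: (smB (NG_smod B k _ _)).
- move=> g h b y hy; have [-> |c] := eqVneq (binc g h) 0.
    by rewrite scale0r; exact: (sm0 (NG_smod B k _ _)).
  apply: (smZ (NG_smod B k _ _)); first exact: inS_kainc.
  exact: (NG_mono (kainc_sub c) hy).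
- by move=> g b y hy; exact: NG_d.
Qed.

Lemma N1_good : good (X := Kp) N1.
Proof.
split.
- by move=> g b; split=> //; exact: (good0 N2_good g).
- move=> g b y z [y0 hy] [z0 hz]; split; last exact: (goodB N2_good (g := g)).
  by move=> g0; rewrite y0 // z0 // subrr.
- move=> g h b y [y0 hy]; split; last exact: (@goodZ _ _ _ _ N2_good g h).
  move=> h0; have [-> |c] := eqVneq (binc g h) 0; first by rewrite scale0r.
  rewrite y0 ?scaler0 //; have := kainc_sub c; rewrite h0 => /finset.subset_leqif_cards.
  by move=> hh; apply/eqP; rewrite -finset.subset0 -h0; exact: (kainc_sub c).
- move=> g b y [y0 hy]; split; last exact: NG_d.
  by move=> g0; rewrite y0 // raddf0.
Qed.

Lemma Kp_deg (p : Kp) : bdeg p < m%:Z + 1.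
Proof. case: p => t [i|]; rewrite ?kdegS ?kdegN; have := cards_le_ord (t : {set I}); lia. Qed.

Lemma N1_step j c : j - c != 0 -> step N1 j c.
Proof.
move=> jc; apply: (step_exact N1_good) => p y pc [y0 yN] dy.
have [p0|pn] := eqVneq p.1 finset.set0.
  by exists 0; [exact: (good0 N1_good p)|rewrite raddf0 y0].
have [v vN ->] := G_exact hAB hBA k0 km i0 pn jc yN dy.
by exists v => //; split=> // p0; rewrite p0 eqxx in pn.
Qed.

Definition Jm : 'M[L]_2 := \matrix_(i, j) (if (i == 0) && (j == 1) then 1 else if (i == 1) && (j == 0) then - 1 else 0).
Definition asy (X : 'M[L]_2) : L^o := X 0 1 - X 1 0.
Fact asy_linear : linear asy.
Proof. by move=> a X Y; rewrite /asy !mxE opprD addrACA -mulrBr. Qed.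
HB.instance Definition _ := GRing.isLinear.Build L 'M[L]_2 L^o _ asy asy_linear.
Lemma asyJ X : X - X^T = (asy X : L) *: Jm.
Proof.
apply/matrixP => i j; rewrite !mxE /asy.
have o2 (l : 'I_2) : l = 0 \/ l = 1 by case: l => [[|[|]]] //= p; [left|right]; exact: val_inj.
case: (o2 i) => ->; case: (o2 j) => -> /=; rewrite ?mulr1 ?mulr0 ?subrr //.
by rewrite mulrN1 opprB.
Qed.

Context (delta : L).
Hypothesis hdelta : delta != 0.
Hypothesis hQ : forall t : {set I}, t != finset.set0 -> forall z : L, Qsec t (z *: Jm) <-> loc t (z / delta).

(** The coefficient system of the antisymmetric sections: division by [delta] turns it into that of
    the structure sheaf. *)
Definition Q1 (t : {set I}) (z : L) : Prop := (t = finset.set0 -> z = 0) /\ loc t (z / delta).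

(** Division by [delta] reduces this to [loc_cex]. The bound 2 <= q keeps the primitive, which lives
    on sets of size q - 1, away from the empty set. *)
Lemma Q1_cex (q : int) : 2 <= q -> q < m%:Z -> cex Q1 q.
Proof.
move=> q2 qm c cQ cc c0.
have [||s|b [bl bc hb]] := @loc_cex K m q qm (fun s => c s / delta).
- by move=> s; have [] := cQ s.
- by move=> s sq; rewrite cc // mul0r.
- rewrite /dS; under eq_bigr do rewrite -mulrzAl.
  by rewrite -mulr_suml -/(dS c s) c0 mul0r.
exists (fun s => b s * delta); split.
- move=> s; split; last by rewrite mulfK.
  by move=> s0; rewrite bc ?mul0r // s0 cards0; apply/eqP; lia.
- by move=> s sq; rewrite bc // mul0r.
- move=> s; transitivity (dS b s * delta); last by rewrite hb divfK.
  by rewrite /dS mulr_suml; apply: eq_bigr => i si; rewrite mulrzAl.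
Qed.

Lemma Q1B t z w : Q1 t z -> Q1 t w -> Q1 t (z - w).
Proof.
move=> [z0 hz] [w0 hw]; split; first by move=> t0; rewrite z0 // w0 // subrr.
by rewrite mulrBl; exact: locB.
Qed.
Lemma Q1Z t z w : inS z -> Q1 t w -> Q1 t (z * w).
Proof.
move=> hz [w0 hw]; split; first by move=> t0; rewrite w0 // mulr0.
by rewrite -mulrA; exact: locZ.
Qed.
Lemma Q10 t : Q1 t 0. Proof. by split=> //; rewrite mul0r; exact: loc0. Qed.
Lemma Q1S (s t : {set I}) z : s \subset t -> Q1 s z -> Q1 t z.
Proof.
move=> st [z0 hz]; split; last exact: locS st hz.
by move=> t0; apply: z0; apply/eqP; rewrite -finset.subset0 -t0.
Qed.

Lemma Qsec_antisym (t : {set I}) X : Qsec t X -> Qsec t (X - X^T).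
Proof.
move=> h i it x y.
have subE (P Q : 'M[L]_r) : (P - Q) x y = P x y - Q x y by rewrite !mxE.
have trE (P : 'M[L]_r) : P^T x y = P y x by rewrite mxE.
have e : B i *m X^T *m (B i)^T = (B i *m X *m (B i)^T)^T by rewrite !trmx_mul trmxK mulmxA.
rewrite mulmxBr mulmxBl e subE trE; apply: locB; exact: h.
Qed.
(** Up to a boundary [w] starts in basis degree [j], and its lowest column then gives, by [pig] and
    [asy], a cocycle with values in the line bundle of antisymmetric matrices. This is a coboundary;
    a lift of its primitive bounds the lowest column of [w] minus its exchange up to the kernel of
    [pig], where the tensor square is exact. *)
Lemma step_one (j : int) (w : fs Kp G) : 2 <= j -> j + 1 < m%:Z ->
  inN N1 j w -> dT w = 0 ->
  exists2 v, inN N1 (j - 1) v & w - fmap (fun=> tw : {linear G -> G}) w = dT v.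
Proof.
move=> j2 jm wN w0.
pose T := fmap (fun=> tw : {linear G -> G}) : fs Kp G -> fs Kp G.
have TdT (u : fs Kp G) : T (dT u) = dT (T u) by rewrite /T [RHS](@dT_fmap L Kp G G tw) //; exact: tw_d.
have TB (u v : fs Kp G) : T (u - v) = T u - T v by rewrite /T; exact: raddfB.
have TN b (u : fs Kp G) : inN N1 b u -> inN N1 b (T u).
  move=> h p; have [h1 h2] := h p; split; last exact: NG_tw.
  by move=> p0; rewrite /T fmapE h1 // raddf0.
have [|u uN hu] := chase_to (a0 := j) N1_good wN w0.
  by move=> c cj; apply: N1_step; apply/eqP; lia.
pose w' := w - dT u.
have w'N : inN N1 j w'.
  by apply: (inNB N1_good) => //; have := inN_dT N1_good uN; rewrite subrK.
have w'0 : dT w' = 0.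
  have -> : dT w' = dT w - dT (dT u) by exact: raddfB.
  by rewrite w0 dTdT subr0.
have w'c p : bdeg p = j -> cd G (w' p) = 0.
  move=> pj; have := congr1 (fun f : fs Kp G => f p) w'0; rewrite dTE.
  rewrite (@dX_ext _ _ _ _ 0) => [|h hg]; last by rewrite hu // hg pj; lia.
  by rewrite raddf0 !fs0 add0r => /eqP; rewrite scaler_eq0 (negbTE (sgz_neq0 _ _)) => /eqP.
pose phi : {linear G -> L^o} := asy \o pig.
pose d : fs Kp (triv L^o) := fmap (fun=> phi) (restr j w').
have dE p : d p = if bdeg p == j then asy (pig (w' p)) else 0.
  by rewrite /d fmapE restrE; case: ifP => // _; rewrite raddf0.
have dN : inN (X := Kp) (kN Q1) j d.
  move=> p; rewrite /kN dE; case: (eqVneq (bdeg p) j) => [pj|pj]; last by split=> //; exact: Q10.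
  rewrite pj subrr; split=> //; have [p0 pN] := w'N p; rewrite pj subrr in pN.
  split; first by move=> e; rewrite p0 // !raddf0.
  have [e|pn] := eqVneq (p.1 : {set I}) finset.set0; first by rewrite p0 // !raddf0 mul0r; exact: loc0.
  apply/(hQ pn); rewrite -asyJ; apply: Qsec_antisym.
  by apply: (pig_Q hAB hBA k0 km) => //; exact: w'c.
have dd : dT d = 0.
  rewrite dT_triv; apply: fs_eq => h; have [h1|h1] := eqVneq (bdeg h) (j + 1); last first.
    by rewrite (@dX_deg _ _ _ _ j) // => p /negbTE pj; rewrite dE pj.
  rewrite /d dX_fmap fmapE (@dX_ext _ _ _ (restr j w') w') => [|p]; last first.
    by rewrite h1 addrK restrE => ->; rewrite eqxx.
  have := congr1 (fun f : fs Kp G => f h) w'0; rewrite dTE fs0 => /eqP; rewrite addr_eq0 => /eqP ->.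
  rewrite -scaleNr; have -> : phi (- sgz L (bdeg h) *: cd G (w' h)) = (- sgz L (bdeg h)) *: phi (cd G (w' h)) by exact: linearZ.
  by rewrite /phi /= pig_d raddf0 scaler0.
have [e eN de] : exists2 e, inN (X := Kp) (kN Q1) (j - 1) e & d = dT e.
  apply: (@kappa_exact_at K m Q1) => //; [exact: Q10|exact: Q1B|exact: Q1Z|exact: Q1S| |]; apply: Q1_cex; lia.
(* [y] lifts the primitive [e] from antisymmetric matrices to the tensor square. *)
have [||y hy] := @fs_choice L Kp G (supp e) (fun p y => [/\ bdeg p != j - 1 -> y = 0, N1 p 0 y, cd G y = 0 & pig y = (e p : L) *: Jm]).
2: by move=> p /suppP p0; split=> //; rewrite ?raddf0 ?p0 ?scale0r //; exact: (good0 N1_good p).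
- move=> p; have [ec [e0 eQ]] := eN p.
  have [ep0|epn] := eqVneq (e p : L) 0.
    exists 0; rewrite ep0 scale0r raddf0; split=> //; [exact: (good0 N1_good p)|exact: raddf0].
  have pj : bdeg p = j - 1.
    by apply/eqP; apply: contraNT epn => pj; apply/eqP; apply: ec; rewrite subr_eq0 eq_sym.
  have pn : (p.1 : {set I}) != finset.set0 by apply: contraNneq epn => pe; apply/eqP; exact: e0.
  have /(hQ pn) hJ := eQ.
  have [y [yN y0 py]] := pig_onto hAB hBA k0 km i0 pn hJ.
  by exists y; split=> //; [rewrite pj eqxx|split=> // pe; rewrite pe eqxx in pn].
have cy : conc (j - 1) y by move=> p pj; have [h _ _ _] := hy p; exact: h.
have yN1 : inN N1 (j - 1) y.
  move=> p; have [pj|pj] := eqVneq (bdeg p) (j - 1); last by rewrite cy //; exact: (good0 N1_good p).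
  by rewrite pj subrr; have [] := hy p.
pose u1 := w' - T w'.
have u1N : inN N1 j u1 by apply: (inNB N1_good) => //; exact: TN.
have u10 : dT u1 = 0.
  have -> : dT u1 = dT w' - dT (T w') by exact: raddfB.
  by rewrite -TdT w'0 /T raddf0 subr0.
have [|||||p pj|u2 u2N e2] := @chase_mid L Kp G N1 N1_good (m%:Z + 1) j j u1 y Kp_deg u1N u10.
- by move=> p pj; rewrite /u1 fsB /T fmapE hu // raddf0 subrr.
- by move=> c jc; apply: N1_step; apply/eqP; lia.
- exact: cy.
- by move=> p; rewrite subrr; have [] := hy p.
- by move=> p; have [] := hy p.
- have [pe|pn] := eqVneq (p.1 : {set I}) finset.set0.
    exists 0; first exact: (good0 N1_good p).
    have [u1z _] := u1N p; have [yz _] := inN_dX N1_good yN1 p.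
    by rewrite u1z // yz // subrr raddf0.
  have dyN := inN_dX N1_good yN1; rewrite subrK in dyN.
  have [v vN ev'] : exists2 v, NG p.1 (0 - 1) v & u1 p - dX (@binc L Kp) y p = cd G v.
    apply: (pig_ker hAB hBA k0 km (i0 := i0)) => //.
    + by apply: (smB (NG_smod B k _ _)); [have [_] := u1N p|have [_] := dyN p]; rewrite pj subrr.
    + have -> : cd G (u1 p - dX (@binc L Kp) y p) = cd G (u1 p) - cd G (dX (@binc L Kp) y p) by exact: raddfB.
      have -> : cd G (dX (@binc L Kp) y p) = dX (@binc L Kp) (fmap (fun=> cd G) y) p by rewrite dX_fmap.
      have -> : fmap (fun=> cd G) y = 0 by apply: fs_eq => h; rewrite fmapE; have [] := hy h.
      rewrite raddf0 subr0 /u1 fsB /T fmapE.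
      have -> : cd G (w' p - tw (w' p)) = cd G (w' p) - cd G (tw (w' p)) by exact: raddfB.
      by rewrite -tw_d w'c // raddf0 subrr.
    + have -> : pig (u1 p - dX (@binc L Kp) y p) = pig (u1 p) - pig (dX (@binc L Kp) y p) by exact: raddfB.
      have -> : pig (dX (@binc L Kp) y p) = dX (@binc L Kp) (fmap (fun=> pig : {linear G -> 'M[L]_2}) y) p by rewrite dX_fmap.
      have -> : fmap (fun=> pig : {linear G -> 'M[L]_2}) y = fsc (e : fs Kp L^o) Jm.
        by apply: fs_eq => h; rewrite fmapE fscE; have [] := hy h.
      rewrite (dX_fsc (X := Kp)) fscE -[X in (X : L) *: Jm]/(dX (@binc L Kp) e p).
      have -> : dX (@binc L Kp) e p = d p by rewrite de dT_triv.
      rewrite dE pj eqxx /u1 fsB /T fmapE.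
      have -> : pig (w' p - tw (w' p)) = pig (w' p) - pig (tw (w' p)) by exact: raddfB.
      have -> : pig (tw (w' p)) = (pig (w' p))^T by exact: pig_sw.
      by apply/eqP; rewrite subr_eq0; apply/eqP; exact: asyJ.
  exists v => //; split; last by have -> : j - j - 1 = 0 - 1 by lia.
  by move=> pe; rewrite pe eqxx in pn.
exists (u2 + (u - T u)).
  by apply: (inND N1_good) => //; apply: (inNB N1_good) => //; exact: TN.
have -> : dT (u2 + (u - T u)) = dT u2 + (dT u - dT (T u)).
  have -> : dT (u2 + (u - T u)) = dT u2 + dT (u - T u) by exact: raddfD.
  by congr (_ + _); exact: raddfB.
rewrite -e2 -TdT /u1 /w' TB -/T opprB.
exact: telescope4.
Qed.

(** [tame_tens] is applied twice to [kappa_tame], after exchanges of factors have moved [Kp]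
    innermost; each factor [F] costs [k]. *)
Lemma N2_exact (j : int) : j < m%:Z - 1 - k - k ->
  (forall a : int, a < - k -> relex FF (Y := triv (L^o)) inS (inI predT) a) ->
  exact_at (X := Kp) N2 j.
Proof.
move=> jm base w wN w0.
have t1 := tame_tens i0 (@inS_FF K m r B k) (@FF_deg K m r B k) base (kappa_tame K m).
have t2 := tame_tens i0 (@inS_FF K m r B k) (@FF_deg K m r B k) base t1.
pose sw2 : {linear fs Kp (fs FF L^o) -> fs FF (fs Kp L^o)} := @sw L Kp FF L^o.
pose Phi (w : fs Kp (fs FF (fs FF L^o))) : fs FF (fs FF (fs Kp L^o)) := fmap (fun=> sw2) (@sw L Kp FF (fs FF L^o) w).
pose Y1 : cpx L := tens FF (tens Kp (triv L^o)).
have dPhi : dT (Y := Y1) (Phi w) = 0.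
  rewrite /Phi (@dT_fmap L FF (tens Kp (tens FF (triv L^o))) Y1 sw2); last first.
    by move=> y; symmetry; exact: (@dT_sw L Kp FF (triv L^o) y).
  by rewrite [dT _](@dT_sw L Kp FF cF w) w0 !raddf0.
have loc_sgz t z q : loc t q -> loc t (sgz L z * q).
  by apply: locZ; rewrite /sgz; exact: inS_sign.
have [|y' yN ey] := tm_ex t2 jm (y := Phi w) _ dPhi.
  move=> g h p.
  rewrite /Phi sw2E.
  have [h1 h2] := wN p g h; split.
    move=> nz; rewrite h1 ?scaler0 //; apply: contra nz => /eqP nz; apply/eqP; rewrite -nz; lia.
  exact: (loc_sgz _ _ _ (loc_sgz _ _ _ h2)).
pose sw3 : {linear fs FF (fs Kp L^o) -> fs Kp (fs FF L^o)} := @sw L FF Kp L^o.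
exists (@sw L FF Kp (fs FF L^o) (fmap (fun=> sw3) (y' : fs FF (fs FF (fs Kp L^o))))).
  move=> p g h.
  rewrite sw3E.
  have [h1 h2] := yN g h p; split.
    move=> nz; rewrite h1 ?scaler0 //; apply: contra nz => /eqP nz; apply/eqP; rewrite -nz; lia.
  exact: (loc_sgz _ _ _ (loc_sgz _ _ _ h2)).
rewrite [dT _](@dT_sw L FF Kp cF) (@dT_fmap L FF Y1 (tens Kp (tens FF (triv L^o))) sw3); last first.
  by move=> y; symmetry; exact: (@dT_sw L FF Kp (triv L^o) y).
rewrite -ey /Phi.
have -> : fmap (fun=> sw3) (fmap (fun=> sw2) (@sw L Kp FF (fs FF L^o) w)) = @sw L Kp FF (fs FF L^o) w.
  by apply: fs_eq => g; rewrite !fmapE /= swK.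
by rewrite swK.
Qed.

Lemma cd_fsc (e v : cF) : NF k e -> cd G (fsc (e : fs FF L^o) v) = sgz L k *: fsc (e : fs FF L^o) (cd cF v).
Proof.
move=> eN; have de : cd cF e = 0 by apply: (NF_top (k := k) _ (NF_d eN)); lia.
have e1 : dX (@binc L FF) (fsc (e : fs FF L^o) v) = 0.
  rewrite (dX_fsc (X := FF)); have -> : dX (@binc L FF) e = 0 by rewrite -de [cd cF e]dT_triv.
  by apply: fs_eq => g; rewrite fscE scale0r.
transitivity (dX (@binc L FF) (fsc (e : fs FF L^o) v) + sd (fsc (e : fs FF L^o) v)); first by [].
rewrite e1 add0r; apply: fs_eq => g; rewrite sdE fscE fsZ fscE.
have -> : cd cF ((e g : L) *: v) = (e g : L) *: cd cF v by exact: linearZ.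
have [->//|gk] := eqVneq (bdeg g) k.
by have [e0 _] := eN; rewrite e0 // !scale0r !scaler0.
Qed.

Lemma fsc_NG (a b : int) (e v : cF) : NF a e -> NF b v -> NG finset.set0 (a + b) (fsc (e : fs FF L^o) v).
Proof.
move=> [e0 eS] [v0 vS] g h; rewrite fscE; split.
  move=> nz; have [ga|ga] := eqVneq (bdeg g) a; last by rewrite e0 // scale0r.
  have [hb|hb] := eqVneq (bdeg h) b; last by rewrite fsZ v0 // scaler0.
  by move/eqP: nz; rewrite ga hb; lia.
rewrite fsZ; apply: inS_loc; exact: (inSM (eS g) (vS h)).
Qed.

(** [z] lives at the empty set only, and [dT z] vanishes there, hence is a cocycle in [N1]. It need
    not be a coboundary in [N1], but its antisymmetrization is one, of some [v]. The
    antisymmetrization of [z] minus [v] is then a cocycle to which [N2_exact] applies. *)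
Lemma antisym_bound (e g : cF) (u : I -> cF) : 1 <= k -> 2 * k + 1 < m%:Z -> 2 * k - 1 < m%:Z - 1 - k - k ->
  (forall a : int, a < - k -> relex FF (Y := triv (L^o)) inS (inI predT) a) ->
  NF k e -> NF (k - 1) g -> (forall i, NF k (u i)) -> cd cF g = \sum_i xv i *: u i ->
  exists Gi : I -> G, exists2 G0 : G, (forall i, NG finset.set0 (2 * k - 1) (Gi i)) /\ NG finset.set0 (2 * k - 2) G0 &
    fsc (e : fs FF L^o) g - tw (fsc (e : fs FF L^o) g) = \sum_i xv i *: Gi i + cd G G0.
Proof.
move=> k1 km1 km2 base eN gN uN dg.
(* The sign makes the components at [Some i], mapped by S^m -> S, cancel the boundary of e (x) g,
   which is [sgz L k] times e (x) dg. *)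
pose zf (p : {set I} * option I) : G := if p.1 == finset.set0 then
  (if p.2 is Some i then - (sgz L k *: fsc (e : fs FF L^o) (u i)) else fsc (e : fs FF L^o) g) else 0.
pose z : fs Kp G := fsf zf.
have zE p : z p = zf p by [].
have zN : inN (X := Kp) N2 (2 * k - 1) z.
  move=> [t o]; rewrite zE /zf /=; case: eqP => [t0|_]; last exact: (good0 N2_good (t, o)).
  rewrite /N2 /= t0; case: o => [i|].
    have -> : 2 * k - 1 - bdeg ((finset.set0, Some i) : Kp) = k + k by rewrite kdegS cards0; lia.
    apply: (smN (NG_smod B k _ _)); apply: (smZ (NG_smod B k _ _)); last exact: fsc_NG.
    by rewrite /sgz; exact: inS_sign.
  have -> : 2 * k - 1 - bdeg ((finset.set0, None) : Kp) = k + (k - 1) by rewrite kdegN cards0; lia.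
  exact: fsc_NG.
pose w := dT z.
have wN2 : inN (X := Kp) N2 (2 * k) w.
  by have := inN_dT N2_good zN; have -> : 2 * k - 1 + 1 = 2 * k by lia.
have dS0 (c : {set I} -> G) : dS c finset.set0 = 0 by rewrite /dS big_set0.
have w00 o : w (finset.set0, o) = 0.
  rewrite /w dTE dX_kappaE; case: o => [i|].
    rewrite dS0 add0r zE /zf /= eqxx.
    rewrite -scaleNr; have -> : cd G (- sgz L k *: fsc (e : fs FF L^o) (u i)) = - sgz L k *: cd G (fsc (e : fs FF L^o) (u i)) by exact: linearZ.
    rewrite cd_fsc //; have -> : cd cF (u i) = 0 by apply: (NF_top (k := k) _ (NF_d (uN i))); lia.
    by rewrite raddf0 !scaler0.
  rewrite dS0 add0r cards0 expr0 scale1r kdegN cards0 /sgz expr0 scale1r.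
  rewrite [z (finset.set0, None)]zE /zf /= eqxx cd_fsc // dg.
  have -> : fsc (e : fs FF L^o) (\sum_i xv i *: u i) = \sum_i xv i *: fsc (e : fs FF L^o) (u i).
    rewrite raddf_sum; apply: eq_bigr => i _; exact: linearZ.
  rewrite scaler_sumr -big_split big1 // => i _.
  by rewrite /zf /= eqxx scalerN !scalerA mulrC; exact: addNr.
have wN : inN N1 (2 * k) w.
  move=> [t o]; have h2 := wN2 (t, o); have [t0|tn] := eqVneq (t : {set I}) finset.set0.
    by split=> // _; rewrite t0; exact: w00.
  by split=> // t0; move: tn; rewrite -[t]/((t, o).1) t0 eqxx.
have [||v vN ev'] := step_one _ _ wN (dTdT z); [lia|lia|].
pose T := fmap (fun=> tw : {linear G -> G}) : fs Kp G -> fs Kp G.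
pose Z := z - T z - v.
have ZN : inN (X := Kp) N2 (2 * k - 1) Z.
  apply: (inNB N2_good); last by move=> p; have [] := vN p.
  by apply: (inNB N2_good) => // p; apply: NG_tw; exact: zN.
have dZ : dT Z = 0.
  have -> : dT Z = dT z - dT (T z) - dT v.
    have -> : dT Z = dT (z - T z) - dT v by exact: raddfB.
    by congr (_ - _); exact: raddfB.
  rewrite /T (@dT_fmap L Kp G G tw) -?/w -?ev' ?subrr // => y; exact: tw_d.
have [Z' Z'N eZ] := N2_exact km2 base ZN dZ.
exists (fun i => Z' (finset.set0, Some i)), (Z' (finset.set0, None)).
  split=> [i|].
    have := Z'N (finset.set0, Some i); rewrite /N2 /=.
    by have -> : 2 * k - 1 - 1 - bdeg ((finset.set0, Some i) : Kp) = 2 * k - 1 by rewrite kdegS cards0; lia.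
  have := Z'N (finset.set0, None); rewrite /N2 /=.
  by have -> : 2 * k - 1 - 1 - bdeg ((finset.set0, None) : Kp) = 2 * k - 2 by rewrite kdegN cards0; lia.
(* At this place [v] vanishes, no smaller set contributes, and the map S^m -> S produces the
   combination of the coordinates. *)
have := congr1 (fun f : fs Kp G => f (finset.set0, None)) eZ.
rewrite dTE dX_kappaE dS0 add0r cards0 expr0 scale1r kdegN cards0 /sgz expr0 scale1r => <-.
rewrite /Z !fsB /T fmapE; have [v0 _] := vN (finset.set0, None); rewrite v0 // subr0.
by rewrite zE /zf /= eqxx.
Qed.

End Step.

(** * Minimal generators *)

Lemma fs_lin_comb (R : fieldType) (X : choiceType) (J : finType) (P : pred J) (x : R) (y : fs X R^o)
    (a : J -> R) (F : J -> fs X R^o) h :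
  (x *: y + \sum_(i | P i) a i *: F i) h = x * (y h : R) + \sum_(i | P i) a i * (F i h : R).
Proof. by rewrite fsD fs_sum. Qed.

Section Theorem_A.
Context (K : fieldType) (m : nat).
Local Notation S := {mpoly K[m]}.
Local Notation L := {fraction S}.
Local Notation I := 'I_m.
Local Notation inS := (@inS K m).
Local Notation xv := (@xv K m).
Local Notation loc := (@loc K m).
Context (r : nat) (A : I -> 'M[L]_(2, r)) (B : I -> 'M[L]_(r, 2)).
Hypothesis hAB : forall i, A i *m B i = 1%:M.
Hypothesis hBA : forall i j x y, loc [set i; j]%SET ((B j *m A i) x y).
Local Notation C := (Cc K m).
Local Notation NC := (NC B).
Context (k : int).
Local Notation FF := (FF B k).
Local Notation cF := (cF B k).
Local Notation NF := (@NF K m r B k).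
Local Notation epsF := (epsF B k).

Context (i0 : I).
Hypothesis k1 : 1 <= k.
Hypothesis km : 4 * k + 1 <= m%:Z.
Local Notation G := (G B k).
Local Notation NG := (@NG K m r B k).
Local Notation inm := (@inI K m predT).

Definition Pf (p : FF -> K) : cF -> L^o := fext (fun g : FF => (kc m (p g)) \*: (idfun : {linear L^o -> L^o}) : {linear L^o -> L^o}).
HB.instance Definition _ p := GRing.Linear.on (Pf p).

Lemma PfE p (u : cF) : Pf p u = \sum_(g <- supp u) kc m (p g) * u g.
Proof. by []. Qed.

Lemma inI_sum (J : Type) (s : seq J) (P : pred J) (F : J -> L) : (forall j, P j -> inm (F j)) -> inm (\sum_(j <- s | P j) F j).
Proof.
move=> h; elim/big_ind: _ => //; first exact: inI0.
move=> x y hx hy; rewrite -[y]opprK; apply: inIB => //.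
by rewrite -[- y]sub0r; apply: inIB => //; exact: inI0.
Qed.
Lemma inID (z w : L) : inm z -> inm w -> inm (z + w).
Proof. by move=> hz hw; rewrite -[w]opprK; apply: inIB => //; rewrite -sub0r; apply: inIB => //; exact: inI0. Qed.
Lemma inS_kc c : inS (kc m c). Proof. by eexists. Qed.
Lemma kcB c d : kc m (c - d) = kc m c - kc m d :> L. Proof. by rewrite /kc mpolyCB rmorphB. Qed.
Lemma kcM c d : kc m (c * d) = kc m c * kc m d :> L. Proof. by rewrite /kc mpolyCM rmorphM. Qed.
Lemma kc1 : kc m 1 = 1 :> L. Proof. by rewrite /kc mpolyC1 rmorph1. Qed.
Lemma kc0 : kc m 0 = 0 :> L. Proof. by rewrite /kc mpolyC0 rmorph0. Qed.

Lemma Pf_inm p (u : cF) : (forall g, inm (u g)) -> inm (Pf p u).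
Proof. by move=> h; rewrite PfE; apply: inI_sum => g _; apply: inIM => //; exact: inS_kc. Qed.
Lemma Pf_inS p (u : cF) : (forall g, inS (u g)) -> inS (Pf p u).
Proof. by move=> h; rewrite PfE; apply: inS_sum => g _; apply: inSM => //; exact: inS_kc. Qed.
Lemma Pf_eq0 p b (u : cF) : (forall g, bdeg g != b -> p g = 0) -> (forall g, bdeg g = b -> u g = 0) -> Pf p u = 0.
Proof.
move=> hp hu; rewrite PfE big1 // => g _; have [gb|gb] := eqVneq (bdeg g) b; first by rewrite hu // mulr0.
by rewrite hp // kc0 mul0r.
Qed.

Lemma NF_single (g : FF) : NF (bdeg g) (single g 1).
Proof.
split=> h; rewrite singleE; first by case: (eqVneq h g) => // ->; rewrite eqxx.
by case: ifP => _; [exact: inS1|exact: inS0].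
Qed.

(** Modulo [M0] the elements of degree [b] form a vector space over [K]. In the quotient by a
    submodule maximal among those that contain [M0] and avoid [e], they are all multiples of [e];
    the coordinate along [e], read on the basis of [F], gives the constants [p g]. *)
Lemma functional (b : int) (M0 : cF -> Prop) (e : cF) : Smod M0 ->
  (forall i u, NF b u -> M0 (xv i *: u)) -> NF b e -> ~ M0 e ->
  exists p : FF -> K, [/\ forall g, bdeg g != b -> p g = 0, inm (Pf p e - 1) &
    forall u, NF b u -> M0 u -> inm (Pf p u)].
Proof.
move=> hM0 kill eN eM.
(* The union with [M0] is built into the property because the empty chain has to satisfy it as
   well. *)
pose un (X : set cF) u := M0 u \/ X u.
have [|Amax [[hA nA] mx]] := @Zorn_bigcup cF (fun X => Smod (un X) /\ ~ un X e).
  move=> F FP Ft; have dir (X Y : set cF) : F X -> F Y -> exists Z, [/\ F Z, (X `<=` Z)%classic & (Y `<=` Z)%classic].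
    by move=> FX FY; case: (Ft X Y FX FY) => h; [exists Y|exists X]; split=> // x.
  split.
  - split.
    + by left; exact: (sm0 hM0).
    + have one u : un (\bigcup_(X in F) X)%classic u -> M0 u \/ exists2 X, F X & un X u.
        by case=> [h|[X FX Xu]]; [left|right; exists X => //; right].
      have up X u : F X -> un X u -> un (\bigcup_(X in F) X)%classic u.
        by move=> FX [h|h]; [left|right; exists X].
      move=> y z /one[hy|[X FX Xy]] /one[hz|[Z FZ Zz]].
      * by left; exact: (smB hM0).
      * by apply: (up Z) => //; have [hZ _] := FP _ FZ; apply: (smB hZ) => //; left.
      * by apply: (up X) => //; have [hX _] := FP _ FX; apply: (smB hX) => //; left.
      * have [W [FW XW ZW]] := dir _ _ FX FZ; apply: (up W) => //; have [hW _] := FP _ FW.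
        by apply: (smB hW); [case: Xy => h; [left|right; exact: XW]|case: Zz => h; [left|right; exact: ZW]].
    + move=> s y hs [h|[X FX Xy]]; first by left; exact: (smZ hM0).
      have [hX _] := FP _ FX; case: (smZ hX hs (or_intror Xy : un X y)) => h; [by left|by right; exists X].
  - by case=> [//|[X FX Xe]]; have [_ n] := FP _ FX; apply: n; right.
pose M := un Amax.
have kM u (z : L) : NF b u -> inm z -> M (z *: u).
  move=> uN [c [cS ->]]; rewrite scaler_suml; apply: (sm_sum _ hA) => i _.
  rewrite mulrC -scalerA; apply: (smZ hA) => //; left; exact: kill.
have kcM0 c : c != 0 -> M (kc m c *: e) -> False.
  move=> c0 h; apply: nA; have := smZ hA (inS_kc c^-1) h.
  by rewrite scalerA -kcM mulVf // kc1 scale1r.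
have dec u : NF b u -> exists c, M (u - kc m c *: e).
  move=> uN; have [Mu|nMu] := pselect (M u); first by exists 0; rewrite kc0 scale0r subr0.
  pose Bs : set cF := fun w => exists2 s, inS s & M (w - s *: u).
  have [[s sS Ms]|nBe] := pselect (Bs e).
    have [c hc] := inS_split sS.
    have Mc : M (e - kc m c *: u).
      have -> : e - kc m c *: u = (e - s *: u) + (s - kc m c) *: u.
        by rewrite scalerBl addrA subrK.
      by apply: (smD hA) => //; exact: kM.
    have c0 : c != 0.
      by apply/negP => /eqP c0; apply: nA; move: Mc; rewrite c0 kc0 scale0r subr0.
    exists c^-1; have := smN hA (smZ hA (inS_kc c^-1) Mc).
    by rewrite scalerBr scalerA -kcM mulVf // kc1 scale1r opprB.
  exfalso; have toB w : un Bs w -> Bs w.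
    by case=> // h; exists 0; [exact: inS0|rewrite scale0r subr0; left].
  apply: (mx Bs); last first.
    split; last by move=> /toB.
    split.
    + by left; exact: (sm0 hM0).
    + move=> y z /toB[s sS hs] /toB[s' sS' hs']; right; exists (s - s'); first exact: inSB.
      have -> : y - z - (s - s') *: u = (y - s *: u) - (z - s' *: u) by rewrite scalerBl !opprB (AC (2*2) (1*4*(3*2))).
      exact: (smB hA).
    + move=> s y sS /toB[s' sS' h].
      by right; exists (s * s'); [exact: inSM|rewrite -scalerA -scalerBr; exact: (smZ hA)].
  split=> [|AB].
    by move=> w Aw; exists 0; [exact: inS0|rewrite scale0r subr0; right].
  by apply: nMu; right; apply: AB; exists 1; [exact: inS1|rewrite scale1r subrr; exact: (sm0 hA)].
have /choice[p hp] : forall g : FF, exists c : K, (bdeg g != b -> c = 0) /\ (bdeg g = b -> M (single g 1 - kc m c *: e)).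
  move=> g; have [gb|gb] := eqVneq (bdeg g) b.
    have [|c hc] := dec (single g 1); first by rewrite -gb; exact: NF_single.
    by exists c; split.
  by exists 0; split=> // e1; rewrite e1 eqxx in gb.
have main u : NF b u -> exists2 c, M (u - kc m c *: e) & inm (Pf p u - kc m c).
  move=> [u0 uS]; have /choice[c hc] : forall g, exists c, inm ((u g : L) - kc m c).
    by move=> g; exact: inS_split.
  exists (\sum_(g <- supp u) c g * p g).
    have -> : kc m (\sum_(g <- supp u) c g * p g) = \sum_(g <- supp u) kc m (c g * p g) :> L.
      by rewrite /kc; elim/big_rec2: _ => [|g y x _ <-]; [rewrite mpolyC0 rmorph0|rewrite mpolyCD rmorphD].
    rewrite {1}(fs_split u) scaler_suml -sumrB; apply: (sm_sum _ hA) => g _.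
    have [gb|gb] := eqVneq (bdeg g) b; last first.
      have [p0 _] := hp g; rewrite u0 // p0 // mulr0 kc0 scale0r subr0 raddf0.
      exact: (sm0 hA).
    have -> : single g (u g) - kc m (c g * p g) *: e = ((u g : L) - kc m (c g)) *: single g 1 + kc m (c g) *: (single g 1 - kc m (p g) *: e).
      rewrite scalerBl scalerBr scalerA -kcM addrA subrK; congr (_ - _).
      by rewrite -linearZ /=; congr (single g _); rewrite -[RHS]/(u g * 1) mulr1.
    have [_ /(_ gb) Mg] := hp g.
    apply: (smD hA); last by apply: (smZ hA) => //; exact: inS_kc.
    by apply: kM; [rewrite -gb; exact: NF_single|exact: hc].
  have -> : kc m (\sum_(g <- supp u) c g * p g) = \sum_(g <- supp u) kc m (c g * p g) :> L.
    by rewrite /kc; elim/big_rec2: _ => [|g y x _ <-]; [rewrite mpolyC0 rmorph0|rewrite mpolyCD rmorphD].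
  rewrite PfE -sumrB; apply: inI_sum => g _.
  by rewrite kcM mulrC -mulrBl mulrC; apply: inIM => //; exact: inS_kc.
exists p; split.
- by move=> g gb; have [h _] := hp g; exact: h.
- have [c Mc hc] := main e eN.
  have [c1|c1] := eqVneq (1 - c) 0.
    by move/subr0_eq: c1 => c1; move: hc; rewrite -c1 kc1.
  by case: (kcM0 _ c1); rewrite kcB kc1 scalerBl scale1r.
- move=> u uN Mu; have [c Mc hc] := main u uN.
  have [c0|c0] := eqVneq c 0; first by move: hc; rewrite c0 kc0 subr0.
  case: (kcM0 _ c0); have := smB hA (or_introl Mu : M u) Mc; by rewrite subKr.
Qed.

(** [F] has no generators above degree [k], so F^k modulo [Rb] is its top cohomology. *)
Definition Rb (u : cF) : Prop := exists2 v, NF (k - 1) v & u = cd cF v.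
Lemma Rb_smod : Smod Rb.
Proof.
split.
- by exists 0; [exact: (sm0 (NF_smod B k _))|rewrite raddf0].
- move=> y z [y' hy ->] [z' hz ->]; exists (y' - z'); first exact: (smB (NF_smod B k _)).
  by symmetry; exact: raddfB.
- move=> s y hs [y' hy ->]; exists (s *: y'); first exact: (smZ (NF_smod B k _)).
  by symmetry; exact: linearZ.
Qed.

Lemma NF_top_closed u : NF k u -> cd cF u = 0.
Proof. by move=> uN; apply: (NF_top (k := k) _ (NF_d uN)); lia. Qed.

Lemma Rb_tors : exists N, forall j u, NF k u -> Rb (xv j ^+ N *: u).
Proof.
have /choice[N hN] := fun j => coh_tors hAB hBA j.
exists (\sum_j N j)%N => j u uN.
have c0 : cd C (epsF u) = 0 by rewrite -epsF_d NF_top_closed // raddf0.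
have [||c cN ec] := hN j k (epsF u) _ _ (epsF_N uN) c0; [lia|lia|].
have [||||v [vN dv _]] := F_lift (a := k) (u := xv j ^+ N j *: u) (c := c) _ _ _ cN.
- lia.
- by apply: (smZ (NF_smod B k _)) => //; apply: inSX; exact: inS_xv.
- by rewrite linearZ /= NF_top_closed // scaler0.
- by rewrite -ec linearZ.
have le : (N j <= \sum_j N j)%N by rewrite (bigD1 j) //= leq_addr.
by apply: xvX_smod Rb_smod le _; exists v.
Qed.

Hypothesis nex : ~ forall c : C, NC k c -> cd C c = 0 -> exists2 b, NC (k - 1) b & c = cd C b.

Lemma not_Rb : ~ forall u, NF k u -> Rb u.
Proof.
move=> h; apply: nex => c cN c0.
have [|||||u [uN _ eu]] := F_lift (k := k) (B := B) (a := k + 1) (u := 0) (c := c).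
- lia.
- exact: (sm0 (NF_smod B k _)).
- exact: raddf0.
- by rewrite addrK.
- by rewrite raddf0 c0.
rewrite addrK in uN; have [v vN ev'] := h _ uN.
by exists (epsF v); [exact: epsF_N|rewrite -eu ev' epsF_d].
Qed.

Definition Mk (u : cF) : Prop := exists f : I -> cF, exists2 v : cF, (forall i, NF k (f i)) /\ NF (k - 1) v &
  u = \sum_i xv i *: f i + cd cF v.
Lemma Mk_smod : Smod Mk.
Proof.
split.
- exists (fun=> 0), 0; first by split=> *; exact: (sm0 (NF_smod B k _)).
  by rewrite raddf0 addr0 big1 // => i _; rewrite scaler0.
- move=> y z [f [v [fN vN] ->]] [f' [v' [fN' vN'] ->]]; exists (fun i => f i - f' i), (v - v').
    by split=> *; exact: (smB (NF_smod B k _)).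
  have -> : cd cF (v - v') = cd cF v - cd cF v' by exact: raddfB.
  rewrite opprD addrACA; congr (_ + _); rewrite -sumrB; apply: eq_bigr => i _; by rewrite scalerBr.
- move=> s y hs [f [v [fN vN] ->]]; exists (fun i => s *: f i), (s *: v).
    by split=> *; exact: (smZ (NF_smod B k _)).
  have -> : cd cF (s *: v) = s *: cd cF v by exact: linearZ.
  rewrite scalerDr; congr (_ + _); rewrite scaler_sumr; apply: eq_bigr => i _; by rewrite !scalerA mulrC.
Qed.

(** Nakayama's argument, with J the ideal of the coordinates: if F^k were J F^k + d F^(k-1),
    substituting this into itself would give F^k = d F^(k-1), because a power of J carries F^k into
    the boundaries. *)
Lemma exists_e : exists2 e, NF k e & ~ Mk e.
Proof.
apply: contrapT => h; apply: not_Rb.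
have all u : NF k u -> Mk u.
  by move=> uN; apply: contrapT => nu; apply: h; exists u.
have [N hN] := Rb_tors.
have top u : NF k u -> tors Rb (\sum_(j : I) N) u.
  by move=> uN; apply: (torsP i0 (r := fun=> N) Rb_smod) => j; exact: hN.
have down E : (forall u, NF k u -> tors Rb E.+1 u) -> forall u, NF k u -> tors Rb E u.
  move=> hE u uN; have [f [v [fN vN] ->]] := all u uN.
  apply: (smD (tors_smod E Rb_smod)); last by apply: (tors0 E Rb_smod); exists v.
  by apply: (sm_sum _ (tors_smod E Rb_smod)) => i _; exact: (hE _ (fN i) i).
by move: top; elim: (\sum_(j : I) N)%N => [//|E IH] /down; exact: IH.
Qed.

Lemma inI_choice (b : int) (Aset : {pred I}) (u : cF) : NF b u -> (forall g, inI Aset (u g)) ->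
  exists v : I -> cF, (forall i, NF b (v i)) /\ u = \sum_(i in Aset) xv i *: v i.
Proof.
move=> [u0 uS] hu; have /choice[c hc] := hu.
pose f i (g : FF) : L^o := if u g == 0 then 0 else c g i.
have fsv i : exists s : seq FF, forall g, g \notin s -> f i g = 0.
  by exists (supp u) => g /suppP h; rewrite /f h eqxx.
exists (fun i => fs_mk (fsv i) : cF); split.
  move=> i; split=> g; first by move=> gb; rewrite /= /f u0 // eqxx.
  by rewrite /= /f; case: ifP => _; [exact: inS0|have [h _] := hc g; exact: h].
apply: fs_eq => g; rewrite fs_sum.
have [ug|ug] := eqVneq (u g) 0.
  by rewrite ug big1 // => i _; rewrite fsZ /= /f ug eqxx scaler0.
have [_ ->] := hc g; apply: eq_bigr => i _; by rewrite fsZ /= /f (negbTE ug).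
Qed.

Lemma exists_g : exists g u, [/\ NF (k - 1) g, forall i, NF k (u i), cd cF g = \sum_i xv i *: u i &
  ~ exists v : I -> cF, (forall i, NF (k - 1) (v i)) /\ cd cF g = \sum_i xv i *: cd cF (v i)].
Proof.
apply: contrapT => hno; apply: not_Rb.
pose PA (Aset : {set I}) := forall g, NF (k - 1) g -> (forall h, inI Aset (cd cF g h)) ->
  exists v : I -> cF, (forall i, NF (k - 1) (v i)) /\ cd cF g = \sum_(i in Aset) xv i *: cd cF (v i).
have dN g : NF (k - 1) g -> NF k (cd cF g) by move=> /NF_d; rewrite subrK.
have PT : PA finset.setT.
  move=> g gN hg; apply: contrapT => nv.
  have [u [uN eu]] := inI_choice (dN g gN) hg; apply: hno; exists g, u; split=> //.
    by rewrite eu; apply: eq_bigl => i; rewrite finset.in_setT.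
  move=> [v [vN ev']]; apply: nv; exists v; split=> //; rewrite ev'.
  by apply: eq_bigl => i; rewrite finset.in_setT.
have [N hN] := Rb_tors.
have stepA (Aset : {set I}) j : j \notin Aset -> PA (j |: Aset) -> PA Aset.
  move=> jA PjA g gN hg.
  (* Each round uses [PjA] and cancels [x_j], which is regular modulo the ideal of [Aset]. After [N]
     rounds the factor x_j^N turns the coefficients of the remainder into boundaries. *)
  have claim M : exists v g', [/\ forall i, NF (k - 1) (v i), NF (k - 1) g',
     forall h, inI Aset (cd cF g' h) &
     cd cF g = \sum_(i in Aset) xv i *: cd cF (v i) + xv j ^+ M *: cd cF g'].
    elim: M => [|M [v [g' [vN g'N hg' eg']]]].
      exists (fun=> 0), g; split=> //; first by move=> i; exact: (sm0 (NF_smod B k _)).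
      by rewrite expr0 scale1r big1 ?add0r // => i _; rewrite raddf0 scaler0.
    have [h|v' [v'N ev']] := PjA g' g'N.
      have [c [cS ce]] := hg' h; exists (fun i => if i \in Aset then c i else 0); split.
        by move=> i; case: ifP => // _; exact: inS0.
      by rewrite ce big_setU1 //= (negbTE jA) mulr0 add0r; apply: eq_bigr => i ->.
    exists (fun i => v i + xv j ^+ M *: v' i), (v' j); split; [|exact: v'N| |].
    - move=> i; apply: (smD (NF_smod B k _)) => //; apply: (smZ (NF_smod B k _)) => //.
      by apply: inSX; exact: inS_xv.
    - move=> h; apply: (inI_reg jA); first by have [_] := dN _ (v'N j).
      have -> : xv j * cd cF (v' j) h = cd cF g' h - \sum_(i in Aset) xv i * cd cF (v' i) h.
        have e2 : cd cF g' h = xv j * cd cF (v' j) h + \sum_(i in Aset) xv i * cd cF (v' i) h.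
          transitivity ((xv j *: cd cF (v' j) + \sum_(i in Aset) xv i *: cd cF (v' i)) h).
            by rewrite ev' big_setU1.
          exact: fs_lin_comb.
        by rewrite e2 addrK.
      apply: inIB; first exact: hg'.
      by exists (fun i => cd cF (v' i) h); split=> // i; have [_] := dN _ (v'N i).
    - rewrite eg' {1}ev' big_setU1 //= scalerDr addrCA addrC scalerA -exprSr; congr (_ + _).
      rewrite scaler_sumr -big_split; apply: eq_bigr => i _ /=.
      have -> : cd cF (v i + xv j ^+ M *: v' i) = cd cF (v i) + xv j ^+ M *: cd cF (v' i).
        by rewrite addrC [RHS]addrC; exact: linearP.
      by rewrite [RHS]scalerDr [in RHS]scalerA mulrC -scalerA.
  have [v [g' [vN g'N hg' eg']]] := claim N.
  have [f [fN ef]] := inI_choice (dN g' g'N) hg'.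
  have /choice[q hq] : forall i, exists q, NF (k - 1) q /\ xv j ^+ N *: f i = cd cF q.
    by move=> i; have [q qN eq] := hN j _ (fN i); exists q.
  exists (fun i => v i + q i); split.
    by move=> i; apply: (smD (NF_smod B k _)) => //; have [] := hq i.
  rewrite eg' ef scaler_sumr -big_split; apply: eq_bigr => i _ /=.
  have -> : cd cF (v i + q i) = cd cF (v i) + cd cF (q i) by exact: raddfD.
  by have [_ eq] := hq i; rewrite -eq [RHS]scalerDr [in RHS]scalerA mulrC -scalerA.
have P0 : PA [set i0]%SET.
  have gen q (Aset : {set I}) : i0 \in Aset -> #|~: Aset| = q -> PA Aset.
    elim: q Aset => [|q IH] Aset iA cA.
      have -> : Aset = finset.setT by move/eqP: cA; rewrite cards_eq0 => /eqP cA; rewrite -[Aset]finset.setCK cA finset.setC0.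
      exact: PT.
    have /finset.set0Pn[j] : ~: Aset != finset.set0 by rewrite -card_gt0 cA.
    rewrite inE => jA; apply: (stepA _ j jA); apply: IH; first by rewrite inE iA orbT.
    by move: cA; rewrite (cardsD1 j) inE jA => -[<-]; apply: eq_card => x; rewrite !inE negb_or.
  by apply: (gen _ _ _ erefl); rewrite inE.
(* [P0] takes off one factor [x_i0] at a time. *)
move=> u uN; have := hN i0 u uN; elim: N {hN} => [|N IH]; first by rewrite expr0 scale1r.
move=> [g gN eg']; apply: IH.
have [h|v [vN ev']] := P0 g gN.
  rewrite -eg' fsZ; exists (fun=> xv i0 ^+ N * u h); split.
    by move=> i; apply: inSM; [apply: inSX; exact: inS_xv|have [_] := uN].
  by rewrite big_set1 mulrA -exprS.
exists (v i0) => //; move: ev'; rewrite -eg' big_set1 exprS -scalerA => e.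
exact: (scalerI (xv_neq0 _ i0) e).
Qed.

Lemma contradiction : (forall (e g : cF) (u : I -> cF), NF k e -> NF (k - 1) g -> (forall i, NF k (u i)) ->
   cd cF g = \sum_i xv i *: u i ->
  exists Gi : I -> G, exists2 G0 : G, (forall i, NG finset.set0 (2 * k - 1) (Gi i)) /\ NG finset.set0 (2 * k - 2) G0 &
    fsc (e : fs FF L^o) g - tw (fsc (e : fs FF L^o) g) = \sum_i xv i *: Gi i + cd G G0) -> False.
Proof.
move=> bound.
have [e eN ne] := exists_e.
have [g [u [gN uN dg ng]]] := exists_g.
have [|p [p0 pe pM]] := functional Mk_smod _ eN ne.
  move=> i y yN; exists (fun j => if j == i then y else 0), 0.
    by split=> [j|]; [case: ifP => // _|]; exact: (sm0 (NF_smod B k _)).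
  rewrite raddf0 addr0 (bigD1 i) //= eqxx big1 ?addr0 // => j /negbTE ->; by rewrite scaler0.
pose Mq (y : cF) := exists v : I -> cF, (forall i, NF (k - 1) (v i)) /\ cd cF y = \sum_i xv i *: cd cF (v i).
have Mq_smod : Smod Mq.
  split.
  - exists (fun=> 0); split=> [i|]; first exact: (sm0 (NF_smod B k _)).
    by rewrite raddf0 big1 // => i _; rewrite ?raddf0 ?scaler0.
  - move=> y z [v [vN ev']] [w [wN ew]]; exists (fun i => v i - w i); split=> [i|]; first exact: (smB (NF_smod B k _)).
    have -> : cd cF (y - z) = cd cF y - cd cF z by exact: raddfB.
    rewrite ev' ew -sumrB; apply: eq_bigr => i _; rewrite -scalerBr; congr (_ *: _); symmetry; exact: raddfB.
  - move=> s y sS [v [vN ev']]; exists (fun i => s *: v i); split=> [i|]; first exact: (smZ (NF_smod B k _)).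
    have -> : cd cF (s *: y) = s *: cd cF y by exact: linearZ.
    rewrite ev' scaler_sumr; apply: eq_bigr => i _.
    have -> : cd cF (s *: v i) = s *: cd cF (v i) by exact: linearZ.
    by rewrite !scalerA mulrC.
have [|q [q0 qe qM]] := functional Mq_smod _ gN ng.
  move=> i y yN; exists (fun j => if j == i then y else 0); split=> [j|].
    by case: ifP => // _; exact: (sm0 (NF_smod B k _)).
  rewrite (bigD1 i) //= eqxx big1 ?addr0 => [|j /negbTE ->]; last by rewrite raddf0 scaler0.
  by rewrite linearZ.
have [Gi [G0 [GiN G0N] eq1]] := bound e g u eN gN uN dg.
pose fq : fs FF cF -> cF := fmap (fun=> Pf q : {linear cF -> L^o}).
(* [lam] is p (x) q, with [p] on the outer and [q] on the inner factor. *)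
pose lam (w : G) : L^o := Pf p (fq w).
have lamB v w : lam (v - w) = lam v - lam w.
  rewrite /lam; have -> : fq (v - w) = fq v - fq w by exact: raddfB.
  exact: raddfB.
have lamD v w : lam (v + w) = lam v + lam w.
  rewrite /lam; have -> : fq (v + w) = fq v + fq w by exact: raddfD.
  exact: raddfD.
have lamZ (c : L) w : lam (c *: w) = c * lam w.
  rewrite /lam; have -> : fq (c *: w) = c *: fq w by exact: linearZ.
  exact: linearZ.
have NG_NF b (w : G) h : NG finset.set0 b w -> NF (b - bdeg h) (w h).
  move=> wN; split=> h'; first by move=> hb; apply: (NFt_conc (wN h)).
  by apply: loc_set0; exact: (NFt_loc h' (wN h)).
have lamS b w : NG finset.set0 b w -> inS (lam w).
  move=> wN; apply: Pf_inS => h; apply: Pf_inS => h'; by have [_] := NG_NF _ _ h wN.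
have e1 : lam (fsc (e : fs FF L^o) g) = Pf q g * Pf p e.
  rewrite /lam; have -> : fq (fsc (e : fs FF L^o) g) = (Pf q g : L) *: e.
    apply: fs_eq => h; rewrite /fq fmapE fscE fsZ.
    transitivity ((e h : L) *: Pf q g); [exact: linearZ|exact: mulrC].
  exact: linearZ.
(* The outer factor of the exchanged tensor is [g], of degree k - 1, where [p] is 0. *)
have e2 : lam (tw (fsc (e : fs FF L^o) g)) = 0.
  apply: (Pf_eq0 p0) => h hk; rewrite /fq fmapE.
  rewrite (_ : tw _ h = 0) ?raddf0 //; apply: fs_eq => h'.
  rewrite /tw swE fscE fsZ; have [g0 _] := gN; rewrite g0 ?scaler0 //.
  by rewrite hk; apply/eqP; lia.
have e3 : inm (lam (\sum_i xv i *: Gi i)).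
  have -> : lam (\sum_i xv i *: Gi i) = \sum_i xv i * lam (Gi i).
    elim/big_rec2: _ => [|i y x _ <-]; last by rewrite lamD lamZ.
    by rewrite -(subrr (0 : G)) lamB subrr.
  exists (fun i => lam (Gi i)); split=> // i; exact: lamS (GiN i).
(* Of the two parts of the boundary, the outer one is 0 modulo the coordinates because [p] kills d
   F^(k-1), and the inner one because [q] kills the closed elements of degree k - 1. *)
have e4 : inm (lam (cd G G0)).
  rewrite /lam.
  have -> : fq (cd G G0) = dX (@binc L FF) (fq G0) + fq (sd G0).
    by rewrite /fq dX_fmap; exact: raddfD.
  have -> : Pf p (dX (@binc L FF) (fq G0) + fq (sd G0)) = Pf p (dX (@binc L FF) (fq G0)) + Pf p (fq (sd G0)).
    exact: raddfD.
  have fqS h : inS (fq G0 h).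
    by rewrite /fq fmapE; apply: Pf_inS => h'; have [_] := NG_NF _ _ h G0N.
  apply: inID.
    have rN : NF (k - 1) (restr (Y := triv L^o) (k - 1) (fq G0)).
      split=> h; rewrite restrE; first by move/negbTE ->.
      by case: ifP => // _; exact: inS0.
    have -> : Pf p (dX (@binc L FF) (fq G0)) = Pf p (cd cF (restr (Y := triv L^o) (k - 1) (fq G0))).
      apply/eqP; rewrite -subr_eq0.
      have <- : Pf p (dX (@binc L FF) (fq G0) - cd cF (restr (Y := triv L^o) (k - 1) (fq G0))) = Pf p (dX (@binc L FF) (fq G0)) - Pf p (cd cF (restr (Y := triv L^o) (k - 1) (fq G0))).
        exact: raddfB.
      rewrite (Pf_eq0 p0) // => h hk; rewrite fsB [cd cF _]dT_triv.
      apply/eqP; rewrite subr_eq0; apply/eqP; apply: dX_ext => h' eh'.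
      by rewrite restrE eh' hk eqxx.
    apply: pM; first by have := NF_d rN; rewrite subrK.
    exists (fun=> 0), (restr (Y := triv L^o) (k - 1) (fq G0)).
      by split=> // i; exact: (sm0 (NF_smod B k _)).
    by rewrite big1 ?add0r // => i _; rewrite scaler0.
  apply: Pf_inm => h; rewrite /fq fmapE sdE.
  have e5 : Pf q (sgz L (bdeg h) *: cd cF (G0 h)) = sgz L (bdeg h) * Pf q (cd cF (G0 h)) by exact: linearZ.
  suff h5 : inm (sgz L (bdeg h) * Pf q (cd cF (G0 h))) by exact: (eq_ind_r inm h5 e5).
  apply: inIM; first by rewrite /sgz; exact: inS_sign.
  have dGN := NF_d (NG_NF _ _ h G0N).
  have [hk|hk] := eqVneq (2 * k - 2 - bdeg h + 1) (k - 1); last first.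
    rewrite (Pf_eq0 q0); first exact: inI0.
    by move=> h' hk'; have [d0 _] := dGN; apply: d0; rewrite hk' eq_sym.
  apply: qM; first by rewrite -hk.
  exists (fun=> 0); split=> [i|]; first exact: (sm0 (NF_smod B k _)).
  by rewrite cdd big1 // => i _; rewrite raddf0 scaler0.
have e5 : inm (Pf q g * Pf p e).
  have -> : Pf q g * Pf p e = lam (\sum_i xv i *: Gi i) + lam (cd G G0).
    by rewrite -lamD -eq1 lamB e1 e2 subr0.
  exact: inID.
have qS : inS (Pf q g) by apply: Pf_inS; have [_] := gN.
have := inIB e5 (inIM qS pe); rewrite mulrBr mulr1 subKr => e6.
have := inIB e6 qe; rewrite subKr -kc1 => /kc_inI /eqP; by rewrite oner_eq0.
Qed.
End Theorem_A.

(** * Unique factorization *)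

Section Divisibility.
Context (R : idomainType).
Definition dv (a b : R) := exists c, b = c * a.
Definition isprime (p : R) := [/\ p != 0, p \isn't a GRing.unit & forall a b, dv p (a * b) -> dv p a \/ dv p b].
Definition ufd := forall a : R, a != 0 ->
  exists u s, [/\ u \is a GRing.unit, forall p, p \in s -> isprime p & a = u * \prod_(p <- s) p].

Lemma dv_mull a b c : dv a b -> dv a (c * b).
Proof. by move=> [d ->]; exists (c * d); rewrite mulrA. Qed.
Lemma dv_sum p (J : Type) (r : seq J) (P : pred J) (F : J -> R) : (forall j, P j -> dv p (F j)) -> dv p (\sum_(j <- r | P j) F j).
Proof.
move=> h; elim/big_ind: _ => //; first by exists 0; rewrite mul0r.
by move=> x y [c ->] [d ->]; exists (c + d); rewrite mulrDl.
Qed.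
Lemma dvB p a b : dv p a -> dv p b -> dv p (a - b).
Proof. by move=> [c ->] [d ->]; exists (c - d); rewrite mulrBl. Qed.

Lemma prime_unit p u : isprime p -> u \is a GRing.unit -> ~ dv p u.
Proof. by move=> [_ pu _] uu [c e]; move: uu; rewrite e unitrM (negbTE pu) andbF. Qed.

Lemma prime_prod p s : isprime p -> dv p (\prod_(q <- s) q) -> exists2 q, q \in s & dv p q.
Proof.
move=> hp; elim: s => [|q s IH].
  by rewrite big_nil => h; case: (prime_unit hp (unitr1 R) h).
rewrite big_cons; have [_ _ h] := hp => /h[hq|/IH[q' qs hq']].
  by exists q => //; rewrite inE eqxx.
by exists q' => //; rewrite inE qs orbT.
Qed.

Lemma prime_div_cancel p a u s : isprime p -> u \is a GRing.unit -> (forall q, q \in s -> isprime q) ->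
  p * a = u * \prod_(q <- s) q ->
  exists u' s', [/\ u' \is a GRing.unit, forall q, q \in s' -> isprime q, a = u' * \prod_(q <- s') q & size s = (size s').+1].
Proof.
move=> hp uu hs e; have [p0 pu pr] := hp.
have : dv p (u * \prod_(q <- s) q) by exists a; rewrite -e mulrC.
move=> /pr[/(prime_unit hp uu) //|/(prime_prod hp)[q qs [c ec]]].
have [q0 qu qpr] := hs q qs.
have cu : c \is a GRing.unit.
  have : dv q (c * p) by exists 1; rewrite mul1r.
  move=> /qpr[[d ed]|[d ed]].
    move: ec; rewrite ed -mulrA => /eqP; rewrite -{1}[q]mulr1 mulrCA => /eqP /(mulfI q0) e1.
    by move/negP: pu; case; apply/unitrP; exists d; rewrite [p * d]mulrC e1.
  move: ec; rewrite {1}ed mulrA => /eqP; rewrite -{1}[q]mul1r => /eqP /(mulIf q0) e1.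
  by apply/unitrP; exists d; rewrite [d * c]mulrC -e1.
exists (u * c), (rem q s); split.
- by rewrite unitrM uu.
- by move=> x /mem_rem /hs.
- apply: (mulfI p0); rewrite e (perm_big _ (perm_to_rem qs)) big_cons /= {1}ec.
  by rewrite [c * p]mulrC -!mulrA [RHS]mulrCA.
- by rewrite size_rem // prednK //; case: (s) qs.
Qed.

(** The primes of [c] are removed from f(c) a = g h one by one: none of their images divides [h], so
    each divides the cofactor. *)
Lemma cancel_primes (T : idomainType) (f : {rmorphism R -> T}) (a c g h : _) :
  (forall p, isprime p -> forall x y, (exists z, x * y = z * f p) -> (exists z, x = z * f p) \/ exists z, y = z * f p) ->
  (forall p, isprime p -> f p != 0) ->
  (exists u s, [/\ u \is a GRing.unit, forall p, p \in s -> isprime p & c = u * \prod_(p <- s) p]) ->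
  (forall p, isprime p -> ~ exists z, h = z * f p) -> f c * a = g * h -> exists g', a = g' * h.
Proof.
move=> fpr f0 [u [s [uu hs ->]]] hh; rewrite rmorphM.
have [v vu] : exists v, v * f u = 1 by exists (f u^-1); rewrite -rmorphM mulVr ?rmorph1.
move=> e; have {e} : f (\prod_(p <- s) p) * a = (v * g) * h.
  by rewrite -mulrA -e !mulrA vu mul1r.
elim: s (v * g) hs => [|p s IH] q hs; first by rewrite big_nil rmorph1 mul1r => ->; exists q.
have hp : isprime p by apply: hs; rewrite inE eqxx.
rewrite big_cons rmorphM => e.
have [[z ez]|/(hh p hp) //] := fpr p hp q h ltac:(by exists (f (\prod_(j <- s) j) * a); rewrite -e -mulrA mulrC).
apply: (IH z); first by move=> x xs; apply: hs; rewrite inE xs orbT.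
apply: (mulfI (f0 p hp)); by rewrite mulrA e ez mulrAC mulrC.
Qed.

(** Common primes are divided out of all [b j] as long as there are any, which the number of prime
    factors of [b l] bounds. The last property carries a factor [u] so that it can be used for
    fractions. *)
Lemma ufd_gcd (J : finType) (b : J -> R) (l : J) : ufd -> b l != 0 ->
  exists g, [/\ g != 0, forall j, dv g (b j) & forall u v, v != 0 -> (forall j, dv v (u * b j)) -> dv v (u * g)].
Proof.
move=> U bl; have [u [s [uu hs e]]] := U _ bl.
move: {2}(size s) (erefl (size s)) => n; elim: n b u s uu hs bl e => [|n IH] b u s uu hs bl e sz.
all: have [[p [hp hb]]|no] := pselect (exists p, isprime p /\ forall j, dv p (b j)).
- have := hb l; rewrite e; case: s sz {hs e} => // _ h.
  by case: (prime_unit hp uu); move: h; rewrite big_nil mulr1.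
- exists 1; split; [exact: oner_neq0|by move=> j; exists (b j); rewrite mulr1|].
  move=> x v v0 hv; rewrite mulr1.
  have [w [t [wu ht ev]]] := U v v0.
  have [y ->] : exists y, x = y * \prod_(p <- t) p; last by exists (y * w^-1); rewrite ev mulrA mulrVK.
  have {v v0 hv ev} : forall j, exists z, x * b j = z * \prod_(p <- t) p.
    by move=> j; have [z ->] := hv j; exists (z * w); rewrite ev mulrA.
  elim: t x ht => [|p t IHt] x ht hv; first by exists x; rewrite big_nil mulr1.
  have hp : isprime p by apply: ht; rewrite inE eqxx.
  have [j nj] : exists j, ~ dv p (b j) by apply: contrapT => h; apply: no; exists p; split=> // j; apply: contrapT => nj; apply: h; exists j.
  have [x' ex] : dv p x.
    have [_ _ pr] := hp; have [z ez] := hv j.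
    by case: (pr x (b j)) => //; exists (z * \prod_(i <- t) i); rewrite ez big_cons mulrAC -!mulrA.
  have [|y|y ey] := IHt x'; first by move=> q qt; apply: ht; rewrite inE qt orbT.
    have [z ez] := hv y; exists z; have [p0 _ _] := hp; apply: (mulIf p0).
    by rewrite mulrAC -ex ez big_cons mulrAC -!mulrA.
  by exists y; rewrite ex ey big_cons mulrAC -!mulrA.
- have /choice[b' hb'] := hb.
  have e1 : p * b' l = u * \prod_(q <- s) q by rewrite -e mulrC -hb'.
  have [u' [s' [uu' hs' e' sz']]] := prime_div_cancel hp uu hs e1.
  have bl' : b' l != 0 by apply: contraNneq bl => b0; rewrite hb' b0 mul0r.
  have [|g [g0 gb hg]] := IH b' u' s' uu' hs' bl' e'; first by move: sz; rewrite sz' => -[].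
  have [p0 _ _] := hp.
  exists (g * p); split; first exact: mulf_neq0.
    by move=> j; have [c ec] := gb j; exists c; rewrite hb' ec mulrA.
  move=> x v v0 hv; rewrite mulrA mulrAC; apply: hg => // j; rewrite mulrAC -mulrA -hb'.
  exact: hv.
- exists 1; split; [exact: oner_neq0|by move=> j; exists (b j); rewrite mulr1|].
  move=> x v v0 hv; rewrite mulr1.
  have [w [t [wu ht ev]]] := U v v0.
  have [y ->] : exists y, x = y * \prod_(p <- t) p; last by exists (y * w^-1); rewrite ev mulrA mulrVK.
  have {v v0 hv ev} : forall j, exists z, x * b j = z * \prod_(p <- t) p.
    by move=> j; have [z ->] := hv j; exists (z * w); rewrite ev mulrA.
  elim: t x ht => [|p t IHt] x ht hv; first by exists x; rewrite big_nil mulr1.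
  have hp : isprime p by apply: ht; rewrite inE eqxx.
  have [j nj] : exists j, ~ dv p (b j) by apply: contrapT => h; apply: no; exists p; split=> // j; apply: contrapT => nj; apply: h; exists j.
  have [x' ex] : dv p x.
    have [_ _ pr] := hp; have [z ez] := hv j.
    by case: (pr x (b j)) => //; exists (z * \prod_(i <- t) i); rewrite ez big_cons mulrAC -!mulrA.
  have [|y|y ey] := IHt x'; first by move=> q qt; apply: ht; rewrite inE qt orbT.
    have [z ez] := hv y; exists z; have [p0 _ _] := hp; apply: (mulIf p0).
    by rewrite mulrAC -ex ez big_cons mulrAC -!mulrA.
  by exists y; rewrite ex ey big_cons mulrAC -!mulrA.
Qed.
End Divisibility.

Section PolyUFD.
Context (R : idomainType).
Hypothesis U : ufd R.

Lemma dv_polyC (p : R) (f : {poly R}) : dv p%:P f <-> forall i, dv p f`_i.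
Proof.
split=> [[g ->] i|h]; first by exists g`_i; rewrite coefMC.
have /choice[c hc] := h; exists (\poly_(i < size f) c i).
apply/polyP => i; rewrite coefMC coef_poly; case: ltnP => // si; by rewrite nth_default // mul0r.
Qed.

(** Gauss's lemma: take the lowest coefficients of [f] and of [g] that [p] does not divide. Modulo
    [p], their product is the coefficient of the product at the sum of their indices. *)
Lemma polyC_prime (p : R) : isprime p -> isprime p%:P.
Proof.
move=> [p0 pu pr]; split.
- by rewrite polyC_eq0.
- by rewrite poly_unitE coefC eqxx (negbTE pu) andbF.
- move=> f g /dv_polyC fg; apply: contrapT => /not_orP[nf ng].
  have mini (h : {poly R}) : ~ dv p%:P h -> exists i, ~ dv p h`_i /\ forall j, (j < i)%N -> dv p h`_j.
    move=> nh; have [i ni] : exists i, ~ dv p h`_i.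
      by apply: contrapT => no; apply: nh; apply/dv_polyC => i; apply: contrapT => ni; apply: no; exists i.
    have ex : exists i, `[< ~ dv p h`_i >] by exists i; apply/asboolP.
    exists (ex_minn ex); case: ex_minnP => q /asboolP nq mq; split=> // j jq.
    by apply: contrapT => nj; have := mq j; rewrite leqNgt jq => h1; have := h1 (asboolT nj).
  have [i [ni hi]] := mini f nf; have [j [nj hj]] := mini g ng.
  have : dv p (f`_i * g`_j); last by move=> /pr[].
  have := fg (i + j)%N; rewrite coefM (bigD1 (inord i : 'I_(i + j).+1)) //= inordK ?ltnS ?leq_addr // addKn => h.
  rewrite -[f`_i * _](addrK (\sum_(l < (i + j).+1 | l != inord i) f`_l * g`_(i + j - l))).
  apply: dvB => //; apply: dv_sum => l li.
  have [lt|le] := ltnP l i; first by rewrite mulrC; apply: dv_mull; exact: hi.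
  have lti : (i < l)%N.
    rewrite ltn_neqAle le andbT; apply: contraNneq li => e; apply/eqP/val_inj; by rewrite /= inordK // ltnS leq_addr.
  apply: dv_mull; apply: hj; have := ltn_ord l; lia.
Qed.

Definition prim (f : {poly R}) := forall p, isprime p -> ~ dv p%:P f.

Lemma primitive_part (f : {poly R}) : f != 0 -> exists c f0, [/\ c != 0, prim f0 & f = c%:P * f0].
Proof.
move=> f0; have lf : lead_coef f != 0 by rewrite lead_coef_eq0.
have [u [s [uu hs e]]] := U lf.
move: {2}(size s) (erefl (size s)) => n; elim: n f u s uu hs f0 lf e => [|n IH] f u s uu hs f0 lf e sz.
  exists 1, f; split; rewrite ?oner_neq0 ?mul1r // => p hp /dv_polyC /(_ (size f).-1).
  rewrite -/(lead_coef f) e; case: (s) sz => // _; rewrite big_nil mulr1; exact: prime_unit.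
have [[p [hp [g eg]]]|no] := pselect (exists p, isprime p /\ dv p%:P f); last first.
  by exists 1, f; split; rewrite ?oner_neq0 ?mul1r // => p hp h; apply: no; exists p.
have [p0 _ _] := hp.
have g0 : g != 0 by apply: contraNneq f0 => g0; rewrite eg g0 mul0r.
have e1 : p * lead_coef g = u * \prod_(q <- s) q by rewrite -e eg lead_coefM lead_coefC mulrC.
have [u' [s' [uu' hs' e' sz']]] := prime_div_cancel hp uu hs e1.
have lg : lead_coef g != 0 by rewrite lead_coef_eq0.
have [|c [h [c0 hh eh]]] := IH g u' s' uu' hs' g0 lg e'; first by move: sz; rewrite sz' => -[].
exists (p * c), h; split=> //; first exact: mulf_neq0.
by rewrite eg eh polyCM mulrC mulrA.
Qed.

Lemma cancel_prim (c : R) (f g h : {poly R}) : c != 0 -> prim h -> c%:P * f = g * h -> exists g', f = g' * h.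
Proof.
move=> c0 ph e; apply: (@cancel_primes R _ (@polyC R) f c g h _ _ (U c0) ph e).
  by move=> p /polyC_prime[_ _ pr] x y; exact: pr.
by move=> p [p0 _ _]; rewrite polyC_eq0.
Qed.

Lemma prim_const (f : {poly R}) : prim f -> (size f <= 1)%N -> f != 0 -> f \is a GRing.unit.
Proof.
move=> pf sf f0; have ef := size1_polyC sf.
have a0 : f`_0 != 0 by apply: contraNneq f0 => a0; rewrite ef a0.
have [u [s [uu hs e]]] := U a0; rewrite ef poly_unitE size_polyC a0 coefC eqxx /=.
case: s hs e => [|p s] hs e; first by rewrite e big_nil mulr1.
have hp : isprime p by apply: hs; rewrite inE eqxx.
case: (pf p hp); exists (u * \prod_(q <- s) q)%:P.
by rewrite {1}ef e big_cons -polyCM -mulrA [p * _]mulrC.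
Qed.

(** Let [w] have least size among the nonzero elements of the ideal of [f] and [g]. By
    pseudo-division its primitive part [w1] divides both. As [f] is irreducible, either [w1] is [f]
    up to a unit and [f] divides [g], or [w1] is a unit and [f] divides a constant multiple of [h],
    hence [h]. *)
Lemma irr_prime (f : {poly R}) : prim f -> (1 < size f)%N ->
  (forall g h, f = g * h -> (size g <= 1)%N \/ (size h <= 1)%N) -> isprime f.
Proof.
move=> pf sf irr; have f0 : f != 0 by rewrite -size_poly_gt0 (ltn_trans _ sf).
split=> //.
  by rewrite poly_unitE; case: eqP sf => // ->.
move=> g h [q0 eq0].
have [g0|gn] := eqVneq g 0; first by left; exists 0; rewrite mul0r.
pose P n := `[< exists u v w, [/\ w = u * f + v * g, w != 0 & size w = n] >].
have ex : exists n, P n by exists (size f); apply/asboolP; exists 1, 0, f; rewrite mul1r mul0r addr0.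
case: (ex_minnP ex) => n /asboolP[u [v [w [ew w0 sw]]]] mn.
have lw : lead_coef w != 0 by rewrite lead_coef_eq0.
have wdiv x a b : x = a * f + b * g -> exists N q, (lead_coef w ^+ N)%:P * x = q * w.
  move=> ex'; exists (Pdiv.Idomain.scalp x w), (x %/ w)%R.
  have e := Pdiv.Idomain.divp_eq x w; rewrite mul_polyC e.
  have [->|rn] := eqVneq (x %% w) 0; first by rewrite addr0.
  have := ltn_modpN0 x w0; rewrite sw ltnNge mn //; apply/asboolP.
  exists ((lead_coef w ^+ Pdiv.Idomain.scalp x w)%:P * a - (x %/ w) * u), ((lead_coef w ^+ Pdiv.Idomain.scalp x w)%:P * b - (x %/ w) * v), (x %% w).
  split=> //; move/eqP: e; rewrite addrC -subr_eq => /eqP <-.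
  rewrite -mul_polyC; move: (_%:P) (x %/ w) => c q.
  by rewrite ex' ew !mulrDr !mulrBl !mulrA opprD addrACA.
have [c [w1 [c0 pw ew1]]] := primitive_part w0.
have w1div x a b : x = a * f + b * g -> exists q, x = q * w1.
  move=> /wdiv[N [q e]]; apply: (@cancel_prim (lead_coef w ^+ N) x (q * c%:P) w1) => //.
    exact: expf_neq0.
  by rewrite e ew1 mulrA.
have [s es] := w1div f 1 0 ltac:(by rewrite mul1r mul0r addr0).
have [t et] := w1div g 0 1 ltac:(by rewrite mul1r mul0r add0r).
have w10 : w1 != 0 by apply: contraNneq w0 => e; rewrite ew1 e mulr0.
have [ss|sw1] := irr _ _ es.
  have s0 : s != 0 by apply: contraNneq f0 => e; rewrite es e mul0r.
  have su : s \is a GRing.unit.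
    apply: prim_const => // p hp [z ez]; apply: (pf p hp); exists (z * w1); by rewrite es ez mulrAC.
  left; exists (t * s^-1); by rewrite es -mulrA mulKr.
have wu : w1 \is a GRing.unit by apply: prim_const.
right; apply: (@cancel_prim c h (u * w1^-1 * h + v * w1^-1 * q0) f) => //.
have -> : c%:P * h = w * w1^-1 * h by rewrite ew1 mulrK.
by rewrite ew !mulrDl; congr (_ + _); [rewrite -!mulrA; congr (_ * _); rewrite mulrCA [f * _]mulrC mulrA |rewrite -[RHS]mulrA -eq0 -!mulrA; congr (_ * _); rewrite mulrCA].
Qed.

(** The constant factor splits into primes of [R]. A primitive polynomial either is a product of two
    of smaller positive degree, or is irreducible and then prime. *)
Lemma poly_ufd : ufd {poly R}.
Proof.
move=> f; have [n] := ubnP (size f); elim: n f => // n IH f sf f0.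
have [c [f1 [c0 pf ef]]] := primitive_part f0.
have f10 : f1 != 0 by apply: contraNneq f0 => e; rewrite ef e mulr0.
have sz : size f = size f1 by rewrite ef size_Cmul.
have [u [s [uu hs ec]]] := U c0.
suff [v [t [vu ht e1]]] : exists v t, [/\ v \is a GRing.unit, forall p, p \in t -> isprime p & f1 = v * \prod_(p <- t) p].
  exists (u%:P * v), ([seq p%:P | p <- s] ++ t); split.
  - have u0 : u != 0 by apply: contraTneq uu => ->; rewrite unitr0.
    by rewrite unitrM vu andbT poly_unitE size_polyC u0 coefC eqxx uu.
  - by move=> p; rewrite mem_cat => /orP[/mapP[q /hs /polyC_prime hq ->]|/ht].
  - rewrite ef ec e1 polyCM big_cat /= big_map rmorph_prod /= -!mulrA; congr (_ * _); exact: mulrCA.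
have [s1|s1] := leqP (size f1) 1.
  by exists f1, [::]; split=> //; [exact: prim_const|rewrite big_nil mulr1].
have [[g [h [eg sg sh]]]|no] := pselect (exists g h, [/\ f1 = g * h, (1 < size g)%N & (1 < size h)%N]).
  have g0 : g != 0 by apply: contraNneq f10 => e; rewrite eg e mul0r.
  have h0 : h != 0 by apply: contraNneq f10 => e; rewrite eg e mulr0.
  have ss := size_mul g0 h0; rewrite -eg in ss.
  have [||v [t [vu ht e1]]] := IH g; [lia|by []|].
  have [||v' [t' [vu' ht' e1']]] := IH h; [lia|by []|].
  exists (v * v'), (t ++ t'); split; first by rewrite unitrM vu.
    by move=> p; rewrite mem_cat => /orP[/ht|/ht'].
  by rewrite big_cat /= eg e1 e1' mulrACA.
exists 1, [:: f1]; split; [exact: unitr1| |by rewrite big_seq1 mul1r].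
move=> p; rewrite inE => /eqP ->; apply: irr_prime => // g h e.
have [|sg] := leqP (size g) 1; first by left.
by right; rewrite leqNgt; apply/negP => sh; apply: no; exists g, h.
Qed.
End PolyUFD.

Lemma ufd_iso (R T : idomainType) (f : {rmorphism R -> T}) (g : T -> R) : cancel f g -> cancel g f -> ufd T -> ufd R.
Proof.
move=> fK gK UT a a0.
have fi : injective f := can_inj fK.
have gM x y : g (x * y) = g x * g y by apply: fi; rewrite rmorphM !gK.
have g1 : g 1 = 1 by apply: fi; rewrite gK rmorph1.
have fa0 : f a != 0 by rewrite -(rmorph0 f) (inj_eq fi).
have funit x : (f x \is a GRing.unit) = (x \is a GRing.unit).
  apply/idP/idP => [xu|]; last exact: rmorph_unit.
  by apply/unitrP; exists (g (f x)^-1); split; apply: fi; rewrite rmorphM gK rmorph1 ?mulVr ?mulrV.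
have [u [s [uu hs e]]] := UT _ fa0.
exists (g u), [seq g p | p <- s]; split.
- by rewrite -funit gK.
- move=> p /mapP[q /hs[q0 qu qp] ->]; split.
  + by apply: contraNneq q0 => e0; rewrite -[q]gK e0 rmorph0.
  + by rewrite -funit gK.
  + move=> x y [c ec]; have [|[d ed]|[d ed]] := qp (f x) (f y).
    * by exists (f c); rewrite -rmorphM ec rmorphM gK.
    * by left; exists (g d); apply: fi; rewrite rmorphM !gK.
    * by right; exists (g d); apply: fi; rewrite rmorphM !gK.
- rewrite big_map; apply: fi; rewrite rmorphM rmorph_prod gK e; congr (_ * _).
  by apply: eq_bigr => p _; rewrite gK.
Qed.

Section MpolyUFD.
Context (K : fieldType).

Definition unmuni n (p : {poly {mpoly K[n]}}) : {mpoly K[n.+1]} := (map_poly (@mwiden n K) p).['X_ord_max].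

Lemma muniXw n (j : 'I_n) : muni ('X_(widen_ord (leqnSn n) j) : {mpoly K[n.+1]}) = ('X_j)%:P.
Proof.
rewrite muniE msuppX big_seq1 mcoeffX eqxx scale1r mnm1E.
have -> : (widen_ord (leqnSn n) j == ord_max) = false.
  by apply/eqP => /(congr1 val) /= e; have := ltn_ord j; rewrite e ltnn.
rewrite expr0 alg_polyC; congr (_%:P); congr mpolyX; apply/mnmP => i; rewrite !mnmE.
by congr nat_of_bool; apply/eqP/eqP => [/(congr1 val) /= /val_inj|->].
Qed.
Lemma muniXmax n : muni ('X_ord_max : {mpoly K[n.+1]}) = 'X.
Proof.
rewrite muniE msuppX big_seq1 mcoeffX eqxx scale1r mnm1E eqxx expr1.
have -> : [multinom U_(@ord_max n)%MM (widen_ord (leqnSn n) i) | i < n] = 0%MM.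
  apply/mnmP => i; rewrite !mnmE; case: eqP => // /(congr1 val) /= e.
  by have := ltn_ord i; rewrite -e ltnn.
by rewrite mpolyX0 scale1r.
Qed.

Fact unmuni_zmod n : zmod_morphism (@unmuni n).
Proof. by move=> p q; rewrite /unmuni rmorphB hornerD hornerN. Qed.
Fact unmuni_monoid n : monoid_morphism (@unmuni n).
Proof. by split=> [|p q]; rewrite /unmuni ?rmorph1 ?hornerC // rmorphM hornerM. Qed.
HB.instance Definition _ n := GRing.isZmodMorphism.Build _ _ (@unmuni n) (@unmuni_zmod n).
HB.instance Definition _ n := GRing.isMonoidMorphism.Build _ _ (@unmuni n) (@unmuni_monoid n).

Lemma unmuniC n (a : {mpoly K[n]}) : unmuni a%:P = mwiden a.
Proof. by rewrite /unmuni map_polyC hornerC. Qed.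
Lemma unmuniX n : unmuni ('X : {poly {mpoly K[n]}}) = 'X_ord_max.
Proof. by rewrite /unmuni map_polyX hornerX. Qed.

Lemma widen_lift n (j : 'I_n) : widen_ord (leqnSn n) j = lift ord_max j.
Proof. by apply: val_inj; rewrite /= /bump leqNgt ltn_ord. Qed.

Lemma mpoly_rmorph_eq n (T : comNzRingType) (f g : {rmorphism {mpoly K[n]} -> T}) :
  (forall c, f c%:MP = g c%:MP) -> (forall i, f 'X_i = g 'X_i) -> f =1 g.
Proof.
move=> hc hX p; elim/mpolyind: p => [|c k p _ _ IH]; first by rewrite !rmorph0.
rewrite !rmorphD IH -mul_mpolyC !rmorphM hc; congr (_ * _ + _).
by rewrite mpolyXE_id !rmorph_prod; apply: eq_bigr => i _; rewrite !rmorphXn hX.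
Qed.

Lemma muniK n : cancel (@muni n K) (@unmuni n).
Proof.
apply: (@mpoly_rmorph_eq _ _ (@unmuni n \o @muni n K) idfun) => [c|i] /=.
  by rewrite muniC unmuniC mwidenC.
case: (unliftP ord_max i) => [j ->|->]; last by rewrite muniXmax unmuniX.
by rewrite -widen_lift muniXw unmuniC mwidenX mnmwiden1.
Qed.

Lemma unmuniK n : cancel (@unmuni n) (@muni n K).
Proof.
have h a : muni (mwiden a) = a%:P :> {poly {mpoly K[n]}}.
  apply: (@mpoly_rmorph_eq _ _ (@muni n K \o @mwiden n K) (@polyC {mpoly K[n]})) => [c|i] /=.
    by rewrite mwidenC muniC.
  by rewrite mwidenX mnmwiden1 muniXw.
elim/poly_ind => [|p c IH]; first by rewrite !rmorph0.
by rewrite rmorphD rmorphM /= unmuniX unmuniC rmorphD rmorphM /= h IH muniXmax.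
Qed.

Lemma mpoly_ufd n : ufd {mpoly K[n]}.
Proof.
elim: n => [|n IH].
  move=> a a0; exists a, [::]; split=> //; last by rewrite big_nil mulr1.
  have -> : a = (a@_0)%:MP.
    by apply/mpolyP => k; rewrite mcoeffC (_ : k = 0%MM) ?eqxx ?mulr1 //; apply/mnmP => -[].
  rewrite -mpolyC0 in a0.
  have c0 : a@_0 != 0.
    apply: contraNneq a0 => e; apply/eqP/mpolyP => k; rewrite mcoeffC mul0r (_ : k = 0%MM) ?e //.
    by apply/mnmP => -[].
  by apply/unitrP; exists (a@_0)^-1%:MP; rewrite -!mpolyCM mulVf ?mulfV.
exact: (ufd_iso (@muniK n) (@unmuniK n) (poly_ufd IH)).
Qed.

(** Primes are non-units and so have size at least 2; by degree, the factorization of a variable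
    contains exactly one. *)
Lemma X_prime n (i : 'I_n) : isprime ('X_i : {mpoly K[n]}).
Proof.
have X0 : ('X_i : {mpoly K[n]}) != 0 by exact: X_neq0.
have [u [s [uu hs e]]] := mpoly_ufd X0.
have unit1 (a : {mpoly K[n]}) : a != 0 -> (msize a <= 1)%N -> a \is a GRing.unit.
  move=> a0 /msize1_polyC ea; rewrite ea mpolyC_eq0 in a0.
  by apply/unitrP; exists (a@_0)^-1%:MP; rewrite ea mcoeffC eqxx mulr1 -!mpolyCM mulVf ?mulfV.
have nz t : (forall p, p \in t -> isprime p) -> \prod_(p <- t) p != 0 :> {mpoly K[n]} /\ (size t < msize (\prod_(p <- t) p : {mpoly K[n]}))%N.
  elim: t => [|p t IH] ht; first by rewrite big_nil msize1 oner_neq0.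
  have [|t0 st] := IH; first by move=> q qt; apply: ht; rewrite inE qt orbT.
  have [p0 pu _] := ht p (mem_head _ _); rewrite big_cons; split; first exact: mulf_neq0.
  rewrite msizeM //=; have : (1 < msize p)%N by rewrite ltnNge; apply: contra pu; exact: unit1.
  move=> mp; have h := leq_add mp st.
  by rewrite -ltnS prednK //; exact: leq_trans _ h.
have u0 : u != 0 by apply: contraTneq uu => ->; rewrite unitr0.
have su : (0 < msize u)%N by rewrite lt0n msize_poly_eq0.
have [t0 st] := nz s hs.
have h : (msize u + msize (\prod_(p <- s) p)).-1 = 2 by rewrite -msizeM // -e msizeX mdeg1.
have [s2|s2] := leqP 2 (size s).
  have h3 := leq_add su (leq_trans (s2 : (2 < (size s).+1)%N) st).
  by move: (h3); rewrite -(ltn_predK h3) h.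
case: s hs e s2 {t0 st h} => [|p [|//]] hs e _.
  rewrite big_nil mulr1 in e; have : ('X_i : {mpoly K[n]}) \is a GRing.unit by rewrite e.
  move=> /unitrP[z [_ hz]]; have z0 : z != 0.
    by apply/eqP => z0; move/eqP: hz; rewrite z0 mulr0 eq_sym oner_eq0.
  have sz : msize z != 0 by rewrite msize_poly_eq0.
  have := congr1 (fun q : {mpoly K[n]} => msize q) hz; rewrite msizeM // msize1 msizeX mdeg1.
  by case: (msize z) sz.
rewrite big_seq1 in e; have [p0 pu pr] := hs p (mem_head _ _).
have nX : ('X_i : {mpoly K[n]}) \isn't a GRing.unit by rewrite e unitrM (negbTE pu) andbF.
split=> //.
move=> a b [c ec]; have /pr[[d ->]|[d ->]] : dv p (a * b) by exists (c * u); rewrite ec e mulrA.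
  by left; exists (d * u^-1); rewrite e mulrA mulrVK.
by right; exists (d * u^-1); rewrite e mulrA mulrVK.
Qed.
End MpolyUFD.

Section FieldIdentities.
Context (F : fieldType).
Add Field Ff : (@ffield F).
Implicit Types a b c d e f g s t u v w x y z : F.

Lemma mulr_exchange x t y z : x * (t * (y * z)) = y * (t * (x * z)).
Proof. by fold_field F; field. Qed.
Lemma mulr_unit_cancel x y w x' y' : w != 0 -> x * y * w * (x' * y' / w) = x * x' * (y * y').
Proof. by move=> /eqP w0; fold_field F; field. Qed.
Lemma div_transfer di dj xe xn ym yf v : di != 0 -> xn != 0 -> yf != 0 -> v != 0 ->
  xn * ym * (dj / di) = xe * yf * v -> di * (xe / xn) = dj * (ym / yf / v).
Proof.
move=> d0 x0 y0 v0 e; apply: (mulIf (mulf_neq0 (mulf_neq0 x0 y0) v0)).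
have -> : di * (xe / xn) * (xn * yf * v) = di * (xe * yf * v).
  by move/eqP: x0 => x0; fold_field F; field.
rewrite -e; move/eqP: x0 => x0; move/eqP: y0 => y0; move/eqP: v0 => v0; move/eqP: d0 => d0.
by fold_field F; field; do ?split.
Qed.
Lemma frac_expand a b c : b != 0 -> c != 0 -> a / b = a * c / (b * c).
Proof. by move=> /eqP b0 /eqP c0; fold_field F; field; split. Qed.
Lemma mul_div_gcd z c g s : s != 0 -> g != 0 -> z * (c * g / s) = c * (z / (s / g)).
Proof. by move=> /eqP b0 /eqP c0; fold_field F; field; split. Qed.
Lemma gcd_denominator t z s g u v c : s != 0 -> g != 0 -> v != 0 ->
  t * (z / s) = u / v -> u * g = c * v -> t * (z / (s / g)) = c.
Proof.
move=> s0 g0 v0 e1 e2; have -> : t * (z / (s / g)) = t * (z / s) * g.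
  by move/eqP: s0 => s0; move/eqP: g0 => g0; fold_field F; field; split.
by rewrite e1 mulrAC e2 mulfK.
Qed.
Lemma cross_denominator t z s a u v c : v != 0 -> t * (z / s) = u / v -> t * (z * (a / s)) = c -> u * a = c * v.
Proof.
move=> v0 e1 <-; have -> : t * (z * (a / s)) = t * (z / s) * a by rewrite -!mulrA [a / s]mulrC.
by rewrite e1 mulrAC divfK.
Qed.
Lemma div_neq0 a b : a != 0 -> b != 0 -> a / b != 0.
Proof. by move=> a0 b0; rewrite mulf_neq0 ?invr_neq0. Qed.
End FieldIdentities.

Section PrimePowers.
Context (R : idomainType).

Lemma prime_pow_cancel (p q a b : R) N M : isprime p -> ~ dv p q -> q ^+ M * a = p ^+ N * b -> dv (p ^+ N) a.
Proof.
move=> [p0 pu pr] pq; elim: N a b => [|N IH] a b e; first by exists a; rewrite expr0 mulr1.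
have pa : dv p a.
  have : dv p (q ^+ M * a) by exists (p ^+ N * b); rewrite e exprS -mulrA mulrC.
  elim: (M) => [|M' IHM]; first by rewrite expr0 mul1r.
  by rewrite exprS -mulrA => /pr[//|]; exact: IHM.
have [a' ea] := pa; have [c ec] : dv (p ^+ N) a'.
  by apply: (IH _ b); apply: (mulfI p0); rewrite [RHS]mulrA -exprS -e ea mulrCA [p * _]mulrC.
by exists c; rewrite ea ec exprSr mulrA.
Qed.

Lemma prime_pow_split (p a b c : R) N : isprime p -> a * b = p ^+ N * c ->
  exists e f a' b', [/\ a = p ^+ e * a', b = p ^+ f * b' & a' * b' = c].
Proof.
move=> [p0 pu pr]; elim: N a b c => [|N IH] a b c e.
  by exists 0%N, 0%N, a, b; rewrite !expr0 !mul1r; split=> //; rewrite e expr0 mul1r.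
have /pr[[a1 ea]|[b1 eb]] : dv p (a * b) by exists (p ^+ N * c); rewrite e exprS -mulrA mulrC.
  have [|e1 [f1 [a' [b' [ea1 eb1 ec1]]]]] := IH a1 b c.
    by apply: (mulfI p0); rewrite [RHS]mulrA -exprS -e ea mulrCA mulrA.
  by exists e1.+1, f1, a', b'; split=> //; rewrite ea ea1 exprSr mulrAC.
have [|e1 [f1 [a' [b' [ea1 eb1 ec1]]]]] := IH a b1 c.
  by apply: (mulfI p0); rewrite [RHS]mulrA -exprS -e eb mulrC mulrA.
by exists e1, f1.+1, a', b'; split=> //; rewrite eb eb1 exprSr mulrAC.
Qed.
End PrimePowers.

(** * The determinant line of a bundle *)

Section Delta.
Context (K : fieldType) (m : nat).
Local Notation S := {mpoly K[m]}.
Local Notation L := {fraction S}.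
Local Notation I := 'I_m.
Local Notation inS := (@inS K m).
Local Notation xv := (@xv K m).
Local Notation xm := (@xm K m).
Local Notation loc := (@loc K m).
Local Notation "x %:F" := (@tofrac S x).
Hint Resolve xv_neq0 xm_neq0 : core.

Lemma frac_repr (z : L) : exists u v : S, v != 0 /\ z = u%:F / v%:F.
Proof.
elim/quotW: z => x; exists (\n_x), (\d_x); have d0 : \d_x != 0 by exact: denom_ratioP.
split=> //; set z := (X in X = _); have e : z * (\d_x)%:F = (\n_x)%:F.
  rewrite /z; unlock FracField.tofrac; rewrite -[LHS]FracField.pi_mul; apply/eqmodP.
  by rewrite /= FracField.equivfE /FracField.mulf !numden_Ratio ?mulr1 ?mul1r ?oner_eq0 // mulrC.
by rewrite -e mulfK // tofrac_eq0.
Qed.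

Lemma X_ndv (i j : I) : i != j -> ~ dv ('X_i : S) 'X_j.
Proof.
move=> ij [c ec]; have := congr1 (meval (fun l => (l != i)%:R)) ec.
by rewrite rmorphM /= !mevalXU eqxx mulr0 eq_sym ij => /eqP; rewrite oner_eq0.
Qed.

Lemma xvX (i : I) N : xv i ^+ N = ('X_i ^+ N)%:F. Proof. by rewrite rmorphXn. Qed.

Lemma xvX_neq0 (i : I) N : xv i ^+ N != 0.
Proof. by rewrite xvX tofrac_eq0 expf_neq0 // X_neq0. Qed.
Lemma fraction_div_neq0 (a b : L) : a != 0 -> b != 0 -> a / b != 0.
Proof. exact: div_neq0. Qed.

(** [x_i] is prime and does not divide [x_j], so a denominator in [x_i] that a power of [x_j] could
    replace cancels against the numerator. *)
Lemma loc_inter (t : {set I}) (i j : I) z : i != j -> loc (i |: t) z -> loc (j |: t) z -> loc t z.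
Proof.
move=> ij /loc_U1[N [P ha]] /loc_U1[M [Q hb]].
have [a ea] := loc_up (leq_addr Q P) ha; have [b eb] := loc_up (leq_addl P Q) hb.
have e : 'X_j ^+ M * a = 'X_i ^+ N * b.
  by apply: tofrac_inj; rewrite !tofracM -ea -eb !tofracXn; exact: mulr_exchange.
have [c ec] := prime_pow_cancel (X_prime K i) (X_ndv ij) e.
exists (P + Q)%N, c; have xN := xvX_neq0 i N.
by apply: (mulfI xN); rewrite mulrCA ea ec tofracM -xvX mulrC.
Qed.

Lemma xm2 (i j : I) : i != j -> xm [set i; j]%SET = xv i * xv j.
Proof. by move=> ij; rewrite xmU1 ?xm1 // inE. Qed.

(** The numerators of [w] and of its inverse multiply to a monomial in [x_i] and [x_j]; by primality
    each of them is such a monomial times a unit. *)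
Lemma loc_unit2 (i j : I) w : i != j -> w != 0 -> loc [set i; j]%SET w -> loc [set i; j]%SET w^-1 ->
  exists N M e f (v : S), v \is a GRing.unit /\ xv i ^+ N * xv j ^+ M * w = xv i ^+ e * xv j ^+ f * v%:F.
Proof.
move=> ij w0 [N [a ea]] [M [b eb]]; rewrite xm2 // !exprMn in ea eb.
have e : a * b = 'X_i ^+ (N + M) * ('X_j ^+ (N + M) * 1).
  by rewrite mulr1; apply: tofrac_inj; rewrite !tofracM -ea -eb !tofracXn !exprD; exact: mulr_unit_cancel.
have [e1 [f1 [a1 [b1 [ea1 _ e2]]]]] := prime_pow_split (X_prime K i) e.
have [e3 [f3 [a2 [b2 [ea2 _ e4]]]]] := prime_pow_split (X_prime K j) e2.
exists N, N, e1, e3, a2; split; first by apply/unitrP; exists b2; rewrite [b2 * _]mulrC.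
by rewrite ea ea1 ea2 !tofracM !tofracXn mulrA.
Qed.

Lemma tofrac_unit (v : S) : v \is a GRing.unit -> inS (v%:F)^-1.
Proof. by move=> hv; exists v^-1; rewrite rmorphV. Qed.

(** The transition function between the charts [i0] and [j0] is a monomial times a unit, so it
    splits into a part [u] invertible over D(x_i0) and a part [u'] invertible over D(x_j0). The
    common value D = d_i0 u = d_j0 u' serves every chart by [loc_inter]. *)
Lemma glue_delta (d : I -> L) (i0 j0 : I) : i0 != j0 -> (forall i, d i != 0) ->
  (forall i j, loc [set i; j]%SET (d i / d j)) ->
  exists2 D, D != 0 & forall i, loc [set i]%SET (D / d i) /\ loc [set i]%SET (d i / D).
Proof.
move=> ij d0 hd; have w0 : d j0 / d i0 != 0 by exact: div_neq0.
have [||N [M [e [f [v [hv ew]]]]]] := loc_unit2 ij w0; first by rewrite finset.setUC.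
  by rewrite invfM invrK mulrC.
have v0 : v%:F != 0 by rewrite tofrac_eq0; apply: contraTneq hv => ->; rewrite unitr0.
pose u := xv i0 ^+ e / xv i0 ^+ N; pose u' := xv j0 ^+ M / xv j0 ^+ f / v%:F.
have nz := xvX_neq0.
have u0 : u != 0 by exact: fraction_div_neq0 (nz _ _) (nz _ _).
have u'0 : u' != 0 by exact: fraction_div_neq0 (fraction_div_neq0 (nz _ _) (nz _ _)) v0.
have li (t : {set I}) i n : i \in t -> loc t (xv i ^+ n) /\ loc t (xv i ^+ n)^-1.
  move=> it; split; first by apply: inS_loc; apply: inSX; exact: inS_xv.
  by rewrite -exprVn; apply: locX; exact: loc_xvV.
have lu (t : {set I}) : i0 \in t -> loc t u /\ loc t u^-1.
  move=> it; rewrite /u invfM invrK; split; apply: locM; by [case: (li t i0 e it)|case: (li t i0 N it)].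
have lu' (t : {set I}) : j0 \in t -> loc t u' /\ loc t u'^-1.
  move=> it; rewrite /u' !invfM !invrK; split; do ?apply: locM; try by [case: (li t j0 M it)|case: (li t j0 f it)].
    by apply: inS_loc; exact: tofrac_unit.
  by apply: inS_loc; exists v.
have e1 : d i0 * u = d j0 * u' by exact: (@div_transfer L _ _ _ _ _ _ _ (d0 i0) (nz _ _) (nz _ _) v0 ew).
have h i (t := [set i0; i]%SET) (t' := [set j0; i]%SET) z : loc t z -> loc t' z -> loc [set i]%SET z by exact: loc_inter.
have D0 : d i0 * u != 0 by rewrite -[u]invrK; exact: fraction_div_neq0 (d0 i0) (invr_neq0 u0).
exists (d i0 * u) => //.
move=> i; have m0 : i0 \in [set i0; i]%SET by rewrite !inE eqxx.
have m1 : j0 \in [set j0; i]%SET by rewrite !inE eqxx.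
have [ua ub] := lu _ m0; have [ua' ub'] := lu' _ m1.
split; apply: h.
- by rewrite mulrAC; apply: locM.
- by rewrite e1 mulrAC; apply: locM.
- by rewrite invfM mulrA; apply: locM => //; rewrite finset.setUC.
- by rewrite e1 invfM mulrA; apply: locM => //; rewrite finset.setUC.
Qed.

Lemma common_denominator (J : finType) (b : J -> L) :
  exists2 s : S, s != 0 & exists a : J -> S, forall j, b j = (a j)%:F / s%:F.
Proof.
have /choice[u hu] : forall j, exists p : S * S, p.2 != 0 /\ b j = p.1%:F / p.2%:F.
  by move=> j; have [x [y h]] := frac_repr (b j); exists (x, y).
exists (\prod_j (u j).2); first by apply/prodf_neq0 => j _; have [] := hu j.
exists (fun j => (u j).1 * \prod_(l | l != j) (u l).2) => j; have [u0 ->] := hu j.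
have tM (p q : S) : (p * q)%:F = p%:F * q%:F by exact: tofracM.
have -> : \prod_j (u j).2 = (u j).2 * \prod_(l | l != j) (u l).2 by rewrite (bigD1 j).
rewrite !tM; apply: frac_expand; rewrite tofrac_eq0 //.
by apply/prodf_neq0 => l _; have [] := hu l.
Qed.

(** With a common denominator [s], the element is d = s / g for g the gcd of the numerators. The
    factor [u] in [ufd_gcd] makes one [d] serve all localizations. *)
Lemma frac_gcd (J : finType) (b : J -> L) (l : J) : b l != 0 ->
  exists2 d : L, d != 0 & forall (t : {set I}) z, (forall j, loc t (z * b j)) <-> loc t (z / d).
Proof.
move=> bl; have [s s0 [a ea]] := common_denominator b.
have sF : s%:F != 0 by rewrite tofrac_eq0.
have al : a l != 0 by apply: contraNneq bl; rewrite ea => ->; rewrite tofrac0 mul0r.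
have [g [g0 hg gg]] := ufd_gcd (@mpoly_ufd K m) al.
have gF : g%:F != 0 by rewrite tofrac_eq0.
have d0 := fraction_div_neq0 sF gF; exists (s%:F / g%:F) => //.
move=> t z; split=> [h|h j]; last first.
  have [c ec] := hg j; have -> : z * b j = c%:F * (z / (s%:F / g%:F)).
    by rewrite ea ec tofracM; exact: (@mul_div_gcd L z c%:F g%:F s%:F sF gF).
  by apply: locM => //; apply: inS_loc; exists c.
have /choice[N hN] : forall j, exists N, inS (xm t ^+ N * (z * b j)) by [].
pose P := (\sum_j N j)%N; have [u [v [v0 e]]] := frac_repr (xm t ^+ P * (z / s%:F)).
have vF : v%:F != 0 by rewrite tofrac_eq0.
have [|c ec] := gg u v v0.
  move=> j; have le : (N j <= P)%N by rewrite /P (bigD1 j) //= leq_addr.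
  have [c ec] := loc_up le (hN j); exists c; apply: tofrac_inj; rewrite !tofracM.
  by apply: (@cross_denominator L _ z s%:F _ _ _ _ vF e); rewrite -ec ea.
exists P, c; apply: (@gcd_denominator L _ z _ _ _ _ _ sF gF vF e).
by have := congr1 (@tofrac S) ec; rewrite !tofracM.
Qed.

Section BundleDelta.
Context (r : nat) (A : I -> 'M[L]_(2, r)) (B : I -> 'M[L]_(r, 2)).
Hypothesis hAB : forall i, A i *m B i = 1%:M.
Hypothesis hBA : forall i j x y, loc [set i; j]%SET ((B j *m A i) x y).
Local Notation Jm := (@Jm K m).

Lemma Qsec_one i (t : {set I}) X : i \in t -> (forall x y, loc t ((B i *m X *m (B i)^T) x y)) -> Qsec B t X.
Proof.
move=> it h j jt x y.
have -> : B j *m X *m (B j)^T = (B j *m A i) *m ((B i *m X *m (B i)^T) *m (B j *m A i)^T).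
  by rewrite [(B j *m A i)^T]trmx_mul -!mulmxA (mulmxA (A i) (B i)) hAB mul1mx (mulmxA (B i)^T) -trmx_mul hAB trmx1 mul1mx.
have hl a b : loc t ((B j *m A i) a b).
  by apply: (locS _ (hBA i j a b)); apply/fintype.subsetP => l; rewrite !inE => /orP[] /eqP ->.
by do 2?apply: loc_mulmx => //; move=> a b; rewrite mxE.
Qed.

(** In the chart [i], a multiple z of [Jm] is a section iff z times every entry of B_i [Jm] B_i^T is
    regular, so [frac_gcd] gives a local generator. Two of these differ by a unit on the overlap,
    and [glue_delta] applies. *)
Lemma exists_delta (i0 j0 : I) : i0 != j0 -> exists2 delta : L, delta != 0 &
  forall t : {set I}, t != finset.set0 -> forall z : L, Qsec B t (z *: Jm) <-> loc t (z / delta).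
Proof.
move=> ij.
have /choice[d hd] : forall i, exists d : L, d != 0 /\
    forall (t : {set I}) z, (forall p : 'I_r * 'I_r, loc t (z * (B i *m Jm *m (B i)^T) p.1 p.2)) <-> loc t (z / d).
  move=> i; pose b (p : 'I_r * 'I_r) := (B i *m Jm *m (B i)^T) p.1 p.2.
  have [l bl] : exists l, b l != 0.
    apply: contrapT => no; have b0 : B i *m Jm *m (B i)^T = 0.
      apply/matrixP => x y; rewrite [RHS]mxE; apply: contrapT => /eqP h; apply: no; by exists (x, y).
    have : A i *m (B i *m Jm *m (B i)^T) *m (A i)^T = Jm.
      by rewrite -!mulmxA -trmx_mul hAB trmx1 mulmx1 mulmxA hAB mul1mx.
    rewrite b0 mulmx0 mul0mx => /matrixP /(_ 0 1); rewrite !mxE /= => /eqP.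
    by rewrite eq_sym oner_eq0.
  by have [e e0 he] := frac_gcd bl; exists e.
have hQ i (t : {set I}) z : i \in t -> Qsec B t (z *: Jm) <-> loc t (z / d i).
  move=> it; have [_ <-] := hd i.
  have e p : z * (B i *m Jm *m (B i)^T) p.1 p.2 = (B i *m (z *: Jm) *m (B i)^T) p.1 p.2.
    by rewrite -scalemxAr -scalemxAl [RHS]mxE.
  split=> [h p|h]; first by rewrite e; exact: h.
  by apply: (Qsec_one it) => x y; have := h (x, y); rewrite e.
have d0 i : d i != 0 by have [] := hd i.
have hij i j : loc [set i; j]%SET (d i / d j).
  have hi : i \in [set i; j]%SET by rewrite !inE eqxx.
  have hj : j \in [set i; j]%SET by rewrite !inE eqxx orbT.
  apply/(hQ j _ _ hj)/(hQ i _ _ hi); have -> : d i / d i = 1 by exact: (divff (d0 i)).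
  exact: loc1.
have [D D0 hD] := glue_delta ij d0 hij; exists D => // t /finset.set0Pn[i it] z.
have st : [set i]%SET \subset t by rewrite finset.sub1set.
have [h1 h2] := hD i; have {}h1 := locS st h1; have {}h2 := locS st h2.
split=> [/(hQ i _ _ it) h|h].
  have -> : z / D = z / d i * (d i / D) by rewrite mulrA (divfK (d0 i)).
  exact: locM.
apply/(hQ i _ _ it); have -> : z / d i = z / D * (D / d i) by rewrite mulrA (divfK D0).
exact: locM.
Qed.

Lemma middle_exact (k : int) : 1 <= k -> 4 * k + 1 <= m%:Z ->
  (forall (j : int) (c : Cc K m), k < j -> j < m%:Z - 1 - k -> NC B j c -> cd (Cc K m) c = 0 ->
    exists2 b, NC B (j - 1) b & c = cd (Cc K m) b) ->
  forall c : Cc K m, NC B k c -> cd (Cc K m) c = 0 -> exists2 b, NC B (k - 1) b & c = cd (Cc K m) b.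
Proof.
move=> k1 km hC; apply: contrapT => nex.
have m1 : (1 < m)%N by lia.
pose i0 : I := Ordinal (ltnW m1); pose j0 : I := Ordinal m1.
have ij : i0 != j0 by [].
have [delta d0 hQ] := exists_delta ij.
have k0 : 0 <= k by lia.
have km' : k + 1 < m%:Z by lia.
apply: (contradiction hAB hBA i0 k1 km nex) => e g u eN gN uN dg.
apply: (antisym_bound hAB hBA k0 km' i0 d0 hQ) => //; try lia.
by move=> a ak; apply: (FF_relex hAB hBA hC).
Qed.
End BundleDelta.
End Delta.

(** * Homogeneous fractions and prime ideals *)

Section Grading.
Context (K : fieldType) (m : nat).
Local Notation S := {mpoly K[m]}.
Local Notation L := {fraction S}.
Local Notation "x %:F" := (@tofrac S x).
Implicit Types (a b f g : S) (z w : L).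

(* The coaction a |-> sum_d a_d T^d turns statements on homogeneous components
   into statements on coefficients of polynomials in T. *)
Definition hm a : {poly S} := mmap (polyC \o @mpolyC m K) (fun i => ('X_i)%:P * 'X) a.

Lemma hmM a b : hm (a * b) = hm a * hm b.
Proof. exact: rmorphM. Qed.

Lemma hmX (k : 'X_{1..m}) : hm 'X_[k] = ('X_[k])%:P * 'X^(mdeg k).
Proof.
rewrite /hm mmapX /mmap1 mdegE -prodrXr mpolyXE_id rmorph_prod -big_split /=.
by apply: eq_bigr => i _; rewrite exprMn rmorphXn.
Qed.

Lemma coef_hm a d : (hm a)`_d = pihomog mdeg d a.
Proof.
elim/mpolyind: a => [|c k p _ _ IH]; first by rewrite /hm raddf0 coef0 raddf0.
have e1 : (hm (c *: 'X_[k]))`_d = pihomog mdeg d (c *: 'X_[k]).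
  have -> : hm (c *: 'X_[k]) = (c%:MP)%:P * hm 'X_[k] by exact: mmapZ.
  have -> : pihomog mdeg d (c *: 'X_[k]) = c *: pihomog mdeg d 'X_[k] by exact: linearZ.
  rewrite hmX coefCM coefCM coefXn pihomogX eq_sym mul_mpolyC.
  by case: eqP => _; rewrite ?mulr1 ?mulr0.
have -> : hm (c *: 'X_[k] + p) = hm (c *: 'X_[k]) + hm p by exact: raddfD.
have -> : pihomog mdeg d (c *: 'X_[k] + p) = pihomog mdeg d (c *: 'X_[k]) + pihomog mdeg d p by exact: pihomogD.
exact: (etrans (coefD _ _ _) (f_equal2 +%R e1 IH)).
Qed.

Lemma pihomogM d a b : pihomog mdeg d (a * b) = \sum_(i < d.+1) pihomog mdeg i a * pihomog mdeg (d - i) b.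
Proof.
transitivity (hm (a * b))`_d; first by rewrite coef_hm.
rewrite hmM; transitivity (\sum_(i < d.+1) (hm a)`_i * (hm b)`_(d - i)); first exact: coefM.
by apply: eq_bigr => i _; apply: f_equal2; exact: coef_hm.
Qed.

Definition pih (d : int) a : S := if d is Posz e then pihomog mdeg e a else 0.

Lemma pihB d a b : pih d (a - b) = pih d a - pih d b.
Proof. by case: d => e /=; rewrite ?pihomogB ?subrr. Qed.
Lemma pih0 d : pih d 0 = 0.
Proof. by case: d => e //=; rewrite pihomog0. Qed.
Lemma pihD d a b : pih d (a + b) = pih d a + pih d b.
Proof. by case: d => e /=; rewrite ?pihomogD ?addr0. Qed.
Lemma pih_sum d (J : Type) (r : seq J) (F : J -> S) : pih d (\sum_(j <- r) F j) = \sum_(j <- r) pih d (F j).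
Proof. by apply: (big_morph (pih d)); [exact: pihD|exact: pih0]. Qed.
Lemma pih_id d a : pih d (pih d a) = pih d a.
Proof. by case: d => e //=; rewrite pihomog_id. Qed.
Lemma pih_homog (e : nat) a : a \is e.-homog -> pih e a = a.
Proof. exact: pihomog_dE. Qed.
Lemma homog_pih (e : nat) a : pih e a = a -> a \is e.-homog.
Proof. by move=> /= <-; exact: pihomogP. Qed.

Lemma pihM (d : int) (e : nat) a b : b \is e.-homog -> pih (d + e%:Z) (a * b) = pih d a * b.
Proof.
move=> hb; have hbd : hm b = b%:P * 'X^e.
  apply/polyP => i; rewrite coef_hm coefCM coefXn; case: eqP => [->|/eqP ne].
    by rewrite mulr1 pihomog_dE.
  by rewrite mulr0 (pihomog_ne0 _ hb) // eq_sym.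
have key i : pihomog mdeg i (a * b) = if (i < e)%N then 0 else pihomog mdeg (i - e) a * b.
  rewrite -coef_hm hmM hbd mulrA coefMXn; case: ifP => // _.
  by rewrite coefMC coef_hm.
case: d => d; first by rewrite -PoszD /= key ltnNge leq_addl /= addnK.
rewrite NegzE; have [h|h] := leqP d.+1 e.
  have -> : - d.+1%:Z + e%:Z = (e - d.+1)%N%:Z by lia.
  by rewrite -NegzE /= key mul0r ifT //; lia.
have -> : - d.+1%:Z + e%:Z = Negz (d - e) by lia.
by rewrite -NegzE /= mul0r.
Qed.

Lemma pihMl (d : int) (e : nat) a b : b \is e.-homog -> pih (e%:Z + d) (b * a) = b * pih d a.
Proof. by move=> hb; rewrite addrC mulrC (pihM _ _ hb) mulrC. Qed.

(* With ok the nonvanishing of b, resp. b \notin p, these are the homogeneous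
   fractions of degree d, resp. the stalk of O(d) at p. *)
Definition fr (ok : S -> Prop) (d : int) z :=
  exists a b (e : nat), [/\ b \is e.-homog, ok b, pih (d + e%:Z) a = a & z = a%:F / b%:F].

Definition mclosed (ok : S -> Prop) :=
  [/\ ok 1, forall a b, ok a -> ok b -> ok (a * b) & forall a, ok a -> a != 0].

Section Fr.
Context (ok : S -> Prop).
Hypothesis hok : mclosed ok.

Lemma ok_F b : ok b -> b%:F != 0.
Proof. by have [_ _ h] := hok => /h; rewrite tofrac_eq0. Qed.

Lemma homog_fr (d : nat) a : a \is d.-homog -> fr ok d a%:F.
Proof.
have [o1 _ _] := hok; move=> ha; exists a, 1, 0%N; split=> //; first exact: dhomog1.
  by rewrite addr0; exact: pih_homog.
by rewrite tofrac1 divr1.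
Qed.
Lemma fr1 : fr ok 0 1.
Proof. by have := homog_fr (dhomog1 _ _); rewrite tofrac1. Qed.
Lemma fr0 d : fr ok d 0.
Proof.
have [o1 _ _] := hok; exists 0, 1, 0%N; split=> //; first exact: dhomog1.
  by rewrite pih0.
by rewrite tofrac0 mul0r.
Qed.
Lemma frV (d : nat) b : b \is d.-homog -> ok b -> fr ok (- d%:Z) (b%:F)^-1.
Proof.
move=> hb ob; exists 1, b, d; split=> //; last by rewrite tofrac1 mul1r.
by rewrite addrC subrr; apply: pih_homog; exact: dhomog1.
Qed.
Lemma frM d e z w : fr ok d z -> fr ok e w -> fr ok (d + e) (z * w).
Proof.
have [_ oM _] := hok.
move=> [a [b [i [hb ob ha ->]]]] [a' [b' [i' [hb' ob' ha' ->]]]].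
exists (a * a'), (b * b'), (i + i')%N; split; [exact: dhomogM|exact: oM| |by rewrite !tofracM mulf_div].
rewrite PoszD addrACA; move: ha ha'; case: (d + i%:Z) => [j|j] /=; last by move=> <-; rewrite mul0r pih0.
by case: (e + i'%:Z) => [j'|j'] /= ha ha'; [apply: pih_homog; apply: dhomogM; exact: homog_pih|rewrite -ha' mulr0 pih0].
Qed.
Lemma frN d z : fr ok d z -> fr ok d (- z).
Proof.
move=> [a [b [i [hb ob ha ->]]]]; exists (- a), b, i; split=> //; last by rewrite tofracN mulNr.
by rewrite -sub0r pihB pih0 ha.
Qed.
Lemma frD d z w : fr ok d z -> fr ok d w -> fr ok d (z + w).
Proof.
have [_ oM _] := hok.
move=> [a [b [i [hb ob ha ->]]]] [a' [b' [i' [hb' ob' ha' ->]]]].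
exists (a * b' + a' * b), (b * b'), (i + i')%N; split; [exact: dhomogM|exact: oM| |].
  rewrite pihD PoszD addrA (pihM _ _ hb') ha; congr (_ + _).
  by rewrite addrAC (pihM _ _ hb) ha'.
by rewrite tofracD !tofracM; apply: addf_div; exact: ok_F.
Qed.
Lemma frB d z w : fr ok d z -> fr ok d w -> fr ok d (z - w).
Proof. by move=> hz hw; apply: frD => //; exact: frN. Qed.
Lemma fr_sum d (J : Type) (r : seq J) (P : pred J) (F : J -> L) :
  (forall l, P l -> fr ok d (F l)) -> fr ok d (\sum_(l <- r | P l) F l).
Proof. by move=> h; elim/big_ind: _ => //; [exact: fr0|exact: frD]. Qed.
Lemma fr_mulmx d e (p q l : nat) (M : 'M[L]_(p, q)) (N : 'M[L]_(q, l)) :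
  (forall x y, fr ok d (M x y)) -> (forall x y, fr ok e (N x y)) -> forall x y, fr ok (d + e) ((M *m N) x y).
Proof. by move=> hM hN x y; rewrite mxE; apply: fr_sum => z _; exact: frM. Qed.
End Fr.

Lemma frS (ok ok' : S -> Prop) d z : (forall b, ok b -> ok' b) -> fr ok d z -> fr ok' d z.
Proof. by move=> h [a [b [i [hb ob ha e]]]]; exists a, b, i; split=> //; exact: h. Qed.

Definition nz b : Prop := b != 0.
Lemma nz_mclosed : mclosed nz.
Proof. by split=> // [|a b]; [exact: oner_neq0|exact: mulf_neq0]. Qed.

Lemma fr_degree d z (e : nat) a b : fr nz d z -> b \is e.-homog -> b != 0 -> b%:F * z = a%:F -> pih (d + e%:Z) a = a.
Proof.
move=> [a' [b' [i [hb' b0' ha' ->]]]] hb b0 h.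
have b'F : b'%:F != 0 by rewrite tofrac_eq0.
have e1 : a * b' = a' * b.
  by apply: tofrac_inj; rewrite !tofracM -h mulrA divfK // mulrC.
apply: (mulIf b0'); rewrite -(pihM _ _ hb') e1.
by rewrite addrAC (pihM _ _ hb) ha'.
Qed.
End Grading.

Section PrimeIdeals.
Context (K : fieldType) (n : nat).
Local Notation S := {mpoly K[n.+1]}.
Local Notation L := {fraction S}.
Local Notation "x %:F" := (@tofrac S x).

Definition isideal (J : S -> Prop) := [/\ J 0, forall a b, J a -> J b -> J (a - b) & forall r a, J a -> J (r * a)].

Lemma idealD J a b : isideal J -> J a -> J b -> J (a + b).
Proof. by move=> [J0 JB _] ha hb; rewrite -[b]opprK; apply: (JB) => //; rewrite -[- b]sub0r; exact: JB. Qed.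

Record homprime (P : S -> Prop) : Prop := HomPrime {
  hp_ideal : isideal P;
  hp_one : ~ P 1;
  hp_mul : forall a b, P (a * b) -> P a \/ P b;
  hp_homog : forall a d, P a -> P (pihomog mdeg d a);
  hp_rel : exists i : 'I_n.+1, ~ P 'X_i }.

Definition hpred P (h : homprime P) : S -> bool := fun a => `[< P a >].

Section Mk.
Context (P : S -> Prop) (h : homprime P).
Lemma hpred_idealr : idealr_closed (hpred h).
Proof.
have [h0 hB hM] := hp_ideal h; split; [exact/asboolP| |].
  by apply/asboolP; exact: hp_one h.
move=> a u v /asboolP hu /asboolP hv; apply/asboolP.
by apply: (idealD (hp_ideal h)) => //; exact: hM.
Qed.
HB.instance Definition _ := isIdealr.Build S (hpred h) hpred_idealr.
Lemma hpred_prime : prime_idealr_closed (hpred h).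
Proof. by move=> u v /asboolP /(hp_mul h)[hu|hv]; apply/orP; [left|right]; apply/asboolP. Qed.
HB.instance Definition _ := isPrimeIdealrClosed.Build S (hpred h) hpred_prime.
Lemma hpred_homog (f : S) (d : nat) : f \in (hpred h : pred S) -> pihomog mdeg d f \in (hpred h : pred S).
Proof. by move=> /asboolP hf; apply/asboolP; exact: hp_homog. Qed.
Lemma hpred_rel : exists i : 'I_n.+1, 'X_i \notin (hpred h : pred S).
Proof. by have [i hi] := hp_rel h; exists i; apply/asboolP. Qed.
Definition mkproj : proj K n := @ProjPoint K n (hpred h) hpred_homog hpred_rel.
Lemma mkprojE a : (a \in (mkproj : pred S)) <-> P a.
Proof. by split=> [/asboolP|?]; [|apply/asboolP]. Qed.
End Mk.

(** An ideal maximal among those that contain [J] and no power of [f] is prime. As in [functional],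
    the property is imposed on the union with [J] to cover the empty chain. *)
Lemma maximal_avoiding (J : S -> Prop) (f : S) : isideal J -> (forall N, ~ J (f ^+ N)) ->
  exists Q : S -> Prop, [/\ isideal Q, forall a, J a -> Q a, ~ Q f, ~ Q 1 & forall a b, Q (a * b) -> Q a \/ Q b].
Proof.
move=> hJ nJ; pose un (X : set S) a := J a \/ X a.
have [|Amax [[hA nA] mx]] := @Zorn_bigcup S (fun X => isideal (un X) /\ forall N, ~ un X (f ^+ N)).
  move=> F FP Ft; have dir (X Y : set S) : F X -> F Y -> exists Z, [/\ F Z, (X `<=` Z)%classic & (Y `<=` Z)%classic].
    by move=> FX FY; case: (Ft X Y FX FY) => h; [exists Y|exists X]; split=> // x.
  have [J0 JB JM] := hJ; split; last first.
    by move=> N [/nJ//|[X FX Xe]]; have [_ h] := FP _ FX; apply: (h N); right.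
  have up X u : F X -> un X u -> un (\bigcup_(X in F) X)%classic u.
    by move=> FX [h|h]; [left|right; exists X].
  split; first by left.
    move=> a b [ha|[X FX Xa]] [hb|[Y FY Yb]]; first by left; exact: JB.
    - by apply: (up Y) => //; have [[_ h _] _] := FP _ FY; apply: h; [left|right].
    - by apply: (up X) => //; have [[_ h _] _] := FP _ FX; apply: h; [right|left].
    have [Z [FZ XZ YZ]] := dir _ _ FX FY; apply: (up Z) => //; have [[_ h _] _] := FP _ FZ.
    by apply: h; right; [exact: XZ|exact: YZ].
  move=> r a [ha|[X FX Xa]]; first by left; exact: JM.
  by apply: (up X) => //; have [[_ _ h] _] := FP _ FX; apply: h; right.
pose Q := un Amax; have [Q0 QB QM] := hA; exists Q.
have QD a b : Q a -> Q b -> Q (a + b) by exact: idealD.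
have grow a : ~ Q a -> exists N q r, Q q /\ f ^+ N = q + r * a.
  move=> na; apply: contrapT => no.
  pose X : set S := fun b => exists q r, Q q /\ b = q + r * a.
  have QX b : Q b -> X b by move=> hb; exists b, 0; rewrite mul0r addr0.
  have uX b : un X b -> X b by case=> // hb; apply: QX; left.
  apply: (mx X).
    split; first by move=> b hb; apply: QX; right.
    by move=> XA; apply: na; right; apply: XA; exists 0, 1; rewrite add0r mul1r.
  split; last by move=> N /uX[q [r [hq e]]]; apply: no; exists N, q, r.
  split; first by right; exact: QX.
    move=> b c /uX[q [r [hq ->]]] /uX[q' [r' [hq' ->]]]; right; exists (q - q'), (r - r').
    by split; [exact: QB|rewrite mulrBl opprD addrACA].
  move=> s b /uX[q [r [hq ->]]]; right; exists (s * q), (s * r); split; first exact: QM.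
  by rewrite mulrDr mulrA.
split=> //.
- by move=> a; left.
- exact: (nA 1%N).
- exact: (nA 0%N).
move=> a b hab; apply: contrapT => /not_orP[na nb].
have [N [q [r [hq e]]]] := grow _ na; have [N' [q' [r' [hq' e']]]] := grow _ nb.
apply: (nA (N + N')%N); rewrite exprD e e' mulrDl; apply: (QD); first by rewrite mulrC; exact: QM.
by rewrite mulrDr; apply: (QD); [exact: QM|rewrite mulrACA; exact: QM].
Qed.

(** The largest homogeneous ideal inside a prime is prime: if [a] and [b] are not in it, the product
    of their lowest components outside [Q] is, modulo [Q], a component of [a * b]. It is relevant
    because the homogeneous [f] of positive degree is outside [Q]. *)
Lemma homogeneous_core (Q : S -> Prop) (f : S) (d : nat) : isideal Q -> ~ Q 1 -> (forall a b, Q (a * b) -> Q a \/ Q b) ->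
  ~ Q f -> f \is d.-homog -> (0 < d)%N -> homprime (fun a => forall e, Q (pihomog mdeg e a)).
Proof.
move=> idQ Q1 Qp nf hf d0; have [Q0 QB QM] := idQ.
have Qsum (J : Type) (r : seq J) (P : pred J) (F : J -> S) : (forall l, P l -> Q (F l)) -> Q (\sum_(l <- r | P l) F l).
  by move=> h; elim/big_ind: _ => // a b ha hb; exact: idealD.
split.
- split=> [e|a b ha hb e|r a ha e]; first by rewrite pihomog0.
    by rewrite pihomogB; exact: QB.
  by rewrite pihomogM; apply: Qsum => i _; exact: QM.
- by move=> /(_ 0%N); rewrite pihomog_dE ?dhomog1.
- move=> a b hab; apply: contrapT => /not_orP[/existsNP na /existsNP nb].
  have ex c : (exists e, ~ Q (pihomog mdeg e c)) -> exists e, ~ Q (pihomog mdeg e c) /\ forall i, (i < e)%N -> Q (pihomog mdeg i c).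
    move=> [e0 he0]; have [e he mine] := ex_minnP (ex_intro (fun e => `[< ~ Q (pihomog mdeg e c) >]) e0 (asboolT he0)).
    exists e; split; first exact/asboolP.
    move=> i ie; apply: contrapT => /asboolT /mine; rewrite leqNgt ie //.
  have [i [hi li]] := ex _ na; have [j [hj lj]] := ex _ nb.
  have := hab (i + j)%N; rewrite pihomogM.
  have ii : (i < (i + j).+1)%N by rewrite ltnS leq_addr.
  rewrite (bigD1 (Ordinal ii)) //= addKn => hs.
  have : Q (pihomog mdeg i a * pihomog mdeg j b).
    set u := _ * _ in hs *; set v := (X in u + X) in hs; have -> : u = (u + v) - v by rewrite addrK.
    apply: QB => //; apply: Qsum => l ll; have [lti|lti] := ltnP l i.
      by rewrite mulrC; apply: QM; exact: li.
    apply: QM; apply: lj; have li' : (l : nat) != i by apply: contraNneq ll => e; apply/eqP/val_inj.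
    have := ltn_ord l; lia.
  by case/Qp.
- move=> a e ha i; have [->|ne] := eqVneq i e; first by rewrite pihomog_id.
  by rewrite (pihomog_ne0 _ (pihomogP _ e a)) // eq_sym.
- apply: contrapT => no; apply: nf.
  have hX i : Q 'X_i.
    have h : forall e, Q (pihomog mdeg e 'X_i) by apply: contrapT => h; apply: no; exists i.
    by have := h 1%N; rewrite pihomog_dE // dhomogX; apply/eqP; exact: mdeg1.
  have /inIP : forall k, k \in msupp f -> exists2 i, i \in (predT : {pred 'I_n.+1}) & k i != 0%N.
    move=> k kf; apply: contrapT => h; have : mdeg k = d by exact: (dhomog_mf hf kf).
    rewrite mdegE big1 => [d0'|i _].
      by rewrite -d0' in d0.
    by apply: contrapT => /eqP ki; apply: h; exists i.
  move=> [b [hb e]]; have /choice[c hc] : forall i, exists c : S, b i = c%:F by [].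
  have -> : f = \sum_i c i * 'X_i.
    apply: tofrac_inj; rewrite e rmorph_sum /=; apply: eq_bigr => i _.
    by rewrite hc tofracM mulrC.
  by apply: Qsum => i _; exact: QM.
Qed.

(** Otherwise some prime contains [J] but not [f], and its homogeneous core is a point of D(f) that
    [T] does not cover. *)
Lemma cover_power (J T : S -> Prop) (f : S) (d : nat) : isideal J -> f \is d.-homog -> (0 < d)%N ->
  (forall t, T t -> J t /\ exists e, t \is e.-homog) ->
  (forall p : proj K n, f \notin (p : pred S) -> exists2 t, T t & t \notin (p : pred S)) ->
  exists N, J (f ^+ N).
Proof.
move=> hJ hf d0 hT cov; apply: contrapT => no.
have [|Q [hQ JQ nf Q1 Qp]] := @maximal_avoiding J f hJ; first by move=> N h; apply: no; exists N.
pose hp := homogeneous_core hQ Q1 Qp nf hf d0.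
have [|t Tt /negP] := cov (mkproj hp).
  by apply/negP => /mkprojE /(_ d); rewrite pihomog_dE.
apply; apply/mkprojE => e; have [Jt [i hi]] := hT _ Tt.
have [<-|ne] := eqVneq i e; first by rewrite pihomog_dE //; exact: JQ.
by rewrite (pihomog_ne0 ne hi); have [] := hQ.
Qed.

Lemma partition_unity (J : finType) (g : J -> S) (dg : J -> nat) (f : S) (d : nat) :
  f \is d.-homog -> (0 < d)%N -> (forall j, g j \is (dg j).-homog) ->
  (forall p : proj K n, f \notin (p : pred S) -> exists j, g j \notin (p : pred S)) ->
  exists N (a : J -> S), (forall j, pih ((d * N)%N%:Z - (dg j)%:Z) (a j) = a j) /\ f ^+ N = \sum_j a j * g j.
Proof.
move=> hf d0 hg cov.
have [|||N [c e]] := @cover_power (fun b => exists c : J -> S, b = \sum_j c j * g j) (fun t => exists j, t = g j) f d _ hf d0.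
- split; first by exists (fun=> 0); rewrite big1 // => j _; rewrite mul0r.
    by move=> _ _ [c ->] [c' ->]; exists (fun j => c j - c' j); rewrite -sumrB; apply: eq_bigr => j _; rewrite mulrBl.
  by move=> r _ [c ->]; exists (fun j => r * c j); rewrite mulr_sumr; apply: eq_bigr => j _; rewrite mulrA.
- move=> _ [j ->]; split; last by exists (dg j).
  exists (fun i => (i == j)%:R); rewrite (bigD1 j) //= eqxx mul1r big1 ?addr0 // => i /negbTE ->; by rewrite mul0r.
- by move=> p /cov[j hj]; exists (g j) => //; exists j.
exists N, (fun j => pih ((d * N)%N%:Z - (dg j)%:Z) (c j)); split=> [j|]; first exact: pih_id.
have <- : pih (d * N)%N (f ^+ N) = f ^+ N by apply: pih_homog; exact: dhomogMn.
by rewrite e pih_sum; apply: eq_bigr => j _; rewrite -(pihM _ _ (hg j)) subrK.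
Qed.

(** A power of [f] is a combination of finitely many elements of [T], and these already cover. *)
Lemma finite_cover (T : S -> Prop) (f : S) (d : nat) : f \is d.-homog -> (0 < d)%N ->
  (forall t, T t -> exists e, t \is e.-homog) ->
  (forall p : proj K n, f \notin (p : pred S) -> exists2 t, T t & t \notin (p : pred S)) ->
  exists q (t : 'I_q -> S), (forall l, T (t l)) /\
    forall p : proj K n, f \notin (p : pred S) -> exists l, t l \notin (p : pred S).
Proof.
move=> hf d0 hT cov.
have [|||N [s [sT e]]] := @cover_power (fun b => exists s : seq (S * S), (forall x, x \in s -> T x.2) /\ b = \sum_(x <- s) x.1 * x.2) T f d _ hf d0.
- split; first by exists [::]; rewrite big_nil.
    move=> _ _ [s [hs ->]] [s' [hs' ->]]; exists (s ++ [seq (- x.1, x.2) | x <- s']); split.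
      by move=> x; rewrite mem_cat => /orP[/hs//|/mapP[y /hs' hy ->]].
    by rewrite big_cat big_map -sumrN /=; congr (_ + _); apply: eq_bigr => x _; rewrite mulNr.
  move=> r _ [s [hs ->]]; exists [seq (r * x.1, x.2) | x <- s]; split.
    by move=> x /mapP[y /hs hy ->].
  by rewrite big_map mulr_sumr; apply: eq_bigr => x _; rewrite mulrA.
- move=> t Tt; split; last exact: hT.
  by exists [:: (1, t)]; split; [move=> x; rewrite inE => /eqP ->|rewrite big_seq1 mul1r].
- exact: cov.
exists (size s), (fun l => (tnth (in_tuple s) l).2); split; first by move=> l; apply: sT; exact: mem_tnth.
move=> p fp; apply: contrapT => no.
have fN : f ^+ N \notin (p : pred S).
  by elim: (N) => [|i IH]; rewrite ?expr0 ?idealr1 // exprS prime_idealrM negb_or fp.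
move/negP: fN; apply; rewrite e (big_nth (0, 0)) big_mkord; apply: rpred_sum => l _.
apply: idealMr; apply: contrapT => /negP h; apply: no; exists l.
by rewrite (tnth_nth (0, 0)).
Qed.

Definition out (p : proj K n) (b : S) : Prop := b \notin (p : pred S).
Lemma out_mclosed p : mclosed (out p).
Proof.
split; first by rewrite /out idealr1.
  by move=> a b ha hb; rewrite /out prime_idealrM negb_or ha.
by move=> a; apply: contraNneq => ->; exact: idealr0.
Qed.
Lemma outX p b N : out p b -> out p (b ^+ N).
Proof.
have [o1 oM _] := out_mclosed p; move=> hb.
by elim: N => [|N IH]; rewrite ?expr0 ?exprS //; exact: oM.
Qed.
Lemma outM p a b : out p (a * b) <-> out p a /\ out p b.
Proof. by rewrite /out prime_idealrM negb_or; split=> [/andP|[-> ->]]. Qed.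

Lemma generic_prime : homprime (fun a : S => a = 0).
Proof.
split.
- by split=> // [a b -> ->|r a ->]; rewrite ?subrr ?mulr0.
- by apply/eqP; exact: oner_neq0.
- by move=> a b /eqP; rewrite mulf_eq0 => /orP[] /eqP; [left|right].
- by move=> a d ->; rewrite pihomog0.
- by exists ord0; apply/eqP; exact: X_neq0.
Qed.
Definition eta : proj K n := mkproj generic_prime.
Lemma out_eta b : out eta b <-> nz b.
Proof. by split=> h; apply/negP; [move=> /eqP /(mkprojE generic_prime) b0; rewrite /out b0 in h|move=> /(mkprojE generic_prime)/eqP b0; rewrite /nz b0 in h]. Qed.

(** The denominators of [z] form an ideal whose homogeneous elements cover D(f), so it contains a
    power of [f]. *)
Lemma sections_basic (f : S) (e : nat) (d : int) (z : L) : f \is e.-homog -> (0 < e)%N -> f != 0 ->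
  (forall p, out p f -> fr (out p) d z) ->
  exists N a, pih (d + (e * N)%N%:Z) a = a /\ z = a%:F / (f ^+ N)%:F.
Proof.
move=> hf e0 f0 hz.
have [|||N [a ea]] := @cover_power (fun b => exists a, b%:F * z = a%:F) (fun b => (exists a, b%:F * z = a%:F) /\ exists e, b \is e.-homog) f e _ hf e0.
- split; first by exists 0; rewrite tofrac0 mul0r.
    by move=> a b [a' ea] [b' eb]; exists (a' - b'); rewrite !tofracB mulrBl ea eb.
  by move=> r a [a' ea]; exists (r * a'); rewrite !tofracM -mulrA ea.
- by move=> t [].
- move=> p /hz[a [b [i [hb ob _ ->]]]]; exists b => //; split; last by exists i.
  by exists a; rewrite mulrC divfK // (ok_F (out_mclosed p)).
have fN0 : f ^+ N != 0 by exact: expf_neq0.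
have fF : (f ^+ N)%:F != 0 by rewrite tofrac_eq0.
exists N, a; split; last by rewrite -ea mulrC mulKf.
apply: (fr_degree _ (dhomogMn N hf) fN0 ea).
apply: (frS (ok := out eta)) => [b /out_eta//|]; apply: hz; exact/out_eta.
Qed.
End PrimeIdeals.

(** * Homogeneous components of cochains *)

Section HomogeneousComponents.
Context (K : fieldType) (m : nat).
Local Notation S := {mpoly K[m]}.
Local Notation L := {fraction S}.
Local Notation I := 'I_m.
Local Notation loc := (@loc K m).
Local Notation "x %:F" := (@tofrac S x).
Local Notation nz := (@nz K m).
Implicit Types (a b : S) (z w : L) (v : int).

Lemma mulrCAr (R : comPzRingType) (x y z : R) : x * y * z = z * y * x.
Proof. by rewrite mulrC mulrA mulrAC. Qed.

Lemma eqr_divr (F : fieldType) (a b c d : F) : b != 0 -> d != 0 -> a * d = c * b -> a / b = c / d.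
Proof. by move=> b0 d0 e; apply/eqP; rewrite eqr_div // e. Qed.

Section FieldIdentity.
Context (F : fieldType).
Add Field Ff : (@ffield F).
Lemma mul_frac_denom (q b p z : F) : q != 0 -> q * b * (p / q * z) = p * (b * z).
Proof. by move=> /eqP q0; fold_field F; field. Qed.
End FieldIdentity.

Definition hfrac z := exists x : S * (nat * S), [/\ x.1 \is (x.2.1).-homog, x.1 != 0 & x.1%:F * z = x.2.2%:F].

(* Junk value 0 if z has no homogeneous denominator. *)
Definition pr v z : L := if pselect (hfrac z) is left h then
  let x := projT1 (cid h) in (pih (v + x.2.1%:Z) x.2.2)%:F / x.1%:F else 0.

Lemma hfracI (e : nat) a b z : b \is e.-homog -> b != 0 -> b%:F * z = a%:F -> hfrac z.
Proof. by exists (b, (e, a)). Qed.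

Lemma prE v (e : nat) a b z : b \is e.-homog -> b != 0 -> b%:F * z = a%:F -> pr v z = (pih (v + e%:Z) a)%:F / b%:F.
Proof.
move=> hb b0 h; rewrite /pr; case: pselect => [hz|[]]; last exact: (hfracI hb b0 h).
case: (cid hz) => -[b' [e' a']] /= [hb' b0' h'].
have bF : b%:F != 0 by rewrite tofrac_eq0.
have bF' : b'%:F != 0 by rewrite tofrac_eq0.
apply: eqr_divr bF' bF _; rewrite -!tofracM; congr (_%:F).
rewrite -(pihM _ _ hb) -(pihM _ _ hb') addrAC; congr pih.
by apply: tofrac_inj; rewrite !tofracM -h -h'; exact: mulrCAr.
Qed.

Lemma hfracD z w : hfrac z -> hfrac w -> hfrac (z + w) /\ forall v, pr v (z + w) = pr v z + pr v w.
Proof.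
move=> [[b [e a]] /= [hb b0 h]] [[b' [e' a']] /= [hb' b0' h']].
have hbb := dhomogM hb hb'; have b0b := mulf_neq0 b0 b0'.
have hh : (b * b')%:F * (z + w) = (a * b' + a' * b)%:F.
  rewrite tofracD !tofracM -h -h' mulrDr; congr (_ + _); first by rewrite mulrAC.
  by rewrite [RHS]mulrC mulrA.
split; first exact: (hfracI hbb b0b hh).
move=> v; rewrite (prE v hb b0 h) (prE v hb' b0' h') (prE v hbb b0b hh).
rewrite addf_div ?tofrac_eq0 // -!tofracM -tofracD; congr (_%:F / _).
rewrite pihD PoszD addrA (pihM _ _ hb'); congr (_ + _).
by rewrite addrAC (pihM _ _ hb).
Qed.

Lemma hfrac0 : hfrac 0.
Proof. by apply: (hfracI (a := 0) (dhomog1 _ _)); [exact: oner_neq0|rewrite mulr0 tofrac0]. Qed.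
Lemma pr0 v : pr v 0 = 0.
Proof.
rewrite (@prE v 0 0 1) ?pih0 ?tofrac0 ?mul0r //; [exact: dhomog1|exact: oner_neq0|by rewrite mulr0].
Qed.

Lemma hfracM0 u z : fr nz 0 u -> hfrac z -> hfrac (u * z) /\ forall v, pr v (u * z) = u * pr v z.
Proof.
move=> [p [q [i [hq q0 hp ->]]]] [[b [e a]] /= [hb b0 h]].
have qF : q%:F != 0 by rewrite tofrac_eq0.
have hbb := dhomogM hq hb; have b0b : q * b != 0 by exact: mulf_neq0.
have hh : (q * b)%:F * (p%:F / q%:F * z) = (p * a)%:F.
  by rewrite !tofracM -h; exact: mul_frac_denom.
split; first exact: (hfracI hbb b0b hh).
have hp' : p \is i.-homog by apply: homog_pih; rewrite add0r in hp.
move=> v; rewrite (prE v hb b0 h) (prE v hbb b0b hh) [RHS]mulf_div -!tofracM.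
by rewrite PoszD addrCA (pihMl _ _ hp').
Qed.

Lemma pr_id v z : fr nz v z -> hfrac z /\ pr v z = z.
Proof.
move=> [a [b [e [hb b0 ha ->]]]]; have bF : b%:F != 0 by rewrite tofrac_eq0.
have h : b%:F * (a%:F / b%:F) = a%:F by rewrite mulrC divfK.
by split; [exact: (hfracI hb b0 h)|rewrite (prE v hb b0 h) ha].
Qed.

Lemma fr_pr v z : hfrac z -> fr nz v (pr v z).
Proof.
move=> [[b [e a]] /= [hb b0 h]]; rewrite (prE v hb b0 h).
by exists (pih (v + e%:Z) a), b, e; split=> //; exact: pih_id.
Qed.

Lemma hfrac_loc (s : {set I}) z : loc s z -> hfrac z /\ forall v, loc s (pr v z).
Proof.
move=> [N [a ea]]; pose b : S := 'X_[mset s] ^+ N.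
have hb : b \is (mdeg (mset s) * N)%N.-homog by apply: dhomogMn; rewrite dhomogX.
have b0 : b != 0 by rewrite expf_neq0 // X_neq0.
have bE : b%:F = xm K s ^+ N by rewrite tofracXn.
have h : b%:F * z = a%:F by rewrite bE.
split; first exact: (hfracI hb b0 h).
move=> v; rewrite (prE v hb b0 h) bE; exists N; eexists; rewrite mulrC divfK // -bE tofrac_eq0 //.
Qed.

Lemma hfrac_sum (J : Type) (r : seq J) (F : J -> L) : (forall j, hfrac (F j)) ->
  hfrac (\sum_(j <- r) F j) /\ forall v, pr v (\sum_(j <- r) F j) = \sum_(j <- r) pr v (F j).
Proof.
move=> hF; elim: r => [|j r [IH1 IH2]]; first by split=> [|v]; rewrite !big_nil; [exact: hfrac0|exact: pr0].
have [h1 h2] := hfracD (hF j) IH1; split=> [|v]; rewrite !big_cons // h2 IH2 //.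
Qed.

Lemma components_total (J : finType) (z : J -> L) : (forall j, hfrac (z j)) ->
  exists e D : nat, forall j, z j = \sum_(d < D) pr (d%:Z - e%:Z) (z j).
Proof.
move=> hz; have [b [e [hb b0 hbz]]] : exists b (e : nat), [/\ b \is e.-homog, b != 0 & forall j, exists a, b%:F * z j = a%:F].
  suff [b [e [hb b0 h]]] : exists b (e : nat), [/\ b \is e.-homog, b != 0 & forall j, j \in enum J -> exists a, b%:F * z j = a%:F].
    by exists b, e; split=> // j; apply: h; rewrite mem_enum.
  elim: (enum J) => [|j r [b [e [hb b0 IH]]]]; first by exists 1, 0%N; split; [exact: dhomog1|exact: oner_neq0|].
  have [[b' [e' a']] /= [hb' b0' h']] := hz j.
  exists (b' * b), (e' + e)%N; split; [exact: dhomogM|exact: mulf_neq0|].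
  move=> l; rewrite inE => /orP[/eqP ->|/IH[a ha]].
    by exists (b * a'); rewrite !tofracM -h' mulrAC mulrC mulrA.
  by exists (b' * a); rewrite !tofracM -ha mulrA.
have /choice[a ha] := hbz; exists e, (\max_j msize (a j)) => j.
have bF : b%:F != 0 by rewrite tofrac_eq0.
have le : (msize (a j) <= \max_j msize (a j))%N by exact: leq_bigmax.
rewrite {1}(_ : z j = (a j)%:F / b%:F); last by rewrite -ha mulrC mulKf.
rewrite {1}(pihomog_partitionE le) raddf_sum /= mulr_suml; apply: eq_bigr => d _.
by rewrite (prE _ hb b0 (ha j)) subrK.
Qed.
End HomogeneousComponents.

Section GradedCech.
Context (K : fieldType) (m : nat).
Local Notation S := {mpoly K[m]}.
Local Notation L := {fraction S}.
Local Notation I := 'I_m.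
Local Notation loc := (@loc K m).
Local Notation "x %:F" := (@tofrac S x).
Local Notation nz := (@nz K m).
Context (r : nat) (A : I -> 'M[L]_(2, r)) (B : I -> 'M[L]_(r, 2)).
Hypothesis hAB : forall i, A i *m B i = 1%:M.
Hypothesis hBA : forall i j x y, loc [set i; j]%SET ((B j *m A i) x y).
Hypothesis hBA0 : forall i j x y, fr nz 0 ((B j *m A i) x y).
Context (i0 : I).
Local Notation V := 'cV[L]_2.
Local Notation Esec := (Esec B).
Local Notation C := (Cc K m).
Local Notation NC := (NC B).
Implicit Types (w : V) (v : int).

Definition hfV w := forall i x, hfrac ((B i *m w) x 0).
Definition Edeg v w := forall i x, fr nz v ((B i *m w) x 0).
(** The homogeneous component of degree [v], taken in the chart [i0]. By [prV_B] every chart gives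
    the same, the transition matrices being homogeneous of degree 0. *)
Definition prV v w : V := A i0 *m map_mx (pr v) (B i0 *m w).

Lemma AB_inj w w' : B i0 *m w = B i0 *m w' -> w = w'.
Proof. by move=> e; rewrite -[w]mul1mx -(hAB i0) -mulmxA e mulmxA hAB mul1mx. Qed.

Lemma map_mulmx_pr v (M : 'M[L]_r) (u : 'cV[L]_r) : (forall x y, fr nz 0 (M x y)) ->
  (forall y, hfrac (u y 0)) -> map_mx (pr v) (M *m u) = M *m map_mx (pr v) u.
Proof.
move=> hM hu; apply/matrixP => x y; rewrite [y]ord1 !mxE.
have h j : hfrac (M x j * u j 0) by have [] := hfracM0 (hM x j) (hu j).
have [_ ->] := hfrac_sum (index_enum 'I_r) h.
by apply: eq_bigr => j _; rewrite mxE; have [_ ->] := hfracM0 (hM x j) (hu j).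
Qed.

Lemma prV_B v w j : hfV w -> B j *m prV v w = map_mx (pr v) (B j *m w).
Proof.
move=> hw; have e := map_mulmx_pr v (hBA0 i0 j) (hw i0).
by rewrite /prV mulmxA -e -mulmxA [A i0 *m _]mulmxA hAB mul1mx.
Qed.

Lemma hfV0 : hfV 0.
Proof. by move=> i x; rewrite mulmx0 mxE; exact: hfrac0. Qed.
Lemma hfVD w w' : hfV w -> hfV w' -> hfV (w + w').
Proof. by move=> h h' i x; rewrite mulmxDr mxE; have [] := hfracD (h i x) (h' i x). Qed.
Lemma hfVZ u w : fr nz 0 u -> hfV w -> hfV (u *: w).
Proof. by move=> hu h i x; rewrite -scalemxAr mxE; have [] := hfracM0 hu (h i x). Qed.
Lemma prV0 v : prV v 0 = 0.
Proof.
by apply: AB_inj; rewrite prV_B ?mulmx0; [apply/matrixP => x y; rewrite !mxE pr0|exact: hfV0].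
Qed.
Lemma prVD v w w' : hfV w -> hfV w' -> prV v (w + w') = prV v w + prV v w'.
Proof.
move=> h h'; apply: AB_inj; rewrite mulmxDr !prV_B //; last exact: hfVD.
have := h i0; have := h' i0; rewrite mulmxDr; move: (B i0 *m w) (B i0 *m w') => X X' hX' hX.
by apply/matrixP => x y; rewrite [y]ord1 !mxE; have [_ ->] := hfracD (hX x) (hX' x).
Qed.
Lemma prVZ v u w : fr nz 0 u -> hfV w -> prV v (u *: w) = u *: prV v w.
Proof.
move=> hu h; apply: AB_inj; rewrite -scalemxAr !prV_B //; last exact: hfVZ.
have := h i0; rewrite -scalemxAr; move: (B i0 *m w) => X hX.
by apply/matrixP => x y; rewrite [y]ord1 !mxE; have [_ ->] := hfracM0 hu (hX x).
Qed.

Lemma fr_int (n : int) : fr nz 0 (n%:~R : L).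
Proof.
have -> : (n%:~R : L) = (n%:~R : S)%:F by rewrite rmorph_int.
exists n%:~R, 1, 0%N; split; [exact: dhomog1|exact: oner_neq0| |by rewrite tofrac1 divr1].
apply: pih_homog; have -> : (n%:~R : S) = (n%:~R : K) *: 1 by rewrite scaler_int.
by apply: dhomogZ; exact: dhomog1.
Qed.

Lemma prV_mulz v w n : hfV w -> hfV (w *~ n) /\ prV v (w *~ n) = prV v w *~ n.
Proof.
move=> h; rewrite -!scaler_int; split; first exact: (hfVZ (fr_int n) h).
exact: (prVZ v (fr_int n) h).
Qed.

Lemma prV_dS v (c : {set I} -> V) s : (forall t, hfV (c t)) -> prV v (dS c s) = dS (fun t => prV v (c t)) s.
Proof.
move=> hc; rewrite /dS; suff [] : hfV (\sum_(i in s) c (s :\ i) *~ sgn i s) /\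
  prV v (\sum_(i in s) c (s :\ i) *~ sgn i s) = \sum_(i in s) prV v (c (s :\ i)) *~ sgn i s by [].
elim/big_rec2: _ => [|i x y _ [hy ex]]; first by split; [exact: hfV0|exact: prV0].
have [h1 h2] := prV_mulz v (sgn i s) (hc (s :\ i)); split; first exact: hfVD.
by rewrite prVD // h2 ex.
Qed.

Lemma Esec_hfV s w : Esec s w -> hfV w.
Proof.
move=> hw i x; have [s0|[j sj]] := finset.set_0Vmem s.
  by have [w0 _] := hw; rewrite w0 // mulmx0 mxE; exact: hfrac0.
have [_ /(_ _ sj) h] := hw.
have -> : B i *m w = (B i *m A j) *m (B j *m w) by rewrite -mulmxA [A j *m _]mulmxA hAB mul1mx.
rewrite mxE; have [] // := @hfrac_sum K m _ (index_enum 'I_r) (fun y => (B i *m A j) x y * (B j *m w) y 0).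
by move=> y; have [hf _] := hfrac_loc (h y); have [] := hfracM0 (hBA0 j i x y) hf.
Qed.

Lemma prV_sec v s w : Esec s w -> Esec s (prV v w) /\ Edeg v (prV v w).
Proof.
move=> hw; have hf := Esec_hfV hw; have [w0 hl] := hw; split.
  split; first by move=> s0; rewrite w0 // prV0.
  by move=> i si x; rewrite prV_B // mxE; have [_ h] := hfrac_loc (hl i si x); exact: h.
by move=> i x; rewrite prV_B // mxE; apply: fr_pr; exact: hf.
Qed.

Lemma prV_id v w : Edeg v w -> prV v w = w.
Proof.
move=> hw; have hf : hfV w by move=> i x; have [] := pr_id (hw i x).
apply: AB_inj; rewrite prV_B //; apply/matrixP => x y; rewrite [y]ord1 mxE.
by have [] := pr_id (hw i0 x).
Qed.

Lemma prV_total (c : {set I} -> V) : (forall s, hfV (c s)) ->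
  exists e D : nat, forall s, c s = \sum_(d < D) prV (d%:Z - e%:Z) (c s).
Proof.
move=> hc; have [|e [D h]] := @components_total K m _ (fun p : {set I} * 'I_r => (B i0 *m c p.1) p.2 0).
  by move=> p; exact: hc.
exists e, D => s; apply: AB_inj; rewrite mulmx_sumr; apply/matrixP => x y; rewrite [y]ord1 summxE.
rewrite (h (s, x)) /=; apply: eq_bigr => d _; by rewrite (prV_B _ _ (hc s)) [RHS]mxE.
Qed.

Lemma cardsD1_eq (s : {set I}) i q : i \in s -> (#|s :\ i| == q) = (#|s| == q.+1).
Proof. by move=> si; rewrite [in RHS](cardsD1 i s) si. Qed.

Definition graded_exact v p := forall c : {set I} -> V, (forall s, Esec s (c s)) ->
  (forall s, Edeg v (c s)) -> (forall s : {set I}, #|s| = p.+2 -> dS c s = 0) ->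
  exists b : {set I} -> V, (forall s, Esec s (b s) /\ Edeg v (b s)) /\ forall s : {set I}, #|s| = p.+1 -> dS b s = c s.

Lemma cut_NC (p : nat) (f : {set I} -> V) : (forall s : {set I}, #|s| = p.+1 -> Esec s (f s)) ->
  exists2 c : C, NC p c & forall s : {set I}, (c : fs (cech L m 1) V) s = if #|s| == p.+1 then f s else 0.
Proof.
move=> hf; pose c : fs (cech L m 1) (triv V) := fsf (fun s : {set I} => if #|s| == p.+1 then f s else 0).
exists c => //; move=> s; rewrite /EN cech_deg /c fsfE; have [sp|sp] := eqVneq #|s : {set I}| p.+1; split.
- by move=> /eqP h; exfalso; apply: h; rewrite sp; lia.
- exact: hf.
- by [].
- exact: (sm0 (Esec_smod B s)).
Qed.

Lemma exact_graded (p : nat) : (forall c : C, NC p c -> cd C c = 0 -> exists2 b, NC (p%:Z - 1) b & c = cd C b) ->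
  forall v, graded_exact v p.
Proof.
move=> ex v c hE hd dc; have [c' c'N ec] := @cut_NC p c (fun s _ => hE s).
have [||b bN eb] := ex c'.
- exact: c'N.
- apply: fs_eq => s; rewrite cdCc fs0; have [sp|sp] := eqVneq #|s| p.+2.
    rewrite -[RHS](dc s sp); apply: dS_eq => i si; rewrite ec.
    by rewrite cardsD1_eq // sp eqxx.
  rewrite /dS big1 // => i si; rewrite ec.
  by rewrite cardsD1_eq // (negbTE sp) mul0rz.
pose b' s := (b : fs (cech L m 1) V) s.
have hb s : Esec s (b' s) by exact: (NC_E s bN).
exists (fun s => prV v (b' s)); split=> [s|s sp]; first exact: prV_sec.
rewrite -prV_dS; last by move=> t; exact: (Esec_hfV (hb t)).
have -> : dS b' s = c s by rewrite /b' -cdCc -eb ec sp eqxx.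
exact: prV_id.
Qed.

(** A cochain has finitely many values, hence finitely many homogeneous components, and their
    primitives add up. *)
Lemma graded_exact_all (p : nat) : (0 < p)%N -> (forall v, graded_exact v p) ->
  forall c : C, NC p c -> cd C c = 0 -> exists2 b, NC (p%:Z - 1) b & c = cd C b.
Proof.
move=> p0 ex c cN dc; pose f s := (c : fs (cech L m 1) V) s.
have fE s : Esec s (f s) by exact: (NC_E s cN).
have fh s : hfV (f s) by exact: (Esec_hfV (fE s)).
have [e [D eD]] := prV_total fh.
have /choice[b hb] : forall d : 'I_D, exists b : {set I} -> V, (forall s, Esec s (b s)) /\
    forall s : {set I}, #|s| = p.+1 -> dS b s = prV (d%:Z - e%:Z) (f s).
  move=> d; have [|||b [hb1 hb2]] := ex (d%:Z - e%:Z) (fun s => prV (d%:Z - e%:Z) (f s)).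
  - by move=> s; have [] := prV_sec (d%:Z - e%:Z) (fE s).
  - by move=> s; have [] := prV_sec (d%:Z - e%:Z) (fE s).
  - by move=> s sp; rewrite -prV_dS // /f -cdCc dc fs0 prV0.
  by exists b; split=> // s; have [] := hb1 s.
have [q pq] : exists q, p = q.+1 by exists p.-1; rewrite prednK.
subst p; rename q into p.
have [s _|b' b'N eb'] := @cut_NC p (fun s => \sum_(d < D) b d s).
  by apply: (sm_sum _ (Esec_smod B s)) => d _; have [] := hb d.
exists b'; first by rewrite (_ : p.+1%:Z - 1 = p%:Z) //; lia.
apply: fs_eq => s; rewrite cdCc; have [sp|sp] := eqVneq #|s| p.+2; last first.
  rewrite (NC_conc cN); last by apply/eqP => h; move/eqP: sp; apply; lia.
  rewrite /dS big1 // => i si; rewrite eb'.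
  by rewrite cardsD1_eq // (negbTE sp) mul0rz.
transitivity (f s); first by [].
rewrite (eD s); transitivity (\sum_(d < D) dS (b d) s); first by apply: eq_bigr => d _; have [_ ->] := hb d.
rewrite /dS exchange_big /=; apply: eq_bigr => i si; rewrite eb'.
by rewrite cardsD1_eq // sp eqxx mulrz_suml.
Qed.
End GradedCech.

(** * Matrices of a bundle *)

Section Frames.
Context (K : fieldType) (n : nat).
Local Notation S := {mpoly K[n.+1]}.
Local Notation L := {fraction S}.
Local Notation I := 'I_n.+1.
Local Notation loc := (@loc K n.+1).
Local Notation "x %:F" := (@tofrac S x).
Local Notation proj := (proj K n).

Lemma pih_fr ok (d : int) (a : S) : mclosed ok -> pih d a = a -> fr ok d a%:F.
Proof. by move=> [o1 _ _] ha; exists a, 1, 0%N; split=> //; rewrite ?addr0 ?tofrac1 ?divr1 ?dhomog1. Qed.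

Lemma X_homog (i : I) : ('X_i : S) \is 1.-homog.
Proof. by rewrite dhomogX; apply/eqP; exact: mdeg1. Qed.

Lemma frVX p (d : nat) N (b : S) : b \is d.-homog -> out p b -> fr (out p) (- (d * N)%N%:Z) ((b ^+ N)%:F)^-1.
Proof. by move=> hb ob; apply: (frV (dhomogMn N hb)); exact: outX. Qed.

Section FieldIdentity.
Context (F : fieldType).
Add Field Ff : (@ffield F).
Lemma denominators_split (a x x' f f' fM : F) : x != 0 -> x' != 0 -> f != 0 -> f' != 0 ->
  f * fM / x' * (a / (x * (f * f'))) = a * fM / x' / x / f'.
Proof.
by move=> /eqP x0 /eqP x0' /eqP f0 /eqP f0'; fold_field F; field; do ?split.
Qed.
Lemma square_cancel (c f x y : F) : x != 0 -> y != 0 -> c * (x * x) / y * (f / x * (f / x)) = c * (f * f) / y.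
Proof. by move=> /eqP x0 /eqP y0; fold_field F; field; split. Qed.
End FieldIdentity.

(** By [sections_basic] the denominator of [z] is a power of the product of [x_i], [f] and [f']; a
    high power of [f] cancels its part in [f]. *)
Lemma extend_section (i : I) (d d' : nat) (f f' : S) (z : L) : f \is d.-homog -> f' \is d'.-homog ->
  f != 0 -> f' != 0 ->
  (forall q : proj, out q 'X_i -> out q f -> out q f' -> fr (out q) 0 z) ->
  exists N, forall M, (N <= M)%N -> forall q : proj, out q 'X_i -> out q f' ->
    fr (out q) 0 ((f ^+ M)%:F / ('X_i ^+ (d * M))%:F * z).
Proof.
move=> hf hf' f0 f0' hz; pose g : S := 'X_i * (f * f').
have hg : g \is (1 + (d + d'))%N.-homog by do 2?apply: dhomogM => //; exact: X_homog.
have g0 : g != 0 by rewrite !mulf_neq0 // X_neq0.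
have [//||N [a [ha ez]]] := @sections_basic K n g _ 0 z hg _ g0.
  by move=> p /outM[h1 /outM[h2 h3]]; exact: hz.
exists N => M NM q qi qf'.
have nF (b : S) k : b != 0 -> (b ^+ k)%:F != 0 by move=> b0; rewrite tofrac_eq0 expf_neq0.
have -> : (f ^+ M)%:F / ('X_i ^+ (d * M))%:F * z =
    a%:F * (f ^+ (M - N))%:F / ('X_i ^+ (d * M))%:F / ('X_i ^+ N)%:F / (f' ^+ N)%:F.
  rewrite ez /g !exprMn !tofracM -[in LHS](subnKC NM) exprD tofracM subnKC //.
  by apply: denominators_split; apply: nF => //; exact: X_neq0.
have hq := out_mclosed q.
have e0 : (0 + ((1 + (d + d')) * N)%N%:Z) + (d * (M - N))%N%:Z + - (1 * (d * M))%N%:Z + - (1 * N)%N%:Z + - (d' * N)%N%:Z = 0 :> int.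
  rewrite -{2}(subnKC NM); move: (M - N)%N => M'; rewrite !mulnDl !mulnDr; lia.
refine (eq_ind _ (fun k => fr (out q) k _) _ _ e0).
apply: (frM hq); last exact: frVX.
apply: (frM hq); last exact: (frVX _ (X_homog i) qi).
apply: (frM hq); last exact: (frVX _ (X_homog i) qi).
apply: (frM hq); first exact: pih_fr.
by apply: pih_fr => //; apply: pih_homog; exact: dhomogMn.
Qed.

Context (f : proj -> S) (G H : proj -> 'M[L]_2).
Hypothesis hf : forall p, exists d : nat, f p \is d.-homog.
Hypothesis fp : forall p, out p (f p).
Hypothesis GH : forall p, G p *m H p = 1%:M.
Hypothesis HG : forall p p' q, out q (f p) -> out q (f p') -> forall x y, fr (out q) 0 ((H p *m G p') x y).

Lemma f_neq0 p : f p != 0.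
Proof. by have [_ _ h] := out_mclosed p; apply: h; exact: fp. Qed.

Lemma local_frame (i : I) : exists r (A : 'M[L]_(2, r)) (B : 'M[L]_(r, 2)), A *m B = 1%:M /\
  forall q p, out q 'X_i -> out q (f p) -> (forall x y, fr (out q) 0 ((H p *m A) x y)) /\
    forall x y, fr (out q) 0 ((B *m G p) x y).
Proof.
have /choice[d hd] := hf.
have [//||p|N0 [t [hT hcov]]] := @finite_cover K n (fun t => exists p, t = f p) 'X_i 1 (X_homog i).
- by move=> _ [p ->].
- by move=> _; exists (f p); [exists p|exact: fp].
have /choice[pt ept] := hT.
have /choice[NN hNN] : forall u : ('I_N0 * 'I_N0) * ('I_2 * 'I_2), exists N, forall M, (N <= M)%N -> forall q : proj, out q 'X_i -> out q (f (pt u.1.2)) ->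
    fr (out q) 0 (((f (pt u.1.1)) ^+ M)%:F / ('X_i ^+ (d (pt u.1.1) * M))%:F * (H (pt u.1.1) *m G (pt u.1.2)) u.2.1 u.2.2).
  move=> u; apply: (extend_section (hd _) (hd _) (f_neq0 _) (f_neq0 _)) => q qi q1 q2.
  exact: HG.
have /choice[NN' hNN'] : forall u : ('I_N0 * 'I_N0) * ('I_2 * 'I_2), exists N, forall M, (N <= M)%N -> forall q : proj, out q 'X_i -> out q (f (pt u.1.2)) ->
    fr (out q) 0 (((f (pt u.1.1)) ^+ M)%:F / ('X_i ^+ (d (pt u.1.1) * M))%:F * (H (pt u.1.2) *m G (pt u.1.1)) u.2.1 u.2.2).
  move=> u; apply: (extend_section (hd _) (hd _) (f_neq0 _) (f_neq0 _)) => q qi q1 q2.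
  exact: HG.
pose M := (\sum_u NN u + \sum_u NN' u)%N.
pose u l : L := (f (pt l) ^+ M)%:F / ('X_i ^+ (d (pt l) * M))%:F.
have hu l l' q x y : out q 'X_i -> out q (f (pt l')) -> fr (out q) 0 (u l * (H (pt l) *m G (pt l')) x y).
  move=> qi ql; apply: (hNN ((l, l'), (x, y))) => //; rewrite /M (bigD1 ((l, l'), (x, y))) //=; lia.
have hu' l l' q x y : out q 'X_i -> out q (f (pt l')) -> fr (out q) 0 (u l * (H (pt l') *m G (pt l)) x y).
  move=> qi ql; apply: (hNN' ((l, l'), (x, y))) => //; rewrite /M addnC (bigD1 ((l, l'), (x, y))) //=; lia.
have [//|||N [c [hc ec]]] := @partition_unity K n _ (fun l => f (pt l) ^+ (M + M)) (fun l => (d (pt l) * (M + M))%N) 'X_i 1 (X_homog i).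
- by move=> l; exact: dhomogMn.
- by move=> p pi; have [l hl] := hcov p pi; exists l; apply: outX; rewrite -ept.
pose ga l : L := (c l)%:F * ('X_i ^+ (d (pt l) * (M + M)))%:F / ('X_i ^+ N)%:F.
have X0 k : ('X_i ^+ k : S)%:F != 0 by rewrite tofrac_eq0 expf_neq0 // X_neq0.
have sga : \sum_l ga l * (u l * u l) = 1.
  have -> : \sum_l ga l * (u l * u l) = \sum_l (c l * f (pt l) ^+ (M + M))%:F / ('X_i ^+ N)%:F.
    apply: eq_bigr => l _; rewrite /ga /u mulnDr !exprD !tofracM.
    exact: (square_cancel _ _ (X0 _) (X0 _)).
  rewrite -mulr_suml; have -> : \sum_l (c l * f (pt l) ^+ (M + M))%:F = ('X_i ^+ N : S)%:F by rewrite ec rmorph_sum.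
  exact: divff (X0 N).
have hga l q : out q 'X_i -> fr (out q) 0 (ga l).
  move=> qi; have hq := out_mclosed q; have := hc l; set e := (_ - _) => he.
  have e0 : e + (1 * (d (pt l) * (M + M)))%N%:Z + - (1 * N)%N%:Z = 0 :> int by rewrite /e; lia.
  refine (eq_ind _ (fun k => fr (out q) k _) _ _ e0).
  apply: (frM hq); last exact: (frVX _ (X_homog i) qi).
  apply: (frM hq); first exact: pih_fr.
  by apply: pih_fr => //; apply: pih_homog; apply: dhomogMn; exact: X_homog.
pose T := ('I_N0 * 'I_2)%type.
exists #|{: T}|, (\matrix_(x, y) (ga (enum_val y).1 * u (enum_val y).1 * G (pt (enum_val y).1) x (enum_val y).2)),
  (\matrix_(y, x) (u (enum_val y).1 * H (pt (enum_val y).1) (enum_val y).2 x)).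
split.
  apply/matrixP => x z; rewrite mxE.
  transitivity (\sum_(p : T) (ga p.1 * (u p.1 * u p.1)) * (G (pt p.1) x p.2 * H (pt p.1) p.2 z)).
    rewrite [RHS](big_enum_val (A := {: T})) /=; apply: eq_bigr => y _; rewrite !mxE.
    by rewrite mulrACA -[ga _ * _ * u _]mulrA.
  rewrite -(pair_bigA _ (fun l k => (ga l * (u l * u l)) * (G (pt l) x k * H (pt l) k z))) /=.
  transitivity (\sum_l (ga l * (u l * u l)) * ((1%:M : 'M[L]_2) x z)).
    by apply: eq_bigr => l _; rewrite -mulr_sumr -(GH (pt l)) mxE.
  by rewrite -mulr_suml sga mul1r.
move=> q p qi qp; have hq := out_mclosed q; have [l' hl'] := hcov q qi; rewrite ept in hl'.
split=> x y; rewrite mxE.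
  set l := (enum_val y).1.
  have -> : \sum_j H p x j * (\matrix_(x0, y0) (ga (enum_val y0).1 * u (enum_val y0).1 * G (pt (enum_val y0).1) x0 (enum_val y0).2)) j y =
      ga l * \sum_j (H p *m G (pt l')) x j * (u l * (H (pt l') *m G (pt l)) j (enum_val y).2).
    transitivity (ga l * (u l * (H p *m G (pt l)) x (enum_val y).2)).
      rewrite mxE !mulr_sumr; apply: eq_bigr => j _; rewrite mxE -mulrA mulrCA; congr (_ * _); exact: mulrCA.
    congr (_ * _); have -> : H p *m G (pt l) = (H p *m G (pt l')) *m (H (pt l') *m G (pt l)).
      by rewrite -mulmxA [G (pt l') *m _]mulmxA GH mul1mx.
    by rewrite [in LHS]mxE mulr_sumr; apply: eq_bigr => j _; exact: mulrCA.
  rewrite -[0]addr0; apply: (frM hq); first exact: hga.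
  apply: (fr_sum hq) => j _; rewrite -[0]addr0; apply: (frM hq); [exact: HG|exact: hu'].
set l := (enum_val x).1.
have -> : \sum_j (\matrix_(y0, x0) (u (enum_val y0).1 * H (pt (enum_val y0).1) (enum_val y0).2 x0)) x j * G p j y =
    \sum_j (u l * (H (pt l) *m G (pt l')) (enum_val x).2 j) * (H (pt l') *m G p) j y.
  transitivity (u l * (H (pt l) *m G p) (enum_val x).2 y).
    by rewrite mxE mulr_sumr; apply: eq_bigr => j _; rewrite mxE -mulrA.
  have -> : H (pt l) *m G p = (H (pt l) *m G (pt l')) *m (H (pt l') *m G p).
    by rewrite -mulmxA [G (pt l') *m _]mulmxA GH mul1mx.
  by rewrite [in LHS]mxE mulr_sumr; apply: eq_bigr => j _; exact: mulrA.
apply: (fr_sum hq) => j _; rewrite -[0]addr0; apply: (frM hq); [exact: hu|exact: HG].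
Qed.

Lemma frames : exists r (A : I -> 'M[L]_(2, r)) (B : I -> 'M[L]_(r, 2)),
  [/\ forall i, A i *m B i = 1%:M,
      forall i j x y, loc [set i; j]%SET ((B j *m A i) x y),
      forall i j q x y, out q 'X_i -> out q 'X_j -> fr (out q) 0 ((B j *m A i) x y) &
      forall i q p w, out q 'X_i -> out q (f p) ->
        (forall x, fr (out q) 0 ((B i *m w) x 0)) <-> (forall x, fr (out q) 0 ((H p *m w : 'cV_2) x 0))].
Proof.
have /choice[F hF] : forall i, exists F : {r : nat & ('M[L]_(2, r) * 'M[L]_(r, 2))%type},
    (projT2 F).1 *m (projT2 F).2 = 1%:M /\ forall q p, out q 'X_i -> out q (f p) ->
    (forall x y, fr (out q) 0 ((H p *m (projT2 F).1) x y)) /\ forall x y, fr (out q) 0 (((projT2 F).2 *m G p) x y).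
  move=> i; have [r [A [B h]]] := local_frame i.
  by exists (existT (fun r => ('M[L]_(2, r) * 'M[L]_(r, 2))%type) r (A, B)).
(* Zero columns and rows give all charts the same number [R] of coordinates. *)
pose R := (\max_i projT1 (F i))%N.
have le i : (projT1 (F i) <= R)%N by exact: leq_bigmax.
pose A i : 'M[L]_(2, R) := (projT2 (F i)).1 *m pid_mx (projT1 (F i)).
pose B i : 'M[L]_(R, 2) := pid_mx (projT1 (F i)) *m (projT2 (F i)).2.
have fpid ok (a b c : nat) x y : mclosed ok -> fr ok 0 ((pid_mx c : 'M[L]_(a, b)) x y).
  move=> hok; rewrite mxE; case: andP => _; [exact: (fr1 hok)|exact: (fr0 hok)].
have hAB i : A i *m B i = 1%:M.
  rewrite /A /B -mulmxA [pid_mx _ *m (_ *m _)]mulmxA mul_pid_mx.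
  by rewrite minnn (minn_idPr (le i)) pid_mx_1 mul1mx; have [] := hF i.
have hA i q p x y : out q 'X_i -> out q (f p) -> fr (out q) 0 ((H p *m A i) x y).
  move=> qi qp; have hq := out_mclosed q; have [_ /(_ q p qi qp)[h _]] := hF i.
  rewrite /A mulmxA -[0]addr0; apply: (fr_mulmx hq) => // a b; exact: fpid.
have hB i q p x y : out q 'X_i -> out q (f p) -> fr (out q) 0 ((B i *m G p) x y).
  move=> qi qp; have hq := out_mclosed q; have [_ /(_ q p qi qp)[_ h]] := hF i.
  rewrite /B -mulmxA -[0]addr0; apply: (fr_mulmx hq) => // a b; exact: fpid.
have hBA i j q x y : out q 'X_i -> out q 'X_j -> fr (out q) 0 ((B j *m A i) x y).
  move=> qi qj; have hq := out_mclosed q.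
  have -> : B j *m A i = (B j *m G q) *m (H q *m A i) by rewrite -mulmxA [G q *m _]mulmxA GH mul1mx.
  by rewrite -[0]addr0; apply: (fr_mulmx hq) => a b; [apply: hB|apply: hA].
have Xn (i : I) : ('X_i : S) != 0 by exact: X_neq0.
exists R, A, B; split=> //.
- move=> i j x y; have hg := dhomogM (X_homog i) (X_homog j).
  have [//||N [a [_ ->]]] := @sections_basic K n ('X_i * 'X_j) _ 0 ((B j *m A i) x y) hg _ (mulf_neq0 (Xn i) (Xn j)).
    by move=> p /outM[h1 h2]; exact: hBA.
  rewrite exprMn tofracM invfM !tofracXn -!exprVn; apply: locM; first by apply: inS_loc; exists a.
  by apply: locM; apply: locX; apply: loc_xvV; rewrite !inE eqxx ?orbT.
move=> i q p w qi qp; have hq := out_mclosed q; split=> h x.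
  have -> : H p *m w = (H p *m A i) *m (B i *m w) by rewrite -mulmxA [A i *m _]mulmxA hAB mul1mx.
  by rewrite -[0]addr0; apply: (fr_mulmx hq) => a b; [apply: hA|rewrite [b]ord1; exact: h].
have -> : B i *m w = (B i *m G p) *m (H p *m w) by rewrite -mulmxA [G p *m _]mulmxA GH mul1mx.
by rewrite -[0]addr0; apply: (fr_mulmx hq) => a b; [apply: hB|rewrite [b]ord1; exact: h].
Qed.
End Frames.

(** * Values at the generic point *)

Local Open Scope classical_set_scope.
Local Open Scope ring_scope.
Lemma choice2 (T : Type) (U : T -> Type) (P : forall x, U x -> Prop) :
  (forall x, exists y, P x y) -> exists f : forall x, U x, forall x, P x (f x).
Proof. by move=> h; exists (fun x => projT1 (cid (h x))) => x; case: cid. Qed.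

Section Opens.
Context (K : fieldType) (n : nat).
Local Notation S := {mpoly K[n.+1]}.
Local Notation L := {fraction S}.
Local Notation proj := (proj K n).
Local Notation O := (Oproj K n).
Local Notation eta := (eta K n).

Lemma basic_nbhd (U : opens proj) p : oset U p -> exists f (d : nat),
  [/\ f \is d.-homog, out p f & forall q, out q f -> oset U q].
Proof.
have [T [hT eU]] := oset_open U; rewrite eU => -[f Tf fp]; have [d hf] := hT _ Tf.
by exists f, d; split=> // q qf; exists f.
Qed.

Lemma eta_in (U : opens proj) p : oset U p -> oset U eta.
Proof.
move=> /basic_nbhd[f [d [_ fp h]]]; apply: h; apply/out_eta.
by have [_ _ h] := out_mclosed p; exact: h.
Qed.

Definition Iop (U V : opens proj) : opens proj := Opens (openI (oset_open U) (oset_open V)).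
Lemma IopL U V : Iop U V `<=` U. Proof. by move=> x []. Qed.
Lemma IopR U V : Iop U V `<=` V. Proof. by move=> x []. Qed.
Definition Dop (f : S) (d : nat) (hf : f \is d.-homog) : opens proj := Opens (zariski_open_basic hf).

Definition pt (U : opens proj) q (h : oset U q) : U := SigSub (mem_set h).

(** A section is locally a single fraction and every nonempty open set contains the generic point,
    so it takes only one value in L. *)
Lemma sec_const d (U : opens proj) (s : twist_sec d U) (p q : U) : s p = s q.
Proof.
suff h (r : U) (he : oset U eta) : s r = s (pt he).
  have he := eta_in (set_valP p); by rewrite (h p he) (h q he).
have [V [Vr [a [b [da [db [_ _ _ hV]]]]]]] := twist_secP s r.
by have [_ ->] := hV r Vr; have [_ ->] := hV (pt he) (eta_in Vr).
Qed.

(** The value 0 is the default for the empty open set. *)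
Definition gval d (U : opens proj) (s : twist_sec d U) : L :=
  if pselect (oset U eta) is left h then s (pt h) else 0.

Lemma evE d (U : opens proj) (s : twist_sec d U) (q : U) : gval s = s q.
Proof.
rewrite /gval; case: pselect => [h|[]]; first exact: sec_const.
exact: (eta_in (set_valP q)).
Qed.

Lemma ev_inj d (U : opens proj) (s t : twist_sec d U) : gval s = gval t -> s = t.
Proof. by move=> e; apply: twist_sec_inj => q; rewrite -!evE. Qed.

Lemma ev_res d (U V : opens proj) (h : V `<=` U) (s : twist_sec d U) : oset V eta -> gval (twist_res h s) = gval s.
Proof. by move=> he; rewrite (evE _ (pt he)) (evE _ (pt (h _ he))); exact: twist_resE. Qed.

Lemma evD d (U : opens proj) (s t : twist_sec d U) : gval (s + t) = gval s + gval t.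
Proof. by rewrite /gval; case: pselect => [h|_]; rewrite ?addr0. Qed.
Lemma evZ d (U : opens proj) (a : O U) (s : twist_sec d U) : gval (a *: s : twist K n d U) = gval a * gval s.
Proof. by rewrite /gval; case: pselect => [h|_]; rewrite ?mulr0. Qed.
Lemma ev1 (U : opens proj) : oset U eta -> gval (1 : O U) = 1.
Proof. by move=> he; rewrite (evE _ (pt he)). Qed.
Lemma ev0 d (U : opens proj) : gval (0 : twist_sec d U) = 0.
Proof. by rewrite /gval; case: pselect. Qed.

Lemma ev_fr d (U : opens proj) (s : twist_sec d U) p : oset U p -> fr (out p) d (gval s).
Proof.
move=> Up; rewrite (evE _ (pt Up)).
have [V [Vp [a [b [da [db [ha hb hd hV]]]]]]] := twist_secP s (pt Up).
have [bp ->] := hV (pt Up) Vp; exists a, b, db; split=> //.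
by rewrite addrC -hd; exact: pih_homog.
Qed.

Lemma Xn_homog (i : 'I_n.+1) k : 'X_i ^+ k \is [in K[n.+1], k.-homog].
Proof. by have := dhomogMn k (@X_homog K n i); rewrite mul1n. Qed.

Lemma cst_is_section d (U : opens proj) (z : L) : (forall p, oset U p -> fr (out p) d z) ->
  is_section d (fun _ : U => z).
Proof.
move=> hz p; have [a [b [e [hb ob ha ->]]]] := hz _ (set_valP p).
have [i hi] := pideal_relevant (val p).
pose k := absz d; have hbX : b * 'X_i ^+ k \is (e + k)%N.-homog.
  by apply: dhomogM => //; exact: Xn_homog.
have oX : out (val p) (b * 'X_i ^+ k) by apply/outM; split=> //; exact: outX.
exists (Dop hbX); split=> //.
have hk : d + e%:Z + k%:Z = absz (d + e%:Z + k%:Z) by rewrite /k; lia.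
have hX : 'X_i ^+ k \is [in K[n.+1], k.-homog] by exact: Xn_homog.
exists (a * 'X_i ^+ k), (b * 'X_i ^+ k), (absz (d + e%:Z + k%:Z)), (e + k)%N; split=> //.
- by apply: homog_pih; rewrite -hk (pihM _ _ hX) ha.
- by rewrite -hk PoszD; lia.
move=> q qb; split=> //; have [qb1 qX] : out (val q) b /\ out (val q) ('X_i ^+ k) by apply/outM.
by rewrite !tofracM; apply: frac_expand; apply: (ok_F (out_mclosed (val q))).
Qed.

Definition cst_sec d (U : opens proj) (z : L) (h : forall p, oset U p -> fr (out p) d z) : twist_sec d U :=
  twist_mk (cst_is_section h).
Lemma ev_cst d (U : opens proj) (z : L) (h : forall p, oset U p -> fr (out p) d z) : oset U eta -> gval (cst_sec h) = z.
Proof. by move=> he; rewrite (evE _ (pt he)). Qed.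
End Opens.

Section Bundles.
Context (K : fieldType) (n : nat).
Local Notation S := {mpoly K[n.+1]}.
Local Notation L := {fraction S}.
Local Notation proj := (proj K n).
Local Notation O := (Oproj K n).
Local Notation eta := (eta K n).
Context (E : mod_sheaf O).

Lemma md_comp (U V W : opens proj) (h1 : V `<=` U) (h2 : W `<=` V) (h3 : W `<=` U) (s : E U) :
  md_res E h2 (md_res E h1 s) = md_res E h3 s.
Proof. exact: (sheaf_comp (md_sheafP E)). Qed.

Lemma empty_sections (U : opens proj) (s t : E U) : ~ oset U eta -> s = t.
Proof.
move=> ne; apply: (sheaf_sep (md_sheafP E) (I := False) (W := fun i => match i with end)) => //.
by move=> x Ux; case: ne; exact: eta_in Ux.
Qed.

Context (N : proj -> opens proj).
Hypothesis Np : forall p, oset (N p) p.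
Context (phi : forall p (V : opens proj), V `<=` N p -> {linear 'rV[O V]_2 -> E V}).
Hypothesis phi_bij : forall p (V : opens proj) (h : V `<=` N p), bijective (phi h).
Hypothesis phi_nat : forall p (V W : opens proj) (hV : V `<=` N p) (hW : W `<=` N p) (h : W `<=` V)
  (v : 'rV[O V]_2), phi hW (map_mx (rg_res O h) v) = md_res E h (phi hV v).

Lemma phi_inj p (V : opens proj) (h : V `<=` N p) : injective (phi h).
Proof. exact: bij_inj. Qed.
Lemma phi_surj p (V : opens proj) (h : V `<=` N p) (s : E V) : exists x, phi h x = s.
Proof. by case: (phi_bij h) => g _ gK; exists (g s). Qed.

Definition evv (V : opens proj) (x : 'rV[O V]_2) : 'cV[L]_2 := \col_j gval (x 0 j : O V).

Lemma evv_inj (V : opens proj) (x y : 'rV[O V]_2) : evv x = evv y -> x = y.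
Proof.
move=> /matrixP e; apply/matrixP => i j; rewrite [i]ord1.
by apply: ev_inj; have := e j 0; rewrite !mxE.
Qed.
Lemma evv_lin (V : opens proj) (a : O V) (x y : 'rV[O V]_2) : evv (a *: x + y) = gval a *: evv x + evv y.
Proof. by apply/matrixP => i j; rewrite !mxE evD; congr (_ + _); exact: evZ. Qed.
Lemma evv_res (V W : opens proj) (h : W `<=` V) (x : 'rV[O V]_2) : oset W eta -> evv (map_mx (rg_res O h) x) = evv x.
Proof. by move=> he; apply/matrixP => i j; rewrite !mxE; exact: ev_res. Qed.

(* The value at the generic point, in a trivialization around it. *)
Definition iota (U : opens proj) (s : E U) : 'cV[L]_2 :=
  evv (projT1 (cid (phi_surj (@IopR K n U (N eta)) (md_res E (@IopL K n U (N eta)) s)))).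

Lemma iotaP (U W : opens proj) (hU : W `<=` U) (hN : W `<=` N eta) (s : E U) x : oset W eta ->
  phi hN x = md_res E hU s -> iota s = evv x.
Proof.
move=> he hx; rewrite /iota; case: cid => y /= hy.
have hW : W `<=` Iop U (N eta) by move=> q Wq; split; [apply: (hU)|apply: (hN)].
rewrite -(evv_res hW y he); congr evv; apply: (@phi_inj eta W hN).
by rewrite (phi_nat (@IopR K n U (N eta))) hy hx; exact: md_comp.
Qed.

Lemma iota_ex (U : opens proj) (s : E U) : oset U eta -> exists (W : opens proj) (hU : W `<=` U) (hN : W `<=` N eta) x,
  oset W eta /\ phi hN x = md_res E hU s.
Proof.
move=> he; exists (Iop U (N eta)), (@IopL K n U (N eta)), (@IopR K n U (N eta)).
by have [x hx] := phi_surj (@IopR K n U (N eta)) (md_res E (@IopL K n U (N eta)) s); exists x.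
Qed.

Lemma iota_res (U V : opens proj) (h : V `<=` U) (s : E U) : oset V eta -> iota (md_res E h s) = iota s.
Proof.
move=> he; have [W [hU [hN [x [We hx]]]]] := iota_ex (md_res E h s) he.
have hWU : W `<=` U by move=> q /hU /h.
rewrite (iotaP We hx); symmetry; apply: (iotaP (hU := hWU) (hN := hN) We).
by rewrite hx; exact: md_comp.
Qed.

Lemma iota_lin (U : opens proj) (a : O U) (s t : E U) : oset U eta -> iota (a *: s + t) = gval a *: iota s + iota t.
Proof.
move=> he; have hU := @IopL K n U (N eta); have hN := @IopR K n U (N eta); set W := Iop U (N eta) in hU hN.
have We : oset W eta by split.
have [x hx] := phi_surj hN (md_res E hU s); have [y hy] := phi_surj hN (md_res E hU t).
rewrite (iotaP We hx) (iotaP We hy) -(ev_res hU a We) -evv_lin.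
apply: (iotaP (hU := hU) (hN := hN) We).
transitivity (rg_res O hU a *: phi hN x + phi hN y); first exact: linearP.
by rewrite hx hy -md_resZ; symmetry; exact: raddfD.
Qed.

Lemma iota0 (U : opens proj) : oset U eta -> iota (0 : E U) = 0.
Proof.
move=> he; have := iota_lin 1 (0 : E U) 0 he; rewrite scaler0 addr0 ev1 // scale1r => /eqP.
by rewrite -subr_eq0 opprD addNKr oppr_eq0 => /eqP.
Qed.

Lemma iotaZ (U : opens proj) (a : O U) (s : E U) : oset U eta -> iota (a *: s) = gval a *: iota s.
Proof. by move=> he; rewrite -[a *: s]addr0 iota_lin // iota0 // addr0. Qed.

(** The frame given by the trivialization at [p], expressed in the one around the generic point. *)
Definition frame_mx p : 'M[L]_2 := \matrix_(i, j) iota (phi (@subset_refl _ (N p)) (delta_mx 0 j)) i 0.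

Lemma phi_res p (W : opens proj) (h : W `<=` N p) j : phi h (delta_mx 0 j) = md_res E h (phi (@subset_refl _ (N p)) (delta_mx 0 j)).
Proof.
rewrite -(phi_nat (@subset_refl _ (N p)) h); congr (phi h _).
by apply/matrixP => i l; rewrite [RHS]mxE !(mxE _ (fun _ _ => _)); symmetry; exact: rmorph_nat.
Qed.

Lemma iota_phi p (W : opens proj) (h : W `<=` N p) (x : 'rV[O W]_2) : oset W eta -> iota (phi h x) = frame_mx p *m evv x.
Proof.
move=> We; have -> : phi h x = x 0 0 *: phi h (delta_mx 0 0) + x 0 1 *: phi h (delta_mx 0 1).
  rewrite {1}[x]row_sum_delta big_ord_recl big_ord1 [LHS]linearD; congr (_ + _); first exact: linearZ.
  have -> : lift ord0 ord0 = 1 :> 'I_2 by exact: val_inj.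
  exact: linearZ.
have ej j : iota (phi h (delta_mx 0 j)) = col j (frame_mx p).
  by rewrite phi_res iota_res //; apply/matrixP => i l; rewrite [l]ord1 [RHS]mxE [RHS]mxE.
have e1 : iota (x 0 1 *: phi h (delta_mx 0 1)) = gval (x 0 1 : O W) *: col 1 (frame_mx p).
  by rewrite -ej; exact: iotaZ.
have -> : iota (x 0 0 *: phi h (delta_mx 0 0) + x 0 1 *: phi h (delta_mx 0 1)) =
   gval (x 0 0 : O W) *: col 0 (frame_mx p) + gval (x 0 1 : O W) *: col 1 (frame_mx p).
  by rewrite -e1 -ej; exact: iota_lin.
apply/matrixP => i j; rewrite [j]ord1 [LHS]mxE [RHS]mxE big_ord_recl big_ord1.
have -> : lift ord0 ord0 = 1 :> 'I_2 by exact: val_inj.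
have f1 l : (gval (x 0 l : O W) *: col l (frame_mx p)) i 0 = frame_mx p i l * evv x l 0.
  by rewrite mxE mxE [evv x l 0]mxE mulrC.
by rewrite !f1.
Qed.

Lemma evv_delta (W : opens proj) j : oset W eta -> evv (delta_mx 0 j : 'rV[O W]_2) = delta_mx j 0.
Proof.
move=> We; apply/matrixP => i l; rewrite [l]ord1 [LHS]mxE (mxE _ (fun _ _ => _) 0 i) [RHS]mxE /= andbT.
by case: (i == j); [exact: ev1|exact: ev0].
Qed.

Lemma G_inverse p : exists frame_inv : 'M[L]_2, frame_mx p *m frame_inv = 1%:M.
Proof.
pose W := Iop (N p) (N eta); have We : oset W eta by split; [exact: (eta_in (Np p))|exact: Np].
have hp : W `<=` N p by exact: IopL.
have hN : W `<=` N eta by exact: IopR.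
have /choice[y hy] : forall j : 'I_2, exists y, phi hp y = phi hN (delta_mx 0 j) by move=> j; exact: phi_surj.
exists (\matrix_(i, j) evv (y j) i 0); apply/matrixP => i j.
have e : frame_mx p *m evv (y j) = evv (delta_mx 0 j : 'rV[O W]_2).
  rewrite -(iota_phi hp) // hy; apply: (iotaP (hU := @subset_refl _ W) (hN := hN) We).
  by symmetry; exact: (sheaf_id (md_sheafP E)).
have := congr1 (fun M : 'cV[L]_2 => M i 0) e; rewrite [X in _ = X -> _]mxE !mxE eqxx /=.
have -> : (\sum_j0 frame_mx p i j0 * evv (y j) j0 0) = \sum_j0 frame_mx p i j0 * (\matrix_(i0, j1) evv (y j1) i0 0) j0 j.
  by apply: eq_bigr => l _; rewrite [in RHS]mxE.
move=> ->; case: eqP => _; [exact: ev1|exact: ev0].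
Qed.

Definition frame_inv p : 'M[L]_2 := projT1 (cid (G_inverse p)).
Lemma GH p : frame_mx p *m frame_inv p = 1%:M. Proof. by rewrite /frame_inv; case: cid. Qed.
Lemma HG1 p : frame_inv p *m frame_mx p = 1%:M. Proof. exact: mulmx1C (GH p). Qed.

Lemma iota_eq0 (U : opens proj) (s : E U) : iota s = 0 -> s = 0.
Proof.
move=> s0; pose W (i : {p | oset U p}) := Iop U (N (sval i)).
apply: (sheaf_sep (md_sheafP E) (W := W) (h := fun i => @IopL K n U (N (sval i)))).
  by move=> p Up; exists (exist _ p Up) => //; split=> //; exact: Np.
move=> [p Up]; rewrite raddf0.
have We : oset (Iop U (N p)) eta by apply: (@eta_in K n _ p); split=> //; exact: Np.
have [x hx] := phi_surj (@IopR K n U (N p)) (md_res E (@IopL K n U (N p)) s).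
have := iota_phi (@IopR K n U (N p)) x We; rewrite hx iota_res // s0 => e.
have x0 : x = 0.
  apply: evv_inj; rewrite -[evv x]mul1mx -(HG1 p) -mulmxA -e mulmx0.
  by apply/matrixP => i j; rewrite !mxE ev0.
by rewrite /= -hx x0; exact: raddf0.
Qed.

Lemma iota_inj (U : opens proj) (s t : E U) : iota s = iota t -> s = t.
Proof.
move=> e; have [he|ne] := pselect (oset U eta); last exact: empty_sections.
apply/eqP; rewrite -subr_eq0; apply/eqP; apply: iota_eq0.
by have := iota_lin (-1) t s he; rewrite scaleN1r addrC => ->; rewrite e -{2}[iota t]scale1r -scalerDl /gval; case: pselect => // h; rewrite addNr scale0r.
Qed.

Lemma fr_nbhd d (z : L) q : fr (out q) d z -> exists f (e : nat), [/\ f \is e.-homog, out q f & forall p, out p f -> fr (out p) d z].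
Proof. by move=> [a [b [e [hb ob ha ->]]]]; exists b, e; split=> // p bp; exists a, b, e. Qed.

(** Near each point a frame produces a section with generic value [w]; these agree on overlaps
    because [iota] is injective, and so they glue. *)
Lemma iota_image (U : opens proj) w : oset U eta ->
  (exists s : E U, iota s = w) <-> forall q, oset U q -> forall x, fr (out q) 0 ((frame_inv q *m w) x 0).
Proof.
move=> he; split=> [[s <-] q Uq x|hw].
  have Wq : oset (Iop U (N q)) q by split=> //; exact: Np.
  have We := eta_in Wq; have [y hy] := phi_surj (@IopR K n U (N q)) (md_res E (@IopL K n U (N q)) s).
  have := iota_phi (@IopR K n U (N q)) y We; rewrite hy iota_res // => ->.
  by rewrite mulmxA HG1 mul1mx mxE; apply: ev_fr Wq.
have loc1 (i : {p | oset U p}) : exists W : opens proj, [/\ W `<=` U, oset W (sval i) & exists s : E W, iota s = w].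
  case: i => q Uq /=.
  have [f0 [d0 [hf0 of0 h0]]] := fr_nbhd (hw q Uq 0); have [f1 [d1 [hf1 of1 h1]]] := fr_nbhd (hw q Uq 1).
  pose W := Iop (Iop U (N q)) (Iop (Dop hf0) (Dop hf1)).
  have Wq : oset W q by split; split=> //; exact: Np.
  exists W; split=> //; first by move=> p [[]].
  have hN : W `<=` N q by move=> p [[]].
  have hs j p : oset W p -> fr (out p) 0 ((frame_inv q *m w) j 0).
    move=> [_ [p0 p1]]; have [->|->] : j = 0 \/ j = 1; first by case: j => [[|[|]]] //= l; [left|right]; exact: val_inj.
      exact: h0.
    exact: h1.
  exists (phi hN (\row_j (cst_sec (hs j) : O W))); rewrite iota_phi; last exact: eta_in Wq.
  have -> : evv (\row_j (cst_sec (hs j) : O W)) = frame_inv q *m w.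
    apply/matrixP => i j; rewrite [j]ord1; transitivity (gval (cst_sec (hs i))); last exact: ev_cst (hs i) (eta_in Wq).
    by rewrite [LHS]mxE; congr gval; rewrite mxE.
  by rewrite mulmxA GH mul1mx.
have /choice[W hW] := loc1.
have hU i : W i `<=` U by have [] := hW i.
have /choice2 [s hs] : forall i, exists s : E (W i), iota s = w by move=> i; have [] := hW i.
have [||t ht] := @sheaf_glue _ _ _ (md_sheafP E) U _ W hU _ s.
- by move=> p Up; exists (exist _ p Up) => //; have [_] := hW (exist _ p Up).
- move=> i j V hi hj; have [Ve|ne] := pselect (oset V eta); last exact: empty_sections.
  by apply: iota_inj; rewrite !iota_res // !hs.
exists t; have i : {p | oset U p} by exists eta.
have Wie : oset (W i) eta by apply: (@eta_in K n _ (sval i)); have [] := hW i.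
by rewrite -(iota_res (hU i) t Wie) (ht i) hs.
Qed.

Lemma HG_regular p p' q : oset (N p) q -> oset (N p') q -> forall x y, fr (out q) 0 ((frame_inv p *m frame_mx p') x y).
Proof.
move=> pq p'q x y; pose W := Iop (N p) (N p'); have Wq : oset W q by [].
have We := eta_in Wq; have hp : W `<=` N p by exact: IopL.
have hp' : W `<=` N p' by exact: IopR.
have [z hz] := phi_surj hp (phi hp' (delta_mx 0 y)).
have e : frame_mx p *m evv z = col y (frame_mx p').
  by rewrite -(iota_phi hp) // hz iota_phi // evv_delta // -colE.
have -> : (frame_inv p *m frame_mx p') x y = evv z x 0.
  rewrite -[evv z]mul1mx -(HG1 p) -mulmxA e [LHS]mxE [RHS]mxE.
  by apply: eq_bigr => l _; rewrite [col _ _ _ _]mxE.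
by rewrite mxE; exact: ev_fr Wq.
Qed.
End Bundles.

Section BundleData.
Context (K : fieldType) (n : nat).
Local Notation S := {mpoly K[n.+1]}.
Local Notation L := {fraction S}.
Local Notation proj := (proj K n).
Local Notation O := (Oproj K n).
Local Notation eta := (eta K n).
Local Notation I := 'I_n.+1.

(** All that is retained of [E]: its sections over a nonempty [U] are the vectors of L^2 whose
    coordinates by [B i] are regular at the points of [U] where [x_i] does not vanish. *)
Record bundle_data (E : mod_sheaf O) := BundleData {
  bd_r : nat;
  bd_A : I -> 'M[L]_(2, bd_r);
  bd_B : I -> 'M[L]_(bd_r, 2);
  bd_iota : forall U : opens proj, E U -> 'cV[L]_2;
  bd_AB : forall i, bd_A i *m bd_B i = 1%:M;
  bd_BA : forall i j x y, loc [set i; j]%SET ((bd_B j *m bd_A i) x y);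
  bd_BA0 : forall i j x y, fr (@nz K n.+1) 0 ((bd_B j *m bd_A i) x y);
  bd_BAq : forall i j q x y, out q 'X_i -> out q 'X_j -> fr (out q) 0 ((bd_B j *m bd_A i) x y);
  bd_lin : forall (U : opens proj) (a : O U) (s t : E U), oset U eta ->
    bd_iota (a *: s + t) = gval a *: bd_iota s + bd_iota t;
  bd_res : forall (U V : opens proj) (h : V `<=` U) (s : E U), oset V eta -> bd_iota (md_res E h s) = bd_iota s;
  bd_inj : forall (U : opens proj) (s t : E U), bd_iota s = bd_iota t -> s = t;
  bd_image : forall (U : opens proj) w, oset U eta ->
    (exists s : E U, bd_iota s = w) <->
    forall i q, oset U q -> out q 'X_i -> forall x, fr (out q) 0 ((bd_B i *m w) x 0)
}.

Lemma bundle_data_exists (E : mod_sheaf O) : vector_bundle 2 E -> inhabited (bundle_data E).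
Proof.
move=> /choice[N hN]; have Np p : oset (N p) p by have [] := hN p.
have /choice2[phi hphi] : forall p, exists phi : forall V : opens proj, V `<=` N p -> {linear 'rV[O V]_2 -> E V},
      (forall (V : opens proj) (h : V `<=` N p), bijective (phi V h)) /\
      (forall (V W : opens proj) (hV : V `<=` N p) (hW : W `<=` N p) (h : W `<=` V)
         (v : 'rV[O V]_2),
         phi W hW (map_mx (rg_res O h) v) = md_res E h (phi V hV v)) by move=> p; have [] := hN p.
have bij p := (hphi p).1; have pnat p := (hphi p).2.
have /choice[f hf] : forall p, exists f : S, (exists d : nat, f \is d.-homog) /\ out p f /\ forall q, out q f -> oset (N p) q.
  by move=> p; have [f [d [h1 h2 h3]]] := basic_nbhd (Np p); exists f; split; [exists d|].
have fh p := (hf p).1; have fp p := (hf p).2.1; have fN p := (hf p).2.2.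
pose GG := frame_mx bij; pose HH := @frame_inv K n E N Np phi bij pnat.
have hHG p p' q : out q (f p) -> out q (f p') -> forall x y, fr (out q) 0 ((HH p *m GG p') x y).
  by move=> h h'; apply: HG_regular; exact: fN.
have [r [A [B [hAB hBA hBAq hB]]]] := frames fh fp (GH Np bij pnat) hHG.
constructor; apply: (@BundleData E r A B (iota bij)) => //.
- move=> i j x y; apply: (frS (ok := out eta)) => [b /out_eta//|].
  by apply: hBAq; apply/out_eta; exact: X_neq0.
- move=> U a s t; exact: iota_lin.
- move=> U V h s; exact: iota_res.
- move=> U s t; exact: (iota_inj Np).
move=> U w he; rewrite (iota_image Np bij pnat w he); split=> h.
  by move=> i q Uq qi; apply/(hB i q q w qi (fp q)); exact: h.
move=> q Uq; have [i qi] := pideal_relevant q.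
by apply/(hB i q q w qi (fp q)); exact: h.
Qed.
End BundleData.

(** * Twists of a bundle *)

Lemma linear_scale (R : pzRingType) (U V : lmodType R) (f : U -> V) : linear f -> forall a u, f (a *: u) = a *: f u.
Proof.
move=> hf a u; have f0 : f 0 = 0.
  by apply: (addrI (f 0)); have := hf 1 0 0; rewrite !scale1r !addr0 => <-.
by rewrite -[a *: u]addr0 hf f0 addr0.
Qed.

Section TwistedBundle.
Context (K : fieldType) (n : nat).
Local Notation S := {mpoly K[n.+1]}.
Local Notation L := {fraction S}.
Local Notation proj := (proj K n).
Local Notation O := (Oproj K n).
Local Notation eta := (eta K n).
Local Notation I := 'I_n.+1.
Local Notation V := 'cV[L]_2.
Local Notation xv := (@xv K n.+1).
Context (E : mod_sheaf O) (D : bundle_data E) (v : int).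
Local Notation B := (bd_B D).
Local Notation iota := (@bd_iota K n E D).

Definition Est p (w : V) := forall i, out p 'X_i -> forall x, fr (out p) v ((B i *m w) x 0).

Lemma Est0 p : Est p 0.
Proof. by move=> i _ x; rewrite mulmx0 mxE; exact: (fr0 (out_mclosed p)). Qed.
Lemma EstB p w w' : Est p w -> Est p w' -> Est p (w - w').
Proof.
move=> h h' i ip x; rewrite mulmxBr mxE [(- _ : 'cV_ _) _ _]mxE.
by apply: (frB (out_mclosed p)); [exact: h|exact: h'].
Qed.
Lemma EstZ p (a : L) w : fr (out p) 0 a -> Est p w -> Est p (a *: w).
Proof. by move=> ha h i ip x; rewrite -scalemxAr mxE -[v]add0r; apply: (frM (out_mclosed p)) => //; exact: h. Qed.

Lemma Est_one p i w : out p 'X_i -> (forall x, fr (out p) v ((B i *m w) x 0)) -> Est p w.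
Proof.
move=> pi h j pj x; have hp := out_mclosed p.
have -> : B j *m w = (B j *m bd_A D i) *m (B i *m w) by rewrite -mulmxA [bd_A D i *m _]mulmxA bd_AB mul1mx.
by rewrite -[v]add0r; apply: (fr_mulmx hp) => a b; [by apply: bd_BAq|rewrite [b]ord1; exact: h].
Qed.

(** Sections are constant functions on [U] rather than bare vectors, so that the empty open set has
    exactly one section. *)
Definition tsec (U : opens proj) (w : U -> V) : Prop := (forall p q : U, w p = w q) /\ forall p : U, Est (val p) (w p).
Definition tpred (U : opens proj) : pred (U -> V) := fun w => `[< tsec w >].

Lemma tpred_zmod U : zmod_closed (@tpred U).
Proof.
split; first by apply/asboolP; split=> // p; exact: Est0.
move=> s t /asboolP[s1 s2] /asboolP[t1 t2]; apply/asboolP; split=> [p q|p].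
  by transitivity (s p - t p) => //; rewrite (s1 p q) (t1 p q).
exact: EstB.
Qed.
HB.instance Definition _ U := GRing.isZmodClosed.Build _ (@tpred U) (@tpred_zmod U).

Record esec (U : opens proj) := ESec { es_fun :> U -> V; _ : tpred es_fun }.
HB.instance Definition _ U := [isSub for @es_fun U].
HB.instance Definition _ U := [Choice of esec U by <:].
HB.instance Definition _ U := [SubChoice_isSubZmodule of esec U by <:].

Lemma esecP U (s : esec U) : tsec s.
Proof. by case: s => s hs; apply/asboolP. Qed.
Lemma esec_inj U (s t : esec U) : (forall q, s q = t q) -> s = t.
Proof. by move=> st; apply/val_inj/funext. Qed.
Definition es_mk (U : opens proj) (w : U -> V) (h : tsec w) : esec U := @ESec U w (asboolT h).

Section Scale.
Context (U : opens proj).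
Lemma es_scale_sec (a : twist_sec 0 U) (s : esec U) : tsec (fun q => a q *: s q).
Proof.
have [s1 s2] := esecP s; split=> [p q|p]; first by rewrite (s1 p q) (sec_const a p q).
by apply: EstZ => //; rewrite -evE; exact: ev_fr (set_valP p).
Qed.
Definition es_scale (a : twist_sec 0 U) (s : esec U) : esec U := es_mk (es_scale_sec a s).
Let es_scaleA a b (s : esec U) : es_scale a (es_scale b s) = es_scale (a * b) s.
Proof. by apply: esec_inj => q; exact: scalerA. Qed.
Let es_scale1 : left_id (reg_one U) es_scale.
Proof. by move=> s; apply: esec_inj => q; exact: scale1r. Qed.
Let es_scaleDr : right_distributive es_scale +%R.
Proof. by move=> a s t; apply: esec_inj => q; exact: scalerDr. Qed.
Let es_scaleDl (s : esec U) : {morph es_scale^~ s : a b / a + b}.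
Proof. by move=> a b; apply: esec_inj => q; exact: scalerDl. Qed.
HB.instance Definition _ := GRing.Zmodule_isLmodule.Build (twist_sec 0 U) (esec U)
  es_scaleA es_scale1 es_scaleDr es_scaleDl.
End Scale.

Lemma es_res_sec (U W : opens proj) (h : W `<=` U) (s : esec U) : tsec (fun q : W => s (subfun h q)).
Proof. by have [s1 s2] := esecP s; split=> [p q|p]; [exact: s1|exact: (s2 (subfun h p))]. Qed.
Definition es_res (U W : opens proj) (h : W `<=` U) (s : esec U) : esec W := es_mk (es_res_sec h s).
Let es_res_additive (U W : opens proj) (h : W `<=` U) : zmod_morphism (es_res h).
Proof. by move=> s t; exact: esec_inj. Qed.
HB.instance Definition _ U W h := GRing.isZmodMorphism.Build (esec U) (esec W) (@es_res U W h) (es_res_additive h).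

Lemma es_const U (s : esec U) (p q : U) : s p = s q.
Proof. by have [h _] := esecP s. Qed.

Lemma es_sheafP : is_sheaf es_res.
Proof.
split.
- by move=> U h s; apply: esec_inj => q; exact: (es_const s _ q).
- by move=> U W W' h1 h2 h3 s; apply: esec_inj => q; exact: (es_const s).
- move=> U J W h hU s t st; apply: esec_inj => q; have [i _ Wq] := hU _ (set_valP q).
  have := congr1 (fun u : esec (W i) => u (pt Wq)) (st i).
  by rewrite /= (es_const s _ q) (es_const t _ q).
move=> U J W h hU s hs.
have /choice[c hc] : forall q : U, exists i, oset (W i) (val q).
  by move=> q; have [i _ Wq] := hU _ (set_valP q); exists i.
have agree i j (p : W i) (q : W j) : s i p = s j q.
  have ei := eta_in (set_valP p); have ej := eta_in (set_valP q).
  have Ve : oset (Iop (W i) (W j)) eta by split.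
  have := congr1 (fun u : esec (Iop (W i) (W j)) => u (pt Ve)) (hs i j _ (@IopL K n _ _) (@IopR K n _ _)).
  by rewrite /= (es_const (s i) _ p) (es_const (s j) _ q).
have ht : tsec (fun q : U => s (c q) (pt (hc q))).
  split=> [p q|p]; first exact: agree.
  by have [_ h2] := esecP (s (c p)); exact: (h2 (pt (hc p))).
by exists (es_mk ht) => i; apply: esec_inj => q; exact: agree.
Qed.

Lemma es_resZ (U W : opens proj) (h : W `<=` U) (a : O U) (s : esec U) :
  es_res h (a *: s) = rg_res O h a *: es_res h s.
Proof. exact: esec_inj. Qed.

Definition Etw : mod_sheaf O := @ModSheaf proj O esec es_res es_resZ es_sheafP.

Definition evw U (s : esec U) : V := if pselect (oset U eta) is left h then s (pt h) else 0.
Lemma evwE U (s : esec U) (q : U) : evw s = s q.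
Proof.
rewrite /evw; case: pselect => [h|[]]; first exact: es_const.
exact: (eta_in (set_valP q)).
Qed.
Lemma evw_inj U (s t : esec U) : evw s = evw t -> s = t.
Proof. by move=> e; apply: esec_inj => q; rewrite -!evwE. Qed.
Lemma evw_res (U W : opens proj) (h : W `<=` U) (s : esec U) : oset W eta -> evw (es_res h s) = evw s.
Proof. by move=> he; rewrite (evwE _ (pt he)) (evwE _ (pt (h _ he))); exact: (es_const s). Qed.
Lemma evwD U (s t : esec U) : evw (s + t) = evw s + evw t.
Proof. by rewrite /evw; case: pselect => [h|_]; rewrite ?addr0. Qed.
Lemma evwZ U (a : O U) (s : esec U) : evw (a *: s) = gval a *: evw s.
Proof. by rewrite /evw /gval; case: pselect => [h|_]; rewrite ?scaler0. Qed.
Lemma evw_Est U (s : esec U) p : oset U p -> Est p (evw s).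
Proof. by move=> Up; rewrite (evwE _ (pt Up)); have [_ h] := esecP s; exact: (h (pt Up)). Qed.
Lemma es_cst_sec (U : opens proj) w : (forall p, oset U p -> Est p w) -> tsec (fun _ : U => w).
Proof. by move=> h; split=> // p; apply: h; exact: set_valP. Qed.
Definition es_cst (U : opens proj) w (h : forall p, oset U p -> Est p w) : esec U := es_mk (es_cst_sec h).
Lemma evw_cst (U : opens proj) w (h : forall p, oset U p -> Est p w) : oset U eta -> evw (es_cst h) = w.
Proof. by move=> he; rewrite (evwE _ (pt he)). Qed.

Lemma iota_sec (U : opens proj) (s : E U) i q : oset U q -> out q 'X_i -> forall x, fr (out q) 0 ((B i *m iota s) x 0).
Proof. by move=> Uq; have [h _] := bd_image D (iota s) (eta_in Uq); apply: h => //; exists s. Qed.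

Lemma tensor_sec U (s : E U) (t : twist K n v U) : tsec (fun q : U => (t : twist_sec v U) q *: iota s).
Proof.
split=> [p q|p i pi x]; first by congr (_ *: _); exact: sec_const.
rewrite -scalemxAr mxE -(evE (t : twist_sec v U) p).
have h := frM (out_mclosed _) (ev_fr (t : twist_sec v U) (set_valP p)) (iota_sec s (set_valP p) pi x).
by rewrite addr0 in h; exact: h.
Qed.
Definition tens_fun U (s : E U) (t : twist K n v U) : Etw U := es_mk (tensor_sec s t).
Lemma evw_tens U (s : E U) (t : twist K n v U) : evw (tens_fun s t) = gval (t : twist_sec v U) *: iota s.
Proof. by rewrite /evw /gval; case: pselect => // _; rewrite scale0r. Qed.

Lemma tens_linl U t : linear (fun s => @tens_fun U s t).
Proof.
move=> a s s'; apply: evw_inj; rewrite evwD; have [he|ne] := pselect (oset U eta); last first.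
  by rewrite /evw; case: pselect => // _; rewrite addr0.
rewrite [X in _ = X + _]evwZ !evw_tens bd_lin // scalerDr !scalerA; congr (_ *: _ + _).
exact: mulrC.
Qed.
Lemma tens_linr U s : linear (@tens_fun U s).
Proof.
move=> a t t'; apply: evw_inj; rewrite evwD [X in _ = X + _]evwZ !evw_tens evD scalerDl; congr (_ + _).
by rewrite evZ scalerA.
Qed.
Lemma tens_nat (U W : opens proj) (h : W `<=` U) (s : E U) (t : twist K n v U) :
  tens_fun (md_res E h s) (md_res (twist K n v) h t) = md_res Etw h (tens_fun s t).
Proof.
apply: evw_inj; have [he|ne] := pselect (oset W eta); last by rewrite /evw; case: pselect.
by rewrite evw_tens evw_res // evw_tens bd_res // ev_res.
Qed.
Definition tens_bi : mod_bihom E (twist K n v) Etw := ModBihom tens_linl tens_linr tens_nat.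

(** The generator of O(v) over D(x_i). *)
Definition xz (i : I) : L := xv i ^ v.
Lemma xz_neq0 i : xz i != 0.
Proof. by rewrite /xz expfz_neq0 // xv_neq0. Qed.
Lemma frxz (w : int) i p : out p 'X_i -> fr (out p) w (xv i ^ w).
Proof.
move=> pi; case: w => k; first by rewrite -exprnP -tofracXn; apply: (homog_fr (out_mclosed p)); exact: Xn_homog.
rewrite NegzE -exprnN -tofracXn; apply: (frV (Xn_homog _ i k.+1)); exact: outX.
Qed.
Definition Uc (U : opens proj) i := Iop U (Dop (@X_homog K n i)).
Lemma gen_fr U i p : oset (Uc U i) p -> fr (out p) v (xz i).
Proof. by move=> [_ pi]; exact: frxz. Qed.
Definition xgen U i : twist K n v (Uc U i) := cst_sec (@gen_fr U i).
Lemma Uc_eta U i : oset U eta -> oset (Uc U i) eta.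
Proof. by move=> he; split=> //; apply/out_eta; exact: X_neq0. Qed.
Lemma ev_gen U i : oset U eta -> gval (xgen U i : twist_sec v _) = xz i.
Proof. by move=> he; apply: ev_cst; exact: Uc_eta. Qed.
Lemma Uc_cover (U : opens proj) : U `<=` \bigcup_i (Uc U i : set proj).
Proof. by move=> p Up; have [i hi] := pideal_relevant p; exists i. Qed.

Lemma local_gen U i (w : esec U) : oset U eta -> exists s : E (Uc U i), evw w = xz i *: iota s.
Proof.
move=> he; have [|s hs] := (bd_image D ((xz i)^-1 *: evw w) (Uc_eta i he)).2.
  move=> j q [Uq qi] qj x; rewrite -scalemxAr mxE -[0](addNr v).
  apply: (frM (out_mclosed q)); last exact: evw_Est.
  by rewrite /xz invr_expz; exact: frxz.
by exists s; rewrite hs scalerA mulfV ?scale1r // xz_neq0.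
Qed.

Section Universal.
Context (H : mod_sheaf O) (c : mod_bihom E (twist K n v) H).

(* Both sides are u c(s, x') for the regular function u = x / x'. *)
Lemma bihom_move (W : opens proj) i (s s' : E W) (x x' : twist K n v W) :
  (forall p, oset W p -> out p 'X_i) -> (oset W eta -> gval (x' : twist_sec v W) = xz i) ->
  (oset W eta -> gval (x : twist_sec v W) *: iota s = xz i *: iota s') -> c W s x = c W s' x'.
Proof.
move=> hW hx' e; have [he|ne] := pselect (oset W eta); last exact: empty_sections.
have hu p : oset W p -> fr (out p) 0 (gval (x : twist_sec v W) / xz i).
  move=> Wp; rewrite -[0](subrr v); apply: (frM (out_mclosed p)); first exact: ev_fr Wp.
  by rewrite /xz invr_expz; apply: frxz; exact: hW.
pose u : O W := cst_sec hu; have eu : gval (u : twist_sec 0 W) = gval (x : twist_sec v W) / xz i by exact: ev_cst.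
have -> : x = u *: x'.
  apply: ev_inj; have -> : gval (u *: x' : twist_sec v W) = gval u * gval (x' : twist_sec v W) by exact: evZ.
  by rewrite eu hx' // divfK // xz_neq0.
have -> : s' = u *: s.
  apply: (bd_inj (b := D)); rewrite -[u *: s]addr0 bd_lin //.
  have -> : iota (0 : E W) = 0.
    have := bd_lin D 1 (0 : E W) 0 he; rewrite scaler0 addr0 ev1 // scale1r => /eqP.
    by rewrite -subr_eq0 opprD addNKr oppr_eq0 => /eqP.
  by rewrite addr0 eu mulrC -scalerA e // scalerA mulVf ?scale1r // xz_neq0.
have e1 : c W s (u *: x') = u *: c W s x' by exact: (linear_scale (bh_linr c s)).
have e2 : c W (u *: s) x' = u *: c W s x' by exact: (linear_scale (bh_linl c x')).
by rewrite e1 e2.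
Qed.

(** Over D(x_i) a section [w] of the twist is s (x) x_i^v, so the map induced by [c] has to send it
    to c(s, x_i^v). This condition determines the image locally. *)
Definition Fspec U (w : esec U) (t : H U) := forall i (s : E (Uc U i)), evw w = xz i *: iota s ->
  md_res H (@IopL K n U _) t = c (Uc U i) s (xgen U i).

Lemma Fspec_uniq U w (t t' : H U) : Fspec w t -> Fspec w t' -> t = t'.
Proof.
move=> h h'; have [he|ne] := pselect (oset U eta); last exact: empty_sections.
apply: (sheaf_sep (md_sheafP H) (W := Uc U) (h := fun i => @IopL K n U _)); first exact: Uc_cover.
by move=> i; have [s hs] := local_gen i w he; rewrite /= (h i s hs) (h' i s hs).
Qed.

Lemma Fspec_ex U w : exists t : H U, Fspec w t.
Proof.
have [he|ne] := pselect (oset U eta); last first.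
  by exists 0 => i s _; apply: empty_sections => -[].
have /choice2[s hs] : forall i, exists s : E (Uc U i), evw w = xz i *: iota s by move=> i; exact: local_gen.
have [||t ht] := @sheaf_glue _ _ _ (md_sheafP H) U _ (Uc U) (fun i => @IopL K n U _) _ (fun i => c (Uc U i) (s i) (xgen U i)).
- exact: Uc_cover.
- move=> i j W hi hj; rewrite -!bh_nat; apply: (@bihom_move W j).
  + by move=> p /hj[].
  + move=> We; have -> : gval (md_res (twist K n v) hj (xgen U j) : twist_sec v W) = gval (xgen U j : twist_sec v _) by exact: ev_res.
    exact: ev_gen.
  + move=> We; have -> : gval (md_res (twist K n v) hi (xgen U i) : twist_sec v W) = gval (xgen U i : twist_sec v _) by exact: ev_res.
    by rewrite ev_gen // !bd_res // -hs -hs.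
exists t => i s' hs'; rewrite (ht i); congr (c _ _ _).
by apply: (bd_inj (b := D)); apply: (scalerI (xz_neq0 i)); rewrite -hs -hs'.
Qed.

Definition ff U (w : Etw U) : H U := projT1 (cid (Fspec_ex (w : esec U))).
Lemma ffP U (w : Etw U) : Fspec (w : esec U) (ff w).
Proof. by rewrite /ff; case: cid. Qed.

Lemma ff_linear U : linear (@ff U).
Proof.
move=> a w w'; have [he|ne] := pselect (oset U eta); last exact: empty_sections.
apply: (@Fspec_uniq U (a *: w + w')); first exact: ffP.
move=> i s hs; have [s1 h1] := local_gen i w he; have [s2 h2] := local_gen i w' he.
have We := Uc_eta i he.
have -> : md_res H (@IopL K n U _) (a *: ff w + ff w') =
   rg_res O (@IopL K n U (Dop (@X_homog K n i))) a *: md_res H (@IopL K n U _) (ff w) + md_res H (@IopL K n U _) (ff w').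
  by rewrite -md_resZ; exact: raddfD.
rewrite (ffP h1) (ffP h2) -(bh_linl c); congr (c _ _ _).
apply: (bd_inj (b := D)); apply: (scalerI (xz_neq0 i)); rewrite -hs bd_lin // scalerDr -h2 evwD evwZ; congr (_ + _).
by rewrite h1 !scalerA mulrC; congr (_ * _ *: _); exact: ev_res.
Qed.
HB.instance Definition _ U := GRing.isLinear.Build (O U) (Etw U) (H U) _ (@ff U) (@ff_linear U).

Lemma ff_nat (U W : opens proj) (h : W `<=` U) (w : Etw U) : ff (md_res Etw h w) = md_res H h (ff w).
Proof.
have [he|ne] := pselect (oset W eta); last exact: empty_sections.
apply: (@Fspec_uniq W (md_res Etw h w)); first exact: ffP.
have Ue := h _ he; move=> i s hs; have [s1 h1] := local_gen i w Ue.
have hc : Uc W i `<=` Uc U i by move=> p [Wp pi]; split=> //; exact: (h _ Wp).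
have hWU : Uc W i `<=` U by move=> p [/h].
rewrite (md_comp _ _ hWU) -(md_comp (@IopL K n U _) hc) (ffP h1) -bh_nat.
have We := Uc_eta i he; apply: (@bihom_move _ i).
- by move=> p [].
- by move=> _; exact: ev_gen.
move=> _; have -> : gval (md_res (twist K n v) hc (xgen U i) : twist_sec v _) = gval (xgen U i : twist_sec v _) by exact: ev_res.
by rewrite ev_gen // bd_res // -h1 -hs; symmetry; exact: evw_res.
Qed.

Definition ffh : mod_hom Etw H := @ModHom proj O Etw H (fun U => @ff U : {linear Etw U -> H U}) ff_nat.

Lemma ff_tens U s t : ff (tens_fun s t) = c U s t.
Proof.
apply: (@Fspec_uniq U (tens_fun s t)); first exact: ffP.
move=> i s1 h1; rewrite -bh_nat; apply: (@bihom_move _ i).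
- by move=> p [].
- by move=> [he _]; exact: ev_gen.
move=> We; rewrite -h1 evw_tens bd_res //; congr (_ *: _); exact: ev_res.
Qed.

Lemma ff_unique (f' : mod_hom Etw H) : (forall U s t, f' U (tens_fun s t) = c U s t) -> forall U x, f' U x = ff x.
Proof.
move=> hf' U w; apply: (@Fspec_uniq U w); last exact: ffP.
move=> i s hs; rewrite -mh_nat -hf'; congr (f' _ _); apply: evw_inj.
have [We|ne] := pselect (oset (Uc U i) eta); last by rewrite /evw; case: pselect.
have [he _] := We.
rewrite evw_tens ev_gen // -hs; exact: evw_res.
Qed.
End Universal.

Lemma Etw_tensor : is_tensor E (twist K n v) Etw.
Proof.
exists tens_bi => H c; exists (ffh c); split=> [U s t|f' hf' U x]; first exact: ff_tens.
exact: (ff_unique hf').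
Qed.
End TwistedBundle.

(** * Cohomology of the twists *)

Lemma theta_cancel (R : fieldType) (a gM gN g0 b h : R) : gN != 0 ->
  (a * (gM * gN)) / g0 * (b / (gN * h)) = a * gM * b / g0 / h.
Proof.
move=> gN0; rewrite mulf_div; have -> : a * (gM * gN) * b = a * gM * b * gN by rewrite mulrA mulrAC.
have -> : g0 * (gN * h) = g0 * h * gN by rewrite mulrCA mulrC.
by rewrite -mulf_div divff // mulr1 invfM mulrA.
Qed.

Section CechComparison.
Context (K : fieldType) (n : nat).
Local Notation S := {mpoly K[n.+1]}.
Local Notation L := {fraction S}.
Local Notation proj := (proj K n).
Local Notation O := (Oproj K n).
Local Notation eta := (eta K n).
Local Notation I := 'I_n.+1.
Local Notation V := 'cV[L]_2.
Local Notation "x %:F" := (@tofrac S x).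

Lemma out_prod (J : finType) (P : pred J) (g : J -> S) p :
  out p (\prod_(j | P j) g j) <-> forall j, P j -> out p (g j).
Proof.
have [o1 _ _] := out_mclosed p.
suff h (r : seq J) : out p (\prod_(j <- r | P j) g j) <-> forall j, j \in r -> P j -> out p (g j).
  rewrite h; split=> H j; last by move=> _; exact: H.
  by move=> Pj; apply: H => //; exact: mem_index_enum.
elim: r => [|j r IH]; first by rewrite big_nil; split.
rewrite big_cons; case: ifP => Pj; last first.
  rewrite IH; split=> H l lr Pl; last by apply: H => //; rewrite inE lr orbT.
  by move: lr; rewrite inE => /orP[/eqP e|lr]; [rewrite e Pj in Pl|exact: H].
rewrite outM IH; split=> [[h1 h2] l|H].
  by rewrite inE => /orP[/eqP ->//|]; exact: h2.
split; first by apply: H => //; exact: mem_head.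
by move=> l lr; apply: H; rewrite inE lr orbT.
Qed.

Lemma prod_homog (J : finType) (P : pred J) (g : J -> S) (d : J -> nat) : (forall j, g j \is (d j).-homog) ->
  \prod_(j | P j) g j \is (\sum_(j | P j) d j)%N.-homog.
Proof.
move=> hg; elim/big_rec2: _ => [|j x y _ h]; first exact: dhomog1.
exact: dhomogM.
Qed.

(** The nonempty opens D(x_i f). The factor [x_i] provides one chart of [E] on the whole open set
    and makes the degree of its equation positive. *)
Definition Bz (U : opens proj) : Prop := exists (i : I) (f : S) (d : nat),
  [/\ f \is d.-homog, f != 0 & forall p, oset U p <-> out p ('X_i * f)].

Lemma Xi_neq0 (i : I) : ('X_i : S) != 0. Proof. exact: X_neq0. Qed.

Lemma refine_Bz (U : opens proj) (W : proj -> opens proj) : Bz U -> (forall x, oset U x -> oset (W x) x) ->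
  exists m (W' : 'I_m -> opens proj), iscov Bz U W' /\ forall i, exists2 x, oset U x & W' i `<=` W x.
Proof.
move=> [i [f [d [hf f0 hU]]]] hW; pose g : S := 'X_i * f.
have hg : g \is (1 + d)%N.-homog by apply: dhomogM => //; exact: X_homog.
pose T (h : S) := (exists e : nat, h \is e.-homog) /\ h != 0 /\ exists x, oset U x /\ forall q, out q h -> oset (W x) q.
have [//|||q [t [hT cov]]] := @finite_cover K n T g _ hg.
- by move=> h [].
- move=> p /hU Up; have [h [e [h1 h2 h3]]] := basic_nbhd (hW p Up); exists h => //.
  split; first by exists e.
  by split; [have [_ _ o] := out_mclosed p; exact: o|exists p].
have /choice[e he] : forall l, exists e : nat, t l \is e.-homog by move=> l; have [] := hT l.
pose W' l := Dop (he l); exists q, W'; split.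
  split; first by move=> p /hU /cov[l hl]; exists l.
  move=> s _; exists i, (f * \prod_(l in s) t l), (d + \sum_(l in s) e l)%N; split.
  - by apply: dhomogM => //; exact: prod_homog.
  - by apply: mulf_neq0 => //; apply/prodf_neq0 => l _; have [_ []] := hT l.
  move=> p; rewrite mulrA outM out_prod; split=> [[/hU h1 h2]|[/hU h1 h2]]; split=> //.
by move=> l; have [_ [_ [x [Ux hx]]]] := hT l; exists x.
Qed.

Lemma standard_cover : iscov Bz (otop proj) (fun i => Dop (@X_homog K n i)).
Proof.
split; first by move=> p _; have [i hi] := pideal_relevant p; exists i.
move=> s /finset.set0Pn[i si]; exists i, (\prod_(j in s :\ i) 'X_j), (\sum_(j in s :\ i) 1)%N; split.
- by apply: prod_homog => j; exact: X_homog.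
- by apply/prodf_neq0 => j _; exact: Xi_neq0.
move=> p; rewrite outM out_prod; split=> [[_ h]|[h1 h2]].
  by split=> [|j]; [exact: h|rewrite !inE => /andP[_ sj]; exact: h].
split=> // j sj; have [->//|ji] := eqVneq j i.
by apply: h2; rewrite !inE ji.
Qed.

Context (E : mod_sheaf O) (D : bundle_data E).
Local Notation A := (bd_A D).
Local Notation B := (bd_B D).
Local Notation F v := (ab_of_mod (Etw D v)).

Section Twist.
Context (v : int).
Local Notation Est := (Est D v).

Lemma EstD p w w' : Est p w -> Est p w' -> Est p (w + w').
Proof. by move=> h h'; rewrite -[w']opprK; apply: EstB => //; rewrite -sub0r; apply: EstB => //; exact: Est0. Qed.
Lemma Est_mulz p w (z : int) : Est p w -> Est p (w *~ z).
Proof.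
move=> h; have hn k : Est p (w *+ k).
  by elim: k => [|k IH]; [rewrite mulr0n; exact: Est0|rewrite mulrS; exact: EstD].
case: z => k; first exact: hn.
by rewrite NegzE mulrNz -sub0r; apply: EstB; [exact: Est0|exact: hn].
Qed.

Lemma evw_zmod U : zmod_morphism (@evw K n E D v U).
Proof. by move=> s t; rewrite /evw; case: pselect => [h|_]; rewrite ?subr0. Qed.
HB.instance Definition _ U := GRing.isZmodMorphism.Build (esec D v U) V (@evw K n E D v U) (@evw_zmod U).

Lemma evw_dC (U : opens proj) m (W : 'I_m -> opens proj) (c : cochain U W (F v)) (s : {set 'I_m}) :
  (oset (wcap U W s) eta) -> evw (dC c s : esec D v _) = dS (fun t => evw (c t : esec D v _)) s.
Proof.
move=> he; rewrite /dC /dS raddf_sum; apply: eq_bigr => i si.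
transitivity (evw (es_res (@wcapD _ U m W s i) (c (s :\ i) : esec D v _)) *~ sgn i s).
  exact: (raddfMz (@evw K n E D v _)).
by congr (_ *~ _); exact: evw_res.
Qed.

(** A partition of unity: theta_j = a_j g_j^M / f0'^N0 sum to 1, and theta_j cancels [g j] in the
    denominator of c(j |: t). So the sum of the theta_j [hS j] is a contraction that preserves
    regularity. *)
Lemma acyclic_functions (i0 : I) (f : S) (d : nat) m (g : 'I_m -> S) (dd : 'I_m -> nat) (p : nat) (c : {set 'I_m} -> V) :
  f \is d.-homog -> f != 0 -> (forall j, g j \is (dd j).-homog) -> (forall j, g j != 0) ->
  (forall q, out q ('X_i0 * f) -> exists j, out q (g j)) ->
  (forall (s : {set 'I_m}) q, out q ('X_i0 * f) -> (forall j, j \in s -> out q (g j)) -> Est q (c s)) ->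
  (forall s : {set 'I_m}, #|s| = p.+2 -> dS c s = 0) ->
  exists b : {set 'I_m} -> V, (forall (s : {set 'I_m}) q, out q ('X_i0 * f) -> (forall j, j \in s -> out q (g j)) -> Est q (b s)) /\
    forall s : {set 'I_m}, #|s| = p.+1 -> dS b s = c s.
Proof.
move=> hf f0 hg g0 cov cE dc; set f0' := ('X_i0 * f) in cov cE *.
have hf0 : f0' \is (1 + d)%N.-homog by apply: dhomogM => //; exact: X_homog.
have f00 : f0' != 0 by apply: mulf_neq0 => //; exact: Xi_neq0.
pose h (s : {set 'I_m}) : S := f0' * \prod_(j in s) g j.
pose e (s : {set 'I_m}) : nat := (1 + d + \sum_(j in s) dd j)%N.
have hh s : h s \is (e s).-homog by apply: dhomogM => //; exact: prod_homog.
have h0 s : h s != 0 by apply: mulf_neq0 => //; apply/prodf_neq0.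
have hout s q : out q (h s) <-> out q f0' /\ forall j, j \in s -> out q (g j) by rewrite outM out_prod.
have /choice[N hN] : forall u : {set 'I_m} * 'I_(bd_r D), exists N : nat, exists a,
    pih (v + (e u.1 * N)%N%:Z) a = a /\ (B i0 *m c u.1) u.2 0 = a%:F / ((h u.1) ^+ N)%:F.
  move=> u; have [//||N [a ha]] := @sections_basic K n (h u.1) _ v ((B i0 *m c u.1) u.2 0) (hh _) _ (h0 _); last by exists N, a.
  move=> q /hout[h1 h2]; apply: cE => //; by have /outM[] := h1.
pose M := (\sum_u N u)%N.
have [|||N0 [a [ha ea]]] := @partition_unity K n _ (fun j => g j ^+ M) (fun j => (dd j * M)%N) f0' _ hf0.
- by [].
- by move=> j; exact: dhomogMn.
- by move=> q /cov[j hj]; exists j; exact: outX.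
pose th j : L := (a j * g j ^+ M)%:F / (f0' ^+ N0)%:F.
have nF (b : S) k : b != 0 -> (b ^+ k)%:F != 0 by move=> b0; rewrite tofrac_eq0 expf_neq0.
have sth : \sum_j th j = 1.
  rewrite /th -mulr_suml; have -> : \sum_j (a j * g j ^+ M)%:F = (f0' ^+ N0)%:F by rewrite ea rmorph_sum.
  by exact: divff (nF _ _ f00).
exists (fun t => \sum_j th j *: hS j c t); split.
  move=> t q qf qg; elim/big_ind: _ => [||j _]; [exact: Est0|exact: EstD|].
  have hq := out_mclosed q; rewrite /hS; case: ifPn => tj; first by rewrite scaler0; exact: Est0.
  have -> : th j *: (c (j |: t) *~ sgn j t) = (th j *: c (j |: t)) *~ sgn j t by exact: (raddfMz (GRing.scale (th j))).
  apply: Est_mulz; have /outM[qi0 _] := qf; apply: (Est_one qi0) => x.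
  rewrite -scalemxAr mxE; have [b [hb ->]] := hN (j |: t, x); rewrite /=.
  have le : (N (j |: t, x) <= M)%N by rewrite /M (bigD1 (j |: t, x)) //= leq_addr.
  set Nx := N _ in hb le *; have eh : h (j |: t) = g j * h t by rewrite /h big_setU1 //= mulrCA.
  have ee : e (j |: t) = (dd j + e t)%N by rewrite /e big_setU1 //= addnCA.
  have -> : th j * (b%:F / (h (j |: t) ^+ Nx)%:F) =
     (a j)%:F * (g j ^+ (M - Nx))%:F * b%:F / (f0' ^+ N0)%:F / (h t ^+ Nx)%:F.
    have tM (y y' : S) : (y * y')%:F = y%:F * y'%:F by exact: tofracM.
    have eM : g j ^+ M = g j ^+ (M - Nx) * g j ^+ Nx by rewrite -exprD subnK.
    have eh2 : (g j * h t) ^+ Nx = g j ^+ Nx * h t ^+ Nx by exact: exprMn.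
    by rewrite /th eh eh2 eM !tM; exact: (@theta_cancel L _ _ _ _ _ _ (nF _ _ (g0 j))).
  have e0 : ((1 + d) * N0)%N%:Z - (dd j * M)%N%:Z + (dd j * (M - Nx))%N%:Z + (v + (e (j |: t) * Nx)%N%:Z) + - ((1 + d) * N0)%N%:Z + - (e t * Nx)%N%:Z = v.
    have e1 : (dd j * M = dd j * (M - Nx) + dd j * Nx)%N by rewrite -mulnDr subnK.
    have e2 : (e (j |: t) * Nx = dd j * Nx + e t * Nx)%N by rewrite ee mulnDl.
    rewrite e1 e2; move: (dd j * (M - Nx))%N (dd j * Nx)%N (e t * Nx)%N ((1 + d) * N0)%N => y1 y2 y3 y4.
    by rewrite !PoszD; lia.
  refine (eq_ind _ (fun k => fr (out q) k _) _ _ e0).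
  apply: (frM hq); last by apply: frVX => //; apply/hout.
  apply: (frM hq); last exact: frVX.
  apply: (frM hq); last exact: pih_fr.
  apply: (frM hq); first exact: pih_fr.
  by apply: pih_fr => //; apply: pih_homog; exact: dhomogMn.
move=> s sp; rewrite (dS_sum (index_enum _) predT (fun j t => th j *: hS j c t)).
transitivity (\sum_j th j *: c s); last by rewrite -scaler_suml sth scale1r.
apply: eq_bigr => j _; transitivity (th j *: dS (hS j c) s).
  by symmetry; exact: (dS_raddf (GRing.scale (th j))).
congr (_ *: _); have := dShS j c s; rewrite {2}/hS; case: ifPn => sj; first by rewrite addr0.
by rewrite dc ?mul0rz ?addr0 // cardsU1 sj sp.
Qed.

Lemma Etw_acyclic : sheaf_acyclic Bz (F v).
Proof.
move=> U m W [i0 [f [d [hf f0 hU]]]] [cov cB] p _ c _ dc.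
have /choice[g hg] : forall j, exists g : S, (exists dd : nat, g \is dd.-homog) /\ g != 0 /\ forall q, oset (wcap U W [set j]%SET) q <-> out q g.
  move=> j; have [|i [f' [d' [h1 h2 h3]]]] := cB [set j]%SET; first by apply/finset.set0Pn; exists j; rewrite inE.
  exists ('X_i * f'); split; first by exists (1 + d')%N; apply: dhomogM => //; exact: X_homog.
  by split=> //; apply: mulf_neq0 => //; exact: Xi_neq0.
have /choice[dd hdd] : forall j, exists dd : nat, g j \is dd.-homog by move=> j; have [] := hg j.
have g0 j : g j != 0 by have [_ []] := hg j.
have gq j q : oset (wcap U W [set j]%SET) q <-> out q (g j) by have [_ []] := hg j.
have wq s q : oset (wcap U W s) q <-> out q ('X_i0 * f) /\ forall j, j \in s -> out q (g j).
  split=> [[/hU Uq h]|[/hU Uq h]]; split=> // j sj.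
    by apply/gq; split; [exact/hU|move=> l; rewrite inE => /eqP ->; exact: h].
  by have /gq[_] := h j sj; apply; rewrite inE.
have we s : oset (wcap U W s) eta.
  by apply/wq; split=> [|j _]; apply/out_eta; [exact: (mulf_neq0 (Xi_neq0 i0) f0)|exact: g0].
have [|||b [hb db]] := @acyclic_functions i0 f d m g dd p (fun s => evw (c s : esec D v _)) hf f0 hdd g0.
- move=> q /hU Uq; have [j _ Wq] := cov q Uq; exists j; apply/gq; split=> // l; by rewrite inE => /eqP ->.
- by move=> s q h1 h2; apply: evw_Est; apply/wq.
- move=> s sp; rewrite -evw_dC // dc //; exact: raddf0.
have hb' s q : oset (wcap U W s) q -> Est q (b s) by move=> /wq[h1 h2]; exact: hb.
exists (fun s => es_cst (hb' s) : Etw D v (wcap U W s)); split=> // s sp.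
apply: (@evw_inj K n E D v); rewrite evw_dC // -(db s sp); apply: dS_eq => i si.
exact: evw_cst.
Qed.

Local Notation Wi := (fun i => Dop (@X_homog K n i)).
Lemma wcapE (s : {set I}) q : oset (wcap (otop proj) Wi s) q <-> forall i, i \in s -> out q 'X_i.
Proof. by split=> [[]|]. Qed.
Lemma wcap_eta (s : {set I}) : oset (wcap (otop proj) Wi s) eta.
Proof. by apply/wcapE => i _; apply/out_eta; exact: Xi_neq0. Qed.

Lemma out_mset (s : {set I}) q : out q ('X_[mset s] : S) <-> forall i, i \in s -> out q 'X_i.
Proof.
rewrite mpolyXE_id out_prod; split=> h i; first by move=> si; have := h i isT; rewrite msetE si expr1.
by move=> _; rewrite msetE; case: (boolP (i \in s)) => [/h //|_]; rewrite expr0; have [] := out_mclosed q.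
Qed.

(** By [sections_basic], regularity at all points of D(x_s) means a monomial denominator;
    homogeneity is tested at the generic point. *)
Lemma Est_graded (s : {set I}) w : s != finset.set0 ->
  (forall q, (forall i, i \in s -> out q 'X_i) -> Est q w) <-> Esec B s w /\ Edeg B v w.
Proof.
move=> /finset.set0Pn[i si].
have hX : ('X_[mset s] : S) \is (mdeg (mset s)).-homog by rewrite dhomogX.
have dX : (0 < mdeg (mset s))%N by rewrite mdegE (bigD1 i) //= msetE si.
have X00 : ('X_[mset s] : S) != 0 by exact: X_neq0.
split=> [h|[[_ h1] h2] q hq].
  split; last first.
    move=> j x; apply: (frS (ok := out eta)) => [b /out_eta//|].
    by apply: h => [l _|]; apply/out_eta; exact: Xi_neq0.
  refine (@Esec_one K n.+1 (bd_r D) A B (bd_AB D) (@bd_BA K n E D) i s w si _) => x.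
  have [//|N [a [_ ez]]] := sections_basic (d := v) (z := (B i *m w) x 0) hX dX X00.
    by move=> q /out_mset hq; apply: h => //; exact: hq.
  exists N, a; rewrite ez mulrC -[xm _ _ ^+ N]tofracXn divfK // tofrac_eq0 expf_neq0 //.
apply: (Est_one (hq i si)) => x; have [N [a ea]] := h1 i si x.
have ha := fr_degree (h2 i x) (dhomogMn N hX) (expf_neq0 N X00) (etrans (congr1 (fun y => y * _) (tofracXn _ _)) ea).
exists a, ('X_[mset s] ^+ N), (mdeg (mset s) * N)%N; split=> //; first exact: dhomogMn.
  by apply: outX; apply/out_mset.
by rewrite -ea tofracXn mulrC mulKf // -tofracXn tofrac_eq0 expf_neq0.
Qed.

(** The two kinds of cochains differ only on the empty set, where one has the global sections and
    the other 0. For p > 0 the primitive matters on nonempty sets only, so both notions of exactness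
    agree. *)
Lemma cech_graded (p : nat) : (0 < p)%N ->
  cech_exact (otop proj) Wi (A := F v) (fun _ _ => True) p <-> graded_exact B v p.
Proof.
move=> p0; have card0 (s : {set I}) q : (0 < q)%N -> #|s| = q -> s != finset.set0.
  by move=> q0 sq; apply: contraTneq q0 => e; rewrite -sq e cards0.
have cardD (s : {set I}) i q : i \in s -> #|s| = q.+1 -> #|s :\ i| = q.
  by move=> si sq; have := cardsD1 i s; rewrite si sq => -[].
split=> [ex c cE cd dc|ex c _ dc].
  have hc s q : oset (wcap (otop proj) Wi s) q -> Est q (c s).
    have [s0|sn] := eqVneq s finset.set0; first by have [c0 _] := cE s; rewrite c0 // => _; exact: Est0.
    by move=> /wcapE; move: q; apply/(Est_graded _ sn).
  have [|s sp|b [_ db]] := ex (fun s => es_cst (hc s) : Etw D v (wcap (otop proj) Wi s)) => //.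
    apply: (@evw_inj K n E D v); rewrite evw_dC; last exact: wcap_eta.
    transitivity (0 : V); last by symmetry; exact: raddf0.
    rewrite -(dc s sp); apply: dS_eq => i si; apply: evw_cst; exact: wcap_eta.
  exists (fun s => if s == finset.set0 then 0 else evw (b s : esec D v _)); split=> s.
    case: eqVneq => [s0|sn].
      by split; [exact: (sm0 (Esec_smod B s))|move=> i x; rewrite mulmx0 mxE; exact: (fr0 (@nz_mclosed K n.+1))].
    by apply/(Est_graded _ sn) => q hq; apply: evw_Est; exact/wcapE.
  move=> sp; transitivity (evw (dC b s : esec D v _)); last first.
    by rewrite db // evw_cst //; exact: wcap_eta.
  rewrite evw_dC; last exact: wcap_eta.
  apply: dS_eq => i si; rewrite (negbTE (card0 _ _ p0 (cardD _ _ _ si sp))) //.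
pose c' (s : {set I}) : V := if s == finset.set0 then 0 else evw (c s : esec D v _).
have [s|s|s sp|b [hb db]] := ex c'.
- rewrite /c'; case: eqVneq => [s0|sn]; first exact: (sm0 (Esec_smod B s)).
  by have [] := (Est_graded (evw (c s : esec D v _)) sn).1 (fun q hq => evw_Est _ ((wcapE s q).2 hq)).
- rewrite /c'; case: eqVneq => [s0|sn]; first by move=> i x; rewrite mulmx0 mxE; exact: (fr0 (@nz_mclosed K n.+1)).
  by have [] := (Est_graded (evw (c s : esec D v _)) sn).1 (fun q hq => evw_Est _ ((wcapE s q).2 hq)).
- transitivity (evw (dC c s : esec D v _)); last by rewrite dc //; exact: raddf0.
  rewrite evw_dC; last exact: wcap_eta.
  apply: dS_eq => i si; rewrite /c' (negbTE (card0 _ p.+1 isT (cardD _ _ _ si sp))) //.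
have hb' s q : oset (wcap (otop proj) Wi s) q -> Est q (b s).
  have [b1 b2] := hb s; have [s0|sn] := eqVneq s finset.set0; first by have [c0 _] := b1; rewrite c0 // => _; exact: Est0.
  by move=> /wcapE; move: q; apply/(Est_graded _ sn).
exists (fun s => es_cst (hb' s) : Etw D v (wcap (otop proj) Wi s)); split=> // s sp.
apply: (@evw_inj K n E D v); rewrite evw_dC; last exact: wcap_eta.
have -> : evw (c s : esec D v _) = c' s by rewrite /c' (negbTE (card0 _ p.+1 isT sp)).
rewrite -(db s sp); apply: dS_eq => i si; apply: evw_cst; exact: wcap_eta.
Qed.

Lemma cohomology_graded i : cohomology_eq0 i.+1 (F v) <-> graded_exact B v i.+1.
Proof.
rewrite -cech_graded //; exact: (cohomology_cech refine_Bz i Etw_acyclic standard_cover).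
Qed.
End Twist.
End CechComparison.

(** * Uniqueness of tensor products *)

Section TensorIso.
Context (X : topologicalType) (O : ring_sheaf X).

Definition mh_id (F : mod_sheaf O) : mod_hom F F := @ModHom X O F F (fun U => idfun) (fun _ _ _ _ => erefl).
Lemma mh_comp_nat (F G H : mod_sheaf O) (g : mod_hom G H) (f : mod_hom F G) (U W : opens X) (h : W `<=` U) (s : F U) :
  (g W \o f W) (md_res F h s) = md_res H h ((g U \o f U) s).
Proof. by rewrite /= mh_nat mh_nat. Qed.
Definition mh_comp (F G H : mod_sheaf O) (g : mod_hom G H) (f : mod_hom F G) : mod_hom F H :=
  @ModHom X O F H (fun U => g U \o f U) (mh_comp_nat g f).

Lemma tensor_iso (F G T T' : mod_sheaf O) : is_tensor F G T -> is_tensor F G T' ->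
  exists (f : mod_hom T T') (g : mod_hom T' T), (forall U x, g U (f U x) = x) /\ (forall U x, f U (g U x) = x).
Proof.
move=> [b hb] [b' hb'].
have [f [fb _]] := hb T' b'; have [g [gb _]] := hb' T b; exists f, g; split=> U x.
  have [i [_ ui]] := hb T b.
  transitivity (i U x); last by symmetry; apply: (ui (mh_id T)).
  by apply: (ui (mh_comp g f)) => W s t; rewrite /= fb gb.
have [i [_ ui]] := hb' T' b'.
transitivity (i U x); last by symmetry; apply: (ui (mh_id T')).
by apply: (ui (mh_comp f g)) => W s t; rewrite /= gb fb.
Qed.

Lemma cohomology_iso (T T' : mod_sheaf O) (f : mod_hom T T') (g : mod_hom T' T) i :
  (forall U x, g U (f U x) = x) -> (forall U x, f U (g U x) = x) ->
  cohomology_eq0 i (ab_of_mod T) -> cohomology_eq0 i (ab_of_mod T').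
Proof.
move=> gf fg h R.
have aug_nat (U W : opens X) (hh : W `<=` U) (s : T U) :
    (ir_aug R W \o f W) (md_res T hh s) = ab_res (R 0%N) hh ((ir_aug R U \o f U) s).
  by rewrite /= mh_nat; exact: (ah_nat (ir_aug R)).
pose aug : ab_hom (ab_of_mod T) (R 0%N) := @AbHom X (ab_of_mod T) (R 0%N) (fun U => ir_aug R U \o f U) aug_nat.
have aug_mono : ab_mono aug.
  by move=> U s t e0; have e := @ir_mono X (ab_of_mod T') R U _ _ e0; rewrite -[s]gf -[t]gf e.
have aug_exact : ab_exact aug (ir_diff R 0%N).
  have [e1 e2] := ir_exact0 R; split=> [U s|U t t0 x Ux]; first exact: e1.
  have [W [hW [Wx [s hs]]]] := e2 U t t0 x Ux; exists W, hW; split=> //; exists (g W s).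
  by rewrite /= fg.
exact: (h (@InjectiveResolution X (ab_of_mod T) (ir_term R) aug (ir_diff R) (@ir_inj X _ R) aug_mono aug_exact (@ir_exact X _ R))).
Qed.
End TensorIso.

(** [Hstar_eq0] speaks of every tensor product with a twist. The hypotheses are applied to [Etw],
    which is one by [Etw_tensor]; the conclusion is carried to any other along [tensor_iso]. *)
Lemma Hstar_middle (K : fieldType) (n k : nat) (E : mod_sheaf (Oproj K n)) : (0 < k)%N -> (4 * k <= n)%N ->
  vector_bundle 2 E -> (forall p : nat, (k < p)%N -> (p < n - k)%N -> Hstar_eq0 p E) -> Hstar_eq0 k E.
Proof.
move=> hk hn hE zero; have [D] := bundle_data_exists hE.
have hC (j : int) (c : Cc K n.+1) : k%:Z < j -> j < n.+1%:Z - 1 - k%:Z -> NC (bd_B D) j c -> cd (Cc K n.+1) c = 0 ->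
    exists2 b, NC (bd_B D) (j - 1) b & c = cd (Cc K n.+1) b.
  case: j => // p kp pn; apply: (graded_exact_all (bd_AB D) (@bd_BA0 K n E D) ord0); first by lia.
  move=> v; case: p kp pn => [|p] kp pn; first by lia.
  apply/cohomology_graded; have hz : Hstar_eq0 p.+1 E by apply: zero; lia.
  exact: (hz v (Etw D v) (Etw_tensor D v)).
have mid := middle_exact (bd_AB D) (@bd_BA K n E D) (k := k%:Z) _ _ hC.
move=> v T hT; have [f [g [gf fg]]] := tensor_iso (Etw_tensor D v) hT.
apply: (cohomology_iso gf fg); case: k hk hn mid {hC zero} => // k' hk hn mid.
apply/cohomology_graded; apply: (exact_graded (bd_AB D) (@bd_BA0 K n E D) ord0).
by apply: mid; lia.
Qed.

Close Scope classical_set_scope.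
Close Scope ring_scope.

Theorem theorem2p6 (K : fieldType) (n k : nat) (hk : 1 < k) (hn : 4 * k <= n) :
  ~ exists E : mod_sheaf (Oproj K n),
      [/\ vector_bundle 2 E,
          forall i : nat, i \in [:: 1; k; n - k; n - 1] -> ~ Hstar_eq0 i E
        & forall i : nat, 1 <= i <= n - 1 ->
            i \notin [:: 1; k; n - k; n - 1] -> Hstar_eq0 i E].
Proof.
move=> [E [hE nonzero zero]]; apply: (nonzero k); first by rewrite !inE eqxx orbT.
apply: Hstar_middle hE _ => //; first exact: ltnW.
by move=> p kp pn; apply: zero; [lia|rewrite !inE; lia].
Qed.
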